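(* Fix $\alpha\in(0,1)$, $c_G,c_H\in\mathbb{R}$ and $F\in C^4(\mathbb{R};\mathbb{R})$ with $F'>-\lambda_1$, where $\lambda_1$ is the first eigenvalue of the Dirichlet Laplacian in $D_{-1,1}=\mathbb{T}\times[-1,1]$. Assume that the solution $\psi_0$ of $\Delta\psi_0=F(\psi_0)$ in $D_{-1,1}$, $\psi_0(x,1)=c_H$, $\psi_0(x,-1)=c_G$, is non-constant and has a stagnation point in $\mathbb{T}\times(-1,1)$. Let $$\mathcal{B}'=\{(g,h)\in(C^{2,\alpha}(\mathbb{T}))^2:\ h'(x)+g'(x)\not\equiv 0\}.$$ Then there exists an open and dense set $\mathcal{B}_0\subset\mathcal{B}'$ such that for all $(g,h)\in\mathcal{B}_0$ there exists $\varepsilon_*>0$ such that, for all $0<\varepsilon<\varepsilon_*$, the solution $\psi_\varepsilon$ to $$\begin{cases}\Delta\psi_\varepsilon=F(\psi_\varepsilon) & \text{in } D_{-1+\varepsilon g,1+\varepsilon h},\\ \psi_\varepsilon=c_H & \text{on } y=1+\varepsilon h(x),\\ \psi_\varepsilon=c_G & \text{on } y=-1+\varepsilon g(x),\end{cases}$$ possesses islands whose maximal height is at least of order $\sqrt{\varepsilon}$; that is, there is a constant $c>0$ independent of $\varepsilon\in(0,\varepsilon_* )$ such that the maximal height of the islands of $\psi_\varepsilon$ is at least $c\sqrt{\varepsilon}$.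
   Context: $\mathbb{T}=\mathbb{R}/2\pi\mathbb{Z}$. For $G,H\in C^{2,\alpha}(\mathbb{T},\mathbb{R})$ with $G<H$ pointwise, $D_{G,H}=\{(x,y): x\in\mathbb{T},\ G(x)\le y\le H(x)\}$. A stagnation point of $\psi$ is a point where $\nabla\psi=0$. The streamlines of $\psi$ are the connected components of its level sets. An island is a region of the fluid domain filled by contractible closed streamlines (closed streamlines that can be contracted to a point in $\mathbb{T}\times\mathbb{R}$). The height of an island is its extent in the $y$ direction.
   Formalization: ''The solution ψ_ε'' is taken to be the unique solution uniformly close to ψ_0 (within some δ>0 independent of ε, after straightening the channel); its existence and local uniqueness are asserted, since F'>-λ_1 alone does not ensure a single solution in the perturbed channel. *)

(* Defs.v *)
From HB Require Import structures.
From mathcomp Require Import all_boot all_order all_algebra.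
From mathcomp Require Import generic_quotient.
From mathcomp Require Import all_classical all_reals all_analysis.

Set Implicit Arguments.
Unset Strict Implicit.
Unset Printing Implicit Defensive.
Import Order.TTheory GRing.Theory Num.Theory.
Import numFieldNormedType.Exports.

Local Open Scope classical_set_scope.
Local Open Scope ring_scope.
Local Open Scope quotient_scope.

Section Torus.
Context {R : realType}.

Definition period_rel (x y : R) : bool :=
  `[< exists k : int, x - y = 2 * pi * k%:~R >].

Lemma period_rel_refl : reflexive period_rel.
Proof. by move=> x; apply/asboolP; exists 0; rewrite subrr mulr0. Qed.

Lemma period_rel_sym : symmetric period_rel.
Proof.
move=> x y; apply: asbool_equiv_eq; split => -[k xy];
  by exists (- k); rewrite -opprB xy mulrNz mulrN.
Qed.

Lemma period_rel_trans : transitive period_rel.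
Proof.
move=> y x z /asboolP[k xy] /asboolP[l yz]; apply/asboolP; exists (k + l).
by rewrite intrD mulrDr -xy -yz subrKA.
Qed.

Definition period_equiv :=
  EquivRel period_rel period_rel_refl period_rel_sym period_rel_trans.

End Torus.

(* R / 2 pi Z with the quotient topology *)
Definition torus (R : realType) : topologicalType :=
  quotient_topology {eq_quot (@period_equiv R)}.

Definition to_torus {R : realType} (x : R) : torus R :=
  (\pi_(quotient_topology {eq_quot (@period_equiv R)}) x).

Section Channel.
Context {R : realType}.
Local Notation T := (torus R).

(* Derivatives of functions on T and on T x R are derivatives of their lifts. *)
Definition lift1 (f : T -> R) : R -> R := f \o to_torus.
Definition cover (z : R * R) : T * R := (to_torus z.1, z.2).
Definition lift2 (psi : T * R -> R) : R * R -> R := psi \o cover.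

Definition continuously_differentiable (n : nat) (f : R -> R) : Prop :=
  (forall k, (k < n)%N -> forall x, derivable (derive1n k f) x 1) /\
  continuous (derive1n n f).

Definition C2alpha (a : R) : set (T -> R) := [set f |
  continuously_differentiable 2 (lift1 f) /\
  exists C : R, forall x y : R,
    `|derive1n 2 (lift1 f) x - derive1n 2 (lift1 f) y| <= C * `|x - y| `^ a].

Definition sup_norm (f : R -> R) : R := sup (range (fun x => `|f x|)).

(* For the lift of a function on T this is also the seminorm for the distance
   of T, because the nearest representatives give the largest quotient. *)
Definition holder_seminorm (a : R) (f : R -> R) : R :=
  sup [set r | exists x y : R,
    x != y /\ r = `|f x - f y| / `|x - y| `^ a].

Definition C2alpha_norm (a : R) (f : T -> R) : R :=
  \sum_(k < 3) sup_norm (derive1n k (lift1 f)) +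
  holder_seminorm a (derive1n 2 (lift1 f)).

Definition C2alpha_dist (a : R) (p q : (T -> R) * (T -> R)) : R :=
  C2alpha_norm a (p.1 \- q.1) + C2alpha_norm a (p.2 \- q.2).

Definition relatively_open (a : R) (B B0 : set ((T -> R) * (T -> R))) : Prop :=
  forall p, B0 p -> exists2 r : R, 0 < r &
    forall q, B q -> C2alpha_dist a p q < r -> B0 q.

Definition relatively_dense (a : R) (B B0 : set ((T -> R) * (T -> R))) : Prop :=
  forall p, B p -> forall r : R, 0 < r ->
    exists2 q, B0 q & C2alpha_dist a p q < r.

Definition channel (G H : T -> R) : set (T * R) :=
  [set p | G p.1 <= p.2 <= H p.1].

Definition open_channel (G H : T -> R) : set (T * R) :=
  [set p | G p.1 < p.2 < H p.1].

Definition dx (f : R * R -> R) : R * R -> R := 'D_((1, 0) : R * R) f.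
Definition dy (f : R * R -> R) : R * R -> R := 'D_((0, 1) : R * R) f.

Definition laplacian (psi : T * R -> R) (z : R * R) : R :=
  dx (dx (lift2 psi)) z + dy (dy (lift2 psi)) z.

Definition C1_on (A : set (R * R)) (f : R * R -> R) : Prop :=
  forall z, A z ->
    [/\ derivable f z (1, 0), derivable f z (0, 1),
        {for z, continuous (dx f)} & {for z, continuous (dy f)}].

Definition C2_on (A : set (R * R)) (f : R * R -> R) : Prop :=
  [/\ C1_on A f, C1_on A (dx f) & C1_on A (dy f)].

Definition classical_regularity (G H : T -> R) (psi : T * R -> R) : Prop :=
  C2_on (cover @^-1` open_channel G H) (lift2 psi) /\
  {within channel G H, continuous psi}.

Definition is_solution (F : R -> R) (cG cH : R) (G H : T -> R)
    (psi : T * R -> R) : Prop :=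
  [/\ classical_regularity G H psi,
      forall z, open_channel G H (cover z) ->
        laplacian psi z = F (lift2 psi z),
      forall x, psi (x, H x) = cH &
      forall x, psi (x, G x) = cG].

Definition dirichlet_eigenvalue (G H : T -> R) (l : R) : Prop :=
  exists phi : T * R -> R,
    is_solution (fun s => - l * s) 0 0 G H phi /\
    exists2 p, channel G H p & phi p != 0.

Definition first_dirichlet_eigenvalue (G H : T -> R) (l : R) : Prop :=
  dirichlet_eigenvalue G H l /\
  forall m, dirichlet_eigenvalue G H m -> l <= m.

Definition stagnation_point (psi : T * R -> R) (z : R * R) : Prop :=
  dx (lift2 psi) z = 0 /\ dy (lift2 psi) z = 0.

Definition nonconstant_on (A : set (T * R)) (psi : T * R -> R) : Prop :=
  exists p q, [/\ A p, A q & psi p <> psi q].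

Definition streamline (G H : T -> R) (psi : T * R -> R) (p : T * R) :
    set (T * R) :=
  connected_component [set q | channel G H q /\ psi q = psi p] p.

Definition loop (gamma : R -> T * R) : Prop :=
  {within `[0, 1], continuous gamma} /\ gamma 0 = gamma 1.

Definition simple_loop (gamma : R -> T * R) : Prop :=
  loop gamma /\ {in `[0, 1[ &, injective gamma}.

(* free homotopy, through loops in T x R, to a constant loop *)
Definition contractible_loop (gamma : R -> T * R) : Prop :=
  exists (h : R * R -> T * R) (p : T * R),
    [/\ {within `[0, 1] `*` `[0, 1], continuous h},
        forall t, t \in `[0, 1] -> h (0, t) = gamma t,
        forall t, t \in `[0, 1] -> h (1, t) = p &
        forall s, s \in `[0, 1] -> h (s, 0) = h (s, 1)].

Definition contractible_closed_curve (S : set (T * R)) : Prop :=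
  exists gamma : R -> T * R,
    [/\ simple_loop gamma, S = gamma @` `[0, 1] & contractible_loop gamma].

(* Closed streamlines are Jordan curves, so an elliptic stagnation point does
   not belong to the island surrounding it. *)
Definition island (G H : T -> R) (psi : T * R -> R) (U : set (T * R)) : Prop :=
  [/\ open U, connected U, U !=set0, U `<=` channel G H &
      forall p, U p ->
        streamline G H psi p `<=` U /\
        contractible_closed_curve (streamline G H psi p)].

Definition height (U : set (T * R)) : R := sup (snd @` U) - inf (snd @` U).

(* the vertical straightening of T x [-1, 1] onto the channel *)
Definition straighten (G H : T -> R) (p : T * R) : T * R :=
  (p.1, (1 - p.2) / 2 * G p.1 + (1 + p.2) / 2 * H p.1).

(* psi, pulled back to T x [-1, 1], is uniformly within delta of psi0 *)
Definition near_flat (delta : R) (G H : T -> R) (psi psi0 : T * R -> R) : Prop :=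
  forall p, channel (cst (-1)) (cst 1) p ->
    `|psi (straighten G H p) - psi0 p| < delta.

(* With F' > - lambda_1 only pointwise, a solution in a perturbed channel need
   not be globally unique, as the first eigenvalue may drop there; "the"
   solution is the unique one near the unperturbed psi0. *)
Definition is_perturbed_solution (F : R -> R) (cG cH : R)
    (psi0 : T * R -> R) (delta : R) (G H : T -> R) (psi : T * R -> R) : Prop :=
  [/\ is_solution F cG cH G H psi,
      near_flat delta G H psi psi0 &
      forall psi', is_solution F cG cH G H psi' ->
        near_flat delta G H psi' psi0 -> {in channel G H, psi' =1 psi}].

Definition perturbed_graph (b eps : R) (g : T -> R) : T -> R :=
  fun x => b + eps * g x.

Definition admissible_perturbations (a : R) : set ((T -> R) * (T -> R)) :=
  [set p | [/\ C2alpha a p.1, C2alpha a p.2 &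
    exists x, derive1 (lift1 p.2) x + derive1 (lift1 p.1) x != 0]].

End Channel.

(* Main.v *)
(** The maximum principle with the weight [cos (b y)], [b] slightly below [pi / 2], is
    available because [F' > - lambda_1 >= - (pi / 2)^2]. It shows that [psi_0] depends
    on [y] only, say [psi_0 = P y], and it controls the problem in the perturbed
    channel, whose solution [u] is obtained as an ultralimit of finite difference
    solutions by means of discrete gradient bounds.

    On a strip [|y| <= 1 - O (eps)] the function [(u - P) / eps] solves the
    linearised equation up to [O (eps)], with boundary values [- P' (1) h] and
    [- P' (-1) g]. Let [y0] be a critical point of [P]. [B_0] consists of the data for
    which [u] oscillates along [y = y0] by at least a fixed multiple of [eps]. This is
    an open condition by stability of the linearised problem. It is dense: adding
    a small multiple of the datum [(P' (-1) sin x, P' (1) sin x)] makes the response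
    oscillate, because its own response is odd in [x] and, by comparison with a
    subsolution on the half period [0, pi], nonzero at [x = pi / 2].

    As [P] is non-constant, [P'' (y0) = F (P (y0)) <> 0], so up to sign [u] is
    uniformly convex in [y] near [y0], i.e. a valley whose depth varies by at least [c
    eps]. The level curves between the lowest point of the valley floor and a pass
    close up around that point, and by the quadratic growth in [y] their height is at
    least [c sqrt eps]. *)
Require Import Defs.
From HB Require Import structures.
From mathcomp Require Import all_boot all_order all_algebra.
From mathcomp Require Import all_classical all_reals all_analysis.
From mathcomp Require Import ring lra.
Import Order.TTheory GRing.Theory Num.Theory.
Import numFieldNormedType.Exports.

Local Open Scope classical_set_scope.
Local Open Scope ring_scope.

(* The cost of [lra] grows with the context, so only the numerical hypotheses are
   kept, at first the ten most recent ones. Section hypotheses are to be cleared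
   beforehand, or they become arguments of the lemma. *)
Ltac is_linear P := lazymatch P with
  | is_true (~~ _) => fail
  | is_true _ => idtac
  | _ /\ _ => idtac
  | _ = _ :> bool => fail
  | _ = _ => idtac
  end.

Ltac revert_linear n := lazymatch n with
  | O => idtac
  | S ?n' => try (match goal with H : ?P |- _ => is_linear P; revert H end; revert_linear n')
  end.

Ltac clear_props := repeat match goal with H : ?P |- _ =>
    let T := type of P in constr_eq T Prop; clear H end.

Ltac intro_fresh := repeat (let H := fresh "hyp" in intro H).

Ltac linear_core := first
  [ solve [intros; revert_linear 10%nat; clear_props; intro_fresh; lra]
  | solve [intros; revert_linear 200%nat; clear_props; intro_fresh; lra]
  | lra ].

Ltac linear := linear_core.

(** * Calculus in one and two variables *)

(** The bound on [F'] is pointwise and the walls move, so [F] itself admits no global theory in the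
    perturbed channel. It is replaced by a function [f] with bounded Lipschitz derivative and slopes
    at least [k - b ^+ 2], equal to [F] on an interval larger than the range of [psi_0]. For [f] the
    perturbed problem is uniquely solvable, and the solutions of the original problem within
    distance 1 of [psi_0] are the same. The linearised problem is never solved. It is present
    through its approximate solutions [(u - P) / e], and stability lets two of them be compared even
    when they belong to different [e]. This is why the oscillation is demanded of the solutions [u]
    at all small [e], and why a single [e] at which it fails is enough for the density argument. The
    valley floor depends on [x] in a merely Lipschitz way, so regular levels cannot be taken from
    Sard's theorem. Tilting the graph of the floor yields an interval of levels that are crossed
    exactly once on each side of the lowest point, and these levels fill the island. *)

Section Calculus.
Context {R : realType}.
Implicit Types (f g : R -> R) (a b c d e h l m p q r s t x y C M N : R).

Lemma near_dist x (Q : R -> Prop) :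
  (\forall t \near x, Q t) <-> exists2 d : R, 0 < d & forall t, `|t - x| < d -> Q t.
Proof.
split.
  move=> /nbhs_ballP[d /= d0 dQ]; exists d => // t td; apply: dQ.
  by rewrite /ball /= distrC.
move=> [d d0 dQ]; apply/nbhs_ballP; exists d => //= t; rewrite /ball /= => td.
by apply: dQ; rewrite distrC.
Qed.

Lemma is_deriveP f x a : is_derive x 1 f a <->
  forall e, 0 < e -> exists2 d : R, 0 < d & forall h, `|h| < d ->
    `|f (x + h) - f x - a * h| <= e * `|h|.
Proof.
split.
  move=> [fx fa] e e0.
  have /cvgrPdist_le /(_ e e0) := fx; rewrite -/(derive f x 1) fa.
  move=> /nbhs_ballP[d /= d0 dP]; exists d => // h hd.
  have [->|h0] := eqVneq h 0.
    by rewrite addr0 subrr mulr0 subr0 normr0 mulr0.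
  have := dP h; rewrite /ball /= sub0r normrN => /(_ hd h0).
  rewrite /GRing.scale /= mulr1 [h + x]addrC => H.
  have -> : f (x + h) - f x - a * h = h * -(a - h^-1 * (f (x + h) - f x)).
    by field.
  by rewrite normrM normrN mulrC ler_wpM2r.
move=> H.
have L : h^-1 *: (f (h *: 1 + x) - f x) @[h --> 0^'] --> a.
  apply/cvgrPdist_le => e e0; have [d d0 dP] := H _ e0.
  apply/nbhs_ballP; exists d => //= h; rewrite /ball /= sub0r normrN => hd h0.
  have := dP h hd; rewrite /GRing.scale /= mulr1 [h + x]addrC.
  have -> : f (x + h) - f x - a * h = h * -(a - h^-1 * (f (x + h) - f x)).
    by field.
  by rewrite normrM normrN mulrC ler_pM2r // normr_gt0.
have D : derivable f x 1 by apply/cvg_ex; exists a.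
by split => //; apply: cvg_lim L.
Qed.

Lemma is_derive_bound f x a C e0 : 0 < e0 ->
  (forall h, `|h| < e0 -> `|f (x + h) - f x - a * h| <= C * h ^+ 2) ->
  is_derive x 1 f a.
Proof.
move=> e00 H; apply/is_deriveP => e ep.
have C1 : 0 < `|C| + 1 by rewrite ltr_wpDl.
exists (Num.min e0 (e / (`|C| + 1))); first by rewrite lt_min e00 divr_gt0.
move=> h; rewrite lt_min => /andP[h1 h2]; apply: (le_trans (H h h1)).
rewrite -real_normK ?num_real // expr2 mulrA ler_wpM2r //.
apply: (@le_trans _ _ ((`|C| + 1) * `|h|)).
  by rewrite ler_wpM2r // (le_trans (ler_norm _)) // lerDl.
by rewrite mulrC -ler_pdivlMr // ltW.
Qed.

Lemma is_derive_uniq {f x a b} : is_derive x 1 f a -> is_derive x 1 f b -> a = b.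
Proof. by move=> [_ <-] [_ <-]. Qed.

Lemma is_derive_cont {f x a} : is_derive x 1 f a -> {for x, continuous f}.
Proof. by move=> [fx _]; apply/differentiable_continuous/derivable1_diffP. Qed.

Lemma is_derive_lin {f g x a b} (c : R) : is_derive x 1 f a ->
  is_derive x 1 g b -> is_derive x 1 (fun t => f t + c * g t) (a + c * b).
Proof. by move=> fa gb; apply: is_deriveD. Qed.

Lemma is_derive_affine {f x a} (c b : R) : is_derive (c + b * x) 1 f a ->
  is_derive x 1 (fun t => f (c + b * t)) (b * a).
Proof.
move=> fa; rewrite mulrC.
have -> : (fun t => f (c + b * t)) = f \o (fun t => c + b * t) by [].
apply: is_derive1_comp.
have := is_derive_lin b (is_derive_cst c x 1) (is_derive_id x 1).
by rewrite mulr1 add0r.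
Qed.

Lemma is_derive_near {f g x a} : (\forall t \near x, f t = g t) ->
  is_derive x 1 f a -> is_derive x 1 g a.
Proof.
move=> /near_dist[r r0 fg] /is_deriveP fa; apply/is_deriveP => e e0.
have [d d0 dP] := fa e e0; exists (Num.min d r); first by rewrite lt_min d0.
move=> h; rewrite lt_min => /andP[hd hr]; rewrite -!fg ?dP //.
  by rewrite subrr normr0.
by rewrite addrC addKr.
Qed.

(** A relation at a single point: the maximum principle tests second derivatives only at a maximum,
    and a relation passes through sums and affine substitutions without regularity elsewhere. *)
Definition is_d2 f x l := exists f1 : R -> R,
  (\forall t \near x, is_derive (t : R) 1 f (f1 t)) /\ is_derive x 1 f1 l.

Lemma is_d2_lin {f g x l m} (c : R) : is_d2 f x l -> is_d2 g x m ->
  is_d2 (fun t => f t + c * g t) x (l + c * m).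
Proof.
move=> [f1 [Hf f1l]] [g1 [Hg g1m]]; exists (fun t => f1 t + c * g1 t); split.
  by near=> t; apply: is_derive_lin; near: t.
exact: is_derive_lin.
Unshelve. all: by end_near. Qed.

Lemma is_d2_glob {f f1 x l} : (forall t : R, is_derive t (1 : R) f (f1 t)) ->
  is_derive x 1 f1 l -> is_d2 f x l.
Proof. by move=> ff f1l; exists f1; split => //; near=> t; apply: ff.
Unshelve. all: by end_near. Qed.

Lemma is_d2_affine {f x l} (c b : R) : is_d2 f (c + b * x) l ->
  is_d2 (fun t => f (c + b * t)) x (b ^+ 2 * l).
Proof.
move=> [f1 [/near_dist[d d0 Hf] f1l]]; exists (fun t => b * f1 (c + b * t)); split.
  apply/near_dist; exists (d / (`|b| + 1)); first by rewrite divr_gt0 // ltr_wpDl.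
  move=> t td; apply: is_derive_affine; apply: Hf.
  have -> : c + b * t - (c + b * x) = b * (t - x) by ring.
  rewrite normrM; apply: le_lt_trans (_ : (`|b| + 1) * `|t - x| < d).
    by rewrite ler_wpM2r // lerDl.
  by rewrite mulrC -ltr_pdivlMr // ltr_wpDl.
have := is_derive_lin b (is_derive_cst 0 x 1) (is_derive_affine c b f1l).
rewrite add0r mulrA -expr2; apply: is_derive_near.
by near=> t; rewrite add0r.
Unshelve. all: by end_near. Qed.

Lemma is_d2_near {f g x l} : (\forall t \near x, f t = g t) ->
  is_d2 f x l -> is_d2 g x l.
Proof.
move=> fg [f1 [ff f1l]]; exists f1; split => //.
have /near_dist[d d0 dP] : \forall t \near x, f t = g t /\ is_derive (t : R) 1 f (f1 t).
  by near=> t; split; near: t.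
apply/near_dist; exists (d / 2); first by rewrite divr_gt0.
move=> t td; have tx : `|t - x| < d by apply: lt_trans td _; linear.
apply: is_derive_near (dP t tx).2; apply/near_dist; exists (d / 2); first by linear.
move=> s st; apply: (dP s _).1; rewrite (splitr d).
by apply: le_lt_trans (ltrD st td); rewrite (le_trans _ (ler_normD _ _)) // subrKA.
Unshelve. all: by end_near. Qed.

Lemma is_d2_cst (c : R) x : is_d2 (fun=> c) x 0.
Proof. exact: (is_d2_glob (fun t => is_derive_cst c t 1) (is_derive_cst 0 x 1)). Qed.

Lemma is_d2_id x : is_d2 (fun t => t) x 0.
Proof.
by apply: (@is_d2_glob (fun t => t) (fun=> 1)).
Qed.

Lemma is_d2_sqr x : is_d2 (fun t => t ^+ 2) x 2.
Proof.
apply: (@is_d2_glob _ (fun t => 2 * t)) => [t|].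
  apply: (@is_derive_bound _ _ _ 1 1) => // h _.
  by rewrite (_ : _ - _ = h ^+ 2) ?mul1r ?ger0_norm ?sqr_ge0 //; ring.
apply: (@is_derive_bound _ _ _ 0 1) => // h _.
by rewrite (_ : _ - _ = 0) ?normr0 ?mul0r //; ring.
Qed.

(** If [l] were positive, then [f1 x = 0] would force [f1 > 0] just to the right of [x], and the
    mean value theorem would produce a larger value there. *)
Lemma is_d2_max {f x l} : is_d2 f x l -> (\forall t \near x, f t <= f x) -> l <= 0.
Proof.
move=> [f1 [ff f1l]] mx; rewrite leNgt; apply/negP => l0.
have /near_dist[d d0 dP] : \forall t \near x, f t <= f x /\ is_derive (t : R) 1 f (f1 t).
  by near=> t; split; near: t.
have in_d t : t \in `]x - d, x + d[ -> `|t - x| < d.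
  by rewrite in_itv /= => /andP[? ?]; rewrite ltr_norml; linear.
have fx0 : f1 x = 0.
  have /is_derive_uniq : is_derive x 1 f (f1 x).
    by apply: (dP x _).2; rewrite subrr normr0.
  apply; apply: (@derive1_at_max _ _ (x - d) (x + d)); first linear.
  - by move=> t /in_d td; have [_ []] := dP t td.
  - by rewrite in_itv /=; linear.
  - by move=> t /in_d td; have [] := dP t td.
have /is_deriveP /(_ (l / 2)) [] := f1l; first linear.
move=> r r0 rP.
pose s := Num.min d r / 2.
have m0 : 0 < Num.min d r by rewrite lt_min d0.
have s0 : 0 < s by rewrite /s; linear.
have [sd sr] : s < d /\ s < r.
  by split; (apply: (@lt_le_trans _ _ (Num.min d r)); [rewrite /s; linear|rewrite ge_min lexx ?orbT]).
have xs : x < x + s by linear.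
have [t||c] := MVT xs (f := f) (df := f1).
- rewrite in_itv /= => /andP[? ?]; apply: (dP t _).2.
  by rewrite ltr_norml; linear.
- apply: derivable_within_continuous => t; rewrite in_itv /= => /andP[? ?].
  have [] // : is_derive (t : R) (1 : R) f (f1 t).
  by apply: (dP t _).2; rewrite ltr_norml; linear.
rewrite in_itv /= => /andP[c1 c2] E.
have fs : f (x + s) <= f x.
  by apply: (dP (x + s) _).1; rewrite (_ : x + s - x = s) ?gtr0_norm //; ring.
have f1c : f1 c <= 0.
  by rewrite -(pmulr_lle0 _ s0) mulrC; move: E; rewrite (_ : x + s - x = s); [linear|ring].
have : `|f1 c - l * (c - x)| <= l / 2 * (c - x).
  have := rP (c - x); rewrite gtr0_norm ?subr_gt0 // (_ : x + (c - x) = c); last ring.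
  by rewrite fx0 subr0; apply; linear.
by rewrite ler_norml => /andP[H1 _]; nra.
Unshelve. all: by end_near. Qed.

(** The end points come in either order, since many uses compare values whose relative size is
    unknown. *)
Lemma mvt {f f1 : R -> R} {a b} :
  (forall t, Num.min a b <= t <= Num.max a b -> is_derive t 1 f (f1 t)) ->
  exists2 c, Num.min a b <= c <= Num.max a b & f b - f a = f1 c * (b - a).
Proof.
have main p q : p <= q -> (forall t, p <= t <= q -> is_derive t 1 f (f1 t)) ->
    exists2 c, p <= c <= q & f q - f p = f1 c * (q - p).
  move=> pq H; have [t|t|c] := MVT_segment pq (f := f) (df := f1).
  - by rewrite in_itv /= => /andP[? ?]; apply: H; linear.
  - apply: derivable_within_continuous => r; rewrite in_itv /= => rpq.
    by have [] := H r rpq.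
  - by rewrite in_itv /=; exists c.
case: (leP a b) => [ab|/ltW ba] H; first exact: main.
by have [c ? E] := main _ _ ba H; exists c => //; rewrite -opprB E; ring.
Qed.

Lemma lip_of_derive {f f1 : R -> R} {a b} C :
  (forall t, Num.min a b <= t <= Num.max a b -> is_derive t 1 f (f1 t)) ->
  (forall t, Num.min a b <= t <= Num.max a b -> `|f1 t| <= C) ->
  `|f b - f a| <= C * `|b - a|.
Proof. by move=> H HC; have [c /HC ? ->] := mvt H; rewrite normrM ler_wpM2r. Qed.

(** The even function [f (x + t) + f (x - t) - C * t ^+ 2] has derivative
    [f1 (x + t) - f1 (x - t) - 2 * C * t], which is nonpositive for [0 <= t <= h]. *)
Lemma second_diff_le {f f1 f2 : R -> R} {x h} C : 0 <= h ->
  (forall t, is_derive t 1 f (f1 t)) -> (forall t, is_derive t 1 f1 (f2 t)) ->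
  (forall t, `|t - x| <= h -> f2 t <= C) ->
  f (x + h) + f (x - h) - 2 * f x <= C * h ^+ 2.
Proof.
move=> h0 ff ff1 HC.
pose g t := f (x + t) + f (x - t) - C * t ^+ 2.
have gg t : is_derive t 1 g (f1 (x + t) - f1 (x - t) - C * (2 * t)).
  have d1 : is_derive t 1 (fun s => f (x + 1 * s)) (1 * f1 (x + 1 * t)).
    exact: is_derive_affine.
  have d2 : is_derive t 1 (fun s => f (x + (-1) * s)) (-1 * f1 (x + (-1) * t)).
    exact: is_derive_affine.
  have d3 : is_derive t 1 (fun s : R => s ^+ 2) (2 * t).
    apply: (@is_derive_bound _ _ _ 1 1) => // k _.
    by rewrite (_ : _ - _ = k ^+ 2) ?mul1r ?ger0_norm ?sqr_ge0 //; ring.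
  have := is_derive_lin (- C) (is_derive_lin 1 d1 d2) d3.
  rewrite (_ : _ + _ = f1 (x + t) - f1 (x - t) - C * (2 * t)); last first.
    by rewrite !mulN1r !mul1r mulNr.
  by apply: is_derive_near; near=> s; rewrite /g !mul1r mulN1r mulNr.
have [c ch E] := @mvt g _ 0 h (fun t _ => gg t).
rewrite min_l // max_r // in ch.
have [c' c'h E'] := @mvt f1 f2 (x - c) (x + c) (fun t _ => ff1 t).
have : f1 (x + c) - f1 (x - c) <= C * (2 * c).
  rewrite E' (_ : x + c - (x - c) = 2 * c); last ring.
  rewrite ler_wpM2r //; first linear.
  by apply: HC; move: c'h; rewrite min_l ?max_r; [rewrite ler_norml|..]; linear.
move: E; rewrite /g addr0 subr0 expr0n mulr0 !subr0 => E H.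
have : (f1 (x + c) - f1 (x - c) - C * (2 * c)) * h <= 0.
  by rewrite mulr_le0_ge0 // subr_le0.
by rewrite -E; linear.
Unshelve. all: by end_near. Qed.

End Calculus.

(** * Maximum principle and interior gradient bound *)

Section MaximumPrinciple.
Context {R : realType}.
Implicit Types (u v w : R -> R -> R) (f : R -> R) (z : R * R)
  (a b c d e h l m p q r s t x y C M N : R).

Definition uc u : R * R -> R := fun z => u z.1 z.2.

Lemma nbhs2P x y (K : set (R * R)) : nbhs (x, y) K <->
  exists2 d : R, 0 < d & forall s t, `|s - x| < d -> `|t - y| < d -> K (s, t).
Proof.
split.
  move=> /nbhs_ballP[d /= d0 dP]; exists d => // s t sx ty; apply: dP.
  by split; rewrite /ball /= distrC.
move=> [d d0 dP]; apply/nbhs_ballP; exists d => //= -[s t] [/= sx ty].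
by apply: dP; rewrite distrC.
Qed.

Definition cont2 u x y := {for (x, y), continuous (uc u)}.

Lemma cont2P u x y : cont2 u x y <-> forall e, 0 < e -> exists2 d : R, 0 < d &
  forall s t, `|s - x| < d -> `|t - y| < d -> `|u s t - u x y| < e.
Proof.
rewrite /cont2 /continuous_at; split.
  move=> /cvgrPdist_lt H e e0; have /nbhs2P[d d0 dP] := H e e0.
  by exists d => // s t sx ty; rewrite distrC; apply: (dP s t).
move=> H; apply/cvgrPdist_lt => e e0; have [d d0 dP] := H e e0.
apply/nbhs2P; exists d => // s t sx ty; rewrite distrC.
exact: dP.
Qed.

Lemma cont2_lin c {u v x y} : cont2 u x y -> cont2 v x y ->
  cont2 (fun s t => u s t + c * v s t) x y.
Proof. by move=> hu hv; apply: cvgD => //; apply: cvgMr. Qed.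

Lemma cont2_scale c {u x y} : cont2 u x y -> cont2 (fun s t => c * u s t) x y.
Proof. by move=> hu; apply: cvgMr. Qed.

Lemma cont2_affine c b {u x y} : cont2 u (c + b * x) y ->
  cont2 (fun s t => u (c + b * s) t) x y.
Proof.
move=> /cont2P H; apply/cont2P => e /H[d d0 dP].
have b1 : 0 < `|b| + 1 by rewrite ltr_wpDl.
exists (d / (`|b| + 1)); first by rewrite divr_gt0.
move=> s t sx ty; apply: dP.
  have -> : c + b * s - (c + b * x) = b * (s - x) by ring.
  rewrite normrM; apply: le_lt_trans (_ : (`|b| + 1) * `|s - x| < d).
    by rewrite ler_wpM2r // lerDl.
  by rewrite mulrC -ltr_pdivlMr.
by apply: (lt_le_trans ty); rewrite ler_pdivrMr // ler_peMr ?lerDr // ltW.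
Qed.

Lemma cont2_swap {u x y} : cont2 u x y -> cont2 (fun s t => u t s) y x.
Proof.
move=> /cont2P H; apply/cont2P => e /H[d d0 dP]; exists d => // s t sx ty.
exact: dP.
Qed.

Lemma cont2_fst {f x} y : {for x, continuous f} -> cont2 (fun s _ => f s) x y.
Proof.
move=> /cvgrPdist_lt H; apply/cont2P => e /H /nbhs_ballP[d /= d0 dP].
by exists d => // s t sx _; rewrite distrC; apply: dP; rewrite /ball /= distrC.
Qed.

Lemma cont2_snd {f y} x : {for y, continuous f} -> cont2 (fun _ t => f t) x y.
Proof. by move=> /(cont2_fst x)/cont2_swap. Qed.

(** The pure second derivatives are existential, so that one relation covers classical solutions,
    one-variable profiles and barriers alike. *)
Definition lap u x y l :=
  exists a b, [/\ is_d2 (u^~ y) x a, is_d2 (u x) y b & l = a + b].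

Lemma lap_lin c {u v x y l m} : lap u x y l -> lap v x y m ->
  lap (fun s t => u s t + c * v s t) x y (l + c * m).
Proof.
move=> [a [b [ua ub ->]]] [a' [b' [va vb ->]]].
exists (a + c * a'), (b + c * b'); split; last by ring.
  exact: is_d2_lin.
exact: is_d2_lin.
Qed.

Lemma lap_fst {f x l} y : is_d2 f x l -> lap (fun s _ => f s) x y l.
Proof. by move=> H; exists l, 0; split; rewrite ?addr0 //; apply: is_d2_cst. Qed.

Lemma lap_snd {f y l} x : is_d2 f y l -> lap (fun _ t => f t) x y l.
Proof. by move=> H; exists 0, l; split; rewrite ?add0r //; apply: is_d2_cst. Qed.

Lemma lap_scale c {u x y l} : lap u x y l -> lap (fun s t => c * u s t) x y (c * l).
Proof.
move=> H; have := lap_lin c (lap_fst y (is_d2_cst 0 x)) H; rewrite add0r.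
by under eq_fun do under eq_fun do rewrite add0r.
Qed.

Lemma lap_affine c b {u x y l} : b ^+ 2 = 1 -> lap u (c + b * x) y l ->
  lap (fun s t => u (c + b * s) t) x y l.
Proof.
move=> b1 [p [q [up uq ->]]]; exists p, q; split => //.
by have := @is_d2_affine _ (u^~ y) _ _ c b up; rewrite b1 mul1r.
Qed.

Lemma lap_swap {u x y l} : lap u x y l -> lap (fun s t => u t s) y x l.
Proof. by move=> [a [b [? ? ->]]]; exists b, a; rewrite addrC. Qed.

Lemma lap_max {w x y l} : lap w x y l ->
  nbhs (x, y) [set z | w z.1 z.2 <= w x y] -> l <= 0.
Proof.
move=> [a [b [wa wb ->]]] /nbhs2P[d d0 dP].
have a0 : a <= 0.
  apply: is_d2_max wa _; apply/near_dist; exists d => // t td.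
  by apply: (dP t y) => //; rewrite subrr normr0.
have b0 : b <= 0.
  apply: is_d2_max wb _; apply/near_dist; exists d => // t td.
  by apply: (dP x t) => //; rewrite subrr normr0.
linear.
Qed.

(* [K0] is a compact set of representatives: for functions that are periodic
   in [x], it is a period cell of the unbounded region [K]. *)
Lemma max_principle (K K0 : set (R * R)) w v : compact K0 -> K0 `<=` K ->
  {within K0, continuous (uc w)} ->
  {within K0, continuous (uc v)} ->
  (forall z, K z -> 0 < v z.1 z.2) ->
  (forall z, K z -> exists2 z0, K0 z0 & uc w z0 = uc w z /\ uc v z0 = uc v z) ->
  (forall z, K z -> 0 < w z.1 z.2 -> nbhs z K /\ exists l m,
    [/\ lap w z.1 z.2 l, lap v z.1 z.2 m & w z.1 z.2 * m < v z.1 z.2 * l]) ->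
  forall z, K z -> w z.1 z.2 <= 0.
Proof.
move=> cK0 K0K cw cv v0 rep H z Kz; rewrite leNgt; apply/negP => wz.
have [z0 K0z0 [wz0 vz0]] := rep z Kz.
(* The quotient [w / v] is maximised. At the maximum [p] the function [w - (w p / v p) * v] vanishes
   and is nonpositive around it, so its Laplacian is nonpositive, against [w * m < v * l]. *)
have [||p] := @compact_EVT_max _ _ (fun z => uc w z / uc v z) K0 _ cK0.
- by exists z0.
- apply/subspace_continuousP => q Kq; apply: cvgM.
    by move/subspace_continuousP : cw; apply.
  apply: cvgV; first by rewrite gt_eqF // v0 //; apply: K0K.
  by move/subspace_continuousP : cv; apply.
rewrite inE => Kp maxp.
have max' (q : R * R) : K q -> uc w q <= uc w p / uc v p * uc v q.
  move=> Kq; have [q0 K0q0 [<- <-]] := rep q Kq.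
  by rewrite -ler_pdivrMr ?v0 ?maxp ?inE //; apply: K0K.
have vp : 0 < uc v p by apply/v0/K0K.
have wp : 0 < uc w p.
  have := max' _ Kz; rewrite leNgt => /negP; apply: contra_notT => wp.
  apply: le_lt_trans wz; rewrite mulr_le0_ge0 ?(ltW (v0 _ Kz)) //.
  by rewrite mulr_le0_ge0 ?invr_ge0 ?(ltW vp) // leNgt.
have [nK [l [m [wl vm lt]]]] := H p (K0K _ Kp) wp.
have := lap_lin (- (uc w p / uc v p)) wl vm => /lap_max.
have -> : (p.1, p.2) = p by case: (p).
move=> /(_ _) H1; have : l + - (uc w p / uc v p) * m <= 0.
  apply: H1; apply: filterS nK => q Kq /=.
  rewrite mulNr mulNr divfK ?gt_eqF // subrr subr_le0.
  exact: max'.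
rewrite mulNr subr_le0 mulrAC ler_pdivlMr // => le.
by move: le lt; rewrite /uc; linear.
Qed.

Lemma is_d2_cos b y : is_d2 (fun t => cos (b * t)) y (- b ^+ 2 * cos (b * y)).
Proof.
have H : is_d2 cos (0 + b * y) (- cos (0 + b * y)).
  by apply: (@is_d2_glob _ _ (fun t => - sin t)).
have := is_d2_affine _ _ H; rewrite add0r mulrN mulNr; apply: is_d2_near.
by near=> t; rewrite add0r.
Unshelve. all: by end_near. Qed.

(* Since [F'] stays above [- b ^+ 2], the positive function [cos (b * y)] is a
   strict supersolution of every linearised problem. *)
Lemma weighted_bound (b k Y v0 : R) (K K0 : set (R * R)) w e e' t :
  0 < v0 -> (forall y, `|y| <= Y -> v0 <= cos (b * y)) ->
  0 < k -> 0 < t -> e < k * v0 * t -> e' <= v0 * t ->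
  compact K0 -> K0 `<=` K -> {within K0, continuous (uc w)} ->
  (forall z, K z -> `|z.2| <= Y) ->
  (forall z, K z -> exists2 z0, K0 z0 & uc w z0 = uc w z /\ z0.2 = z.2) ->
  (forall z, K z -> uc w z <= e' \/ nbhs z K /\ exists l q,
     [/\ lap w z.1 z.2 l, k - b ^+ 2 <= q & q * uc w z - e <= l]) ->
  forall z, K z -> uc w z <= t.
Proof.
move=> v00 hv k0 t0 et e't cK0 K0K cw KY rep H z Kz.
pose W x y := w x y + - t * cos (b * y).
have ccos : continuous (fun y => cos (b * y)).
  by move=> y; have [f1 [/nbhs_singleton /is_derive_cont]] := is_d2_cos b y.
have cc : forall p : R * R, {for p, continuous (uc (fun _ y => cos (b * y)))}.
  by move=> [p q]; apply: (@cont2_snd (fun y => cos (b * y))); apply: ccos.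
have : W z.1 z.2 <= 0.
  apply: (@max_principle K K0 W (fun _ y => cos (b * y))) => //.
  - apply/subspace_continuousP => q Kq; apply: cvgD.
      by move/subspace_continuousP : cw; apply.
    by apply: cvgMr; apply: cvg_within_filter; apply: cc.
  - exact: continuous_subspaceT.
  - by move=> p Kp; apply: lt_le_trans (hv _ (KY _ Kp)).
  - move=> p Kp; have [p0 K0p0 [pw p2]] := rep p Kp; exists p0 => //.
    by move: pw; rewrite /uc /W => ->; rewrite p2.
  - move=> p Kp; rewrite /W => Wp.
    have cp := hv _ (KY _ Kp).
    have tv : t * v0 <= t * cos (b * p.2) by rewrite ler_wpM2l // ltW.
    have tv0 : 0 < t * v0 by rewrite mulr_gt0.
    have [le|[nK [l [q [wl qb ql]]]]] := H p Kp.
      by exfalso; move: le; rewrite /uc; linear.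
    split => //; exists (l + - t * (- b ^+ 2 * cos (b * p.2))), (- b ^+ 2 * cos (b * p.2)).
    split; first exact: (lap_lin _ wl (lap_snd _ (is_d2_cos _ _))).
      exact: lap_snd (is_d2_cos _ _).
    (* Where [w] exceeds [t * cos (b * y) >= t * v0], the part [k * w] of [(q + b ^+ 2) * w]
       outweighs the error [e < k * v0 * t]. *)
    have H1 : 0 < l + b ^+ 2 * w p.1 p.2.
      have : k * w p.1 p.2 <= (q + b ^+ 2) * w p.1 p.2.
        by rewrite ler_wpM2r; linear.
      have : k * (t * v0) < k * w p.1 p.2 by rewrite ltr_pM2l //; linear.
      by move: ql; rewrite /uc; linear.
    have := mulr_gt0 (lt_le_trans v00 cp) H1.
    by move: (cos _) (b ^+ 2) => c bb; linear.
rewrite /W mulNr subr_le0 => le; apply: (le_trans le).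
by rewrite ler_piMr ?cos_le1 // ltW.
Qed.

Lemma compact_box a b c d : compact [set z : R * R | a <= z.1 <= b /\ c <= z.2 <= d].
Proof.
rewrite (_ : [set _ | _] = `[a, b]%classic `*` `[c, d]%classic).
  by apply: compact_setX; apply: segment_compact.
by apply/seteqP; split=> -[x y] /=; rewrite !in_itv.
Qed.

(* Odd reflection in [x = x0] and comparison with a quadratic barrier in the
   half box. *)
Lemma grad_bound u x0 y0 d M N p : 0 < d -> 0 <= M -> 0 < N ->
  (forall x y, `|x - x0| <= d -> `|y - y0| <= d ->
    [/\ `|u x y| <= M, cont2 u x y & exists2 l, lap u x y l & `|l| < N]) ->
  is_derive x0 1 (u^~ y0) p -> `|p| <= 2 * M / d + N * d / 2.
Proof.
move=> d0 M0 N0 H up.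
(* The barrier [c1 X + c2 X ^+ 2 + c3 (y - y0) ^+ 2] has Laplacian [- N], is at least [M] for
   [X = d] and for [|y - y0| = d], and has slope [c1] at [X = 0]. *)
pose c1 := 2 * M / d + N * d / 2; pose c3 := M / d ^+ 2; pose c2 := - (c3 + N / 2).
have d2 : 0 < d ^+ 2 by rewrite exprn_gt0.
have c30 : 0 <= c3 by rewrite divr_ge0 // ltW.
have c1d : c1 * d + c2 * d ^+ 2 = M.
  by rewrite /c1 /c2 /c3; field; rewrite gt_eqF.
have main s x : `|s| = 1 -> 0 <= x <= d ->
    s / 2 * (u (x0 + x) y0 - u (x0 - x) y0) <= x * c1.
  move=> s1 xd.
  have hs q : `|s / 2 * q| = `|q| / 2.
    by rewrite !normrM s1 mul1r ger0_norm ?invr_ge0 // mulrC.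
  have sl q r : `|q| <= r -> - (r / 2) <= s / 2 * q <= r / 2.
    by move=> qr; rewrite -ler_norml hs ler_wpM2r.
  have slt q r : `|q| < r -> - (r / 2) < s / 2 * q < r / 2.
    by move=> qr; rewrite -ltr_norml hs ltr_pM2r.
  (* Half the difference of [u] and its mirror image, minus the barrier. The half difference
     vanishes at [x = 0], is at most [M], and its Laplacian exceeds [- N]. The sum is nested in the
     shape that [lap_lin] and [cont2_lin] expect. *)
  pose w x y := ((((s / 2 * u (x0 + 1 * x) y) +
     (- (s / 2)) * u (x0 + (-1) * x) y) + (- c1) * x) + (- c2) * x ^+ 2) +
     (- c3) * (- y0 + 1 * y) ^+ 2.
  pose K := [set z : R * R | 0 <= z.1 <= d /\ y0 - d <= z.2 <= y0 + d].
  have inb z : K z -> forall b, `|b| = 1 -> `|x0 + b * z.1 - x0| <= d /\ `|z.2 - y0| <= d.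
    move=> [z1 z2] b b1; rewrite (_ : x0 + _ - x0 = b * z.1); last ring.
    by rewrite normrM b1 mul1r !ler_norml; split; linear.
  have wK : w x y0 <= 0.
    apply: (@max_principle K K w (fun _ _ => 1) _ _ _ _ _ _ _ (x, y0)) => //=.
    - exact: compact_box.
    - apply/subspace_continuousP => z Kz; apply: cvg_within_filter.
      have [_ zb] := (inb z Kz 1 (normr1 _)).
      have -> : z = (z.1, z.2) by case: (z).
      have c0 g : continuous g -> cont2 (fun q _ => g q) z.1 z.2.
        by move=> cg; apply: cont2_fst; apply: cg.
      have cu b : `|b| = 1 -> cont2 (fun q r => u (x0 + b * q) r) z.1 z.2.
        move=> b1; have [h1 h2] := inb z Kz b b1.
        by apply: cont2_affine; have [] := H _ _ h1 h2.
      apply: (@cont2_lin (- c3)); last first.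
        apply: (@cont2_snd (fun y => (- y0 + 1 * y) ^+ 2)).
        apply: (@is_derive_cont _ _ _ (1 * (2 * (- y0 + 1 * z.2)))).
        apply: (@is_derive_affine _ (fun r : R => r ^+ 2)).
        apply: (@is_derive_bound _ _ _ _ 1 1) => // h _.
        by rewrite (_ : _ - _ = h ^+ 2) ?mul1r ?ger0_norm ?sqr_ge0 //; ring.
      apply: (@cont2_lin (- c2)); last first.
        by apply: c0 => r; apply: exprn_continuous.
      apply: (@cont2_lin (- c1)); last by apply: (c0 (fun q => q)) => r; apply: cvg_id.
      apply: cont2_lin; last by apply: cu; rewrite normrN normr1.
      by apply: cont2_scale; apply: cu; rewrite normr1.
    - by apply: continuous_subspaceT => ?; apply: cvg_cst.
    - by move=> z Kz; exists z.
    - move=> [a b] /= Kz wz; have [z1 z2] := Kz; rewrite /= in z1 z2.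
      have [x1 yb] := inb _ Kz 1 (normr1 _).
      have [x2 _] := inb _ Kz (-1) (normrN1 _); rewrite /= in x1 x2 yb.
      have [u1 _ [l1 lu1 ll1]] := H _ _ x1 yb.
      have [u2 _ [l2 lu2 ll2]] := H _ _ x2 yb.
      have Bx : 0 <= c1 * a + c2 * a ^+ 2.
        have -> : c1 * a + c2 * a ^+ 2 = c3 * (a * (2 * d - a)) + N / 2 * (a * (d - a)).
          by rewrite /c1 /c2 /c3; field; rewrite gt_eqF.
        by rewrite addr_ge0 // mulr_ge0 // ?mulr_ge0 //; linear.
      have By : 0 <= c3 * (- y0 + 1 * b) ^+ 2 by rewrite mulr_ge0 // sqr_ge0.
      have dif : s / 2 * u (x0 + 1 * a) b - s / 2 * u (x0 + -1 * a) b <= M.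
        by have := sl _ _ u1; have := sl _ _ u2; linear.
      have a0 : 0 < a.
        rewrite lt_neqAle eq_sym; case: eqP => [a0|_] /=; last linear.
        by exfalso; move: wz By; rewrite /w a0 !mulr0 expr0n mulr0; linear.
      have ad : a < d.
        rewrite lt_neqAle; case: eqP => [ad|_] /=; last linear.
        by exfalso; move: wz By dif; rewrite /w ad; linear.
      have cd2 : c3 * d ^+ 2 = M by rewrite /c3 divfK // gt_eqF.
      have bd : `|b - y0| < d.
        rewrite lt_neqAle yb andbT; apply/negP => /eqP bd.
        have Eb : (- y0 + 1 * b) ^+ 2 = d ^+ 2.
          by rewrite -bd real_normK ?num_real //; ring.
        by move: wz Bx dif; rewrite /w Eb; linear.
      split.
        apply/nbhs2P; exists (Num.min (Num.min a (d - a)) (d - `|b - y0|)).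
          by rewrite !lt_min; linear.
        move=> q r; rewrite !lt_min => /andP[/andP[q1 q2] _] /andP[_ r1].
        have rb : `|r - y0| <= d.
          have := ler_normD (r - b) (b - y0); rewrite subrKA; linear.
        by move: q1 q2 rb; rewrite /K /= !ltr_norml ler_norml; linear.
      exists (s / 2 * l1 + (- (s / 2)) * l2 + (- c1) * 0 + (- c2) * 2 + (- c3) * 2), 0; split.
      - apply: lap_lin; last first.
          apply: (@lap_snd (fun y => (- y0 + 1 * y) ^+ 2)).
          by have := is_d2_affine (- y0) 1 (is_d2_sqr (- y0 + 1 * b)); rewrite expr1n mul1r.
        apply: lap_lin; last by apply: lap_fst; apply: is_d2_sqr.
        apply: lap_lin; last by apply: lap_fst; apply: is_d2_id.
        apply: lap_lin; last by apply: lap_affine lu2; rewrite sqrrN expr1n.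
        by apply: lap_scale; apply: lap_affine lu1; rewrite expr1n.
      - exact: lap_fst (is_d2_cst _ _).
      - have := slt _ _ ll1; have := slt _ _ ll2.
        by rewrite mulr0 mul1r /c2; linear.
    - by rewrite /K /=; linear.
  move: wK; rewrite /w !mul1r mulN1r addNr expr0n !mulr0 addr0 => wK.
  have c2x : c2 * x ^+ 2 <= 0.
    by rewrite mulr_le0_ge0 ?sqr_ge0 // /c2; linear.
  by rewrite mulrBr [x * _]mulrC; linear.
rewrite -/c1; apply/ler_addgt0Pr => e e0.
have /is_deriveP/(_ e e0)[r r0 rP] := up.
pose x := Num.min d (r / 2).
have x0' : 0 < x by rewrite lt_min d0 divr_gt0.
have xd : x <= d by rewrite ge_min lexx.
have xr : x < r by apply: (@le_lt_trans _ _ (r / 2)); [rewrite ge_min lexx orbT|linear].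
have := rP x; rewrite gtr0_norm // => /(_ xr); rewrite ler_norml => H1.
have := rP (- x); rewrite normrN gtr0_norm // => /(_ xr); rewrite ler_norml => H2.
have xx : 0 <= x <= d by rewrite xd ltW.
have := main 1 x (normr1 _) xx; have := main (-1) x (normrN1 _) xx.
move=> m1 m2.
have : `|p * x| <= (c1 + e) * x.
  by rewrite ler_norml; move: m1 m2 H1 H2; linear.
by rewrite normrM (gtr0_norm x0') ler_pM2r.
Qed.

End MaximumPrinciple.

(** * The discretised problem *)

Section UltraLimit.
Context {R : realType}.
Implicit Types (u v : nat -> R) (a b c d e h l m p q r s t x y C M N : R).

(** Along an ultrafilter finer than the eventually filter every bounded sequence converges, at all
    points of the plane at once. This replaces the extraction of subsequences, and ordinary limits
    keep their values. *)
Definition ultra : set_system nat :=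
  sval (cid (ultraFilterLemma (@eventually_filter : ProperFilter \oo))).

#[global] Instance ultra_ultra : UltraFilter ultra.
Proof. by rewrite /ultra; case: cid => U []. Qed.

#[global] Instance ultra_proper : ProperFilter ultra.
Proof. by case: ultra_ultra. Qed.

Lemma ultra_near (P : set nat) : (\forall n \near \oo, P n) -> ultra P.
Proof. by rewrite /ultra; case: cid => U [_ H] /= /H. Qed.

Definition ubnd u := exists M, \forall n \near \oo, `|u n| <= M.

Definition ulim u : R := lim (u @ ultra).

(** The image of an ultrafilter is again one, and on a compact segment an ultrafilter converges. *)
Lemma ulimP u : ubnd u -> u @ ultra --> ulim u.
Proof.
move=> [M HM]; have := segment_compact (a := - M) (b := M).
rewrite compact_ultra => /(_ (u @ ultra) _) [||l [_ ul]].
- split; first exact: fmap_proper_filter.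
  move=> V PV sV; apply/seteqP; split => [A VA|]; last exact: sV.
  case: (in_ultra_setVsetC (u @^-1` A) ultra_ultra) => // NA.
  have VA' : V (~` A) by apply: sV.
  have VF : Filter V by case: PV.
  by have := @filterI _ V VF _ _ VA VA'; rewrite setICr => /(@filter_not_empty _ V PV).
- by apply: ultra_near; apply: filterS HM => n; rewrite /= in_itv /= -ler_norml.
by rewrite /ulim; have := cvg_lim (@Rhausdorff R) ul => ->.
Qed.

Lemma ulim_cvg {u l} : u @ ultra --> l -> ulim u = l.
Proof. by move=> ul; apply: cvg_lim. Qed.

Lemma ulim_oo {u l} : u n @[n --> \oo] --> l -> ulim u = l.
Proof.
by move=> ul; apply: ulim_cvg => A /ul; apply: ultra_near.
Qed.

Lemma ulim_near {u v} : (\forall n \near \oo, u n = v n) -> ulim u = ulim v.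
Proof.
move=> uv; rewrite /ulim; congr (lim _); apply/seteqP; split => A /= H.
  have : ultra [set n | u n = v n] by apply: ultra_near.
  by apply: filterS2 H => n /= ? <-.
have : ultra [set n | u n = v n] by apply: ultra_near.
by apply: filterS2 H => n /= ? ->.
Qed.

Lemma ubnd_lin c {u v} : ubnd u -> ubnd v -> ubnd (fun n => u n + c * v n).
Proof.
move=> [M HM] [N HN]; exists (M + `|c| * N); near=> n.
apply: (le_trans (ler_normD _ _)); rewrite normrM lerD //; first by near: n.
by rewrite ler_wpM2l //; near: n.
Unshelve. all: by end_near. Qed.

Lemma ubnd_cst c : ubnd (fun=> c).
Proof. by exists `|c|; near=> n. Unshelve. all: by end_near. Qed.

Lemma ulim_lin c {u v} : ubnd u -> ubnd v ->
  ulim (fun n => u n + c * v n) = ulim u + c * ulim v.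
Proof.
by move=> /ulimP hu /ulimP hv; apply: ulim_cvg; apply: cvgD => //; apply: cvgMr.
Qed.

Lemma ulim_comp (f : R -> R) {u} : continuous f -> ubnd u ->
  ulim (f \o u) = f (ulim u).
Proof. by move=> cf /ulimP hu; apply: ulim_cvg; exact: (cvg_comp _ _ hu (cf _)). Qed.

Lemma ulim_cst c : ulim (fun=> c) = c.
Proof. by apply: ulim_cvg; apply: cvg_cst. Qed.

Lemma ulim_ge0 {u} : ubnd u -> (\forall n \near \oo, 0 <= u n) -> 0 <= ulim u.
Proof.
move=> /ulimP hu H.
by apply: limr_ge; [apply: cvgP hu|apply: ultra_near].
Qed.

Lemma ulim_le {u v} : ubnd u -> ubnd v ->
  (\forall n \near \oo, u n <= v n) -> ulim u <= ulim v.
Proof.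
move=> hu hv H; rewrite -subr_ge0 -mulN1r -ulim_lin //.
apply: ulim_ge0; first exact: ubnd_lin.
by apply: filterS H => n; rewrite mulN1r subr_ge0.
Qed.

Lemma ulim_abs_le {u v} : ubnd u -> ubnd v ->
  (\forall n \near \oo, `|u n| <= v n) -> `|ulim u| <= ulim v.
Proof.
move=> hu hv H; have hv' := ubnd_lin (-1) (ubnd_cst 0) hv.
have E : - ulim v = ulim (fun n => 0 + -1 * v n).
  by rewrite ulim_lin ?ulim_cst ?add0r ?mulN1r //; apply: ubnd_cst.
rewrite ler_norml E; apply/andP; split; apply: ulim_le => //.
  by apply: filterS H => n; rewrite ler_norml add0r mulN1r => /andP[].
by apply: filterS H => n; rewrite ler_norml => /andP[].
Qed.

Lemma ulim_abs_le_lim {u v l} : ubnd u -> v n @[n --> \oo] --> l ->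
  (\forall n \near \oo, `|u n| <= v n) -> `|ulim u| <= l.
Proof.
move=> hu vl H; rewrite -(ulim_oo vl); apply: ulim_abs_le => //.
have [M [_ HM]] := cvg_seq_bounded (cvgP _ vl).
by exists (M + 1); near=> n; apply: HM => //; rewrite ltrDl.
Unshelve. all: by end_near. Qed.

Lemma ulim_eq {u v} : ubnd u -> ubnd v ->
  (u n - v n) @[n --> \oo] --> 0 -> ulim u = ulim v.
Proof.
move=> hu hv uv; apply/eqP; rewrite -subr_eq0 -mulN1r -ulim_lin //.
apply/eqP/ulim_oo; apply: cvg_trans uv; apply: near_eq_cvg.
by near=> n; rewrite mulN1r.
Unshelve. all: by end_near. Qed.

End UltraLimit.

(** * The five-point scheme and its solution by a contracting iteration *)

Section DiscreteProblem.
Context {R : realType}.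
Implicit Types (u v w : R -> R -> R)
  (a b c d e h l m p q r s t x y C M N : R).

(** The discrete maximum principle is used on a continuum of points, where a supremum need not be
    attained. Instead each nonnegative bound [S] is improved by a fixed amount [d], and finitely
    many improvements lead down to 0. *)
Lemma sup_iter (I : Type) (A : I -> Prop) (w : I -> R) C d : 0 < d ->
  (forall i, A i -> w i <= C) ->
  (forall S, 0 <= S -> (forall i, A i -> w i <= S) ->
     forall i, A i -> 0 < w i -> w i <= S - d) ->
  forall i, A i -> w i <= 0.
Proof.
move=> d0 wC H i Ai.
have main n : forall j, A j -> w j <= Num.max (C - n%:R * d) 0.
  elim: n => [|n IH] j Aj; first by rewrite mul0r subr0 le_max wC.
  have [w0|w0] := leP (w j) 0; first by rewrite le_max w0 orbT.
  have m0 : 0 <= Num.max (C - n%:R * d) 0 by rewrite le_max lexx orbT.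
  have := H _ m0 IH j Aj w0; rewrite le_max -natr1 mulrDl mul1r opprD addrA.
  by case: (leP (C - n%:R * d) 0) => [_|_ ->//] ?; apply/orP; right; linear.
have [n nC] : exists n : nat, C <= n%:R * d.
  exists (Num.bound `|C / d|); rewrite -ler_pdivrMr //.
  by apply: (le_trans (ler_norm _)); apply/ltW/archi_boundP.
by have := main n i Ai; rewrite max_r // subr_le0.
Qed.

(** The five-point Laplacian, taken at every real point rather than on a lattice, so that the
    channel needs no discrete model. *)
Definition dlap h u x y :=
  (u (x + h) y + u (x - h) y + u x (y + h) + u x (y - h) - 4 * u x y) / h ^+ 2.

Variables (f f1 : R -> R) (b k Kf Y v0 : R).
Hypothesis f_der : forall t, is_derive t (1 : R) f (f1 t).
Hypothesis f1_ge : forall t, k - b ^+ 2 <= f1 t.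
Hypothesis f1_le : forall t, `|f1 t| <= Kf.
Hypotheses (b_gt0 : 0 < b) (k_gt0 : 0 < k) (v0_gt0 : 0 < v0).
Hypothesis cos_ge : forall y, `|y| <= Y -> v0 <= cos (b * y).

Lemma Kf_ge0 : 0 <= Kf.
Proof. exact: le_trans (f1_le 0). Qed.

(** [Kf * s - f s] has derivative in [[0, Kf - k + b ^+ 2]], because [k - b ^+ 2 <= f1 <= Kf]. *)
Lemma slope_bound s t :
  `|Kf * s - f s - (Kf * t - f t)| <= (Kf - k + b ^+ 2) * `|s - t|.
Proof.
apply: (@lip_of_derive _ (fun t => Kf * t - f t) (fun t => Kf - f1 t)) => r _.
  have := is_derive_lin (-1) (is_derive_lin Kf (is_derive_cst 0 r 1)
     (is_derive_id r 1)) (f_der r).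
  rewrite mulr1 add0r mulN1r; apply: is_derive_near.
  by near=> q; rewrite add0r mulN1r.
have := f1_ge r; have := f1_le r; rewrite ler_norml => /andP[_ H] H'.
by rewrite ger0_norm; linear.
Unshelve. all: by end_near. Qed.

(** The cosine remains a supersolution of the discrete problem, with half of the margin [k]: within
    distance [h] it varies by at most [b * h], which costs [b ^+ 3 * h <= k * v0 / 2]. *)
Lemma dcos h y : 0 < h -> `|y| <= Y -> b ^+ 3 * h <= k * v0 / 2 ->
  cos (b * (y + h)) + cos (b * (y - h)) <= (2 - (b ^+ 2 - k / 2) * h ^+ 2) * cos (b * y).
Proof.
move=> h0 yY hb.
have d1 t : is_derive t (1 : R) (fun s => cos (b * s)) (- b * sin (b * t)).
  have := @is_derive_affine _ cos t (- sin (0 + b * t)) 0 b (is_derive_cos _).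
  rewrite add0r mulrN mulNr; apply: is_derive_near.
  by near=> s; rewrite add0r.
have d2 t : is_derive t (1 : R) (fun s => - b * sin (b * s)) (- b ^+ 2 * cos (b * t)).
  have := is_derive_lin (- b) (is_derive_cst 0 t 1)
    (@is_derive_affine _ sin t (cos (0 + b * t)) 0 b (is_derive_sin _)).
  rewrite !add0r mulrA mulNr -expr2 -mulNr; apply: is_derive_near.
  by near=> s; rewrite !add0r.
have lip s : `|cos (b * s) - cos (b * y)| <= b * `|s - y|.
  apply: (@lip_of_derive _ _ _ _ _ _ (fun t _ => d1 t)) => t _.
  rewrite normrM normrN (gtr0_norm b_gt0) ler_piMr //; first exact: ltW.
  by rewrite ler_norml sin_geN1 sin_le1.
have cy := cos_ge _ yY.
have H := @second_diff_le _ _ _ _ y h (- (b ^+ 2 - k / 2) * cos (b * y)) (ltW h0) d1 d2.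
have -> : forall p q, p <= q = (p - 2 * cos (b * y) <= q - 2 * cos (b * y)).
  by move=> p q; rewrite lerBlDr subrK.
apply: (le_trans (H _)) => [t ty|]; last by linear.
have := lip t; rewrite ler_norml => /andP[H1 _].
have H2 : b * `|t - y| <= b * h by rewrite ler_wpM2l // ltW.
have H3 : b ^+ 2 * (cos (b * y) - b * h) <= b ^+ 2 * cos (b * t).
  by rewrite ler_wpM2l ?sqr_ge0 //; linear.
have H4 : k * v0 / 2 <= k / 2 * cos (b * y) by rewrite mulrAC ler_wpM2l // divr_ge0 // ltW.
by move: H3 hb; rewrite exprSr mulrBr; linear.
Unshelve. all: by end_near. Qed.

Variables (G H : R -> R) (cG cH Y1 La eta : R).
Hypothesis GH_Y : forall x, - Y1 <= G x /\ H x <= Y1.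

Definition inside x y := G x < y < H x.

Section Scheme.
Variable h : R.
Hypotheses (h_gt0 : 0 < h) (h_small : b ^+ 3 * h <= k * v0 / 2) (h_Y : Y1 + h <= Y).

(** The time step with [tau * (Kf + 4 / h ^+ 2) = 1]. In an Euler step the centre value then enters
    only through [Kf * u - f u], which is nondecreasing in [u], so that the step is monotone. *)
Let tau := h ^+ 2 / (4 + Kf * h ^+ 2).

(** The explicit Euler step for the parabolic flow [u_t = Delta u - f (u)]; outside the channel it
    writes the boundary values. *)
Definition euler u x y :=
  if inside x y then u x y + tau * (dlap h u x y - f (u x y))
  else if H x <= y then cH else cG.

Hypothesis k_le : k <= Kf.

Let theta := 1 - tau * k / 2.

Lemma step_sq_gt0 : 0 < h ^+ 2. Proof. exact: exprn_gt0. Qed.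

Lemma euler_den : 0 < 4 + Kf * h ^+ 2.
Proof.
by rewrite ltr_wpDr // mulr_ge0 ?(ltW step_sq_gt0) // Kf_ge0.
Qed.

Lemma tau_gt0 : 0 < tau.
Proof. by rewrite divr_gt0 ?step_sq_gt0 ?euler_den. Qed.

Lemma tauE : tau * (Kf + 4 / h ^+ 2) = 1.
Proof.
by rewrite /tau; field; rewrite !gt_eqF ?euler_den.
Qed.

Lemma theta_ge0 : 0 <= theta.
Proof.
have : tau * k <= tau * (Kf + 4 / h ^+ 2).
  rewrite ler_pM2l ?tau_gt0 // (le_trans k_le) // lerDl divr_ge0 //.
  exact/ltW/step_sq_gt0.
by rewrite tauE /theta; have := mulr_gt0 tau_gt0 k_gt0; lra.
Qed.

Lemma euler_inside u x y : inside x y -> euler u x y =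
  tau * (Kf * u x y - f (u x y) +
    (u (x + h) y + u (x - h) y + u x (y + h) + u x (y - h)) / h ^+ 2).
Proof.
move=> ins; rewrite /euler ins /dlap.
rewrite -[X in X + _](mul1r (u x y)) -{1}tauE; field.
by rewrite gt_eqF.
Qed.

Lemma nb_sum_bound S p1 p2 p3 p4 y : 0 <= S -> `|y| <= Y ->
  `|p1| <= S * cos (b * y) -> `|p2| <= S * cos (b * y) ->
  `|p3| <= S * cos (b * (y + h)) -> `|p4| <= S * cos (b * (y - h)) ->
  `|(p1 + p2 + p3 + p4) / h ^+ 2| <=
     S * (4 / h ^+ 2 - (b ^+ 2 - k / 2)) * cos (b * y).
Proof.
move=> S0 yY' P1 P2 P3 P4; have h2 := step_sq_gt0.
rewrite normrM (gtr0_norm (_ : 0 < (h ^+ 2)^-1)) ?invr_gt0 // ler_pdivrMr //.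
have D := ler_wpM2l S0 (dcos _ _ h_gt0 yY' h_small).
rewrite (_ : S * _ * _ * _ = S * (4 - (b ^+ 2 - k / 2) * h ^+ 2) * cos (b * y)); last first.
  by field; rewrite gt_eqF.
have := ler_normD (p1 + p2 + p3) p4; have := ler_normD (p1 + p2) p3.
have := ler_normD p1 p2; lra.
Qed.

Lemma inside_nb x y : inside x y ->
  [/\ `|y| <= Y, `|y + h| <= Y & `|y - h| <= Y].
Proof.
move=> /andP[h1 h2']; have [g1 g2] := GH_Y x.
have yY1 : `|y| <= Y1 by rewrite ler_norml; lra.
have := ler_normD y h; have := ler_normB y h; rewrite (gtr0_norm h_gt0).
have := ltW h_gt0 => h0 n1 n2; have hY := h_Y; split; lra.
Qed.

(** In the sup norm weighted by [cos (b * y)] the centre contributes [Kf - k + b ^+ 2] and the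
    neighbours [4 / h ^+ 2 - (b ^+ 2 - k / 2)]. Multiplied by [tau] the two add up to
    [1 - tau * k / 2]. *)
Lemma euler_contr u v S : 0 <= S ->
  (forall x y, `|y| <= Y -> `|u x y - v x y| <= S * cos (b * y)) ->
  forall x y, `|y| <= Y -> `|euler u x y - euler v x y| <= S * theta * cos (b * y).
Proof.
move=> S0 uv x y yY.
have cy : 0 < cos (b * y) := lt_le_trans v0_gt0 (cos_ge _ yY).
have [ins|ins] := boolP (inside x y); last first.
  rewrite /euler (negbTE ins) subrr normr0.
  by rewrite !mulr_ge0 ?theta_ge0 // ltW.
rewrite !euler_inside // -mulrBr normrM (gtr0_norm tau_gt0).
have [y1 y2 y3] := inside_nb _ _ ins.
have HQ := nb_sum_bound _ _ _ _ _ _ S0 y1 (uv (x + h) y y1) (uv (x - h) y y1) (uv x _ y2) (uv x _ y3).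
have HP := slope_bound (u x y) (v x y).
set P := (X in `|X| <= _) in HP; set Q := (X in `|X| <= _) in HQ.
have -> : S * theta * cos (b * y) =
    tau * ((Kf - k + b ^+ 2) * (S * cos (b * y)) +
           S * (4 / h ^+ 2 - (b ^+ 2 - k / 2)) * cos (b * y)).
  transitivity (S * cos (b * y) * (tau * (Kf + 4 / h ^+ 2) - tau * k / 2)); last by field; rewrite gt_eqF.
  by rewrite tauE /theta; ring.
rewrite ler_pM2l ?tau_gt0 //.
rewrite (_ : _ - _ = P + Q); last by rewrite /P /Q; ring.
apply: (le_trans (ler_normD _ _)); rewrite lerD //; apply: (le_trans HP).
rewrite ler_wpM2l ?uv //.
by have := f1_ge 0; have := f1_le 0; rewrite ler_norml; lra.
Qed.

(** The ball of radius [t] in the weighted norm is invariant: the source [f 0] is paid for by the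
    margin [k / 2] that the weight leaves. *)
Lemma euler_bound u t : 0 <= t -> `|cH| <= t * v0 -> `|cG| <= t * v0 ->
  `|f 0| <= k / 2 * (t * v0) ->
  (forall x y, `|y| <= Y -> `|u x y| <= t * cos (b * y)) ->
  forall x y, `|y| <= Y -> `|euler u x y| <= t * cos (b * y).
Proof.
move=> t0 tH tG tf ut x y yY.
have cy := ler_wpM2l t0 (cos_ge _ yY).
have [ins|ins] := boolP (inside x y); last first.
  by rewrite /euler (negbTE ins); case: ifP => _; lra.
rewrite !euler_inside // normrM (gtr0_norm tau_gt0).
have [y1 y2 y3] := inside_nb _ _ ins.
have HQ := nb_sum_bound _ _ _ _ _ _ t0 y1 (ut (x + h) y y1) (ut (x - h) y y1) (ut x _ y2) (ut x _ y3).
have := slope_bound (u x y) 0; rewrite mulr0 subr0 sub0r opprK => HP.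
set Q := (X in `|X| <= _) in HQ.
have HP' : (Kf - k + b ^+ 2) * `|u x y| <= (Kf - k + b ^+ 2) * (t * cos (b * y)).
  by rewrite ler_wpM2l ?ut //; have := f1_ge 0; have := f1_le 0; rewrite ler_norml; lra.
have kt : k / 2 * (t * v0) <= k / 2 * (t * cos (b * y)) by rewrite ler_wpM2l // divr_ge0 // ltW.
apply: (@le_trans _ _ (tau * (k / 2 * (t * cos (b * y)) + (Kf - k + b ^+ 2) * (t * cos (b * y)) +
           t * (4 / h ^+ 2 - (b ^+ 2 - k / 2)) * cos (b * y)))).
  rewrite ler_pM2l ?tau_gt0 //.
  have := ler_normD (Kf * u x y - f (u x y)) Q.
  have := ler_normB (Kf * u x y - f (u x y) + f 0) (f 0); rewrite addrK; lra.
rewrite (_ : tau * _ = tau * (Kf + 4 / h ^+ 2) * (t * cos (b * y))); last by field; rewrite gt_eqF.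
by rewrite tauE mul1r.
Qed.

Hypotheses (G_per : forall x, G (x + 2 * pi) = G x)
  (H_per : forall x, H (x + 2 * pi) = H x).

Lemma euler_per u : (forall x y, u (x + 2 * pi) y = u x y) ->
  forall x y, euler u (x + 2 * pi) y = euler u x y.
Proof.
move=> up x y; rewrite /euler /inside G_per H_per /dlap.
have e1 : x + 2 * pi + h = (x + h) + 2 * pi by ring.
have e2 : x + 2 * pi - h = (x - h) + 2 * pi by ring.
by rewrite e1 e2 !up.
Qed.

Lemma discrete_solution t : 0 <= t -> `|cH| <= t * v0 -> `|cG| <= t * v0 ->
  `|f 0| <= k / 2 * (t * v0) ->
  exists u, [/\ forall x y, u (x + 2 * pi) y = u x y,
    forall x y, inside x y -> dlap h u x y = f (u x y) /\ `|u x y| <= t,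
    forall x y, H x <= y -> u x y = cH &
    forall x y, G x < H x -> y <= G x -> u x y = cG].
Proof.
move=> t0 tH tG tf.
(* The weighted estimates hold for [|y| <= Y]. Beyond that height, which lies outside the channel,
   every iterate from [n = 1] on is a boundary value, whereas the start ignores the boundary
   values. *)
pose U n := iter n euler (fun _ _ => 0).
have cge y : `|y| <= Y -> 0 <= cos (b * y).
  by move=> /cos_ge; apply: le_trans; apply: ltW.
have Ub n x y : `|y| <= Y -> `|U n x y| <= t * cos (b * y).
  elim: n x y => [|n IH] x y yY; last exact: euler_bound.
  by rewrite normr0 mulr_ge0 ?cge.
have Uper n x y : U n (x + 2 * pi) y = U n x y.
  by elim: n x y => [//|n IH] x y; apply: euler_per.
have Ud n x y : `|y| <= Y -> `|U n.+1 x y - U n x y| <= t * theta ^+ n * cos (b * y).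
  elim: n x y => [|n IH] x y yY.
    by rewrite /U /= subr0 expr0 mulr1; apply: (Ub 1%N).
  rewrite exprSr mulrA; apply: euler_contr => //.
  by rewrite mulr_ge0 // exprn_ge0 ?theta_ge0.
have Ubd x y : ubnd (fun n => U n x y).
  exists (Num.max t (Num.max `|cG| `|cH|)).
  near=> n.
  have -> : n = n.-1.+1 by rewrite prednK //; near: n; exists 1%N.
  have [yY|yY] := leP `|y| Y.
    by rewrite le_max (le_trans (Ub _ _ _ yY)) // ler_piMr // cos_le1.
  rewrite /U iterS /euler ifF; first by rewrite !le_max; case: ifP; rewrite lexx ?orbT.
  by apply: contraTF yY => /inside_nb[]; rewrite -leNgt.
have th1 : `|theta| < 1.
  rewrite ger0_norm ?theta_ge0 // /theta; have := mulr_gt0 tau_gt0 k_gt0; lra.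
pose u x y := ulim (fun n => U n x y).
have bd1 g : (forall n, `|g n| <= t * theta ^+ n) -> (g : nat -> R) n @[n --> \oo] --> 0.
  move=> gt; apply: norm_cvg0; apply: (@squeeze_cvgr _ _ _ _ (fun=> 0) (fun n => t * theta ^+ n)).
  - by near=> n; rewrite normr_ge0 gt.
  - exact: cvg_cst.
  - by rewrite -[X in _ --> X](mulr0 t); apply: cvgMr; apply: cvg_expr.
(* An ultralimit is in general not invariant under a shift of the index. Here it is, because the
   increments decay geometrically where [|y| <= Y] and vanish from [n = 1] on elsewhere. *)
have uS x y : u x y = ulim (fun n => U n.+1 x y).
  have [yY|yY] := leP `|y| Y.
    apply: ulim_eq => //.
      have [M HM] := Ubd x y; exists M; have [N _ HN] := HM.
      by exists N => // n Nn; exact: (HN n.+1 (leqW Nn)).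
    apply: bd1 => n; rewrite distrC (le_trans (Ud _ _ _ yY)) //.
    by rewrite ler_piMr ?cos_le1 // mulr_ge0 // exprn_ge0 // theta_ge0.
  apply: ulim_near; near=> n.
  have -> : n = n.-1.+1 by rewrite prednK //; near: n; exists 1%N.
  have ins : inside x y = false.
    by apply: contraTF yY => /inside_nb[]; rewrite -leNgt.
  by rewrite /U !iterS /euler ins.
have uE x y : euler u x y = u x y.
  rewrite [RHS]uS; have [ins|ins] := boolP (inside x y); last first.
    by rewrite /euler (negbTE ins) /U /= /euler (negbTE ins) ulim_cst.
  have cf : continuous (fun s => Kf * s - f s).
    move=> s; apply: cvgB; first by apply: cvgMr; apply: cvg_id.
    exact: is_derive_cont (f_der s).
  have ubd : ubnd (fun n => Kf * U n x y - f (U n x y)).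
    have [M HM] := Ubd x y; exists ((Kf - k + b ^+ 2) * M + `|f 0|).
    apply: filterS HM => n HM; have := slope_bound (U n x y) 0.
    rewrite mulr0 subr0 sub0r opprK => H1.
    have H2 : (Kf - k + b ^+ 2) * `|U n x y| <= (Kf - k + b ^+ 2) * M.
      by rewrite ler_wpM2l //; have := f1_ge 0; have := f1_le 0; rewrite ler_norml; lra.
    have := ler_normB (Kf * U n x y - f (U n x y) + f 0) (f 0); rewrite addrK; lra.
  transitivity (tau * (ulim ((fun s => Kf * s - f s) \o (fun n => U n x y)) + (h ^+ 2)^-1 *
     (ulim (fun n => U n (x + h) y) + 1 * ulim (fun n => U n (x - h) y) +
      1 * ulim (fun n => U n x (y + h)) + 1 * ulim (fun n => U n x (y - h))))).
    by rewrite euler_inside // ulim_comp // !mul1r [_^-1 * _]mulrC.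
  have u0 := ubnd_cst 0.
  rewrite -!ulim_lin //; do ?apply: ubnd_lin => //.
  rewrite -[LHS]add0r -[X in X + _](ulim_cst 0) -ulim_lin //; do ?apply: ubnd_lin => //.
  apply: ulim_near; near=> n.
  by rewrite /U iterS euler_inside // !mul1r add0r [_^-1 * _]mulrC.
exists u; split.
- by move=> x y; rewrite /u; apply: ulim_near; near=> n.
- move=> x y ins; split.
    have := uE x y; rewrite /euler ins => /eqP; rewrite -subr_eq0 addrAC subrr add0r.
    by rewrite mulf_eq0 gt_eqF ?tau_gt0 // subr_eq0 => /eqP.
  have [yY _ _] := inside_nb _ _ ins.
  rewrite -[X in _ <= X](ulim_cst t); apply: ulim_abs_le => //; first exact: ubnd_cst.
  by near=> n; rewrite (le_trans (Ub _ _ _ yY)) // ler_piMr // cos_le1.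
- by move=> x y Hy; rewrite -uE /euler /inside [y < H x]ltNge Hy andbF.
- move=> x y GH Gy; rewrite -uE /euler /inside [G x < y]ltNge Gy /= leNgt.
  by rewrite (le_lt_trans Gy GH).
Unshelve. all: by end_near. Qed.

End Scheme.
End DiscreteProblem.

(** * Discrete boundary and gradient estimates *)

Section DiscreteEstimates.
Context {R : realType}.
Implicit Types (u v w : R -> R -> R)
  (a b c d e h l m p q r s t x y C M N : R).

Lemma sq_le a b : 0 <= a -> a <= b -> a ^+ 2 <= b ^+ 2.
Proof. by move=> a0 ab; rewrite -subr_ge0 subr_sqr mulr_ge0; linear. Qed.

(* Comparison with [10 s - s ^+ 2], where [s = H x - y]: its discrete Laplacian
   is at most [-1] because the second differences of [H] are small. *)
Lemma boundary_barrier u (G H : R -> R) h cH N M La : 0 < h -> (La + 1) * h <= 1 ->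
  0 <= N -> 0 <= La ->
  (forall x, 1 <= H x - G x <= 4) ->
  (forall s t, `|H s - H t| <= La * `|s - t|) ->
  (forall x, `|H (x + h) + H (x - h) - 2 * H x| <= h ^+ 2 / 16) ->
  (forall x y, inside G H x y -> `|dlap h u x y| <= N /\ `|u x y| <= M) ->
  (forall x y, H x <= y -> u x y = cH) ->
  (forall x y, y <= G x -> `|u x y - cH| <= M) ->
  forall x y, inside G H x y -> `|u x y - cH| <=
    (N + M + 1) * (10 * (H x - y) + (10 * (La + 1) + (La + 1) ^+ 2) * h).
Proof.
move=> h0 h1 N0 La0 HG Hlip Hd uin uH uG.
have h2 : 0 < h ^+ 2 by rewrite exprn_gt0.
have Lh0 : 0 <= La * h by rewrite mulr_ge0 // ltW.
have h1' : h <= 1 by linear.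
have N1 : 0 <= N + M + 1.
  have := uG 0 (G 0) (lexx _); have := normr_ge0 (u 0 (G 0) - cH); linear.
(* In [B] the term [N] dominates the equation, [M] the values at the opposite wall, and 1 gives the
   strict gain for [sup_iter]. [E] allows for neighbours beyond the wall, since one step from an
   inside point overshoots [H] by at most [(La + 1) * h]. *)
pose B := N + M + 1; pose E := B * (10 * (La + 1) + (La + 1) ^+ 2) * h.
have E0 : 0 <= E.
  rewrite /E mulr_ge0 ?(ltW h0) // mulr_ge0 // addr_ge0 ?sqr_ge0 // mulr_ge0 //.
  linear.
suff main s x y : `|s| = 1 -> inside G H x y ->
    s * (u x y - cH) - B * (10 * (H x - y) - (H x - y) ^+ 2) - E <= 0.
  move=> x y ins.
  have := main 1 x y (normr1 _) ins; have := main (-1) x y (normrN1 _) ins.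
  have : 0 <= B * (H x - y) ^+ 2 by rewrite mulr_ge0 ?sqr_ge0.
  have -> : (N + M + 1) * (10 * (H x - y) + (10 * (La + 1) + (La + 1) ^+ 2) * h) =
    B * (10 * (H x - y)) + E by rewrite /E /B; ring.
  rewrite ler_norml; linear.
move=> s1 ins.
have sl p q : `|p| <= q -> s * p <= q.
  by move=> pq; rewrite (le_trans (ler_norm _)) // normrM s1 mul1r.
pose w x y := s * (u x y - cH) - B * (10 * (H x - y) - (H x - y) ^+ 2) - E.
pose A (z : R * R) := inside G H z.1 z.2.
have wb p q : inside G H p q -> w p q <= M + `|cH|.
  move=> pin; have [_ um] := uin p q pin.
  have u1 : s * (u p q - cH) <= M + `|cH|.
    by apply: sl; apply: (le_trans (ler_normB _ _)); linear.
  have /andP[p1 p2] := pin; have /andP[p3 p4] := HG p.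
  have : 0 <= B * (10 * (H p - q) - (H p - q) ^+ 2).
    rewrite mulr_ge0 // (_ : _ - _ = (H p - q) * (10 - (H p - q))); last ring.
    by rewrite mulr_ge0; linear.
  by rewrite /w; linear.
(* A neighbour outside lies either past [G], at a distance between 1 and 9 from [H], where
   [10 s - s ^+ 2 >= 9], or past [H], where [u = cH] and the negative value of the barrier is
   covered by [E]. *)
have wout p q p' q' : inside G H p q -> ~~ inside G H p' q' ->
    `|p' - p| + `|q' - q| <= h -> w p' q' <= 0.
  move=> pin; rewrite /inside negb_and -!leNgt => /orP[qG|qH] pq.
    have u1 : s * (u p' q' - cH) <= M by apply/sl/uG.
    have /andP[p1 p2] := pin; have /andP[p3 p4] := HG p'; have /andP[p5 p6] := HG p.
    have := Hlip p' p; rewrite ler_norml => /andP[_ L1].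
    have L2 : La * `|p' - p| <= La * h.
      by rewrite ler_wpM2l //; have := normr_ge0 (q' - q); linear.
    have qq : q - q' <= h.
      by have := ler_norm (q - q'); rewrite distrC; have := normr_ge0 (p' - p); linear.
    have s5 : 1 <= H p' - q' <= 9 by linear.
    have : B * 9 <= B * (10 * (H p' - q') - (H p' - q') ^+ 2).
      rewrite ler_wpM2l // -subr_ge0.
      rewrite (_ : _ - _ = (H p' - q' - 1) * (9 - (H p' - q'))); last ring.
      by rewrite mulr_ge0; linear.
    have M0 : 0 <= M by apply: le_trans (uG _ _ qG).
    by rewrite /w; move: E0; rewrite /B; linear.
  have := Hlip p p'; rewrite ler_norml => /andP[_ L1].
  have /andP[p1 p2] := pin.
  have L2 : La * `|p - p'| <= La * h.
    by rewrite ler_wpM2l // distrC; have := normr_ge0 (q' - q); linear.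
  have qq : q' - q <= h.
    by have := ler_norm (q' - q); have := normr_ge0 (p' - p); linear.
  rewrite /w uH // subrr mulr0 sub0r -opprD oppr_le0.
  pose r := q' - H p'.
  have r1 : 0 <= r <= (La + 1) * h by rewrite /r; linear.
  have r2 : r ^+ 2 <= (La + 1) ^+ 2 * h.
    apply: (@le_trans _ _ (((La + 1) * h) ^+ 2)); first by have /andP[] := r1; apply: sq_le.
    rewrite exprMn ler_wpM2l ?sqr_ge0 // expr2 ler_piMr //; exact: ltW.
  rewrite /E -mulrA -mulrDr mulr_ge0 //.
  have -> : H p' - q' = - r by rewrite /r; ring.
  by rewrite sqrrN; linear.
suff main : forall z, A z -> w z.1 z.2 <= 0 by exact: (main (x, y)).
apply: (@sup_iter _ _ _ _ (M + `|cH|) (h ^+ 2 / 4)); first by rewrite divr_gt0.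
  by move=> z Az; apply: wb.
move=> S S0 wS [p q] /= Az wz; have Az' : inside G H p q := Az.
have nbS p' q' : `|p' - p| + `|q' - q| <= h -> w p' q' <= S.
  move=> pq; have [ins'|ins'] := boolP (inside G H p' q'); first exact: (wS (p', q')).
  by apply: le_trans S0; apply: wout pq.
have hh : `|h| = h by rewrite gtr0_norm.
have n1 : w (p + h) q <= S by apply: nbS; rewrite subrr normr0 addr0 (_ : _ - p = h) ?hh //; ring.
have n2 : w (p - h) q <= S.
  by apply: nbS; rewrite subrr normr0 addr0 (_ : _ - p = - h) ?normrN ?hh //; ring.
have n3 : w p (q + h) <= S by apply: nbS; rewrite subrr normr0 add0r (_ : _ - q = h) ?hh //; ring.
have n4 : w p (q - h) <= S.
  by apply: nbS; rewrite subrr normr0 add0r (_ : _ - q = - h) ?normrN ?hh //; ring.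
have [ul um] := uin p q Az'.
have lapE : h ^+ 2 * dlap h u p q =
    u (p + h) q + u (p - h) q + u p (q + h) + u p (q - h) - 4 * u p q.
  by rewrite /dlap mulrC divfK // gt_eqF.
have sN : - N <= s * dlap h u p q.
  by have := sl _ _ (_ : `|- dlap h u p q| <= N); rewrite normrN mulrN => /(_ ul); linear.
have sN2 : - (N * h ^+ 2) <= s * (u (p + h) q + u (p - h) q + u p (q + h) + u p (q - h) - 4 * u p q).
  rewrite -lapE (_ : s * _ = s * dlap h u p q * h ^+ 2); last ring.
  by rewrite -mulNr ler_wpM2r // ltW.
have /andP[p1 p2] := Az'; have /andP[p3 p4] := HG p.
have := Hd p; rewrite ler_norml => /andP[d1 d2].
pose D := H (p + h) + H (p - h) - 2 * H p.
pose t := H p - q.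
(* The curvature of the wall costs at most [10 / 16] of [h ^+ 2], while the second differences of
   [- s ^+ 2] contribute at most [- 2 * h ^+ 2]. *)
have Dt : (10 - 2 * t) * D <= 10 * (h ^+ 2 / 16).
  have t1 : -10 <= 10 - 2 * t <= 10 by rewrite /t; linear.
  apply: (le_trans (ler_norm _)); rewrite normrM ler_pM //.
    by rewrite ler_norml.
  exact: Hd.
have sq1 : 0 <= (H (p + h) - H p) ^+ 2 by rewrite sqr_ge0.
have sq2 : 0 <= (H (p - h) - H p) ^+ 2 by rewrite sqr_ge0.
pose bs x y := 10 * (H x - y) - (H x - y) ^+ 2.
have bsum : bs (p + h) q + bs (p - h) q + bs p (q + h) + bs p (q - h) - 4 * bs p q
    <= - h ^+ 2.
  have -> : bs (p + h) q + bs (p - h) q + bs p (q + h) + bs p (q - h) - 4 * bs p q =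
     (10 - 2 * t) * D - (H (p + h) - H p) ^+ 2 - (H (p - h) - H p) ^+ 2 - 2 * h ^+ 2.
    by rewrite /bs /t /D; ring.
  by linear.
have := ler_wpM2l N1 bsum; rewrite -/B => Bs.
have M0 : 0 <= M by apply: le_trans (normr_ge0 _) um.
have Mh : 0 <= M * h ^+ 2 by rewrite mulr_ge0 // ltW.
move: n1 n2 n3 n4 Bs; rewrite /w /B -!/(bs _ _) => n1 n2 n3 n4 Bs.
have : 4 * (s * (u p q - cH) - B * bs p q - E) + h ^+ 2 <= 4 * S.
  by rewrite /B; linear.
by rewrite /B; linear.
Qed.

(* Discrete counterpart of [grad_bound]; the reflection is about the midpoint of
   the two points that are compared. *)
Lemma discrete_grad u x0 y0 d h M N : 0 < h -> h <= d / 4 -> 0 <= M -> 0 <= N ->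
  (forall x y, `|x - x0| <= d -> `|y - y0| <= d ->
    `|u x y| <= M /\ `|dlap h u x y| <= N) ->
  `|(u (x0 + h) y0 - u x0 y0) / h| <= 16 * M / d + (N + 1) * d.
Proof.
move=> h0 hd M0 N0 H.
have d0 : 0 < d by linear.
(* The half box must consist of a whole number [m] of steps, so that its far side is reached
   exactly. *)
have [m /andP[m1 m2]] : exists m : nat, d / 4 <= h * m%:R <= d / 2.
  exists (Num.truncn (d / 2 / h)).
  have dh : 0 <= d / 2 / h by rewrite !divr_ge0 // ltW.
  have /andP[] := truncn_itv dh; move: (Num.truncn _) => j.
  rewrite ler_pdivlMr // ltr_pdivrMr // -(natr1 j) => t1 t2.
  by apply/andP; split; linear.
pose D := h * m%:R; have DD : d / 4 <= D <= d / 2 by rewrite m1 m2.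
have D0 : 0 < D by linear.
have h2 : 0 < h ^+ 2 by rewrite exprn_gt0.
have D2 : 0 < D ^+ 2 by rewrite exprn_gt0.
(* The extra 1 makes the barrier strict, and so each comparison gains the [h ^+ 2 / 4] that
   [sup_iter] requires. *)
pose N' := N + 1.
pose c1 := 2 * M / D + N' * D / 2; pose c3 := M / D ^+ 2; pose c2 := - (c3 + N' / 2).
have c30 : 0 <= c3 by rewrite divr_ge0 // ltW.
have N'0 : 0 <= N' by rewrite /N'; linear.
have c2le : c2 <= 0 by rewrite /c2; linear.
have bx X : 0 <= X <= D -> 0 <= c1 * X + c2 * X ^+ 2.
  move=> XD; have -> : c1 * X + c2 * X ^+ 2 = c3 * (X * (2 * D - X)) + N' / 2 * (X * (D - X)).
    by rewrite /c1 /c2 /c3; field; rewrite gt_eqF.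
  by rewrite addr_ge0 // mulr_ge0 // ?mulr_ge0 //; linear.
have bD : c1 * D + c2 * D ^+ 2 = M by rewrite /c1 /c2 /c3; field; rewrite gt_eqF.
suff main s : `|s| = 1 -> s * (u (x0 + h) y0 - u x0 y0) <= 2 * (c1 * h).
  have c1le : 2 * c1 <= 16 * M / d + (N + 1) * d.
    have : 2 * M / D <= 8 * M / d.
      rewrite ler_pdivrMr // mulrAC ler_pdivlMr //.
      have : M * (d / 4) <= M * D by rewrite ler_wpM2l.
      linear.
    have : N' * D <= N' * (d / 2) by rewrite ler_wpM2l.
    have : 0 <= N' * d by rewrite mulr_ge0 // ltW.
    by rewrite /c1 -/N'; linear.
  rewrite normrM normfV (gtr0_norm h0) ler_pdivrMr //.
  apply: le_trans (_ : 2 * c1 * h <= _); last by rewrite ler_pM2r.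
  by have := main 1 (normr1 _); have := main (-1) (normrN1 _); rewrite ler_norml; linear.
move=> s1.
have sl p q : `|p| <= q -> s * p <= q.
  by move=> pq; rewrite (le_trans (ler_norm _)) // normrM s1 mul1r.
(* The mirror image of [x0 + i h] in [x0 + h / 2] is [x0 + (1 - i) h]. Thus [ph] is odd under the
   exchange of [i] and [1 - i], and [ph 1] is half the signed difference to be bounded. *)
pose ph (i : nat) y := s / 2 * (u (x0 + i%:R * h) y - u (x0 + (1 - i%:R) * h) y).
pose w (i : nat) y := ph i y - (c1 * (i%:R * h) + c2 * (i%:R * h) ^+ 2 + c3 * (y - y0) ^+ 2).
pose A (z : nat * R) := [/\ (0 < z.1)%N, (z.1 < m)%N & `|z.2 - y0| < D].
have inb i y : (i <= m)%N -> `|y - y0| <= d -> `|ph i y| <= M.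
  move=> im yd; have ih : i%:R * h <= D by rewrite mulrC /D ler_pM2l // ler_nat.
  have ih0 : 0 <= i%:R * h by rewrite mulr_ge0 // ltW.
  have [u1 _] : `|u (x0 + i%:R * h) y| <= M /\ `|dlap h u (x0 + i%:R * h) y| <= N.
    by apply: H => //; rewrite addrAC subrr add0r ger0_norm //; linear.
  have [u2 _] : `|u (x0 + (1 - i%:R) * h) y| <= M /\ `|dlap h u (x0 + (1 - i%:R) * h) y| <= N.
    by apply: H => //; rewrite addrAC subrr add0r ler_norml; linear.
  rewrite /ph !normrM s1 mul1r ger0_norm ?invr_ge0 //.
  have := ler_normB (u (x0 + i%:R * h) y) (u (x0 + (1 - i%:R) * h) y); linear.
have iD i : (i <= m)%N -> 0 <= i%:R * h <= D.
  by move=> im; rewrite mulr_ge0 ?(ltW h0) //= mulrC /D ler_pM2l // ler_nat.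
have dlb i y : (i <= m)%N -> `|y - y0| <= d ->
    `|dlap h u (x0 + i%:R * h) y| <= N /\ `|dlap h u (x0 + (1 - i%:R) * h) y| <= N.
  move=> im yd; have /andP[i0 i1] := iD i im; split.
    by apply: (H _ _ _ yd).2; rewrite addrAC subrr add0r ger0_norm //; linear.
  by apply: (H _ _ _ yd).2; rewrite addrAC subrr add0r ler_norml; linear.
have wD i y : (i <= m)%N -> D <= `|y - y0| <= d -> w i y <= 0.
  move=> im /andP[yD yd]; have := inb i y im yd; rewrite ler_norml => /andP[_ p2].
  have := bx _ (iD i im); have : M <= c3 * (y - y0) ^+ 2.
    rewrite /c3 mulrAC ler_pdivlMr // ler_wpM2l // -[leRHS]real_normK ?num_real //.
    by apply: sq_le; linear.
  by rewrite /w; linear.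
have wm y : `|y - y0| <= d -> w m y <= 0.
  move=> yd; have := inb m y (leqnn m) yd; rewrite ler_norml => /andP[_ p1].
  have : 0 <= c3 * (y - y0) ^+ 2 by rewrite mulr_ge0 ?sqr_ge0.
  by rewrite /w [m%:R * h]mulrC -/D bD; linear.
have m_gt0 : (0 < m)%N.
  by rewrite lt0n; apply: contraTneq D0 => m0; rewrite /D m0 mulr0 ltxx.
suff main : w 1%N y0 <= 0.
  move: main; rewrite /w /ph (subrr y0) expr0n /= mulr0 !mul1r subrr mul0r !addr0.
  have : c2 * h ^+ 2 <= 0 by rewrite mulr_le0_ge0 // ltW.
  linear.
have [m1'|m1'] := ltnP 1 m; last first.
  have -> : 1%N = m by apply/eqP; rewrite eqn_leq m_gt0 m1'.
  by apply: wm; rewrite subrr normr0 ltW.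
suff : forall z, A z -> w z.1 z.2 <= 0.
  by move=> main; apply: (main (1%N, y0)); split => //=; rewrite subrr normr0.
apply: (@sup_iter _ _ _ _ M (h ^+ 2 / 4)); first by rewrite divr_gt0.
  move=> [i y] [/= i0 im yD].
  have yd : `|y - y0| <= d by linear.
  have := inb i y (ltnW im) yd; rewrite ler_norml => /andP[_ p1].
  have := bx _ (iD i (ltnW im)); have : 0 <= c3 * (y - y0) ^+ 2 by rewrite mulr_ge0 ?sqr_ge0.
  by rewrite /w; linear.
move=> S S0 wS [i y] [/= i0 im yD] wiy.
have hD : h <= D by rewrite /D ler_peMr ?ler1n // ltW.
have n1 : w i.+1 y <= S.
  have [im'|im'] := ltnP i.+1 m; first exact: (wS (i.+1, y)).
  have -> : i.+1 = m by apply/eqP; rewrite eqn_leq im im'.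
  by apply: le_trans S0; apply: wm; linear.
have n2 : w i.-1 y <= S.
  have [i1|i1] := ltnP 1 i.
    apply: (wS (i.-1, y)); split => //=; first by rewrite -ltnS prednK.
    by rewrite (leq_ltn_trans (leq_pred _)).
  have i1' : i = 1%N by apply/eqP; rewrite eqn_leq i0 i1.
  apply: le_trans S0; move: wiy (bx _ (iD i (ltnW im))); rewrite i1' /w /=.
  (* The left neighbour of [i = 1] carries the opposite value: if [w 1] is positive then so is
     [ph 1], hence [w 0 <= 0]. *)
  have -> : ph 0%N y = - ph 1%N y.
    by rewrite /ph mulr0n mulr1n subr0 subrr !mul0r addr0 mul1r; ring.
  rewrite mulr0n !mul0r expr0n /= mulr0 mulr0 !add0r.
  have : 0 <= c3 * (y - y0) ^+ 2 by rewrite mulr_ge0 ?sqr_ge0.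
  linear.
have nby t : `|t| = h -> w i (y + t) <= S.
  move=> th; have [yD'|yD'] := ltP `|y + t - y0| D; first exact: (wS (i, y + t)).
  apply: le_trans S0; apply: wD; first exact: ltnW.
  rewrite yD' /= addrAC; have := ler_normD (y - y0) t; linear.
have n3 : w i (y + h) <= S by apply: nby; rewrite gtr0_norm.
have n4 : w i (y - h) <= S by apply: nby; rewrite normrN gtr0_norm.
have /andP[ih0 ihD] := iD i (ltnW im).
have [|l1 l2] := dlb i y (ltnW im).
  by have /andP[_ DD'] := DD; apply: le_trans (ltW yD) _; apply: le_trans DD' _; clear -d0; linear.
have lapE p q : u (p + h) q + u (p - h) q + u p (q + h) + u p (q - h) =
    4 * u p q + h ^+ 2 * dlap h u p q.
  by rewrite /dlap; field; rewrite gt_eqF.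
have sN p q : `|dlap h u p q| <= N ->
    - (N * h ^+ 2) <= s * (h ^+ 2 * dlap h u p q) <= N * h ^+ 2.
  move=> pN; rewrite -ler_norml normrM s1 mul1r normrM (gtr0_norm h2) mulrC.
  by rewrite ler_wpM2r // ltW.
have /andP[b1 _] := sN _ _ l1; have /andP[_ b2] := sN _ _ l2.
have iS : i.+1%:R = i%:R + 1 :> R by rewrite -natr1.
have iP : i.-1%:R = i%:R - 1 :> R by rewrite -[in RHS](prednK i0) -natr1 addrK.
have cE : 2 * c2 + 2 * c3 = - (N + 1) by rewrite /c2 /N'; field.
have key : w i.+1 y + w i.-1 y + w i (y + h) + w i (y - h) = 4 * w i y +
    s / 2 * (h ^+ 2 * dlap h u (x0 + i%:R * h) y) -
    s / 2 * (h ^+ 2 * dlap h u (x0 + (1 - i%:R) * h) y) - (2 * c2 + 2 * c3) * h ^+ 2.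
  have e1 := lapE (x0 + i%:R * h) y; have e2 := lapE (x0 + (1 - i%:R) * h) y.
  rewrite /w /ph iS iP.
  have -> : x0 + (i%:R + 1) * h = x0 + i%:R * h + h by ring.
  have -> : x0 + (i%:R - 1) * h = x0 + i%:R * h - h by ring.
  have -> : x0 + (1 - (i%:R + 1)) * h = x0 + (1 - i%:R) * h - h by ring.
  have -> : x0 + (1 - (i%:R - 1)) * h = x0 + (1 - i%:R) * h + h by ring.
  have -> : h ^+ 2 * dlap h u (x0 + i%:R * h) y = u (x0 + i%:R * h + h) y +
    u (x0 + i%:R * h - h) y + u (x0 + i%:R * h) (y + h) + u (x0 + i%:R * h) (y - h) -
    4 * u (x0 + i%:R * h) y by rewrite e1; ring.
  have -> : h ^+ 2 * dlap h u (x0 + (1 - i%:R) * h) y = u (x0 + (1 - i%:R) * h + h) y +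
    u (x0 + (1 - i%:R) * h - h) y + u (x0 + (1 - i%:R) * h) (y + h) +
    u (x0 + (1 - i%:R) * h) (y - h) - 4 * u (x0 + (1 - i%:R) * h) y by rewrite e2; ring.
  by ring.
rewrite cE in key; clear -key n1 n2 n3 n4 b1 b2 h2.
by linear.
Qed.

End DiscreteEstimates.

(** * Limits of grid functions *)

Section GridLimit.
Context {R : realType}.
Implicit Types (U V : nat -> R -> R -> R) (u v w : R -> R -> R) (e : bool) (i j n : nat)
  (a b c d h l m p q r s t x y C M N : R).

Lemma ev2 {P Q S : nat -> Prop} : (\forall n \near \oo, P n) ->
  (\forall n \near \oo, Q n) -> (forall n, P n -> Q n -> S n) ->
  \forall n \near \oo, S n.
Proof.
by move=> hP hQ H; near=> n; apply: H; near: n.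
Unshelve. all: by end_near. Qed.

(** A period is a whole number of steps, so that rounding to the lattice commutes with translation
    by [2 * pi]. *)
Definition step n : R := 2 * pi / n.+1%:R.

Lemma step_gt0 n : 0 < step n.
Proof. by rewrite divr_gt0 // mulr_gt0 // pi_gt0. Qed.

Lemma step_cvg0 : step n @[n --> \oo] --> 0.
Proof.
rewrite -[X in _ --> X](mulr0 (2 * pi)); apply: cvgMr.
exact: cvg_harmonic.
Qed.

Lemma step_le r : 0 < r -> \forall n \near \oo, step n <= r.
Proof.
move=> r0; have /cvgrPdist_le /(_ r r0) := step_cvg0; apply: filterS => n.
by rewrite sub0r normrN gtr0_norm ?step_gt0.
Qed.

(** Difference bounds relate only points that are whole steps apart. Limits are therefore taken
    along the points of a single lattice, reached by rounding down, and not at a fixed point. *)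
Definition grid n x : R := step n * (Num.floor (x / step n))%:~R.

Lemma gridP n x : grid n x <= x < grid n x + step n.
Proof.
have /andP[f1 f2] := floor_itv (x / step n).
rewrite intrD in f2; have s0 := step_gt0 n.
rewrite ler_pdivlMr // in f1; rewrite ltr_pdivrMr // mulrDl mul1r in f2.
by rewrite /grid mulrC f1.
Qed.

Lemma grid_dist n x : `|grid n x - x| <= step n.
Proof.
have /andP[g1 g2] := gridP n x; have := step_gt0 n.
by rewrite ler_norml; linear.
Qed.

Lemma grid_sub n x y : x <= y -> exists k : nat, grid n y = grid n x + k%:R * step n.
Proof.
move=> xy; have s0 := step_gt0 n.
have fxy : Num.floor (x / step n) <= Num.floor (y / step n).
  by apply: le_floor; rewrite ler_pM2r ?invr_gt0.
exists `|Num.floor (y / step n) - Num.floor (x / step n)|%N.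
have : 0 <= Num.floor (y / step n) - Num.floor (x / step n) by rewrite subr_ge0.
move/gez0_abs => E; rewrite pmulrn E intrB /grid; ring.
Qed.

Lemma grid_per n x : grid n (x + 2 * pi) = grid n x + 2 * pi.
Proof.
have s0 := step_gt0 n.
have E : (x + 2 * pi) / step n = x / step n + n.+1%:Z%:~R.
  rewrite mulrDl; congr (_ + _); rewrite /step invf_div mulrC divfK //.
  by rewrite gt_eqF // mulr_gt0 // pi_gt0.
rewrite /grid E floorDrz ?intr_int // intrKfloor intrD mulrDr; congr (_ + _).
by rewrite -pmulrn /step divfK.
Qed.

Definition shx e h : R := if e then h else 0.
Definition shy e h : R := if e then 0 else h.

Definition DD e U n x y :=
  (U n (x + shx e (step n)) (y + shy e (step n)) - U n x y) / step n.

Definition DL U n x y := dlap (step n) (U n) x y.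

Definition swap U n x y := U n y x.

Definition locally_bounded U x0 y0 := exists r C, [/\ 0 < r, 0 <= C &
  \forall n \near \oo, forall x y, `|x - x0| < r -> `|y - y0| < r -> `|U n x y| <= C].

Lemma locally_bounded_swap {U x y} : locally_bounded U x y -> locally_bounded (swap U) y x.
Proof.
move=> [r [C [r0 C0 H]]]; exists r, C; split => //.
by apply: filterS H => n H x' y' hx hy; apply: H.
Qed.

Lemma locally_bounded_near {U V x0 y0} : locally_bounded U x0 y0 -> (exists2 r : R, 0 < r &
  \forall n \near \oo, forall x y, `|x - x0| < r -> `|y - y0| < r ->
     `|V n x y| <= `|U n x y|) -> locally_bounded V x0 y0.
Proof.
move=> [r [C [r0 C0 H]]] [r' r'0 H']; exists (Num.min r r'), C; split => //.
  by rewrite lt_min r0.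
near=> n => x y; rewrite !lt_min => /andP[x1 x2] /andP[y1 y2].
apply: (@le_trans _ _ `|U n x y|); first by move: x y x1 x2 y1 y2; near: n; apply: filterS H' => n H' x y *; apply: H'.
by move: x y x1 x2 y1 y2; near: n; apply: filterS H => n H x y *; apply: H.
Unshelve. all: by end_near. Qed.

Lemma dlap_swap h u x y : dlap h (fun s t => u t s) x y = dlap h u y x.
Proof. by rewrite /dlap; congr (_ / _); ring. Qed.

Lemma DD_true U n x y : DD true U n x y = (U n (x + step n) y - U n x y) / step n.
Proof. by rewrite /DD /= addr0. Qed.

(** The bootstrap: as differences commute with [DL], this can be applied again to the differences it
    bounds. *)
Lemma locally_bounded_grad e {U x0 y0} : locally_bounded U x0 y0 -> locally_bounded (DL U) x0 y0 -> locally_bounded (DD e U) x0 y0.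
Proof.
have main V p q : locally_bounded V p q -> locally_bounded (DL V) p q -> locally_bounded (DD true V) p q.
  move=> [r [C [r0 C0 H]]] [r' [C' [r'0 C'0 H']]].
  pose m := Num.min r r'; have m0 : 0 < m by rewrite lt_min r0.
  pose d := m / 3; have d0 : 0 < d by rewrite divr_gt0.
  exists (m / 2), (16 * C / d + (C' + 1) * d); split.
  - by rewrite divr_gt0.
  - by rewrite addr_ge0 // mulr_ge0 ?invr_ge0 ?addr_ge0 ?mulr_ge0 // ltW.
  have H2 : \forall n \near \oo, forall x y, `|x - p| < m -> `|y - q| < m ->
      `|V n x y| <= C /\ `|DL V n x y| <= C'.
    near=> n => x y; rewrite !lt_min => /andP[x1 x2] /andP[y1 y2]; split.
      by move: x y x1 x2 y1 y2; near: n; apply: filterS H => n H x y *; apply: H.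
    by move: x y x1 x2 y1 y2; near: n; apply: filterS H' => n H' x y *; apply: H'.
  have d4 : 0 < d / 4 by rewrite divr_gt0.
  apply: (ev2 H2 (step_le _ d4)) => n {}H2 sn x y hx hy.
  rewrite DD_true; apply: discrete_grad => // [|x' y' hx' hy']; first exact: step_gt0.
  have dE : d * 3 = m by rewrite /d divfK.
  apply: H2.
    by rewrite -(subrKA x); apply: (le_lt_trans (ler_normD _ _)); linear.
  by rewrite -(subrKA y); apply: (le_lt_trans (ler_normD _ _)); linear.
move=> hU hL; case: e; first exact: main.
have E : DL (swap U) = swap (DL U).
  by apply/funext => n; apply/funext => x; apply/funext => y; apply: dlap_swap.
by apply: (@locally_bounded_swap (DD true (swap U))); apply: main; [|rewrite E]; apply: locally_bounded_swap.
Unshelve. all: by end_near. Qed.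

Lemma DL_DD e U : DL (DD e U) = DD e (DL U).
Proof.
apply/funext => n; apply/funext => x; apply/funext => y.
have s0 : step n != 0 by rewrite gt_eqF // step_gt0.
rewrite /DL /DD /dlap; move: (step n) s0 => h h0.
by case: e; rewrite /= ?addr0 ?addrK ?subrK; field.
Qed.

Lemma telescope_le (g : R -> R) x h C k :
  (forall j, (j < k)%N -> `|g (x + j.+1%:R * h) - g (x + j%:R * h)| <= C * h) ->
  `|g (x + k%:R * h) - g x| <= C * (k%:R * h).
Proof.
elim: k => [|k IH] H; first by rewrite mul0r addr0 subrr normr0 mulr0.
have := IH (fun j jk => H j (ltnW jk)); have := H k (ltnSn k).
rewrite -natr1 mulrDl mul1r mulrDr.
have := ler_normD (g (x + (k%:R * h + h)) - g (x + k%:R * h)) (g (x + k%:R * h) - g x).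
rewrite subrKA; linear.
Qed.

(** A discrete Taylor formula: when the increments [h * g1 t] are summed, the remainder is the
    variation of [g1] along the way. *)
Lemma telescope_sq_le (g g1 : R -> R) x h B k : 0 <= h ->
  (forall t, g (t + h) - g t = h * g1 t) ->
  (forall j, (j < k)%N -> `|g1 (x + j%:R * h) - g1 x| <= B) ->
  `|g (x + k%:R * h) - g x - k%:R * h * g1 x| <= k%:R * h * B.
Proof.
move=> h0 E; elim: k => [|k IH] H.
  by rewrite mul0r addr0 subrr mul0r subr0 normr0 mul0r.
have := IH (fun j jk => H j (ltnW jk)); have := ler_wpM2l h0 (H k (ltnSn k)).
rewrite -{1}(ger0_norm h0) -normrM => h1 h2.
have -> : g (x + k.+1%:R * h) - g x - k.+1%:R * h * g1 x =
    (g (x + k%:R * h) - g x - k%:R * h * g1 x) + h * (g1 (x + k%:R * h) - g1 x).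
  by rewrite mulrBr -E -natr1 (_ : x + (k%:R + 1) * h = x + k%:R * h + h); ring.
apply: (le_trans (ler_normD _ _)); apply: (le_trans (lerD h2 h1)).
by rewrite -natr1; linear.
Qed.

Lemma locally_bounded_lip0 {U x0 y0} : locally_bounded (DD true U) x0 y0 ->
  exists r C, [/\ 0 < r, 0 <= C & \forall n \near \oo, forall x k y,
    `|x - x0| < r -> `|x + k%:R * step n - x0| < r -> `|y - y0| < r ->
    `|U n (x + k%:R * step n) y - U n x y| <= C * (k%:R * step n)].
Proof.
move=> [r [C [r0 C0 H]]]; exists r, C; split => //.
apply: filterS H => n H x k y hx hk hy; have s0 := step_gt0 n.
apply: (telescope_le (fun t => U n t y)) => j jk.
have := H (x + j%:R * step n) y; rewrite DD_true => H1.
have -> : x + j.+1%:R * step n = x + j%:R * step n + step n by rewrite -natr1; ring.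
rewrite -[X in `|X|](divfK (_ : step n != 0)) ?gt_eqF // normrM (gtr0_norm s0).
rewrite ler_wpM2r ?(ltW s0) //; apply: H1 hy.
have j1 : j%:R * step n <= k%:R * step n by rewrite ler_pM2r // ler_nat ltnW.
have j0 : 0 <= j%:R * step n by rewrite mulr_ge0 // ltW.
by move: hx hk; rewrite !ltr_norml => /andP[? ?] /andP[? ?]; linear.
Qed.

Lemma locally_bounded_lip {U x0 y0} : locally_bounded (DD true U) x0 y0 ->
  exists r C, [/\ 0 < r, 0 <= C & \forall n \near \oo,
    forall x x' y, `|x - x0| < r -> `|x' - x0| < r -> `|y - y0| < r ->
    `|U n (grid n x') y - U n (grid n x) y| <= C * (`|x' - x| + 2 * step n)].
Proof.
move=> /locally_bounded_lip0[r [C [r0 C0 H]]]; exists (r / 2), C; split => //; first by rewrite divr_gt0.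
have r4 : 0 < r / 4 by rewrite divr_gt0.
apply: (ev2 H (step_le _ r4)) => n {}H sn x x' y hx hx' hy.
have s0 := step_gt0 n.
wlog xx' : x x' hx hx' / x <= x'.
  move=> W; have [xx|/ltW xx] := leP x x'; first exact: W.
  by rewrite distrC [`|x' - x|]distrC; apply: W.
have [k kE] := grid_sub n _ _ xx'.
have g1 := grid_dist n x; have g2 := grid_dist n x'.
rewrite !ler_norml in g1 g2; have /andP[? ?] := g1; have /andP[? ?] := g2.
have kle : k%:R * step n <= `|x' - x| + 2 * step n by rewrite ger0_norm; linear.
rewrite kE; apply: (@le_trans _ _ (C * (k%:R * step n))); last by rewrite ler_wpM2l.
by apply: H; rewrite -?kE; move: hx hx' hy; rewrite ?ltr_norml; linear.
Qed.

Definition glim U x y : R := ulim (fun n => U n (grid n x) (grid n y)).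

Lemma locally_bounded_ubnd {U x0 y0} : locally_bounded U x0 y0 -> exists2 r : R, 0 < r & forall x y,
  `|x - x0| < r -> `|y - y0| < r -> ubnd (fun n => U n (grid n x) (grid n y)).
Proof.
move=> [r [C [r0 C0 H]]]; exists (r / 2); first by rewrite divr_gt0.
move=> x y hx hy; exists C.
have r4 : 0 < r / 4 by rewrite divr_gt0.
apply: (ev2 H (step_le _ r4)) => n {}H sn; apply: H.
  by have := ler_normD (grid n x - x) (x - x0); rewrite subrKA; have := grid_dist n x; linear.
by have := ler_normD (grid n y - y) (y - y0); rewrite subrKA; have := grid_dist n y; linear.
Qed.

Lemma locally_bounded_ubnd0 {U x0 y0} : locally_bounded U x0 y0 -> ubnd (fun n => U n (grid n x0) (grid n y0)).
Proof. by move=> /locally_bounded_ubnd[r r0]; apply; rewrite subrr normr0. Qed.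

Lemma cvg_step_lin C a c : (C * (a + c * step n)) @[n --> \oo] --> C * a.
Proof.
apply: cvgMr; rewrite -[X in _ --> X]addr0; apply: cvgD; first exact: cvg_cst.
by rewrite -[X in _ --> X](mulr0 c); apply: cvgMr; apply: step_cvg0.
Qed.

(** First differences bound the increments of [U n] along lattice paths, in [x] and then in [y].
    Rounding adds a multiple of [step n], which disappears in the limit. *)
Lemma glim_cont {U x0 y0} : locally_bounded U x0 y0 -> (forall e, locally_bounded (DD e U) x0 y0) ->
  cont2 (glim U) x0 y0.
Proof.
move=> hU hD; have [r0 r00 bU] := locally_bounded_ubnd hU.
have [r1 [C1 [r10 C10 H1]]] := locally_bounded_lip (hD true).
have [r2 [C2 [r20 C20 H2]]] := @locally_bounded_lip (swap U) y0 x0 (locally_bounded_swap (hD false)).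
pose r := Num.min r0 (Num.min r1 r2); have r_gt0 : 0 < r by rewrite !lt_min r00 r10.
have lip x y : `|x - x0| < r -> `|y - y0| < r ->
    `|glim U x y - glim U x0 y0| <= (C1 + C2) * (`|x - x0| + `|y - y0|).
  move=> hx hy; have [x1 x2 x3] : [/\ `|x - x0| < r0, `|x - x0| < r1 & `|x - x0| < r2].
    by move: hx; rewrite !lt_min => /and3P[].
  have [y1 y2 y3] : [/\ `|y - y0| < r0, `|y - y0| < r1 & `|y - y0| < r2].
    by move: hy; rewrite !lt_min => /and3P[].
  have u1 := bU _ _ x1 y1; have u0 := locally_bounded_ubnd0 hU.
  have -> : glim U x y - glim U x0 y0 = ulim (fun n => U n (grid n x) (grid n y) +
      -1 * U n (grid n x0) (grid n y0)) by rewrite ulim_lin // mulN1r.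
  apply: (ulim_abs_le_lim (ubnd_lin _ u1 u0) (cvg_step_lin (C1 + C2) _ 4)).
  have rr : 0 < Num.min (r1 - `|y - y0|) r2 / 2.
    by rewrite divr_gt0 // lt_min; apply/andP; split; linear.
  apply: (ev2 (step_le _ rr) (filterI H1 H2)) => n sn [H1n H2n].
  have s0 := step_gt0 n; rewrite mulN1r.
  have [s1 s2] : step n < r1 - `|y - y0| /\ step n < r2.
    have [m1 m2] : Num.min (r1 - `|y - y0|) r2 <= r1 - `|y - y0| /\
      Num.min (r1 - `|y - y0|) r2 <= r2 by rewrite !ge_min !lexx orbT.
    by move: (Num.min _ _) rr sn m1 m2 => m; linear.
  have gy : `|grid n y - y0| < r1.
    by have := ler_normD (grid n y - y) (y - y0); rewrite subrKA; have := grid_dist n y; linear.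
  have gx0 : `|grid n x0 - x0| < r2 by have := grid_dist n x0; linear.
  have x01 : `|x0 - x0| < r1 by rewrite subrr normr0.
  have y02 : `|y0 - y0| < r2 by rewrite subrr normr0.
  have P1 := H1n _ _ _ x01 x2 gy; have P2 := H2n _ _ _ y02 y3 gx0.
  rewrite /swap in P2.
  have E1 : (C1 + C2) * (`|x - x0| + `|y - y0| + 4 * step n) =
    C1 * (`|x - x0| + 2 * step n) + C2 * (`|y - y0| + 2 * step n) +
    (C1 * (`|y - y0| + 2 * step n) + C2 * (`|x - x0| + 2 * step n)) by ring.
  have : 0 <= C1 * (`|y - y0| + 2 * step n) + C2 * (`|x - x0| + 2 * step n).
    by rewrite addr_ge0 // mulr_ge0 // addr_ge0 // mulr_ge0 // ltW.
  have := ler_normD (U n (grid n x) (grid n y) - U n (grid n x0) (grid n y))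
    (U n (grid n x0) (grid n y) - U n (grid n x0) (grid n y0)).
  by rewrite subrKA E1; linear.
apply/cont2P => e e0.
have C0 : 0 < C1 + C2 + 1 by linear.
exists (Num.min r (e / (C1 + C2 + 1) / 2)); first by rewrite lt_min r_gt0 !divr_gt0.
move=> x y; rewrite lt_min => /andP[x1 x2]; rewrite lt_min => /andP[y1 y2].
apply: (le_lt_trans (lip x y x1 y1)).
apply: (@le_lt_trans _ _ ((C1 + C2 + 1) * (`|x - x0| + `|y - y0|))).
  by rewrite ler_wpM2r ?addr_ge0 //; linear.
by rewrite mulrC -ltr_pdivlMr //; linear.
Qed.

(** Bounded second differences make the first-order expansion of [U n] uniform in [n], with a
    remainder of order [t ^+ 2], and such an expansion passes to the ultralimit. *)
Lemma glim_derive {U x0 y0} : locally_bounded U x0 y0 -> locally_bounded (DD true U) x0 y0 ->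
  locally_bounded (DD true (DD true U)) x0 y0 ->
  is_derive x0 (1 : R) (fun x => glim U x y0) (glim (DD true U) x0 y0).
Proof.
move=> hU hD hDD; have [r0 r00 bU] := locally_bounded_ubnd hU.
have [r1 [C1 [r10 C10 H1]]] := locally_bounded_lip0 hDD.
have [r2 [C2 [r20 C20 H2]]] := hD.
pose r := Num.min r0 (Num.min r1 r2) / 2.
have r_gt0 : 0 < r by rewrite divr_gt0 // !lt_min r00 r10.
have [rr0 rr1 rr2] : [/\ 2 * r <= r0, 2 * r <= r1 & 2 * r <= r2].
  by rewrite /r mulrC divfK // !ge_min !lexx !orbT.
apply: (@is_derive_bound _ _ _ _ (2 * C1) r) => // t tr.
have yy : `|y0 - y0| < r0 by rewrite subrr normr0.
have xt : `|x0 + t - x0| < r0 by rewrite addrAC subrr add0r; linear.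
have u1 := bU _ _ xt yy; have u0 := locally_bounded_ubnd0 hU; have d0 := locally_bounded_ubnd0 hD.
have -> : glim U (x0 + t) y0 - glim U x0 y0 - glim (DD true U) x0 y0 * t =
    ulim (fun n => (U n (grid n (x0 + t)) (grid n y0) + -1 * U n (grid n x0) (grid n y0)) +
      (- t) * DD true U n (grid n x0) (grid n y0)).
  by rewrite !ulim_lin //; [rewrite /glim; ring|apply: ubnd_lin].
pose v n := 2 * C1 * (`|t| + 2 * step n) ^+ 2 + C2 * (0 + 2 * step n).
have vl : v n @[n --> \oo] --> 2 * C1 * t ^+ 2.
  have -> : 2 * C1 * t ^+ 2 = 2 * C1 * (`|t| ^+ 2) + C2 * 0.
    by rewrite mulr0 addr0 real_normK ?num_real.
  apply: cvgD; last exact: cvg_step_lin.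
  have l1 : (`|t| + 2 * step n) @[n --> \oo] --> `|t|.
    by have := cvg_step_lin 1 `|t| 2; rewrite mul1r; under eq_fun do rewrite mul1r.
  by apply: cvgMr; rewrite expr2; apply: cvgM.
apply: (ulim_abs_le_lim _ vl); first by do !apply: ubnd_lin.
have rh : 0 < Num.min (r / 2) (r1 / 2) by rewrite lt_min; apply/andP; split; apply: divr_gt0.
apply: (ev2 (step_le _ rh) (filterI H1 H2)) => n sn [H1n H2n].
have s0 := step_gt0 n; rewrite mulN1r.
have [s1 s2] : step n <= r / 2 /\ step n <= r1 / 2 by move: sn; rewrite le_min => /andP[].
have gy1 : `|grid n y0 - y0| < r1 by have := grid_dist n y0; linear.
have gy2 : `|grid n y0 - y0| < r2 by have := grid_dist n y0; linear.
have xn : `|grid n x0 - x0| < r2 by have := grid_dist n x0; linear.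
have D2 := H2n _ _ xn gy2.
have g1 := grid_dist n x0; have g2 := grid_dist n (x0 + t).
rewrite !ler_norml in g1 g2; have /andP[g11 g12] := g1; have /andP[g21 g22] := g2.
have x01 : `|x0 - x0| < r1 by rewrite subrr normr0.
have xt1 : `|x0 + t - x0| < r1 by rewrite addrAC subrr add0r; linear.
move: (grid n y0) gy1 gy2 D2 => y' gy1 gy2 D2.
have gn x : `|x - x0| < r -> `|grid n x - x0| < r1.
  move=> hx; have := ler_normD (grid n x - x) (x - x0).
  by rewrite subrKA; have := grid_dist n x; linear.
have tele x x' : x <= x' -> `|x - x0| < r -> `|x' - x0| < r ->
   let d := grid n x' - grid n x in
   [/\ 0 <= d, `|DD true U n (grid n x') y' - DD true U n (grid n x) y'| <= C1 * d &
   `|U n (grid n x') y' - U n (grid n x) y' - d * DD true U n (grid n x) y'|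
     <= d * (C1 * d)].
  move=> xx' hx hx' /=; have [k kE] := grid_sub n _ _ xx'.
  have dE : grid n x' - grid n x = k%:R * step n by rewrite kE addrAC subrr add0r.
  have hk : `|grid n x + k%:R * step n - x0| < r1 by rewrite -kE; apply: gn.
  have k0 : 0 <= k%:R * step n by rewrite mulr_ge0 // ltW.
  rewrite dE kE; split => //; first exact: (H1n _ _ _ (gn _ hx) hk gy1).
  apply: (@telescope_sq_le (fun s => U n s y') (fun s => DD true U n s y')); first exact: ltW.
    by move=> s; rewrite DD_true mulrC divfK // gt_eqF.
  move=> j jk; have jk' : j%:R * step n <= k%:R * step n by rewrite ler_pM2r // ler_nat ltnW.
  have j0 : 0 <= j%:R * step n by rewrite mulr_ge0 // ltW.
  apply: (le_trans (H1n _ _ _ (gn _ hx) _ gy1)); last by rewrite ler_wpM2l.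
  by move: hk (gn _ hx); rewrite !ltr_norml; linear.
have xr : `|x0 - x0| < r by rewrite subrr normr0.
have xtr : `|x0 + t - x0| < r by rewrite addrAC subrr add0r.
pose d := grid n (x0 + t) - grid n x0.
have dt : `|d - t| <= 2 * step n by rewrite /d ler_norml; linear.
have dabs : `|d| <= `|t| + 2 * step n.
  by have := ler_normD (d - t) t; rewrite subrK; linear.
have main : `|U n (grid n (x0 + t)) y' - U n (grid n x0) y' -
    d * DD true U n (grid n x0) y'| <= 2 * C1 * `|d| ^+ 2.
  have Cd : 0 <= C1 * `|d| ^+ 2 by rewrite mulr_ge0 // sqr_ge0.
  have [t0|t0] := leP 0 t.
    have [|d0' _] := tele x0 (x0 + t) _ xr xtr; first by rewrite lerDl.
    by rewrite -/d in d0' *; rewrite [`|d|](ger0_norm d0') in Cd *; linear.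
  have [|d0' h1 h2] := tele (x0 + t) x0 _ xtr xr; first by linear.
  have dN : grid n x0 - grid n (x0 + t) = - d by rewrite /d; ring.
  rewrite dN in d0' h1 h2.
  have dn : `|d| = - d by rewrite -normrN ger0_norm.
  rewrite dn in Cd *.
  move: h1 h2; set A1 := DD _ _ _ _ _; set A2 := DD _ _ _ _ _.
  set B1 := U _ _ _; set B2 := U _ _ _ => h1 h2.
  have h3 := ler_wpM2l d0' h1; rewrite -{1}(ger0_norm d0') -normrM in h3.
  have -> : B2 - B1 - d * A1 = - (B1 - B2 - - d * A2) + - d * (A1 - A2) by ring.
  have := ler_normD (- (B1 - B2 - - d * A2)) (- d * (A1 - A2)).
  by rewrite (normrN (_ - _ - _)); linear.
have C2d : `|(d - t) * DD true U n (grid n x0) y'| <= C2 * (0 + 2 * step n).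
  by rewrite normrM add0r mulrC ler_pM.
have -> : U n (grid n (x0 + t)) y' - U n (grid n x0) y' + - t * DD true U n (grid n x0) y' =
   (U n (grid n (x0 + t)) y' - U n (grid n x0) y' - d * DD true U n (grid n x0) y') +
   (d - t) * DD true U n (grid n x0) y' by ring.
apply: (le_trans (ler_normD _ _)); rewrite /v lerD //.
apply: (le_trans main); rewrite ler_wpM2l ?mulr_ge0 //.
exact: sq_le.
Qed.

End GridLimit.

(** * Existence in the perturbed channel *)

Section Existence.
Context {R : realType}.
Implicit Types (U V : nat -> R -> R -> R) (u v w : R -> R -> R) (e : bool) (i j n : nat)
  (a b c d h l m p q r s t x y C M N : R).

(** The nonlinearity after truncation. [k] is the gap between its slopes and [- b ^+ 2], where
    [cos (b * y)] is the weight of the maximum principle, and [Y] is a half-height up to which this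
    weight stays above [v0]. By [k <= b ^+ 2] the slope 0 is admissible too, which lets barriers
    treat the nonlinear term as a source. *)
Record stable (f f1 : R -> R) (b k Kf Lf Y v0 : R) : Prop := Stable {
  st_der : forall t, is_derive t (1 : R) f (f1 t);
  st_ge : forall t, k - b ^+ 2 <= f1 t;
  st_le : forall t, `|f1 t| <= Kf;
  st_lip : forall s t, `|f1 s - f1 t| <= Lf * `|s - t|;
  st_b : 0 < b;
  st_k : 0 < k;
  st_kK : k <= Kf;
  st_kb : k <= b ^+ 2;
  st_v0 : 0 < v0;
  st_cos : forall y, `|y| <= Y -> v0 <= cos (b * y) }.

Definition dir_der e u x y a : Prop :=
  if e then is_derive x (1 : R) (u^~ y) a else is_derive y (1 : R) (u x) a.

Lemma glim_dir e {U x y} : locally_bounded U x y -> locally_bounded (DD e U) x y -> locally_bounded (DD e (DD e U)) x y ->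
  dir_der e (glim U) x y (glim (DD e U) x y).
Proof.
case: e => hU hD hDD; first exact: glim_derive.
have := @glim_derive _ (swap U) y x (locally_bounded_swap hU) (locally_bounded_swap hD).
by apply; exact: (@locally_bounded_swap _ (DD false (DD false U))).
Qed.

Lemma dlap_shift h u x y : h != 0 -> dlap h u x y =
  ((u (x - h + h + h) y - u (x - h + h) y) / h - (u (x - h + h) y - u (x - h) y) / h) / h +
  ((u x (y - h + h + h) - u x (y - h + h)) / h - (u x (y - h + h) - u x (y - h)) / h) / h.
Proof. by move=> h0; rewrite /dlap !subrK; field. Qed.

(** The central second difference is the double forward difference one step back, and bounded third
    differences make that step negligible. *)
Lemma DD_lap U x y : locally_bounded (DD true (DD true (DD true U))) x y ->
  locally_bounded (DD false (DD false (DD false U))) x y ->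
  locally_bounded (DD true (DD true U)) x y -> locally_bounded (DD false (DD false U)) x y ->
  ulim (fun n => DL U n (grid n x) (grid n y)) =
  glim (DD true (DD true U)) x y + glim (DD false (DD false U)) x y.
Proof.
have main V p q : locally_bounded (DD true (DD true (DD true V))) p q -> locally_bounded (DD true (DD true V)) p q ->
    exists2 C, 0 <= C & \forall n \near \oo,
    `|DD true (DD true V) n (grid n p - step n) (grid n q) -
      DD true (DD true V) n (grid n p) (grid n q)| <= C * (0 + 1 * step n).
  move=> /locally_bounded_lip0[r [C [r0 C0 H]]] _; exists C => //.
  have r4 : 0 < r / 4 by rewrite divr_gt0.
  apply: (ev2 H (step_le _ r4)) => n {}H sn.
  have g1 := grid_dist n p; have g2 := grid_dist n q; rewrite add0r mul1r.
  have := H (grid n p - step n) 1%N (grid n q); rewrite mulr1n mul1r subrK => H'; rewrite distrC; apply: H'.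
  - have := ler_normB (grid n p - p) (step n); rewrite (gtr0_norm (step_gt0 n)) addrAC; linear.
  - linear.
  - linear.
move=> ttt fff tt ff.
have [C1 C10 H1] := main _ _ _ ttt tt.
have [C2 C20 H2] := main (swap U) y x (locally_bounded_swap fff) (locally_bounded_swap ff).
have b1 := locally_bounded_ubnd0 tt; have b2 := locally_bounded_ubnd0 ff.
rewrite -[glim (DD false _) _ _]mul1r -ulim_lin //.
have dif : \forall n \near \oo, `|DL U n (grid n x) (grid n y) -
    (DD true (DD true U) n (grid n x) (grid n y) +
     1 * DD false (DD false U) n (grid n x) (grid n y))| <= (C1 + C2) * (0 + 1 * step n).
  apply: (ev2 H1 H2) => n {}H1 {}H2.
  have sn : step n != 0 :> R by rewrite gt_eqF // step_gt0.
  have -> : DL U n (grid n x) (grid n y) =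
    DD true (DD true U) n (grid n x - step n) (grid n y) +
    DD false (DD false U) n (grid n x) (grid n y - step n).
    by rewrite /DL dlap_shift // /DD /= !addr0.
  rewrite mul1r opprD addrACA mulrDl.
  by apply: (le_trans (ler_normD _ _)); rewrite lerD.
have b12 := ubnd_lin 1 b1 b2.
have dif0 : (DL U n (grid n x) (grid n y) -
    (DD true (DD true U) n (grid n x) (grid n y) +
     1 * DD false (DD false U) n (grid n x) (grid n y))) @[n --> \oo] --> 0.
  apply: norm_cvg0; apply: (@squeeze_cvgr _ _ _ _ (fun=> 0) (fun n => (C1 + C2) * (0 + 1 * step n))).
  - by apply: filterS dif => n; rewrite normr_ge0.
  - exact: cvg_cst.
  - by have := cvg_step_lin (C1 + C2) 0 1; rewrite mulr0.
apply: ulim_eq => //.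
have [M HM] := b12; exists (M + (C1 + C2) * 1).
apply: (ev2 (filterI HM dif) (step_le _ ltr01)) => n [{}HM {}dif] sn.
have := ler_normD (DL U n (grid n x) (grid n y) -
    (DD true (DD true U) n (grid n x) (grid n y) +
     1 * DD false (DD false U) n (grid n x) (grid n y)))
   (DD true (DD true U) n (grid n x) (grid n y) +
     1 * DD false (DD false U) n (grid n x) (grid n y)).
rewrite subrK; have : (C1 + C2) * (0 + 1 * step n) <= (C1 + C2) * 1.
  by rewrite ler_wpM2l; linear.
linear.
Qed.

(** Two differences of [f (u)] are controlled by a Lipschitz constant of [f1] alone; after
    truncation [f1] need not be differentiable. *)
Lemma second_diff_comp (f f1 : R -> R) Kf Lf a b c d :
  (forall t, is_derive t (1 : R) f (f1 t)) -> (forall t, `|f1 t| <= Kf) ->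
  (forall s t, `|f1 s - f1 t| <= Lf * `|s - t|) ->
  `|f a - f b - (f c - f d)| <= Kf * `|a - b - (c - d)| + Lf * (`|a - b| * `|a - c|).
Proof.
move=> df f1K f1L; pose D := a - b.
have H1 : `|(f a - f (a - D)) - (f c - f (c - D))| <= Lf * `|D| * `|a - c|.
  apply: (@lip_of_derive _ (fun t => f t - f (t - D)) (fun t => f1 t - f1 (t - D))) => t _.
    have := is_derive_lin (-1) (df t) (@is_derive_affine _ f t (f1 (- D + 1 * t)) (- D) 1 (df _)).
    rewrite mulN1r mul1r mul1r [- D + t]addrC; apply: is_derive_near; near=> q.
    by rewrite mulN1r mul1r [- D + q]addrC.
  by rewrite (le_trans (f1L _ _)) // subKr.
have H2 : `|f (c - D) - f d| <= Kf * `|c - D - d|.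
  by apply: lip_of_derive => t _.
have Da : a - D = b by rewrite /D; ring.
rewrite Da in H1.
have -> : f a - f b - (f c - f d) = (f a - f b - (f c - f (c - D))) - (f (c - D) - f d).
  by ring.
apply: (le_trans (ler_normB _ _)).
rewrite (_ : a - b - (c - d) = - (c - D - d)) ?normrN; last by rewrite /D; ring.
by rewrite addrC lerD // mulrA.
Unshelve. all: by end_near. Qed.

Lemma locally_bounded_DD_eq e U V x0 y0 : (exists2 r : R, 0 < r & \forall n \near \oo, forall x y,
    `|x - x0| < r -> `|y - y0| < r -> U n x y = V n x y) ->
  exists2 r : R, 0 < r & \forall n \near \oo, forall x y,
    `|x - x0| < r -> `|y - y0| < r -> DD e U n x y = DD e V n x y.
Proof.
move=> [r r0 H]; exists (r / 2); first by rewrite divr_gt0.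
have r4 : 0 < r / 4 by rewrite divr_gt0.
apply: (ev2 H (step_le _ r4)) => n {}H sn x y hx hy; rewrite /DD.
have s0 := @step_gt0 R n.
have sx : `|x + shx e (step n) - x0| < r.
  rewrite addrAC; apply: (le_lt_trans (ler_normD _ _)).
  by rewrite /shx; case: (e); rewrite /= ?normr0 ?(gtr0_norm s0) //; linear.
have sy : `|y + shy e (step n) - y0| < r.
  rewrite addrAC; apply: (le_lt_trans (ler_normD _ _)).
  by rewrite /shy; case: (e); rewrite /= ?normr0 ?(gtr0_norm s0) //; linear.
by rewrite !H //; linear.
Qed.

Lemma locally_bounded_eq {U V x0 y0} : (exists2 r : R, 0 < r & \forall n \near \oo, forall x y,
    `|x - x0| < r -> `|y - y0| < r -> U n x y = V n x y) ->
  locally_bounded U x0 y0 -> locally_bounded V x0 y0.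
Proof.
move=> [r r0 H] hU; apply: locally_bounded_near hU _; exists r => //.
by apply: filterS H => n H x y hx hy; rewrite H.
Qed.

Section Comp.
Variables (f f1 : R -> R) (Kf Lf : R).
Hypotheses (df : forall t, is_derive t (1 : R) f (f1 t)) (f1K : forall t, `|f1 t| <= Kf)
  (f1L : forall s t, `|f1 s - f1 t| <= Lf * `|s - t|).

Let Kf0 : 0 <= Kf := le_trans (normr_ge0 _) (f1K 0).
Lemma Lf_ge0 : 0 <= Lf.
Proof. by have := le_trans (normr_ge0 _) (f1L 1 0); rewrite subr0 normr1 mulr1. Qed.

Lemma locally_bounded_comp1 e {U x0 y0} : locally_bounded (DD e U) x0 y0 ->
  locally_bounded (DD e (fun n x y => f (U n x y))) x0 y0.
Proof.
move=> [r [C [r0 C0 H]]]; exists r, (Kf * C); split => //; first exact: mulr_ge0.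
apply: filterS H => n H x y hx hy; have s0 := @step_gt0 R n.
have := H x y hx hy; rewrite /DD !normrM normfV (gtr0_norm s0) !ler_pdivrMr // => H1.
apply: (le_trans (@lip_of_derive _ f f1 _ _ Kf (fun t _ => df t) (fun t _ => f1K t))).
by rewrite -mulrA ler_wpM2l.
Qed.

Lemma locally_bounded_shift e {U x0 y0} : locally_bounded U x0 y0 ->
  locally_bounded (fun n x y => U n (x + shx e (step n)) (y + shy e (step n))) x0 y0.
Proof.
move=> [r [C [r0 C0 H]]]; exists (r / 2), C; split => //; first by rewrite divr_gt0.
have r4 : 0 < r / 4 by rewrite divr_gt0.
apply: (ev2 H (step_le _ r4)) => n {}H sn x y hx hy.
have s0 := @step_gt0 R n.
apply: H; rewrite addrAC; apply: (le_lt_trans (ler_normD _ _)).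
  by rewrite /shx; case: (e); rewrite /= ?normr0 ?(gtr0_norm s0) //; linear.
by rewrite /shy; case: (e); rewrite /= ?normr0 ?(gtr0_norm s0) //; linear.
Qed.

Lemma locally_bounded_comp2 e e' {U x0 y0} : locally_bounded (DD e U) x0 y0 -> locally_bounded (DD e' U) x0 y0 ->
  locally_bounded (DD e' (DD e U)) x0 y0 ->
  locally_bounded (DD e' (DD e (fun n x y => f (U n x y)))) x0 y0.
Proof.
move=> /(locally_bounded_shift e')[r1 [C1 [r10 C10 H1]]] /(locally_bounded_shift e)[r2 [C2 [r20 C20 H2]]]
  [r3 [C3 [r30 C30 H3]]].
exists (Num.min r1 (Num.min r2 r3)), (Kf * C3 + Lf * (C1 * C2)); split.
- by rewrite !lt_min r10 r20.
- by rewrite addr_ge0 // mulr_ge0 ?Lf_ge0 // mulr_ge0.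
apply: (ev2 H3 (filterI H1 H2)) => n {}H3 [{}H1 {}H2] x y.
rewrite !lt_min => /and3P[x1 x2 x3] /and3P[y1 y2 y3].
have s0 := @step_gt0 R n; have := H1 x y x1 y1; have := H2 x y x2 y2; have := H3 x y x3 y3.
rewrite /DD [x + shx e _ + _]addrAC [y + shy e _ + _]addrAC.
set a := U n (x + shx e' _ + _) _; set b := U n (x + shx e _) _.
set c := U n (x + shx e' _) _; set d := U n x y.
move: (step n) s0 => h h0.
have h2 : 0 < h ^+ 2 by rewrite exprn_gt0.
have hn : h != 0 by rewrite gt_eqF.
have E p q : (p / h - q / h) / h = (p - q) / h ^+ 2 by field.
rewrite !E ![`|_ / h|]normrM normfV (gtr0_norm h0) !ler_pdivrMr //.
rewrite ![`|_ / h ^+ 2|]normrM normfV (gtr0_norm h2) !ler_pdivrMr // => D3 D2 D1.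
have H := second_diff_comp _ _ _ _ a c b d df f1K f1L.
apply: (le_trans H).
have := ler_wpM2l Kf0 D3.
have := ler_wpM2l Lf_ge0 (ler_pM (normr_ge0 _) (normr_ge0 _) D1 D2).
linear.
Qed.

End Comp.

Lemma channel_solution (f f1 : R -> R) (b k Kf Lf Y v0 : R) (G H : R -> R) (cG cH Y1 La : R) :
  stable f f1 b k Kf Lf Y v0 -> Y1 < Y -> 0 <= La ->
  (forall x, - Y1 <= G x /\ H x <= Y1) ->
  (forall x, 1 <= H x - G x <= 4) ->
  (forall s t, `|G s - G t| <= La * `|s - t| /\ `|H s - H t| <= La * `|s - t|) ->
  (forall x h, 0 <= h -> `|G (x + h) + G (x - h) - 2 * G x| <= h ^+ 2 / 16 /\
    `|H (x + h) + H (x - h) - 2 * H x| <= h ^+ 2 / 16) ->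
  (forall x, G (x + 2 * pi) = G x /\ H (x + 2 * pi) = H x) ->
  exists u D1 D2 C, [/\ forall x y, u (x + 2 * pi) y = u x y,
    forall x y, G x <= y <= H x ->
      `|u x y - cH| <= C * (H x - y) /\ `|u x y - cG| <= C * (y - G x) &
    forall x y, G x < y < H x -> [/\ cont2 u x y,
      forall e, dir_der e u x y (D1 e x y) /\ cont2 (D1 e) x y,
      forall e e', dir_der e' (D1 e) x y (D2 e' e x y) /\ cont2 (D2 e' e) x y &
      D2 true true x y + D2 false false x y = f (u x y)]].
Proof.
move=> st YY La0 GH_Y GH1 GHL GHd GHp.
have [df f1g f1K f1L b0 k0 kK kb v00 hcos] := st.
have Kf0 : 0 <= Kf := le_trans (normr_ge0 _) (f1K 0).
pose t := Num.max (`|cH| / v0) (Num.max (`|cG| / v0) (2 * `|f 0| / (k * v0))).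
have [t1 t2 t3] : [/\ `|cH| / v0 <= t, `|cG| / v0 <= t & 2 * `|f 0| / (k * v0) <= t].
  by rewrite /t !le_max !lexx !orbT.
have t0 : 0 <= t by apply: le_trans t1; rewrite divr_ge0 // ltW.
rewrite !ler_pdivrMr // in t1 t2; rewrite ler_pdivrMr ?mulr_gt0 // in t3.
have tf : `|f 0| <= k / 2 * (t * v0) by linear.
pose good h := [/\ b ^+ 3 * h <= k * v0 / 2, Y1 + h <= Y & (La + 1) * h <= 1 / 2].
have good_near : \forall n \near \oo, good (step n).
  have b3 : 0 < b ^+ 3 by rewrite exprn_gt0.
  have L1 : 0 < La + 1 by linear.
  have m0 : 0 < Num.min (k * v0 / 2 / b ^+ 3) (Num.min (Y - Y1) (1 / 2 / (La + 1))).
    by rewrite !lt_min subr_gt0 YY !divr_gt0 ?mulr_gt0.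
  apply: filterS (step_le _ m0) => n; rewrite !le_min => /and3P[s1 s2 s3]; split.
  - by rewrite mulrC -ler_pdivlMr.
  - by linear.
  - by rewrite mulrC -ler_pdivlMr.
have ex n : exists u, good (step n) -> [/\ forall x y, u (x + 2 * pi) y = u x y,
    forall x y, inside G H x y -> dlap (step n) u x y = f (u x y) /\ `|u x y| <= t,
    forall x y, H x <= y -> u x y = cH & forall x y, y <= G x -> u x y = cG].
  have [[g1 g2 g3]|ng] := pselect (good (step n)); last by exists (fun _ _ => 0).
  have [u [up ui uH uG]] := discrete_solution f f1 b k Kf Y v0 df f1g f1K b0 k0 v00 hcos
    G H cG cH Y1 GH_Y (step n) (step_gt0 n) g1 g2 kK (fun x => (GHp x).1)
    (fun x => (GHp x).2) t t0 t1 t2 tf.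
  exists u => _; split => // x y; apply: uG.
  by have := GH1 x; linear.
have [U HU] := choice ex.
pose u := glim U.
pose N := `|f 0| + Kf * t.
have N0 : 0 <= N by rewrite addr_ge0 ?mulr_ge0.
have fN s : `|s| <= t -> `|f s| <= N.
  move=> st'; have := @lip_of_derive _ f f1 0 s Kf (fun t _ => df t) (fun t _ => f1K t).
  rewrite subr0 => H1; have := ler_normD (f s - f 0) (f 0); rewrite subrK.
  have : Kf * `|s| <= Kf * t by rewrite ler_wpM2l.
  by rewrite /N; linear.
pose M := t + `|cG - cH|.
have M0 : 0 <= M by rewrite addr_ge0.
pose B := N + M + 1; have B0 : 0 < B by rewrite /B; linear.
pose E := 10 * (La + 1) + (La + 1) ^+ 2.
have E0 : 0 <= E by rewrite addr_ge0 ?sqr_ge0 // mulr_ge0 //; linear.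
have Ut n x y : good (step n) -> `|U n x y| <= M + `|cH|.
  move=> /HU[_ ui uH uG]; have c0 := normr_ge0 cH; have g0 := normr_ge0 (cG - cH).
  have [ins|] := boolP (inside G H x y).
    by have [_] := ui x y ins; rewrite /M; linear.
  rewrite /inside negb_and -!leNgt => /orP[/uG ->|/uH ->]; last by rewrite /M; linear.
  by have := ler_normD (cG - cH) cH; rewrite subrK /M; linear.
have Ubd x y : ubnd (fun n => U n (grid n x) (grid n y)).
  by exists (M + `|cH|); apply: filterS good_near => n; apply: Ut.
have bar n x y : good (step n) -> inside G H x y ->
    `|U n x y - cH| <= B * (10 * (H x - y) + E * step n) /\
    `|U n x y - cG| <= B * (10 * (y - G x) + E * step n).
  move=> gn ins; have [up ui uH uG] := HU n gn; have [_ _ g3] := gn.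
  have s0 := @step_gt0 R n.
  have g3' : (La + 1) * step n <= 1 by linear.
  have uN x' y' : inside G H x' y' -> `|dlap (step n) (U n) x' y'| <= N /\ `|U n x' y'| <= M.
    move=> /ui[-> ut]; split; first exact: fN.
    by rewrite /M; have := normr_ge0 (cG - cH); linear.
  split.
    apply: (@boundary_barrier _ (U n) G H (step n) cH N M La) => //.
    - by move=> s t'; exact: (GHL s t').2.
    - by move=> x'; exact: (GHd x' _ (ltW s0)).2.
    - by move=> x' y' /uG ->; rewrite /M; linear.
  (* The lower wall is the upper wall of the channel reflected by [y -> - y]. *)
  have insE x' y' : inside (fun x => - H x) (fun x => - G x) x' y' = inside G H x' (- y').
    by rewrite /inside ltrNl ltrNr andbC.
  suff Q : `|U n x (- - y) - cG| <= B * (10 * (- G x - - y) + E * step n).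
    by move: Q; rewrite !opprK [- G x + y]addrC.
  apply: (@boundary_barrier _ (fun x y => U n x (- y)) (fun x => - H x) (fun x => - G x)
    (step n) cG N M La) => //.
  - by move=> x'; have := GH1 x'; linear.
  - by move=> s t'; rewrite -opprD normrN; exact: (GHL s t').1.
  - move=> x'; rewrite (_ : _ - _ = - (G (x' + step n) + G (x' - step n) - 2 * G x')); last ring.
    by rewrite normrN; exact: (GHd x' _ (ltW s0)).1.
  - move=> x' y'; rewrite insE => /uN[un ut]; split => //.
    rewrite (_ : dlap _ _ _ _ = dlap (step n) (U n) x' (- y')) //.
    by rewrite /dlap opprD opprB [step n - y']addrC; congr (_ / _); ring.
  - by move=> x' y'; rewrite lerNl => /uG.
  - by move=> x' y'; rewrite lerNr => /uH ->; rewrite distrC /M; linear.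
  - by rewrite insE opprK.
pose C2 := 10 * B * (La + 1) + B * E.
have C20 : 0 <= C2.
  by rewrite addr_ge0 // mulr_ge0 //; [rewrite mulr_ge0 // ltW|linear|rewrite ltW].
(* Rounding may carry a point of the channel out of it. There [U n] equals the boundary value of the
   wall that was passed, and the point keeps a distance of at least [1 / 2] from the other wall. *)
have close n x y : good (step n) -> G x <= y <= H x ->
    `|U n (grid n x) (grid n y) - cH| <= 1 * (10 * B * (H x - y) + C2 * step n) /\
    `|U n (grid n x) (grid n y) - cG| <= 1 * (10 * B * (y - G x) + C2 * step n).
  move=> gn /andP[Gy yH]; have [up ui uH uG] := HU n gn; have [_ _ g3] := gn.
  have s0 := @step_gt0 R n.
  have gx := grid_dist n x; have := grid_dist n y; rewrite ler_norml => /andP[gy1 gy2].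
  have [LG LH] := GHL (grid n x) x; rewrite ler_norml in LG; rewrite ler_norml in LH.
  have /andP[L1 L2] := LG; have /andP[L3 L4] := LH.
  have L5 : La * `|grid n x - x| <= La * step n by rewrite ler_wpM2l.
  have C2s : 0 <= C2 * step n by rewrite mulr_ge0 // ltW.
  have Bs : 0 <= B * (H x - y) by rewrite mulr_ge0 ?subr_ge0 // ltW.
  have Bs' : 0 <= B * (y - G x) by rewrite mulr_ge0 ?subr_ge0 // ltW.
  rewrite !mul1r; have [ins|] := boolP (inside G H (grid n x) (grid n y)).
    have [b1 b2] := bar n _ _ gn ins.
    have h1 : B * (H (grid n x) - grid n y) <= B * (H x - y + (La + 1) * step n).
      by rewrite ler_wpM2l ?(ltW B0) //; linear.
    have h2 : B * (grid n y - G (grid n x)) <= B * (y - G x + (La + 1) * step n).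
      by rewrite ler_wpM2l ?(ltW B0) //; linear.
    by rewrite /C2; split; linear.
  have /andP[GH1' _] := GH1 (grid n x).
  have BM : `|cG - cH| <= B by rewrite /B /M; linear.
  rewrite /inside negb_and -!leNgt => /orP[Gy'|Hy'].
    rewrite uG // subrr normr0; split; last by linear.
    have : B * (1 / 2) <= B * (H x - y) by rewrite ler_wpM2l ?(ltW B0) //; linear.
    by linear.
  rewrite uH // subrr normr0; split; first by linear.
  have : B * (1 / 2) <= B * (y - G x) by rewrite ler_wpM2l ?(ltW B0) //; linear.
  by rewrite distrC; linear.
exists u, (fun e => glim (DD e U)), (fun e' e => glim (DD e' (DD e U))), (10 * B); split.
- move=> x y; apply: ulim_near; apply: filterS good_near => n /HU[up _ _ _].
  by rewrite grid_per up.
- move=> x y xy; have lin c : u x y - c = ulim (fun n => U n (grid n x) (grid n y) + (-1) * c).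
    rewrite (@ulim_lin _ (-1) (fun n => U n (grid n x) (grid n y)) (fun=> c)) //; last exact: ubnd_cst.
    by rewrite ulim_cst mulN1r.
  have ub c : ubnd (fun n => U n (grid n x) (grid n y) + (-1) * c).
    by apply: (@ubnd_lin _ (-1) (fun n => U n (grid n x) (grid n y)) (fun=> c)) => //; apply: ubnd_cst.
  rewrite !lin; split.
    have := cvg_step_lin 1 (10 * B * (H x - y)) C2; rewrite mul1r => cl.
    apply: (ulim_abs_le_lim (ub _) cl); apply: filterS good_near => n gn.
    by rewrite mulN1r; have [] := close n x y gn xy.
  have := cvg_step_lin 1 (10 * B * (y - G x)) C2; rewrite mul1r => cl.
  apply: (ulim_abs_le_lim (ub _) cl); apply: filterS good_near => n gn.
  by rewrite mulN1r; have [] := close n x y gn xy.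
move=> x0 y0 /andP[Gy0 yH0].
pose r := Num.min (y0 - G x0) (H x0 - y0) / (2 * (La + 1)).
have r0 : 0 < r by rewrite divr_gt0 ?lt_min ?subr_gt0 ?Gy0 // mulr_gt0 //; linear.
have box x y : `|x - x0| < r -> `|y - y0| < r -> inside G H x y.
  move=> hx hy; have rE : 2 * (La + 1) * r = Num.min (y0 - G x0) (H x0 - y0).
    by rewrite /r mulrC divfK // gt_eqF // mulr_gt0 //; linear.
  have [m1 m2] : Num.min (y0 - G x0) (H x0 - y0) <= y0 - G x0 /\
    Num.min (y0 - G x0) (H x0 - y0) <= H x0 - y0 by rewrite !ge_min !lexx orbT.
  rewrite -rE in m1 m2.
  have [] := GHL x x0; rewrite !ler_norml => /andP[L1 L2] /andP[L3 L4].
  have L5 : La * `|x - x0| <= La * r by rewrite ler_wpM2l // ltW.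
  move: hy; rewrite ltr_norml => /andP[hy1 hy2].
  by rewrite /inside; apply/andP; split; linear.
have lU : locally_bounded U x0 y0.
  exists r, t; split => //; apply: filterS good_near => n /HU[_ ui _ _] x y hx hy.
  by have [] := ui x y (box _ _ hx hy).
pose fU n x y := f (U n x y).
have eqL : exists2 r : R, 0 < r & \forall n \near \oo, forall x y,
    `|x - x0| < r -> `|y - y0| < r -> fU n x y = DL U n x y.
  exists r => //; apply: filterS good_near => n /HU[_ ui _ _] x y hx hy.
  by have [E1 _] := ui x y (box _ _ hx hy); rewrite /fU -E1.
have lL : locally_bounded (DL U) x0 y0.
  apply: (locally_bounded_eq eqL); exists r, N; split => //.
  apply: filterS good_near => n /HU[_ ui _ _] x y hx hy.
  by have [_ ut] := ui x y (box _ _ hx hy); apply: fN.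
(* Three rounds of the bootstrap: the discrete Laplacian of a difference of [U] is the same
   difference of [f (U)], which the round before controls. *)
have l1 e : locally_bounded (DD e U) x0 y0 by apply: locally_bounded_grad.
have l2 e' e : locally_bounded (DD e' (DD e U)) x0 y0.
  apply: locally_bounded_grad => //; rewrite DL_DD.
  have f1' := locally_bounded_comp1 f f1 Kf df f1K e (l1 e).
  exact: (locally_bounded_eq (locally_bounded_DD_eq e fU (DL U) x0 y0 eqL) f1').
have l3 e'' e' e : locally_bounded (DD e'' (DD e' (DD e U))) x0 y0.
  apply: locally_bounded_grad => //; rewrite !DL_DD.
  have eq1 := locally_bounded_DD_eq e fU (DL U) x0 y0 eqL.
  exact: (locally_bounded_eq (locally_bounded_DD_eq e' (DD e fU) (DD e (DL U)) x0 y0 eq1)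
    (locally_bounded_comp2 f f1 Kf Lf df f1K f1L e e' (l1 e) (l1 e') (l2 e' e))).
split.
- exact: glim_cont.
- move=> e; split; first exact: glim_dir.
  exact: glim_cont.
- move=> e e'; split; first exact: glim_dir.
  exact: glim_cont.
rewrite -DD_lap // /u /glim.
have cf : continuous f by move=> s; apply: is_derive_cont (df s).
rewrite -(ulim_comp _ cf) //; apply: ulim_near.
have r2 : 0 < r / 2 by rewrite divr_gt0.
apply: (ev2 good_near (step_le _ r2)) => n /HU[_ ui _ _] sn.
have g1 := grid_dist n x0; have g2 := grid_dist n y0.
have [||E1 _] := ui _ _ (box (grid n x0) (grid n y0) _ _); [linear|linear|].
by rewrite /= -E1.
Qed.

End Existence.

(** * Functions on the torus and their periodic lifts *)

Section Lifts.
Context {R : realType}.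
Local Notation T := (torus R).
Local Notation cover := (@Defs.cover R).
Implicit Types (u v w : R -> R -> R) (e : bool)
  (a b c d h l m p q r s t x y C M N : R).

Lemma to_torus_eqP x y : to_torus x = to_torus y <-> exists k : int, x - y = 2 * pi * k%:~R.
Proof.
rewrite /to_torus; split.
  by move=> /eqquotP/asboolP.
by move=> H; apply/eqquotP/asboolP.
Qed.

Lemma to_torus_per x : to_torus (x + 2 * pi) = to_torus x.
Proof. by apply/to_torus_eqP; exists 1; rewrite mulr1; ring. Qed.

Lemma to_torus_surj (p : T) : exists x, to_torus x = p.
Proof. by exists (repr p); apply: reprK. Qed.

Lemma per_int (g : R -> R) : (forall x, g (x + 2 * pi) = g x) ->
  forall (k : int) x, g (x + 2 * pi * k%:~R) = g x.
Proof.
move=> gp; have nat_case (n : nat) x : g (x + 2 * pi * n%:R) = g x.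
  elim: n x => [|n IH] x; first by rewrite mulr0 addr0.
  have -> : x + 2 * pi * n.+1%:R = x + 2 * pi * n%:R + 2 * pi.
    by rewrite -[n.+1%:R]natr1; ring.
  by rewrite gp IH.
case=> n x; first exact: nat_case.
by rewrite NegzE mulrNz mulrN -(nat_case n.+1 (x - _)) subrK.
Qed.

Lemma torus_fun (g : R -> R) x y : (forall x, g (x + 2 * pi) = g x) ->
  to_torus x = to_torus y -> g x = g y.
Proof.
by move=> gp /to_torus_eqP[k E]; rewrite -(per_int g gp k y) -E addrC subrK.
Qed.

(** [repr] picks an arbitrary representative, which is harmless for periodic [u]. *)
Definition descend u : T * R -> R := fun z => u (repr z.1) z.2.

Lemma descendE u : (forall x y, u (x + 2 * pi) y = u x y) ->
  forall x y, descend u (to_torus x, y) = u x y.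
Proof.
move=> up x y; apply: (torus_fun (u^~ y)) => [x'|]; first exact: up.
exact: reprK.
Qed.

Lemma to_torus_cont : continuous (@to_torus R).
Proof. exact: pi_continuous. Qed.

Lemma cover_cont : continuous cover.
Proof.
move=> z V [[A B] /= [nA nB] AB]; exists (@to_torus R @^-1` A, B) => /=.
  by split => //; apply: to_torus_cont.
by move=> [s t] [/= ? ?]; apply: AB.
Qed.

(** The preimage of the image is the union of the translates of [V] by periods, and the quotient
    topology is tested on preimages. *)
Lemma to_torus_open (V : set R) : open V -> open (@to_torus R @` V).
Proof.
move=> oV; have : open (@to_torus R @^-1` (@to_torus R @` V)).
  rewrite openE => x [x' Vx' /to_torus_eqP[k E]].
  have /near_dist[d d0 dP] : nbhs x' V by apply: open_nbhs_nbhs.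
  apply/near_dist; exists d => // t td; exists (t + (x' - x)).
    by apply: dP; rewrite (_ : _ - _ = t - x) //; ring.
  by apply/to_torus_eqP; exists k; rewrite -E; ring.
by [].
Qed.

(** Since the covering is an open map, continuity and openness can be checked in the plane. *)
Lemma cover_nbhs (z : R * R) (S : set (R * R)) : nbhs z S -> nbhs (cover z) (cover @` S).
Proof.
case: z => x y /nbhs2P[d d0 dP].
exists (@to_torus R @` [set s | `|s - x| < d], [set t | `|t - y| < d]) => /=.
  split => /=.
    have xin : (@to_torus R @` [set s | `|s - x| < d]) (to_torus x).
      by exists x; rewrite //= subrr normr0.
    refine (@open_nbhs_nbhs T _ _ (conj _ xin)).
    apply: to_torus_open; rewrite openE => s /= sd; apply/near_dist.
    exists (d - `|s - x|); first by rewrite subr_gt0.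
    by move=> t ts /=; have := ler_normD (t - s) (s - x); rewrite subrKA; linear.
  by apply/near_dist; exists d.
move=> [p t] [/= [s sd <-] td]; exists (s, t) => //.
exact: dP.
Qed.

Definition closed_in (G H : R -> R) : set (R * R) := [set z | G z.1 <= z.2 <= H z.1].

Lemma within_lift (G H : T -> R) psi : {within channel G H, continuous psi} ->
  {within closed_in (lift1 G) (lift1 H), continuous (lift2 psi)}.
Proof.
move=> /subspace_continuousP cpsi; apply/subspace_continuousP => z Az V nV.
have nV' : nbhs (cover z) [set p | channel G H p -> V (psi p)] := cpsi (cover z) Az V nV.
suff K : nbhs z [set z' | closed_in (lift1 G) (lift1 H) z' -> V (lift2 psi z')] by exact: K.
have K : nbhs z (cover @^-1` [set p | channel G H p -> V (psi p)]) := @cover_cont z _ nV'.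
by apply: filterS K => z' H1 Az'; apply: H1.
Qed.

Lemma within_descend (G H : T -> R) psi :
  {within closed_in (lift1 G) (lift1 H), continuous (lift2 psi)} ->
  {within channel G H, continuous psi}.
Proof.
move=> /subspace_continuousP cl; apply/subspace_continuousP => -[p y] Ap V nV.
have [x xE] := to_torus_surj p; rewrite -xE in Ap nV *.
have /cover_nbhs := cl (x, y) Ap V nV; apply: filterS => q [z' Hz' <-] Aq.
exact: Hz'.
Qed.

Lemma partial_x u x y : (derivable (uc u) (x, y) (1, 0) <-> derivable (u^~ y) x 1) /\
  dx (uc u) (x, y) = 'D_1 (u^~ y) x.
Proof.
have E : (fun h : R => h^-1 *: (uc u (h *: ((1, 0) : R * R) + (x, y)) - uc u (x, y))) =
         (fun h : R => h^-1 *: (u (h *: 1 + x) y - u x y)).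
  by apply/funext => h; rewrite /uc /= /GRing.scale /= mulr0 add0r.
by rewrite /dx /derivable /derive /= /comp /shift /= !E.
Qed.

Lemma partial_y u x y : (derivable (uc u) (x, y) (0, 1) <-> derivable (u x) y 1) /\
  dy (uc u) (x, y) = 'D_1 (u x) y.
Proof.
have E : (fun h : R => h^-1 *: (uc u (h *: ((0, 1) : R * R) + (x, y)) - uc u (x, y))) =
         (fun h : R => h^-1 *: (u x (h *: 1 + y) - u x y)).
  by apply/funext => h; rewrite /uc /= /GRing.scale /= mulr0 add0r.
by rewrite /dy /derivable /derive /= /comp /shift /= !E.
Qed.

Definition pder e (f : R * R -> R) : R * R -> R := if e then dx f else dy f.
Definition pdir e : R * R := if e then (1, 0) else (0, 1).

Lemma dir_derP e u x y a : dir_der e u x y a <->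
  derivable (uc u) (x, y) (pdir e) /\ pder e (uc u) (x, y) = a.
Proof.
case: e; rewrite /dir_der /pdir /pder /=.
  have [P E] := partial_x u x y; split => [[du Da]|[du Da]].
    exact: conj (P.2 du) (etrans E Da).
  exact: DeriveDef (P.1 du) (etrans (esym E) Da).
have [P E] := partial_y u x y; split => [[du Da]|[du Da]].
  exact: conj (P.2 du) (etrans E Da).
exact: DeriveDef (P.1 du) (etrans (esym E) Da).
Qed.

Lemma dir_der_near e u v x y a : nbhs (x, y) [set z | uc u z = uc v z] ->
  dir_der e u x y a -> dir_der e v x y a.
Proof.
move=> /nbhs2P[d d0 dP]; case: e; rewrite /dir_der; apply: is_derive_near;
  apply/near_dist; exists d => // t td; apply: dP => //; by rewrite subrr normr0.
Qed.

Lemma cont2_near u v x y : nbhs (x, y) [set z | uc u z = uc v z] ->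
  cont2 u x y -> cont2 v x y.
Proof.
move=> /nbhs2P[r r0 rP] /cont2P H; apply/cont2P => e /H[d d0 dP].
have E s t : `|s - x| < r -> `|t - y| < r -> u s t = v s t := rP s t.
exists (Num.min r d); first by rewrite lt_min r0.
move=> s t; rewrite !lt_min => /andP[s1 s2] /andP[t1 t2].
by rewrite -!E ?dP // subrr normr0.
Qed.

(** The derivatives are carried as explicit functions, with [true] for the [x] direction, so that
    limits of difference quotients can serve as derivatives directly. *)
Definition C2in (A : set (R * R)) u (D1 : bool -> R -> R -> R)
    (D2 : bool -> bool -> R -> R -> R) := forall x y, A (x, y) ->
  [/\ cont2 u x y, forall e, dir_der e u x y (D1 e x y) /\ cont2 (D1 e) x y &
      forall e e', dir_der e' (D1 e) x y (D2 e' e x y) /\ cont2 (D2 e' e) x y].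

Lemma C2in_C1_on (A : set (R * R)) u D1 : open A ->
  (forall x y, A (x, y) -> forall e, dir_der e u x y (D1 e x y) /\ cont2 (D1 e) x y) ->
  C1_on A (uc u).
Proof.
move=> oA H [x y] Az; have Hz := H x y Az.
have nA : nbhs (x, y) A by apply: open_nbhs_nbhs.
have eqD e : nbhs (x, y) [set z | pder e (uc u) z = uc (D1 e) z].
  apply: filterS nA => -[s t] Ast; have [/dir_derP[_ E] _] := H s t Ast e.
  exact: E.
have ct e : {for (x, y), continuous (pder e (uc u))}.
  have [_ c] := Hz e; pose w x y := pder e (uc u) (x, y).
  have -> : pder e (uc u) = uc w by apply/funext => -[].
  by apply: cont2_near c; apply: filterS (eqD e) => z H0 /=; rewrite -[uc w z]/(pder e (uc u) (z.1, z.2)) -surjective_pairing.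
have [/dir_derP[d1 _] _] := Hz true; have [/dir_derP[d2 _] _] := Hz false.
by split; [exact: d1|exact: d2|exact: (ct true)|exact: (ct false)].
Qed.

Lemma C2in_C2_on (A : set (R * R)) u D1 D2 : open A -> C2in A u D1 D2 -> C2_on A (uc u).
Proof.
move=> oA H; have H1 x y (Az : A (x, y)) e : dir_der e u x y (D1 e x y) /\ cont2 (D1 e) x y.
  by have [_ + _] := H x y Az; apply.
have H2 e : C1_on A (pder e (uc u)).
  pose w x y := pder e (uc u) (x, y).
  have -> : pder e (uc u) = uc w by apply/funext => -[].
  apply: (@C2in_C1_on A w (fun e' => D2 e' e)) => // x y Az e'.
  have [_ _ H3] := H x y Az; have [d2 c2] := H3 e e'; split => //.
  apply: dir_der_near d2; have nA : nbhs (x, y) A by apply: open_nbhs_nbhs.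
  by apply: filterS nA => -[s t] Ast; have [/dir_derP[_ E] _] := H1 s t Ast e; rewrite /uc /w /= E.
split; [exact: C2in_C1_on H1|exact: (H2 true)|exact: (H2 false)].
Qed.

Lemma C2_on_C2in (A : set (R * R)) u : (forall x y, A (x, y) -> cont2 u x y) ->
  C2_on A (uc u) ->
  C2in A u (fun e x y => pder e (uc u) (x, y))
    (fun e' e x y => pder e' (pder e (uc u)) (x, y)).
Proof.
move=> cu [H0 Hx Hy] x y Az.
have ucE (f : R * R -> R) : uc (fun s t => f (s, t)) = f by apply/funext => -[].
have C1_dir w : C1_on A (uc w) -> forall e,
    dir_der e w x y (pder e (uc w) (x, y)) /\ cont2 (fun s t => pder e (uc w) (s, t)) x y.
  move=> Hw e; have [d1 d2 c1 c2] := Hw _ Az; split.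
    by apply/dir_derP; split; [case: (e); [exact: d1|exact: d2]|reflexivity].
  by rewrite /cont2 ucE; case: (e); [exact: c1|exact: c2].
split; [exact: cu|exact: C1_dir|move=> e e'].
have := C1_dir (fun s t => pder e (uc u) (s, t)); rewrite ucE; apply.
by case: (e); [exact: Hx|exact: Hy].
Qed.

Lemma C2in_lap (A : set (R * R)) u D1 D2 x y : open A -> C2in A u D1 D2 -> A (x, y) ->
  lap u x y (D2 true true x y + D2 false false x y).
Proof.
move=> oA H Az; have /nbhs2P[d d0 dP] : nbhs (x, y) A by apply: open_nbhs_nbhs.
have [_ _ H2] := H x y Az.
exists (D2 true true x y), (D2 false false x y); split => //.
  exists (fun t => D1 true t y); split; last exact: (H2 true true).1.
  apply/near_dist; exists d => // t td.
  have At : A (t, y) by apply: dP => //; rewrite subrr normr0.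
  by have [_ /(_ true)[]] := H t y At.
exists (fun t => D1 false x t); split; last exact: (H2 false false).1.
apply/near_dist; exists d => // t td.
have At : A (x, t) by apply: dP => //; rewrite subrr normr0.
by have [_ /(_ false)[]] := H x t At.
Qed.

Definition inside_set (G H : R -> R) : set (R * R) := [set z | G z.1 < z.2 < H z.1].

Lemma inside_open (G H : R -> R) : continuous G -> continuous H -> open (inside_set G H).
Proof.
move=> cG cH; rewrite openE => -[x y] /= /andP[Gy yH].
have /cont2P cG' := cont2_fst y (cG x); have /cont2P cH' := cont2_fst y (cH x).
have e1 : 0 < (y - G x) / 2 by rewrite divr_gt0 // subr_gt0.
have e2 : 0 < (H x - y) / 2 by rewrite divr_gt0 // subr_gt0.
have [d1 d10 P1] := cG' _ e1; have [d2 d20 P2] := cH' _ e2.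
apply/nbhs2P; exists (Num.min (Num.min d1 d2) (Num.min ((y - G x) / 2) ((H x - y) / 2))).
  by rewrite !lt_min d10 d20 e1 e2.
move=> s t; rewrite !lt_min => /andP[/andP[s1 s2] _] /andP[/andP[t1 t2] /andP[t3 t4]].
have := P1 s t s1 t1; have := P2 s t s2 t2; move: t3 t4.
rewrite !ltr_norml /inside_set /= => /andP[? ?] /andP[? ?] /andP[? ?] /andP[? ?].
by apply/andP; split; linear.
Qed.

(** The Dirichlet problem on the universal cover, in curried form. The analysis of the equation
    takes place here; [solution_lift] and [lift_solution] are the passage to and from the torus. *)
Definition lsol (F : R -> R) (cG cH : R) (G H : R -> R) u : Prop :=
  [/\ forall x y, u (x + 2 * pi) y = u x y,
      {within closed_in G H, continuous (uc u)},
      exists D1 D2, C2in (inside_set G H) u D1 D2 /\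
        forall x y, inside_set G H (x, y) -> D2 true true x y + D2 false false x y = F (u x y),
      forall x, u x (H x) = cH & forall x, u x (G x) = cG].

Lemma within_at (G H : R -> R) u x y : continuous G -> continuous H ->
  {within closed_in G H, continuous (uc u)} -> inside_set G H (x, y) -> cont2 u x y.
Proof.
move=> cG cH cu /= ins.
have nI : nbhs (x, y) (inside_set G H).
  by apply: open_nbhs_nbhs; split => //; apply: inside_open.
have ins' : closed_in G H (x, y) by move: ins => /andP[? ?]; apply/andP; split; apply: ltW.
have /subspace_continuousP/(_ _ ins') := cu.
move=> H1 V nV; have := H1 V nV; rewrite /within /= => H2.
apply: filterS2 nI H2 => z /andP[h1 h2]; apply; by apply/andP; split; apply: ltW.
Qed.

Lemma solution_lift (F : R -> R) (cG cH : R) (G H : T -> R) psi :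
  continuous (lift1 G) -> continuous (lift1 H) ->
  is_solution F cG cH G H psi ->
  lsol F cG cH (lift1 G) (lift1 H) (fun x y => psi (to_torus x, y)).
Proof.
move=> kG kH [[C2 cpsi] eqn bH bG].
pose u x y := psi (to_torus x, y).
have uE : uc u = lift2 psi by apply/funext => -[].
have cu : {within closed_in (lift1 G) (lift1 H), continuous (uc u)}.
  by rewrite uE; apply: within_lift.
split => //.
- by move=> x y; rewrite to_torus_per.
- exists (fun e x y => pder e (uc u) (x, y)),
    (fun e' e x y => pder e' (pder e (uc u)) (x, y)); split.
    apply: C2_on_C2in; last by rewrite uE.
    by move=> x y; apply: within_at.
  by move=> x y ins; rewrite uE; exact: (eqn (x, y)).
Qed.

Lemma lift_solution (F : R -> R) (cG cH : R) (G H : T -> R) u :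
  continuous (lift1 G) -> continuous (lift1 H) ->
  lsol F cG cH (lift1 G) (lift1 H) u -> is_solution F cG cH G H (descend u).
Proof.
move=> kG kH [up cu [D1 [D2 [C2 eqn]]] bH bG].
have uE : lift2 (descend u) = uc u.
  by apply/funext => -[x y]; rewrite /lift2 /= /cover /= descendE.
have oA := inside_open _ _ kG kH.
split.
- split; first by rewrite uE; apply: C2in_C2_on C2.
  by apply: within_descend; rewrite uE.
- move=> [x y] ins; rewrite /laplacian uE -[F _]/(F (u x y)) -eqn //.
  have C2' := C2in_C2_on _ _ _ _ oA C2.
  have H1 x' y' (Az : inside_set (lift1 G) (lift1 H) (x', y')) e :
      pder e (uc u) (x', y') = D1 e x' y'.
    by have [_ /(_ e)[/dir_derP[_ ?]]] := C2 x' y' Az.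
  have key e : pder e (pder e (uc u)) (x, y) = D2 e e x y.
    have [_ _ /(_ e e)[d2 _]] := C2 x y ins.
    pose w x y := pder e (uc u) (x, y).
    have -> : pder e (uc u) = uc w by apply/funext => -[].
    suff /dir_derP[_] : dir_der e w x y (D2 e e x y) by [].
    apply: dir_der_near d2.
    have nA : nbhs (x, y) (inside_set (lift1 G) (lift1 H)) by apply: open_nbhs_nbhs.
    by apply: filterS nA => -[s t] Ast; rewrite /uc /w /= H1.
  by rewrite -(key true) -(key false).
- move=> p; have [x <-] := to_torus_surj p; rewrite descendE //; exact: bH.
- move=> p; have [x <-] := to_torus_surj p; rewrite descendE //; exact: bG.
Qed.

End Lifts.

(** * Islands in an oscillating valley *)

Section OneVariable.
Context {R : realType}.
Implicit Types (f g : R -> R) (a b c d e h l m p q r s t x y C M N K : R).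

Lemma taylor_bounds (g g1 g2 : R -> R) a b k K p q : k <= K ->
  (forall t, a <= t <= b -> is_derive t (1 : R) g (g1 t) /\ is_derive t (1 : R) g1 (g2 t)) ->
  (forall t, a <= t <= b -> k <= g2 t <= K) -> a <= p <= b -> a <= q <= b ->
  k / 2 * (q - p) ^+ 2 <= g q - g p - g1 p * (q - p) <= K / 2 * (q - p) ^+ 2.
Proof.
move=> kK dg g2b pab qab.
have bt x y t : a <= x <= b -> a <= y <= b -> Num.min x y <= t <= Num.max x y -> a <= t <= b.
  by case: (leP x y) => xy; linear.
have g1b t : Num.min p q <= t <= Num.max p q ->
    k * (t - p) * (q - p) <= (g1 t - g1 p) * (q - p) <= K * (t - p) * (q - p).
  move=> tpq; have tab := bt _ _ _ pab qab tpq.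
  have [c cpt E] := @mvt _ g1 g2 p t (fun s sI => (dg s (bt _ _ _ pab tab sI)).2).
  have /andP[h1 h2] := g2b c (bt _ _ _ pab tab cpt).
  have tq : 0 <= (t - p) * (q - p).
    by move: tpq; case: (leP p q) => pq tpq; [rewrite mulr_ge0|rewrite mulr_le0]; linear.
  by rewrite E -!mulrA !(ler_wpM2r tq) //; apply/andP.
have quad C t : is_derive t (1 : R) (fun s => g s + (- (C / 2)) * (- p + 1 * s) ^+ 2)
    (g1 t + (- (C / 2)) * (1 * (2 * (- p + 1 * t)))) <-> is_derive t (1 : R) g (g1 t).
  have dq : is_derive t (1 : R) (fun s => (- p + 1 * s) ^+ 2) (1 * (2 * (- p + 1 * t))).
    apply: (@is_derive_affine _ (fun r : R => r ^+ 2)).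
    apply: (@is_derive_bound _ _ _ _ 1 1) => // h _.
    by rewrite (_ : _ - _ = h ^+ 2) ?mul1r ?ger0_norm ?sqr_ge0 //; ring.
  split => H; last exact: is_derive_lin.
  have := is_derive_lin (C / 2) H dq; rewrite (_ : _ + _ + _ = g1 t); last by field.
  by apply: is_derive_near; near=> s; field.
have key C : exists2 c, Num.min p q <= c <= Num.max p q &
    g q - g p - g1 p * (q - p) - C / 2 * (q - p) ^+ 2 =
    (g1 c - g1 p - C * (c - p)) * (q - p).
  have [t tI|c cI E] := @mvt _ (fun s => g s + (- (C / 2)) * (- p + 1 * s) ^+ 2)
    (fun t => g1 t + (- (C / 2)) * (1 * (2 * (- p + 1 * t)))) p q.
    by apply/quad; apply: (dg t (bt _ _ _ pab qab tI)).1.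
  exists c => //; move: E; rewrite !mul1r addNr expr0n mulr0 addr0 => E.
  by linear.
have [c /g1b/andP[h1 _] E1] := key k; have [c' /g1b/andP[_ h2] E2] := key K.
by apply/andP; split; linear.
Unshelve. all: by end_near. Qed.

(** A value below both end values pushes the minimum [p] into the interior, where the derivative
    vanishes. The sign [s] selects a side of [p], and on that side values grow at least
    quadratically in the direction away from [p]. *)
Lemma unimodal (g g1 g2 : R -> R) a b k K : a < b -> 0 < k -> k <= K ->
  (forall t, a <= t <= b -> is_derive t (1 : R) g (g1 t) /\ is_derive t (1 : R) g1 (g2 t)) ->
  (forall t, a <= t <= b -> k <= g2 t <= K) ->
  (exists2 c, a <= c <= b & g c < g a /\ g c < g b) ->
  exists2 p, a < p < b &
   [/\ g1 p = 0, forall q, a <= q <= b -> g q <= g p + K / 2 * (q - p) ^+ 2 &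
    forall s q q', `|s| = 1 -> a <= q <= b -> a <= q' <= b ->
      0 <= s * (q - p) -> 0 <= s * (q' - q) -> k / 2 * (q' - q) ^+ 2 <= g q' - g q].
Proof.
move=> ab k0 kK dg g2b [c cab [ga gb]].
have [|p] := @EVT_min _ g a b (ltW ab).
  apply: derivable_within_continuous => t; rewrite in_itv /= => tab.
  by have [[]] := dg t tab.
rewrite in_itv /= => pab minp.
have gpc : g p <= g c by apply: minp; rewrite in_itv.
have pa : p != a by apply: contraTneq ga => <-; rewrite -leNgt.
have pb : p != b by apply: contraTneq gb => <-; rewrite -leNgt.
have pin : a < p < b.
  have /andP[h1 h2] := pab; apply/andP; split.
    by rewrite lt_neqAle eq_sym pa.
  by rewrite lt_neqAle pb.
have g1p : g1 p = 0.
  have d1 := (dg p pab).1.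
  have : is_derive p (1 : R) g 0.
    apply: (@derive1_at_min _ g a b p (ltW ab)).
    - move=> t; rewrite in_itv /= => tab.
      by have [|[d _] _] := dg t; first linear.
    - by rewrite in_itv.
    - by move=> t; rewrite in_itv /= => tab; apply: minp; rewrite in_itv /=; linear.
  exact: is_derive_uniq.
exists p => //; split => //.
  move=> q qab; have := taylor_bounds _ _ _ _ _ _ _ _ _ kK dg g2b pab qab.
  by rewrite g1p mul0r subr0; linear.
move=> s q q' s1 qab q'ab sp sq.
have /andP[h1 _] := taylor_bounds _ _ _ _ _ _ _ _ _ kK dg g2b qab q'ab.
have btw t : Num.min p q <= t <= Num.max p q -> a <= t <= b.
  by case: (leP p q) => _; linear.
have [c' c'I E] := @mvt _ g1 g2 p q (fun t tI => (dg t (btw t tI)).2).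
have /andP[k1 _] := g2b c' (btw c' c'I).
rewrite g1p subr0 in E.
have s2 : s ^+ 2 = 1 by rewrite -[s ^+ 2]real_normK ?num_real // s1 expr1n.
have pq : 0 <= (q - p) * (q' - q).
  have -> : (q - p) * (q' - q) = s * (q - p) * (s * (q' - q)).
    by rewrite -[LHS]mul1r -s2; ring.
  exact: mulr_ge0.
have : 0 <= g2 c' * ((q - p) * (q' - q)) by rewrite mulr_ge0 //; linear.
by rewrite mulrA -E; linear.
Qed.

(** [a] is a maximum point of the tilted function [min (g x) c2 + s * x]: to its right [g] stays
    below a line of slope [- s]. So a continuous function leaves some level between [c1] and [c2]
    downwards at a definite rate and does not come back to it before [q]. *)
Lemma tilt (g : R -> R) p q c1 c2 : continuous g -> p < q -> c1 < c2 ->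
  c2 <= g p -> g q < c1 -> exists a s, [/\ p <= a < q, 0 < s, c1 < g a <= c2 &
    forall x, a < x <= q -> g x <= g a - s * (x - a)].
Proof.
move=> cg pq c12 gp gq.
(* Over [[p, q]] the tilt gains only half of [c2 - c1], so that the maximum cannot sit where [g] is
   below [c1]. *)
pose s := (c2 - c1) / 2 / (q - p).
have s0 : 0 < s by rewrite !divr_gt0 ?subr_gt0.
have sE : s * (q - p) = (c2 - c1) / 2 by rewrite /s divfK // gt_eqF // subr_gt0.
pose M x := Num.min (g x) c2 + s * x.
have cM : continuous M.
  move=> x; apply: cvgD; last by apply: cvgMr.
  by apply: (@continuous_min _ _ g (fun=> c2) x); [apply: cg|apply: cvg_cst].
have [a] := @EVT_max _ M p q (ltW pq) (continuous_subspaceT cM).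
rewrite in_itv /= => /andP[pa aq] maxa.
have Mp : Num.min (g p) c2 = c2 by rewrite min_r.
have ma : c2 - s * (a - p) <= Num.min (g a) c2.
  by have := maxa p; rewrite in_itv /= lexx ltW // => /(_ isT); rewrite /M Mp; linear.
have sa : s * (a - p) <= (c2 - c1) / 2 by rewrite -sE ler_wpM2l ?(ltW s0) //; linear.
have ga1 : c1 < g a.
  have h : Num.min (g a) c2 <= g a by rewrite ge_min lexx.
  by linear.
have aq' : a < q.
  by rewrite lt_neqAle aq andbT; apply: contraTneq ga1 => ->; rewrite -leNgt ltW.
have key x : a < x <= q -> g x <= Num.min (g a) c2 - s * (x - a).
  move=> /andP[ax xq]; have := maxa x; rewrite in_itv /= xq andbT.
  move=> /(_ _); rewrite /M => H1.
  have H2 : Num.min (g x) c2 <= Num.min (g a) c2 - s * (x - a) by have := H1 (_ : p <= x); linear.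
  have sx : 0 < s * (x - a) by rewrite mulr_gt0 // subr_gt0.
  have m2 : Num.min (g a) c2 <= c2 by rewrite ge_min lexx orbT.
  by move: H2; case: (leP (g x) c2) => // ?; linear.
have ga2 : g a <= c2.
  rewrite leNgt; apply/negP => gac.
  have /cvgrPdist_lt/(_ (g a - c2)) := cg a; rewrite subr_gt0 => /(_ gac)/near_dist[d d0 dP].
  pose x := Num.min q (a + d / 2).
  have xa : a < x by rewrite lt_min aq' ltrDl divr_gt0.
  have xq : x <= q by rewrite ge_min lexx.
  have xd : `|x - a| < d.
    have : x <= a + d / 2 by rewrite ge_min lexx orbT.
    by rewrite ger0_norm; linear.
  have := dP x xd; rewrite ltr_norml => /andP[_ h1].
  have : g x <= Num.min (g a) c2 - s * (x - a) by apply: key; rewrite xa.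
  have : Num.min (g a) c2 <= c2 by rewrite ge_min lexx orbT.
  have : 0 < s * (x - a) by rewrite mulr_gt0 // subr_gt0.
  linear.
exists a, s; split => //; rewrite ?pa ?ga1 //.
by move=> x xI; have := key x xI; rewrite min_l.
Qed.

End OneVariable.

(** * The floor of a valley and the branches of its level curves *)

Section Valley.
Context {R : realType}.
Implicit Types (a b c d e h l m p q r s t x y C M N K : R).

Variables (v vx vy vyy : R -> R -> R) (y0 r k K L : R).
Hypotheses (r_gt0 : 0 < r) (k_gt0 : 0 < k) (k_leK : k <= K) (L_ge0 : 0 <= L).
Hypothesis v_per : forall x y, v (x + 2 * pi) y = v x y.
Hypothesis v_x : forall x y, `|y - y0| <= r ->
  [/\ is_derive x (1 : R) (v^~ y) (vx x y), `|vx x y| <= L & cont2 vx x y].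
Hypothesis v_y : forall x y, `|y - y0| <= r ->
  [/\ is_derive y (1 : R) (v x) (vy x y), is_derive y (1 : R) (vy x) (vyy x y) & k <= vyy x y <= K].
Hypothesis v_edge : forall x x', v x' y0 < v x (y0 - r) /\ v x' y0 < v x (y0 + r).

Lemma strip_itv y : (`|y - y0| <= r) = (y0 - r <= y <= y0 + r).
Proof. by rewrite ler_norml lerBrDr lerBlDr addrC [y0 + r]addrC. Qed.

Lemma valley_bottom : exists eta : R -> R, forall x, [/\ `|eta x - y0| < r,
    forall q, `|q - y0| <= r -> v x q <= v x (eta x) + K / 2 * (q - eta x) ^+ 2 &
    forall s q q', `|s| = 1 -> `|q - y0| <= r -> `|q' - y0| <= r ->
      0 <= s * (q - eta x) -> 0 <= s * (q' - q) -> k / 2 * (q' - q) ^+ 2 <= v x q' - v x q].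
Proof.
suff : forall x, exists p, [/\ `|p - y0| < r,
    forall q, `|q - y0| <= r -> v x q <= v x p + K / 2 * (q - p) ^+ 2 &
    forall s q q', `|s| = 1 -> `|q - y0| <= r -> `|q' - y0| <= r ->
      0 <= s * (q - p) -> 0 <= s * (q' - q) -> k / 2 * (q' - q) ^+ 2 <= v x q' - v x q].
  by move=> H; have [e eP] := choice H; exists e.
move=> x; have ab : y0 - r < y0 + r by have := r_gt0; lra.
have [t|t||p pI [_ h1 h2]] := @unimodal _ (v x) (vy x) (vyy x) (y0 - r) (y0 + r) k K ab k_gt0 k_leK.
- by rewrite -strip_itv => /(v_y x)[].
- by rewrite -strip_itv => /(v_y x)[].
- by exists y0; [have := r_gt0; lra|exact: v_edge].
exists p; split.
- by rewrite ltr_norml; lra.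
- by move=> q qI; apply: h1; rewrite -strip_itv.
- by move=> s q q' s1 qI q'I; apply: h2 => //; rewrite -strip_itv.
Qed.

Variable eta : R -> R.
Hypothesis etaP : forall x, [/\ `|eta x - y0| < r,
    forall q, `|q - y0| <= r -> v x q <= v x (eta x) + K / 2 * (q - eta x) ^+ 2 &
    forall s q q', `|s| = 1 -> `|q - y0| <= r -> `|q' - y0| <= r ->
      0 <= s * (q - eta x) -> 0 <= s * (q' - q) -> k / 2 * (q' - q) ^+ 2 <= v x q' - v x q].

Definition depth x := v x (eta x).

Lemma eta_strip x : `|eta x - y0| <= r.
Proof. by have [/ltW] := etaP x. Qed.

Lemma side_sign q x : exists2 s : R, `|s| = 1 & 0 <= s * (q - eta x).
Proof.
have [le|lt] := leP (eta x) q.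
  by exists 1; rewrite ?normr1 // mul1r subr_ge0.
by exists (-1); rewrite ?normrN1 // mulN1r oppr_ge0 subr_le0 ltW.
Qed.

Lemma depth_quad x q : `|q - y0| <= r -> depth x + k / 2 * (q - eta x) ^+ 2 <= v x q.
Proof.
move=> qI; have [s s1 sq] := side_sign q x; have [_ _ H] := etaP x.
have := H s (eta x) q s1 (eta_strip x) qI; rewrite subrr mulr0 lexx => /(_ isT sq).
by rewrite /depth; lra.
Qed.

Lemma depth_le x q : `|q - y0| <= r -> depth x <= v x q.
Proof.
move=> qI; have := depth_quad x q qI; have : 0 <= k / 2 * (q - eta x) ^+ 2.
  by rewrite mulr_ge0 ?sqr_ge0 // divr_ge0 // ltW.
lra.
Qed.

Lemma v_lip x x' y : `|y - y0| <= r -> `|v x' y - v x y| <= L * `|x' - x|.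
Proof.
move=> yI; apply: (@lip_of_derive _ (v^~ y) (vx^~ y)) => t _; by have [] := v_x t y yI.
Qed.

(** A minimum over [y] of functions with Lipschitz constant [L] in [x] inherits the constant:
    evaluate at the bottom point of the other abscissa. *)
Lemma depth_lip x x' : `|depth x' - depth x| <= L * `|x' - x|.
Proof.
have h t t' : depth t' - depth t <= L * `|t' - t|.
  have := depth_le t' (eta t) (eta_strip t); have := v_lip t t' (eta t) (eta_strip t).
  by rewrite ler_norml /depth => /andP[_]; lra.
by have := h x x'; have := h x' x; rewrite ler_norml distrC; lra.
Qed.

Lemma depth_cont : continuous depth.
Proof.
move=> x; apply/cvgrPdist_lt => e e0; have L1 : 0 < L + 1 by have := L_ge0; lra.
apply/near_dist; exists (e / (L + 1)); first exact: divr_gt0.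
move=> t td; rewrite distrC; apply: (le_lt_trans (depth_lip _ _)).
apply: (@le_lt_trans _ _ ((L + 1) * `|t - x|)); first by rewrite ler_wpM2r // lerDl.
by rewrite mulrC -ltr_pdivlMr.
Qed.

Lemma depth_per x : depth (x + 2 * pi) = depth x.
Proof.
apply/le_anti/andP; split.
  by have := depth_le (x + 2 * pi) (eta x) (eta_strip x); rewrite v_per.
by have := depth_le x (eta (x + 2 * pi)) (eta_strip _); rewrite -v_per.
Qed.

(* [s = 1] is the upper branch of the level curve, [s = -1] the lower one; below
   the depth of the valley both branches sit at its bottom. *)
Lemma branch_exists s c x : `|s| = 1 -> (forall x, c < v x (y0 - r) /\ c < v x (y0 + r)) ->
  exists y, [/\ `|y - y0| < r, 0 <= s * (y - eta x) & v x y = Num.max c (depth x)].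
Proof.
move=> s1 cr; have [e1 _ _] := etaP x.
have s2 : s = 1 \/ s = -1.
  by move: s1; case: (ger0P s) => _ <-; [left|right; rewrite opprK].
have edge : depth x < v x (y0 + s * r) /\ c < v x (y0 + s * r).
  have [v1 v2] := v_edge x x; have [c1 c2] := cr x.
  have : depth x <= v x y0 by apply: depth_le; rewrite subrr normr0 ltW.
  by case: s2 => ->; rewrite ?mul1r ?mulN1r; split; lra.
have in_strip t : Num.min (eta x) (y0 + s * r) <= t <= Num.max (eta x) (y0 + s * r) -> `|t - y0| <= r.
  rewrite strip_itv; move: e1; rewrite ltr_norml => e1.
  by case: s2 => ->; rewrite ?mul1r ?mulN1r; case: (leP (eta x)) => _; lra.
have [y yI vy'] : exists2 y, Num.min (eta x) (y0 + s * r) <= y <= Num.max (eta x) (y0 + s * r) &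
    v x y = Num.max c (depth x).
  have vmax : depth x <= Num.max c (depth x) <= v x (y0 + s * r).
    by rewrite le_max lexx orbT ge_max; have [? ?] := edge; rewrite !ltW.
  have ivt p q : p <= q -> (forall t, p <= t <= q -> `|t - y0| <= r) ->
     Num.min (v x p) (v x q) <= Num.max c (depth x) <= Num.max (v x p) (v x q) ->
     exists2 y, p <= y <= q & v x y = Num.max c (depth x).
    move=> pq pqI vI; have [|y] := @IVT _ (v x) p q _ pq _ vI; last by rewrite in_itv /=; exists y.
    apply: derivable_within_continuous => t; rewrite in_itv /= => /pqI/(v_y x)[d _ _].
    by have [] := d.
  have vm : Num.min (v x (eta x)) (v x (y0 + s * r)) = depth x.
    by rewrite min_l // ltW //; have [] := edge.
  have vM : Num.max (v x (eta x)) (v x (y0 + s * r)) = v x (y0 + s * r).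
    by rewrite max_r // ltW //; have [] := edge.
  have [le|lt] := leP (eta x) (y0 + s * r).
    apply: ivt => //; last by rewrite vm vM.
    by move=> t tI; apply: in_strip; rewrite min_l // max_r.
  apply: ivt; [exact: ltW| |by rewrite (minC (v x (y0 + s * r))) vm (maxC (v x (y0 + s * r))) vM].
  by move=> t tI; apply: in_strip; rewrite min_r ?max_l // ltW.
exists y; split => //.
  rewrite lt_neqAle in_strip // andbT; apply/negP => /eqP yr.
  have : Num.max c (depth x) < v x (y0 + s * r) by rewrite gt_max; have [-> ->] := edge.
  rewrite -vy'; suff -> : y = y0 + s * r by rewrite ltxx.
  move: yI yr e1; rewrite ltr_norml; case: (ger0P (y - y0)) => _ + yr;
    case: s2 => ->; rewrite ?mul1r ?mulN1r; case: (leP (eta x)) => _; lra.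
by move: yI e1; rewrite ltr_norml; case: s2 => ->; rewrite ?mul1r ?mulN1r; case: (leP (eta x)) => _; lra.
Qed.

(** Growth away from the bottom bounds the squared vertical gap by the difference of the values,
    after a horizontal move that costs [L * |x' - x|]. The square reflects that a branch behaves
    like a square root where it turns around, and it suffices for continuity. *)
Lemma branch_gap s x x' y y' : `|s| = 1 -> `|y - y0| <= r -> `|y' - y0| <= r ->
  0 <= s * (y - eta x) -> 0 <= s * (y' - eta x') ->
  k / 2 * (y' - y) ^+ 2 <= `|v x' y' - v x y| + L * `|x' - x|.
Proof.
move=> s1; have main t t' q q' : `|q - y0| <= r -> `|q' - y0| <= r ->
    0 <= s * (q - eta t) -> 0 <= s * (q' - q) ->
    k / 2 * (q' - q) ^+ 2 <= `|v t' q' - v t q| + L * `|t' - t|.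
  move=> qI q'I sq sqq; have [_ _ H] := etaP t.
  have := H s q q' s1 qI q'I sq sqq; have := v_lip t t' q' q'I.
  by have := ler_norm (v t' q' - v t q); rewrite ler_norml => ? /andP[? _]; lra.
move=> yI y'I sy sy'; have [le|/ltW le] := leP 0 (s * (y' - y)); first exact: main.
rewrite -sqrrN opprB (distrC (v x' y')) (distrC x'); apply: main => //.
by rewrite -opprB mulrN oppr_ge0.
Qed.

Lemma gap_cont (f : R -> R) :
  (forall x x', k / 2 * (f x' - f x) ^+ 2 <= 2 * L * `|x' - x|) -> continuous f.
Proof.
move=> H x; apply/cvgrPdist_lt => e e0; have L1 : 0 < 2 * L + 1 by have := L_ge0; lra.
have ke : 0 < k / 2 * e ^+ 2 by rewrite mulr_gt0 ?exprn_gt0 ?divr_gt0.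
apply/near_dist; exists (k / 2 * e ^+ 2 / (2 * L + 1)); first exact: divr_gt0.
move=> t; rewrite ltr_pdivlMr // => td; rewrite ltNge; apply/negP => ef.
have : k / 2 * e ^+ 2 <= k / 2 * (f t - f x) ^+ 2.
  rewrite ler_pM2l ?divr_gt0 // -(real_normK (num_real (f t - f x))) distrC.
  by rewrite ler_pXn2r ?nnegrE ?(ltW e0).
have := H x t; have : 0 <= `|t - x| by []. lra.
Qed.

Lemma eta_cont : continuous eta.
Proof.
apply: gap_cont => x x'.
have := branch_gap 1 x x' (eta x) (eta x'); rewrite !subrr mulr0 normr1 lexx !eta_strip.
move=> /(_ erefl isT isT isT isT); have := depth_lip x x'; rewrite /depth; lra.
Qed.

(** At the point [a] supplied by [tilt] one has [vx <= - s] on the floor. By continuity of [vx] the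
    depth decreases strictly on some [[a, as']], and beyond [as'] the tilt estimate keeps it below
    [depth a - s * (as' - a)]. The levels between this value and [depth a] are therefore crossed
    exactly once. *)
Lemma left_side p q c1 c2 : p < q -> c1 < c2 -> c2 <= depth p -> depth q < c1 ->
  exists a0 l1 l2, [/\ p <= a0 < q, c1 <= l1, l1 < l2, l2 <= c2 &
    forall c, l1 < c < l2 -> exists2 a, a0 < a < q & [/\ depth a = c,
      forall x, a0 <= x < a -> c < depth x & forall x, a < x <= q -> depth x < c]].
Proof.
move=> pq c12 dp dq.
have [a [s [/andP[pa aq] s0 /andP[ca ac] key]]] := tilt _ _ _ _ _ depth_cont pq c12 dp dq.
have eta_near d : 0 < d -> exists2 d', 0 < d' & forall x, `|x - a| < d' -> `|eta x - eta a| < d.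
  move=> d0; have /cvgrPdist_lt/(_ d d0)/near_dist[d' d'0 H] := eta_cont a.
  by exists d' => // x /H; rewrite distrC.
have slope t t' y : `|y - y0| <= r -> t < t' ->
    exists2 x, t <= x <= t' & v t' y - v t y = vx x y * (t' - t).
  move=> yI tt; have [x|x xI E] := @mvt _ (v^~ y) (vx^~ y) t t'.
    by have [] := v_x x y yI.
  by exists x => //; move: xI; rewrite min_l ?max_r // ltW.
have [_ _ /cont2P cvx] := v_x a (eta a) (eta_strip a).
have close e : 0 < e -> exists2 d, 0 < d & forall x t, a <= t <= a + d -> a <= x <= a + d ->
    `|vx t (eta x) - vx a (eta a)| < e.
  move=> /cvx[d d0 dP]; have [d' d'0 d'P] := eta_near d d0.
  have mp : 0 < Num.min d d' by rewrite lt_min d0.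
  have m1 : Num.min d d' <= d by rewrite ge_min lexx.
  have m2 : Num.min d d' <= d' by rewrite ge_min lexx orbT.
  exists (Num.min d d' / 2); first exact: divr_gt0.
  move=> x t tI xI; apply: dP.
    by rewrite ger0_norm; lra.
  by apply: d'P; rewrite ger0_norm; lra.
have pick d : 0 < d -> exists x, [/\ a < x, x <= q & x <= a + d].
  by move=> d0; exists (Num.min q (a + d)); rewrite lt_min aq ltrDl d0 !ge_min !lexx orbT.
(* An envelope argument: comparison of both depths at the same height [eta x] turns the decay of the
   depth into a bound on [vx], without a derivative of [eta]. *)
have va : vx a (eta a) <= - s.
  rewrite leNgt; apply/negP => lt.
  have [|d /pick[x [xa xq xd]] dP] := close (vx a (eta a) + s); first by lra.
  have [t tI E] := slope a x (eta x) (eta_strip x) xa.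
  have h : - s < vx t (eta x) by have := dP x t; rewrite ltr_norml; lra.
  have : - s * (x - a) < vx t (eta x) * (x - a) by rewrite ltr_pM2r // subr_gt0.
  have := key x; rewrite xa xq => /(_ isT); have := depth_le a (eta x) (eta_strip x).
  by move: E; rewrite /depth; lra.
have [|d /pick[as' [sa sq sd]] dP] := close (s / 2); first by lra.
have dec x x' : a <= x -> x < x' -> x' <= as' -> depth x' < depth x.
  move=> ax xx' x'a; have [t tI E] := slope x x' (eta x) (eta_strip x) xx'.
  have vt : vx t (eta x) < 0.
    by have := dP x t; rewrite ltr_norml; lra.
  have : vx t (eta x) * (x' - x) < 0 by rewrite pmulr_llt0 // subr_gt0.
  by have := depth_le x' (eta x) (eta_strip x); rewrite -E /depth; lra.
have ssa : 0 < s * (as' - a) by rewrite mulr_gt0 // subr_gt0.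
exists a, (Num.max c1 (depth a - s * (as' - a))), (depth a); split => //.
- by rewrite pa.
- by rewrite le_max lexx.
- by rewrite gt_max ca; lra.
move=> c; rewrite gt_max => /andP[/andP[c1c lc] cd].
have ds : depth as' <= depth a - s * (as' - a) by apply: key; rewrite sa.
have [||a' +  da'] := @IVT _ depth a as' c (ltW sa).
- exact: continuous_subspaceT depth_cont.
- by rewrite min_r ?max_l; lra.
rewrite in_itv /= => /andP[aa' a's].
have a'1 : a' != a by apply: contraTneq cd => <-; rewrite da' ltxx.
have a'2 : a' != as' by apply: contraTneq lc => E; rewrite -da' E -leNgt.
have {aa'}a'1 : a < a' by rewrite lt_neqAle eq_sym a'1.
have {a's}a'2 : a' < as' by rewrite lt_neqAle a'2.
exists a'; first by lra.
split => // x /andP[x1 x2]; first by rewrite -da'; apply: dec => //; exact: ltW.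
have [xs|sx] := leP x as'; first by rewrite -da'; apply: dec => //; exact: ltW.
have : s * (as' - a) < s * (x - a) by rewrite ltr_pM2l //; lra.
by have := key x; rewrite x2 andbT => /(_ _); have := lt_trans sa sx; lra.
Qed.

End Valley.

(** * The region swept by closed level curves *)

Section Annulus.
Context {R : realType}.
Implicit Types (a b c d e h l m p q r s t x y C M N K : R).
Local Notation T := (torus R).
Local Notation cover := (@Defs.cover R).

Lemma cover_inj (z z' : R * R) : cover z = cover z' -> `|z.1 - z'.1| < 2 * pi -> z = z'.
Proof.
case: z z' => [x y] [x' y'] [/to_torus_eqP[k E] ->] /= lt; congr pair.
have pi2 : 0 < 2 * pi :> R by rewrite mulr_gt0 ?pi_gt0.
move: lt; rewrite E normrM gtr0_norm // gtr_pMr // -intr_norm.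
rewrite (ltr_int R `|k| 1) => k1; have k0 : k = 0.
  by apply/eqP; rewrite -normr_le0 -ltzD1 add0r.
by apply/eqP; rewrite -subr_eq0 E k0 mulr0.
Qed.

Lemma window_shift p x : exists k : int, p <= x + 2 * pi * k%:~R < p + 2 * pi.
Proof.
have pi2 : 0 < 2 * pi :> R by rewrite mulr_gt0 ?pi_gt0.
have := floor_itv ((x - p) / (2 * pi)); set n := Num.floor _ => /andP[n1 n2].
exists (- n); move: n1 n2; rewrite ler_pdivlMr // ltr_pdivrMr // rmorphD rmorphN /=; lra.
Qed.

Variables (G H : T -> R) (psi : T * R -> R) (sig : R).
Variables (v : R -> R -> R) (eta m : R -> R) (y0 r K : R).
Variables (a0 x0 b0 e1 e2 : R) (A B : R -> R) (Y : bool -> R -> R -> R).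
Let sg (i : bool) : R := if i then 1 else -1.
Hypotheses (sig_neq0 : sig != 0) (K_gt0 : 0 < K).
Hypothesis strip_channel : forall x y, `|y - y0| <= r ->
  channel G H (cover (x, y)) /\ psi (cover (x, y)) = sig * v x y.
Hypothesis v_cont2 : forall x y, `|y - y0| < r -> cont2 v x y.
Hypothesis eta_strip : forall x, `|eta x - y0| < r.
Hypothesis v_eta : forall x, v x (eta x) = m x.
Hypothesis v_quad : forall x q, `|q - y0| <= r -> v x q <= m x + K / 2 * (q - eta x) ^+ 2.
Hypothesis v_inc : forall i x q q', `|q - y0| <= r -> `|q' - y0| <= r ->
  0 <= sg i * (q - eta x) -> 0 < sg i * (q' - q) -> v x q < v x q'.
Hypotheses (e12 : e1 < e2) (ba : b0 - a0 <= 2 * pi).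
Hypothesis edge : forall x y, `|y - y0| = r -> e2 < v x y.
Hypothesis levels : forall c, e1 < c < e2 ->
  [/\ a0 < A c < x0, x0 < B c < b0, m (A c) = c /\ m (B c) = c,
      forall x, A c < x < B c -> m x < c &
      forall x, (a0 <= x < A c) || (B c < x <= b0) -> c < m x].
Hypothesis YP : forall i c x, e1 < c < e2 ->
  [/\ `|Y i c x - y0| < r, 0 <= sg i * (Y i c x - eta x) & v x (Y i c x) = Num.max c (m x)].
Hypothesis Y_cont : forall i c, e1 < c < e2 -> continuous (Y i c).

Lemma bottom_le x q : `|q - y0| <= r -> m x <= v x q.
Proof.
move=> qr; rewrite -v_eta; have er := ltW (eta_strip x).
case: (ltgtP (eta x) q) => [lt|lt|->] //; apply: ltW.
  by apply: (@v_inc true) => //; rewrite /sg ?subrr ?mulr0 ?mul1r ?subr_gt0.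
by apply: (@v_inc false) => //; rewrite /sg ?subrr ?mulr0 ?mulN1r ?oppr_gt0 ?subr_lt0.
Qed.

Lemma side_uniq i x y y' : `|y - y0| <= r -> `|y' - y0| <= r ->
  0 <= sg i * (y - eta x) -> 0 <= sg i * (y' - eta x) -> v x y = v x y' -> y = y'.
Proof.
move=> yr y'r sy sy' E; case: (ltgtP (sg i * (y' - y)) 0) => h.
- have := v_inc i x y' y y'r yr sy'; rewrite -opprB mulrN oppr_gt0 E ltxx => /(_ h) //.
- by have := v_inc i x y y' yr y'r sy h; rewrite E ltxx.
- apply/eqP; rewrite eq_sym -subr_eq0; move: h => /eqP; rewrite mulf_eq0 => /orP[|//].
  by rewrite /sg; case: i {sy sy'}; rewrite ?oppr_eq0 oner_eq0.
Qed.

Lemma Y_bottom i c x : e1 < c < e2 -> c <= m x -> Y i c x = eta x.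
Proof.
move=> cI cm; have [yr sy vy] := YP i c x cI.
apply: (side_uniq i x) => //; [exact: ltW|exact/ltW/eta_strip|by rewrite subrr mulr0|].
by rewrite vy v_eta max_r.
Qed.

(** Over [[A c, B c]] this set consists of the branches [Y true c] and [Y false c], which meet on
    the floor over the end points. On the rest of [[a0, b0]] the floor lies above the level [c]. *)
Definition curve c : set (R * R) :=
  [set z | [/\ A c <= z.1 <= B c, `|z.2 - y0| < r & v z.1 z.2 = c]].

Lemma window c : e1 < c < e2 -> A c < B c /\ B c - A c < 2 * pi.
Proof. by move=> /levels[h1 h2 _ _ _]; move: ba; split; lra. Qed.

(** A tent function: the upper branch is traversed from [A c] to [B c] for [t <= 1 / 2], the lower
    one backwards afterwards. *)
Definition curve_x c t := A c + (B c - A c) * (1 - `|2 * t - 1|).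

(** The minimum and the maximum hold one branch fixed over [B c] while the other is traversed, and
    [eta (B c)] removes the fixed value. Continuity then follows by composition, without gluing. *)
Definition curve_y c t := Y true c (curve_x c (Num.min t 2^-1)) +
  Y false c (curve_x c (Num.max t 2^-1)) - eta (B c).

Lemma curve_x_itv c t : e1 < c < e2 -> 0 <= t <= 1 -> A c <= curve_x c t <= B c.
Proof.
move=> /window[AB _] tI; have h0 : 0 <= 1 - `|2 * t - 1| <= 1.
  by rewrite lerBlDr lerDl normr_ge0 andbT subr_ge0 ler_norml; lra.
have /andP[h1 h2] := h0; have AB0 : 0 <= B c - A c by lra.
have := mulr_ge0 AB0 h1; have := ler_wpM2l AB0 h2; rewrite /curve_x mulr1; lra.
Qed.

Lemma curve_yE c t : e1 < c < e2 -> curve_y c t =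
  if t <= 2^-1 then Y true c (curve_x c t) else Y false c (curve_x c t).
Proof.
move=> cI; have mid i : Y i c (curve_x c 2^-1) = eta (B c).
  have -> : curve_x c 2^-1 = B c.
    by rewrite /curve_x divff ?pnatr_eq0 // subrr normr0 subr0 mulr1 addrC subrK.
  by apply: Y_bottom => //; have [_ _ [_ ->]] := levels c cI.
rewrite /curve_y; case: ifPn => [le|]; first by rewrite min_l // max_r // mid addrK.
by rewrite -ltNge => lt; rewrite min_r ?max_l ?(ltW lt) // mid addrC addKr.
Qed.

Lemma curve_image c : e1 < c < e2 ->
  curve c = (fun t => (curve_x c t, curve_y c t)) @` `[0, 1].
Proof.
move=> cI; have [AB _] := window c cI; have [_ _ [mA mB] mlt _] := levels c cI.
have mle x : A c <= x <= B c -> m x <= c.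
  move=> xI; have [->|nA] := eqVneq x (A c); first by rewrite mA.
  have [->|nB] := eqVneq x (B c); first by rewrite mB.
  by apply/ltW/mlt; rewrite !lt_neqAle eq_sym nA nB.
apply/seteqP; split => [[x y] [/= xI yr vc]|_ [t /= + <-]]; last first.
  rewrite in_itv /= => tI; have xI := curve_x_itv c t cI tI.
  have vY i : v (curve_x c t) (Y i c (curve_x c t)) = c.
    by have [_ _ ->] := YP i c (curve_x c t) cI; rewrite max_l // mle.
  split => //=; rewrite curve_yE //; case: ifP => _ //.
    by have [] := YP true c (curve_x c t) cI.
  by have [] := YP false c (curve_x c t) cI.
have BA0 : B c - A c != 0 by rewrite subr_eq0 gt_eqF.
pose p := (x - A c) / (B c - A c).
have pI : 0 <= p <= 1.
  by rewrite /p divr_ge0 ?ler_pdivrMr ?mul1r; lra.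
have pE : A c + (B c - A c) * p = x by rewrite mulrC divfK // addrC subrK.
have cx1 : curve_x c (p / 2) = x.
  rewrite /curve_x (_ : 2 * (p / 2) - 1 = - (1 - p)); last by field.
  by rewrite normrN ger0_norm ?subr_ge0 ?(andP pI).2 // -[RHS]pE; ring.
have cx2 : curve_x c (1 - p / 2) = x.
  rewrite /curve_x (_ : 2 * (1 - p / 2) - 1 = 1 - p); last by field.
  by rewrite ger0_norm ?subr_ge0 ?(andP pI).2 // -[RHS]pE; ring.
have Yy i : 0 <= sg i * (y - eta x) -> Y i c x = y.
  move=> sy; have [Yr sY vY] := YP i c x cI.
  by apply: (side_uniq i x) => //; rewrite ?(ltW yr) ?(ltW Yr) // vY vc max_l // mle.
have [le|lt] := leP (eta x) y.
  exists (p / 2); first by rewrite /= in_itv /=; lra.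
  by rewrite curve_yE // cx1 ifT ?Yy //; [rewrite mul1r subr_ge0|lra].
have Y2 : Y false c x = y by rewrite Yy // /sg mulN1r oppr_ge0 subr_le0 ltW.
exists (1 - p / 2); first by rewrite /= in_itv /=; lra.
rewrite curve_yE // cx2; case: ifPn => [le|_]; last by rewrite Y2.
have p1 : p = 1 by lra.
have xB : x = B c by rewrite -pE p1 mulr1 addrC subrK.
by rewrite -Y2 !Y_bottom // xB mB.
Qed.

Lemma curve_x_cont c : continuous (curve_x c).
Proof.
move=> t; rewrite /curve_x; apply: cvgD; first exact: cvg_cst.
apply: cvgMr; apply: cvgB; first exact: cvg_cst.
apply: cvg_norm; apply: cvgB; last exact: cvg_cst.
by apply: cvgMr.
Qed.

Lemma curve_y_cont c : e1 < c < e2 -> continuous (curve_y c).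
Proof.
move=> cI t; rewrite /curve_y; apply: cvgB; last exact: cvg_cst.
have cc i (f : R -> R) : {for t, continuous f} -> {for t, continuous (fun t => Y i c (curve_x c (f t)))}.
  move=> cf; apply: (@continuous_comp _ _ _ f (fun u => Y i c (curve_x c u))) => //.
  by apply: (@continuous_comp _ _ _ (curve_x c) (Y i c)); [exact: curve_x_cont|exact: Y_cont].
apply: cvgD; apply: cc.
  by apply: (@continuous_min _ _ id (fun=> 2^-1) t); [apply: cvg_id|apply: cvg_cst].
by apply: (@continuous_max _ _ id (fun=> 2^-1) t); [apply: cvg_id|apply: cvg_cst].
Qed.

Definition closed_curve c t : T * R := cover (curve_x c t, curve_y c t).

Lemma cover_pair_cont (S : topologicalType) (f g : S -> R) :
  continuous f -> continuous g -> continuous (fun z => cover (f z, g z)).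
Proof.
move=> cf cg z; apply: (@continuous_comp _ _ _ (fun z => (f z, g z)) cover).
  exact: (cvg_pair (cf z) (cg z)).
exact: cover_cont.
Qed.

Lemma closed_curve_image c : e1 < c < e2 -> cover @` curve c = closed_curve c @` `[0, 1].
Proof. by move=> cI; rewrite curve_image // image_comp. Qed.

Lemma curve_ends c : e1 < c < e2 ->
  (curve_x c 0, curve_y c 0) = (A c, eta (A c)) /\ (curve_x c 1, curve_y c 1) = (A c, eta (A c)).
Proof.
move=> cI; have [_ _ [mA _] _ _] := levels c cI.
have x0E : curve_x c 0 = A c.
  by rewrite /curve_x mulr0 sub0r normrN1 subrr mulr0 addr0.
have x1E : curve_x c 1 = A c.
  by rewrite /curve_x mulr1 (_ : 2 - 1 = 1 :> R) ?normr1 ?subrr ?mulr0 ?addr0 //; ring.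
rewrite !curve_yE // x0E x1E invr_ge0 ler0n ifN; last by rewrite -ltNge invf_lt1 ?ltr1n.
by rewrite !Y_bottom // mA.
Qed.

Lemma closed_curve_contractible c : e1 < c < e2 ->
  contractible_closed_curve (cover @` curve c).
Proof.
move=> cI; have [E0 E1] := curve_ends c cI.
have cc : continuous (closed_curve c).
  by apply: cover_pair_cont; [exact: curve_x_cont|exact: curve_y_cont].
exists (closed_curve c); split.
- split; first split.
  + exact: continuous_subspaceT.
  + by rewrite /closed_curve E0 E1.
  + move=> t t'; rewrite !in_itv /= => tI t'I.
    have [AB w] := window c cI.
    have xI := curve_x_itv c t cI; have xI' := curve_x_itv c t' cI.
    move=> /cover_inj/= h; have [] : (curve_x c t, curve_y c t) = (curve_x c t', curve_y c t').
      by apply: h; rewrite ltr_norml; move: (xI ltac:(lra)) (xI' ltac:(lra)); lra.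
    rewrite !curve_yE // => xE.
    have BA0 : B c - A c != 0 by rewrite subr_eq0 gt_eqF.
    have nE : `|2 * t - 1| = `|2 * t' - 1|.
      by move: xE => /addrI/(mulfI BA0)/addrI/oppr_inj.
    (* A common point of both branches is the bottom itself, whose level is below [c] except over
       the end points. *)
    have opp s s' : 0 <= s < 1 -> s <= 2^-1 -> 2^-1 < s' -> s' < 1 -> curve_x c s = curve_x c s' ->
       `|2 * s - 1| = `|2 * s' - 1| -> Y true c (curve_x c s) <> Y false c (curve_x c s').
      move=> sI s2 s'2 s'1 <-; rewrite ler0_norm ?gtr0_norm; [|lra..] => sE YE.
      have [_ _ _ mlt _] := levels c cI.
      have mc : m (curve_x c s) < c.
        apply: mlt; rewrite /curve_x ler0_norm; last lra.
        have h1 : 0 < (B c - A c) * (2 * s) by rewrite mulr_gt0; lra.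
        have h2 : 0 < (B c - A c) * (1 - 2 * s) by rewrite mulr_gt0; lra.
        by lra.
      have [_ s1 v1] := YP true c (curve_x c s) cI; have [_ s2' _] := YP false c (curve_x c s) cI.
      move: s1 s2'; rewrite /sg mul1r mulN1r -YE => s1 s2'.
      have Ee : Y true c (curve_x c s) = eta (curve_x c s) by lra.
      by move: v1; rewrite Ee v_eta max_l ?(ltW mc) // => E; move: mc; rewrite E ltxx.
    case: (leP t 2^-1) => [t2|t2]; case: (leP t' 2^-1) => t'2 YE.
    * by move: nE; rewrite !ler0_norm; lra.
    * by case: (opp t t'); rewrite //; lra.
    * by case: (opp t' t); rewrite //; lra.
    * by move: nE; rewrite !gtr0_norm; lra.
- exact: closed_curve_image.
(* The plane curve is contracted along straight lines to its starting point, and the homotopy is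
   then projected. *)
- pose hx (z : R * R) := (1 - z.1) * curve_x c z.2 + z.1 * A c.
  pose hy (z : R * R) := (1 - z.1) * curve_y c z.2 + z.1 * eta (A c).
  have chom (f : R -> R) q : continuous f -> continuous (fun z : R * R => (1 - z.1) * f z.2 + z.1 * q).
    move=> cf z; apply: cvgD; last by apply: cvgMl; exact: cvg_fst.
    apply: cvgM; first by apply: cvgB; [exact: cvg_cst|exact: cvg_fst].
    by apply: (@continuous_comp _ _ _ snd f); [exact: cvg_snd|exact: cf].
  exists (fun z => cover (hx z, hy z)), (cover (A c, eta (A c))); split.
  + apply: continuous_subspaceT; apply: cover_pair_cont; apply: chom.
      exact: curve_x_cont.
    exact: curve_y_cont.
  + by move=> t _; rewrite /hx /hy /= subr0 !mul1r !mul0r !addr0.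
  + by move=> t _; rewrite /hx /hy /= subrr !mul0r !mul1r !add0r.
  + by move=> s _; rewrite /hx /hy /=; case: E0 => -> ->; case: E1 => -> ->.
Qed.

Lemma curve_connected c : e1 < c < e2 -> connected (cover @` curve c).
Proof.
move=> cI; rewrite closed_curve_image //; apply: connected_continuous_connected.
  by apply/connected_intervalP; exact: interval_is_interval.
by apply/continuous_subspaceT/cover_pair_cont; [exact: curve_x_cont|exact: curve_y_cont].
Qed.

(** Within the component, the open set [V1] contains exactly the points of the curve and the open
    set [V2] exactly the others. The curve is thus open and closed in a connected set. *)
Lemma curve_streamline c (p : T * R) : e1 < c < e2 -> (cover @` curve c) p ->
  streamline G H psi p = cover @` curve c.
Proof.
move=> cI pc; have [AB w] := window c cI; have [_ _ [mA mB] _ mgt] := levels c cI.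
have lev z : curve c z -> channel G H (cover z) /\ psi (cover z) = sig * c.
  by case: z => x y [/= xI /ltW yr vc]; have := strip_channel x y yr; rewrite vc.
have psip : psi p = sig * c by have [z /lev[_ zE] <-] := pc.
apply/seteqP; split; last first.
  apply: connected_component_max => //; last exact: curve_connected.
  by move=> _ [z /lev[zG zE] <-]; rewrite /= zE psip.
pose C := streamline G H psi p.
have Cc : connected C := @component_connected _ _ _.
have Csub (q : T * R) : C q -> channel G H q /\ psi q = sig * c.
  by move=> /connected_component_sub[? ?]; rewrite -psip.
have Cp : C p by apply: connected_component_refl; have [z /lev[? _] <-] := pc.
have stripP x y : `|y - y0| <= r -> psi (cover (x, y)) = sig * c ->
    v x y = c /\ `|y - y0| < r.
  move=> yr; have [_ ->] := strip_channel x y yr => /(mulfI sig_neq0) vc.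
  split => //; rewrite lt_neqAle yr andbT; apply/eqP => /(edge x); rewrite vc.
  by move: cI => /andP[_ c2] /(lt_trans c2); rewrite ltxx.
pose V1 := [set z : R * R | a0 < z.1 < b0 /\ `|z.2 - y0| < r].
(* Every point has an abscissa in the period that starts at [A c], so a point of the level set off
   the curve lies past [B c] or outside the strip. *)
pose V2 := [set z : R * R | B c < z.1 < A c + 2 * pi \/ r < `|z.2 - y0|].
have cn : continuous (fun z : R * R => `|z.2 - y0|).
  move=> z; apply: cvg_norm; apply: cvgB; [exact: cvg_snd|exact: cvg_cst].
have pre (f : R * R -> R) (D : set R) : continuous f -> open D -> open (f @^-1` D).
  by move=> cf oD; apply: open_comp => // z _; exact: cf.
have cfst : continuous (fun z : R * R => z.1) by move=> z; exact: cvg_fst.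
have oV1 : open V1.
  rewrite (_ : V1 = (fun z : R * R => z.1) @^-1` [set` `]a0, b0[] `&`
    (fun z : R * R => `|z.2 - y0|) @^-1` [set u | u < r]); last first.
    by apply/seteqP; split => z; rewrite /V1 /= in_itv.
  by apply: openI; apply: pre => //; exact: open_lt.
have oV2 : open V2.
  rewrite (_ : V2 = (fun z : R * R => z.1) @^-1` [set` `]B c, A c + 2 * pi[] `|`
    (fun z : R * R => `|z.2 - y0|) @^-1` [set u | r < u]); last first.
    by apply/seteqP; split => z; rewrite /V2 /= in_itv.
  by apply: openU; apply: pre => //; exact: open_gt.
have ocov V : open V -> open (cover @` V).
  move=> oV; rewrite openE => _ [z Vz <-]; apply: cover_nbhs.
  exact: open_nbhs_nbhs.
have CV1 (q : T * R) : C q -> (cover @` curve c) q <-> (cover @` V1) q.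
  move=> Cq; split => [[z [zI zr _] <-]|[[x y] [/= xI yr] qE]].
    exists z => //; split => //.
    by have [h1 h2 _ _ _] := levels c cI; lra.
  have [_ psiq] := Csub q Cq; rewrite -qE in psiq.
  have [vc _] := stripP x y (ltW yr) psiq.
  exists (x, y) => //; split => //=; rewrite leNgt (leNgt x) -negb_or; apply/negP => xo.
  have : c < m x by apply: mgt; move: xI xo => /andP[h1 h2] /orP[h|h]; rewrite h ?orbT ?(ltW h1) ?(ltW h2) // ?orbT.
  by rewrite ltNge -vc bottom_le // ltW.
have CV2 (q : T * R) : C q -> (cover @` curve c) q <-> ~ (cover @` V2) q.
  move=> Cq; split => [[z [zI zr _] <-] [z' V2z' E]|nq].
    case: V2z' => h; last first.
      have zz : z'.2 = z.2 by move: E => [].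
      by move: h; rewrite zz ltNge ltW.
    have : z' = z by apply: cover_inj => //; rewrite ltr_norml; lra.
    by move=> zz; rewrite zz in h; lra.
  have [x1 x1E] := to_torus_surj q.1.
  have [x xI xE] : exists2 x, A c <= x < A c + 2 * pi & to_torus x = q.1.
    have [n nI] := window_shift (A c) x1; exists (x1 + 2 * pi * n%:~R) => //.
    by rewrite -x1E; apply/to_torus_eqP; exists n; ring.
  have qE : q = cover (x, q.2) by rewrite /Defs.cover /= xE; case: (q).
  have [_ psiq] := Csub q Cq.
  have [yr|ry] := leP `|q.2 - y0| r; last first.
    by case: nq; exists (x, q.2) => //; right.
  rewrite qE in psiq; have [vc yr'] := stripP x q.2 yr psiq.
  exists (x, q.2) => //; split => //=; have /andP[-> xA] := xI.
  rewrite leNgt; apply/negP => Bx; case: nq; exists (x, q.2) => //; left => /=.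
  by rewrite Bx.
have CE : C `&` (cover @` curve c) = C.
  apply: Cc; first by exists p.
    exists (cover @` V1); first exact: ocov.
    by apply/seteqP; split => q [Cq hq]; split => //; apply/(CV1 q).
  exists (~` (cover @` V2)); first by apply: open_closedC; exact: ocov.
  by apply/seteqP; split => q [Cq hq]; split => //; apply/(CV2 q).
by move=> q; rewrite -/C -CE => -[].
Qed.

Definition annulus : set (R * R) :=
  [set z | [/\ a0 < z.1 < b0, `|z.2 - y0| < r & e1 < v z.1 z.2 < e2]].

Lemma annulus_curve z : annulus z -> curve (v z.1 z.2) z.
Proof.
case: z => x y [/= xI yr cI]; have [_ _ _ _ mgt] := levels _ cI.
split => //=; rewrite leNgt (leNgt x) -negb_or; apply/negP => xo.
have : v x y < m x.
  by apply: mgt; move: xI xo => /andP[h1 h2] /orP[h|h]; rewrite h ?orbT ?(ltW h1) ?(ltW h2) // ?orbT.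
by rewrite ltNge bottom_le // ltW.
Qed.

Lemma curve_annulus c : e1 < c < e2 -> curve c `<=` annulus.
Proof.
move=> cI z [zI zr vc]; split; rewrite ?vc //.
by have [h1 h2 _ _ _] := levels c cI; lra.
Qed.

Lemma annulus_open : open annulus.
Proof.
rewrite openE => -[x y] [/= xI yr vI].
have e0 : 0 < Num.min (v x y - e1) (e2 - v x y) by rewrite lt_min; lra.
have m1 : Num.min (v x y - e1) (e2 - v x y) <= v x y - e1 by rewrite ge_min lexx.
have m2 : Num.min (v x y - e1) (e2 - v x y) <= e2 - v x y by rewrite ge_min lexx orbT.
have [d d0 dP] := (cont2P v x y).1 (v_cont2 x y yr) _ e0.
apply/nbhs2P; exists (Num.min (Num.min (x - a0) (b0 - x)) (Num.min d (r - `|y - y0|))).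
  by rewrite !lt_min; lra.
move=> s t; rewrite !lt_min => /andP[/andP[s1 s2] /andP[s3 s4]] /andP[_ /andP[t1 t2]]; split => /=.
- by move: s1 s2; rewrite !ltr_norml; lra.
- by have := ler_normD (t - y) (y - y0); rewrite subrKA; lra.
- by have := dP s t s3 t1; rewrite ltr_norml; lra.
Qed.

(** This segment over the lowest point [x0], from the bottom upwards, meets every curve of the
    family and so ties them together into one connected region. *)
Lemma axis_connected : connected (cover @` [set z | z.1 = x0 /\
  [/\ `|z.2 - y0| < r, 0 <= z.2 - eta x0 & e1 < v x0 z.2 < e2]]).
Proof.
pose S := [set y | [/\ `|y - y0| < r, 0 <= y - eta x0 & e1 < v x0 y < e2]].
rewrite (_ : _ @` _ = (fun y => cover (x0, y)) @` S); last first.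
  apply/seteqP; split => [_ [[x y] [/= -> Sy] <-]|_ [y Sy <-]]; first by exists y.
  by exists (x0, y).
apply: connected_continuous_connected.
  apply/connected_intervalP => y1 y2 [r1 s1 v1] [r2 s2 v2] y yI.
  have yr : `|y - y0| < r by move: r1 r2; rewrite !ltr_norml; lra.
  have sy : 0 <= y - eta x0 by lra.
  have mono p q : `|p - y0| < r -> `|q - y0| < r -> 0 <= p - eta x0 -> p <= q -> v x0 p <= v x0 q.
    move=> pr qr sp; rewrite le_eqVlt => /orP[/eqP -> //|pq]; apply: ltW.
    by apply: (@v_inc true) => //; rewrite ?(ltW pr) ?(ltW qr) ?mul1r // subr_gt0.
  split => //; have := mono y1 y r1 yr s1; have := mono y y2 yr r2 sy; lra.
apply: continuous_subspaceT; apply: cover_pair_cont => y; [exact: cvg_cst|exact: cvg_id].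
Qed.

Lemma axis_level c : e1 < c < e2 -> curve c (x0, Y true c x0) /\ curve c (x0, Y false c x0).
Proof.
move=> cI; have [h1 h2 _ mlt _] := levels c cI.
have mc : m x0 <= c by apply/ltW/mlt; lra.
have [r1 _ v1] := YP true c x0 cI; have [r2 _ v2] := YP false c x0 cI.
by split; split => //=; rewrite ?v1 ?v2 ?max_l //; lra.
Qed.

Lemma annulus_connected : connected (cover @` annulus).
Proof.
pose S := cover @` [set z | z.1 = x0 /\
  [/\ `|z.2 - y0| < r, 0 <= z.2 - eta x0 & e1 < v x0 z.2 < e2]].
have onS c : e1 < c < e2 -> S (cover (x0, Y true c x0)).
  move=> cI; have [[_ _ vc] _] := axis_level c cI; have [yr sy _] := YP true c x0 cI.
  exists (x0, Y true c x0) => //; split => //; split => //=; last by rewrite vc.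
  by move: sy; rewrite /sg mul1r.
rewrite (_ : cover @` annulus = \bigcup_(c in `]e1, e2[) (cover @` curve c `|` S)).
  apply: bigcup_connected.
    have cI : e1 < (e1 + e2) / 2 < e2 by move: e12; lra.
    by exists (cover (x0, Y true ((e1 + e2) / 2) x0)) => c _; right; apply: onS.
  move=> c; rewrite /= in_itv /= => cI; apply: connectedU.
  - exists (cover (x0, Y true c x0)); split; last exact: onS.
    by exists (x0, Y true c x0) => //; have [] := axis_level c cI.
  - exact: curve_connected.
  - exact: axis_connected.
apply/seteqP; split => [_ [z az <-]|q [c]].
  exists (v z.1 z.2); first by case: az.
  by left; exists z => //; exact: annulus_curve.
rewrite /= in_itv /= => cI [[z cz <-]|[[x y] [/= -> [yr sy vI]] <-]].
  by exists z => //; exact: curve_annulus cz.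
exists (x0, y) => //; split => //=.
by have [h1 h2 _ _ _] := levels c cI; lra.
Qed.

(** The height is read off over [x0]: there [v <= m x0 + K / 2 * (q - eta x0) ^+ 2], so both
    branches of a level above [e1] keep a distance of at least [sqrt (2 * (e1 - m x0) / K)] from the
    bottom. *)
Lemma annulus_island : island G H psi (cover @` annulus) /\
  2 * Num.sqrt (2 * (e1 - m x0) / K) <= height (cover @` annulus).
Proof.
have onchan (q : T * R) : (cover @` annulus) q -> channel G H q /\ `|q.2 - y0| < r.
  by move=> [[x y] [_ /= yr _] <-]; have [] := strip_channel x y (ltW yr).
pose c := (e1 + e2) / 2; have cI : e1 < c < e2 by rewrite /c; move: e12; lra.
have [c1 c2] := axis_level c cI.
have mem1 := curve_annulus c cI _ c1; have mem2 := curve_annulus c cI _ c2.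
split.
  split.
  - rewrite openE => _ [z az <-]; apply: cover_nbhs; apply: open_nbhs_nbhs.
    by split => //; exact: annulus_open.
  - exact: annulus_connected.
  - by exists (cover (x0, Y true c x0)), (x0, Y true c x0).
  - by move=> q /onchan[].
  - move=> _ [z az <-]; have cz := annulus_curve z az; have [_ _ vI] := az.
    have -> : streamline G H psi (cover z) = cover @` curve (v z.1 z.2).
      by apply: curve_streamline => //; exists z.
    split; last exact: closed_curve_contractible.
    by move=> _ [z' cz' <-]; exists z' => //; exact: curve_annulus cz'.
rewrite /height; set W := (X in sup X).
have Wlo : has_lbound W.
  by exists (y0 - r) => _ [q /onchan[_ +] <-]; rewrite ltr_norml; lra.
have Wup : has_ubound W.
  by exists (y0 + r) => _ [q /onchan[_ +] <-]; rewrite ltr_norml; lra.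
have W1 : W (Y true c x0) by exists (cover (x0, Y true c x0)) => //; exists (x0, Y true c x0).
have W2 : W (Y false c x0) by exists (cover (x0, Y false c x0)) => //; exists (x0, Y false c x0).
have := ub_le_sup Wup W1; have := ge_inf Wlo W2.
have gap i : Num.sqrt (2 * (e1 - m x0) / K) <= sg i * (Y i c x0 - eta x0).
  have [yr sy vy] := YP i c x0 cI; have := v_quad x0 (Y i c x0) (ltW yr).
  rewrite vy; have : c <= Num.max c (m x0) by rewrite le_max lexx.
  have s2 : (Y i c x0 - eta x0) ^+ 2 = (sg i * (Y i c x0 - eta x0)) ^+ 2.
    by rewrite exprMn (_ : sg i ^+ 2 = 1) ?mul1r //; case: (i); rewrite /sg ?sqrrN expr1n.
  rewrite s2 => h1 h2; rewrite -[leRHS]ger0_norm // -sqrtr_sqr; apply: ler_wsqrtr.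
  by rewrite ler_pdivrMr //; lra.
by have := gap true; have := gap false; rewrite /sg mul1r mulN1r; lra.
Qed.

End Annulus.

(** * An island in a valley of oscillating depth *)

Section Island.
Context {R : realType}.
Implicit Types (a b c d e h l m p q r s t x y C M N K : R).
Local Notation T := (torus R).
Local Notation cover := (@Defs.cover R).

Lemma maxr_lip c a b : `|Num.max c a - Num.max c b| <= `|a - b|.
Proof.
by rewrite ler_norml; case: (leP c a) => ?; case: (leP c b) => ?; case: (ger0P (a - b)) => ?; linear.
Qed.

(** Continuity along the vertical line through the point is enough when the increments in [x] are
    bounded uniformly in [y]. *)
Lemma cont2_of_lip (f : R -> R -> R) L x y d : 0 < d -> 0 <= L -> {for y, continuous (f x)} ->
  (forall x' y', `|y' - y| < d -> `|f x' y' - f x y'| <= L * `|x' - x|) -> cont2 f x y.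
Proof.
move=> d0 L0 /cvgrPdist_lt cf lip; apply/cont2P => e e0.
have /near_dist[d1 d10 dP] := cf (e / 2) (ltac:(by rewrite divr_gt0)).
have L1 : 0 < L + 1 by linear.
exists (Num.min (Num.min d d1) (e / 2 / (L + 1))).
  by rewrite !lt_min d0 d10 !divr_gt0.
move=> s t; rewrite !lt_min => /andP[_ s3] /andP[/andP[t1 t2] _].
have h1 := lip s t t1; have h2 := dP t t2; rewrite distrC in h2.
have h3 : (L + 1) * `|s - x| < e / 2 by rewrite mulrC -ltr_pdivlMr.
have := ler_normD (f s t - f x t) (f x t - f x y); rewrite subrKA.
have : 0 <= `|s - x| by []. linear.
Qed.

(* [v] is a valley along the line [y = y0]; its depth oscillates by [d], so the
   sublevel sets above a pass of height at most [d] close up. *)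
Lemma valley_island (G H : T -> R) (psi : T * R -> R) sig
    (v vx vy vyy : R -> R -> R) y0 r k K L x1 x2 d :
  sig != 0 -> 0 < r -> 0 < k -> k <= K -> 0 <= L -> 0 < d ->
  (forall x y, v (x + 2 * pi) y = v x y) ->
  (forall x y, `|y - y0| <= r ->
    channel G H (cover (x, y)) /\ psi (cover (x, y)) = sig * v x y) ->
  (forall x y, `|y - y0| <= r ->
    [/\ is_derive x (1 : R) (v^~ y) (vx x y), `|vx x y| <= L & cont2 vx x y]) ->
  (forall x y, `|y - y0| <= r -> [/\ is_derive y (1 : R) (v x) (vy x y),
    is_derive y (1 : R) (vy x) (vyy x y) & k <= vyy x y <= K]) ->
  (forall x x', v x' y0 < v x (y0 - r) /\ v x' y0 < v x (y0 + r)) ->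
  (forall y, `|y - y0| <= r -> v x1 y0 + d <= v x2 y) ->
  exists2 U, island G H psi U & Num.sqrt (d / K) <= height U.
Proof.
move=> sig0 r0 k0 kK L0 d0 v_per strip v_x v_y v_edge osc.
have K0 : 0 < K by exact: lt_le_trans kK.
have pi2 : 0 < 2 * pi :> R by rewrite mulr_gt0 ?pi_gt0.
have [eta etaP] := valley_bottom v vy vyy y0 r k K r0 k0 kK v_y v_edge.
pose m := depth v eta.
have mc : continuous m := depth_cont v vx y0 r k K L k0 L0 v_x eta etaP.
have m_per x : m (x + 2 * pi) = m x := depth_per v y0 r k K k0 v_per eta etaP x.
have er x : `|eta x - y0| <= r := eta_strip v y0 r k K eta etaP x.
have y0r : `|y0 - y0| <= r by rewrite subrr normr0 ltW.
have mle x q : `|q - y0| <= r -> m x <= v x q := depth_le v y0 r k K k0 eta etaP x q.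
have m12 : m x1 + d <= m x2.
  by have := mle x1 y0 y0r; have := osc (eta x2) (er x2); rewrite /m /depth; linear.
(* The lowest point of the floor within the period that starts at the high point [x2]. It is
   interior to that period, and both ends of the period lie at least [d] higher. *)
have [|x0 x0I minm] := @EVT_min _ m x2 (x2 + 2 * pi) _ (continuous_subspaceT mc).
  by rewrite lerDl ltW.
move: x0I; rewrite in_itv /= => /andP[x20 x02].
have m0 : m x0 <= m x1.
  have [n nI] := window_shift x2 x1; rewrite -(per_int m m_per n x1).
  by apply: minm; rewrite in_itv /=; linear.
have n20 : x2 != x0 by apply/eqP => E; move: m12 m0; rewrite E; linear.
have n02 : x0 != x2 + 2 * pi by apply/eqP => E; move: m12 m0; rewrite E m_per; linear.
have {n20}x20 : x2 < x0 by rewrite lt_neqAle n20.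
have {n02}x02 : x0 < x2 + 2 * pi by rewrite lt_neqAle n02.
have [a0 [l1 [l2 [/andP[xa0 a0x] dl1 l12 l2d left]]]] : exists a0 l1 l2,
    [/\ x2 <= a0 < x0, m x0 + d / 2 <= l1, l1 < l2, l2 <= m x0 + d &
    forall c, l1 < c < l2 -> exists2 a, a0 < a < x0 & [/\ m a = c,
      forall x, a0 <= x < a -> c < m x & forall x, a < x <= x0 -> m x < c]].
  by apply: (left_side v vx y0 r k K L k0 L0 v_x eta etaP) => //; rewrite -/m; linear.
have [b0 [e1 [e2 [/andP[xb0 b0x] le1 e12 e2l right]]]] : exists b0 e1 e2,
    [/\ x0 < b0 <= x2 + 2 * pi, l1 <= e1, e1 < e2, e2 <= l2 &
    forall c, e1 < c < e2 -> exists2 b, x0 < b < b0 & [/\ m b = c,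
      forall x, b < x <= b0 -> c < m x & forall x, x0 <= x < b -> m x < c]].
  pose vr x y := v (0 + (-1) * x) y; pose vxr x y := (-1) * vx (0 + (-1) * x) y.
  have v_xr x y : `|y - y0| <= r ->
      [/\ is_derive x (1 : R) (vr^~ y) (vxr x y), `|vxr x y| <= L & cont2 vxr x y].
    move=> yr; have [h1 h2 h3] := v_x (0 + (-1) * x) y yr.
    split; first exact: is_derive_affine.
      by rewrite /vxr mulN1r normrN.
    exact: cont2_scale (cont2_affine 0 (-1) h3).
  have mE x : depth vr (fun x => eta (0 + (-1) * x)) x = m (- x) by rewrite /depth /vr add0r mulN1r.
  have [|||b [l [l' [/andP[h1 h2] h3 h4 h5 h6]]]] := left_side vr vxr y0 r k K L k0 L0 v_xr
    (fun x => eta (0 + (-1) * x)) (fun x => etaP _) (- (x2 + 2 * pi)) (- x0) l1 l2 _ l12.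
  - by linear.
  - by rewrite mE opprK m_per; linear.
  - by rewrite mE opprK; linear.
  exists (- b), l, l'; split => //; first by linear.
  move=> c /h6[a aI [mac g1 g2]]; exists (- a); first linear.
  split => [|x xI|x xI]; first by rewrite -mE.
    by rewrite -[x]opprK -mE; apply: g1; linear.
  by rewrite -[x]opprK -mE; apply: g2; linear.
have lA c : exists a, e1 < c < e2 -> a0 < a < x0 /\ [/\ m a = c,
    forall x, a0 <= x < a -> c < m x & forall x, a < x <= x0 -> m x < c].
  have [cI|//] := pselect (e1 < c < e2); last by exists 0.
  by have [|a h1 h2] := left c; [linear|exists a].
have rB c : exists b, e1 < c < e2 -> x0 < b < b0 /\ [/\ m b = c,
    forall x, b < x <= b0 -> c < m x & forall x, x0 <= x < b -> m x < c].
  have [cI|//] := pselect (e1 < c < e2); last by exists 0.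
  by have [b h1 h2] := right c cI; exists b.
have [A AP] := choice lA; have [B BP] := choice rB.
have mx2 : m x2 <= v x2 y0 := mle x2 y0 y0r.
have edge c x : c < e2 -> c < v x (y0 - r) /\ c < v x (y0 + r).
  by move=> ce; have [h1 h2] := v_edge x x2; split; linear.
have [Y YP] : exists Y : bool -> R -> R -> R, forall i c x, e1 < c < e2 ->
    [/\ `|Y i c x - y0| < r, 0 <= (if i then 1 else -1) * (Y i c x - eta x) &
       v x (Y i c x) = Num.max c (m x)].
  have HY : forall z : bool * R * R, exists y, e1 < z.1.2 < e2 -> [/\ `|y - y0| < r,
      0 <= (if z.1.1 then 1 else -1) * (y - eta z.2) & v z.2 y = Num.max z.1.2 (m z.2)].
    move=> [[i c] x] /=; have [cI|//] := pselect (e1 < c < e2); last by exists 0.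
    have [||y hy] := branch_exists v vy vyy y0 r k K r0 k0 v_y v_edge eta etaP (if i then 1 else -1) c x.
    - by case: i; rewrite ?normrN1 ?normr1.
    - by move=> t; apply: edge; have /andP[] := cI.
    - by exists y.
  have [f fP] := choice HY; exists (fun i c x => f (i, c, x)) => i c x cI.
  exact: fP (i, c, x) cI.
have v_inc (i : bool) x q q' : `|q - y0| <= r -> `|q' - y0| <= r ->
    0 <= (if i then 1 else -1) * (q - eta x) -> 0 < (if i then 1 else -1) * (q' - q) -> v x q < v x q'.
  move=> qr q'r sq sq'; have [_ _ inc] := etaP x.
  have s1 : `|if i then 1 else -1| = 1 :> R by case: (i); rewrite ?normrN1 ?normr1.
  have := inc _ q q' s1 qr q'r sq (ltW sq').
  suff : 0 < k / 2 * (q' - q) ^+ 2 by linear.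
  rewrite mulr_gt0 ?divr_gt0 // exprn_even_gt0 //=.
  by apply: contraTneq sq' => ->; rewrite mulr0 ltxx.
have vcont x y : `|y - y0| <= r -> {for y, continuous (v x)}.
  by move=> yr; have [dv _ _] := v_y x y yr; exact: is_derive_cont dv.
have v_lipx x x' y : `|y - y0| <= r -> `|v x' y - v x y| <= L * `|x' - x| := v_lip v vx y0 r L v_x x x' y.
have [|x|x q qr||x y yr|c cI|i c cI|isl hgt] := @annulus_island _ G H psi sig v eta m y0 r K a0 x0 b0 e1 e2 A B Y
  sig0 K0 strip _ _ (fun=> erefl) _ v_inc e12 _ _ _ YP _.
- move=> x y yr; apply: (cont2_of_lip v L x y (r - `|y - y0|)) => //; first by rewrite subr_gt0.
    by apply: vcont; exact: ltW.
  move=> x' y' h; apply: v_lipx.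
  by have := ler_normD (y' - y) (y - y0); rewrite subrKA; linear.
- by have [] := etaP x.
- by have [_ + _] := etaP x; apply.
- by linear.
- have [h1 h2] := v_edge x x2; have : y = y0 - r \/ y = y0 + r.
    by move: yr; case: (ger0P (y - y0)) => _ yr; [right|left]; linear.
  by case=> ->; linear.
- have [h1 [h2 h3 h4]] := AP c cI; have [g1 [g2 g3 g4]] := BP c cI; split => //.
    move=> x xI; have [xx0|x0x] := leP x x0; first by apply: h4; linear.
    by apply: g4; linear.
  by move=> x /orP[xI|xI]; [apply: h3|apply: g3].
- apply: (gap_cont k L k0 L0) => x x'.
  have [y1 s1 E1] := YP i c x cI; have [y2 s2 E2] := YP i c x' cI.
  have ns : `|if i then 1 else -1| = 1 :> R by case: (i); rewrite ?normrN1 ?normr1.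
  have := branch_gap v vx y0 r k K L v_x eta etaP _ x x' _ _ ns (ltW y1) (ltW y2) s1 s2.
  rewrite E1 E2; have mx : `|Num.max c (m x') - Num.max c (m x)| <= `|m x' - m x|.
    exact: maxr_lip.
  have := depth_lip v vx y0 r k K L k0 v_x eta etaP x x'; rewrite -/m; linear.
exists (cover @` annulus v y0 r a0 b0 e1 e2) => //.
apply: le_trans hgt; have sq0 : 0 <= Num.sqrt (2 * (e1 - m x0) / K) by exact: sqrtr_ge0.
have : Num.sqrt (d / K) <= Num.sqrt (2 * (e1 - m x0) / K).
  by apply: ler_wsqrtr; rewrite ler_pM2r ?invr_gt0 //; linear.
linear.
Qed.

End Island.

(** * Comparison *)

Section Comparison.
Context {R : realType} {f f1 : R -> R} {b k Kf Lf Y v0 : R}.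
Hypothesis st : stable f f1 b k Kf Lf Y v0.
Implicit Types (u w : R -> R -> R) (x y t e l q : R).

Lemma closed_in_closed (G H : R -> R) : continuous G -> continuous H -> closed (closed_in G H).
Proof.
move=> cG cH; have cfst (h : R -> R) : continuous h -> continuous (fun z : R * R => h z.1).
  by move=> ch z; apply: (@continuous_comp _ _ _ fst h); [exact: cvg_fst|exact: ch].
have cdiff (f0 g0 : R * R -> R) : continuous f0 -> continuous g0 -> closed [set z | f0 z <= g0 z].
  move=> cf cg; rewrite (_ : [set z | _] = (fun z => g0 z - f0 z) @^-1` [set s | 0 <= s]).
    by apply: closed_comp; [move=> z _; apply: cvgB; [exact: cg|exact: cf]|exact: closed_ge].
  by apply/seteqP; split => z /=; rewrite subr_ge0.
have -> : closed_in G H = [set z | G z.1 <= z.2] `&` [set z | z.2 <= H z.1].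
  by apply/seteqP; split => z /andP.
by apply: closedI; apply: cdiff; (try exact: cfst) => z; exact: cvg_snd.
Qed.

Lemma channel_cell (G H : R -> R) : continuous G -> continuous H ->
  (forall x, - Y <= G x /\ H x <= Y) ->
  compact (closed_in G H `&` [set z | 0 <= z.1 <= 2 * pi /\ - Y <= z.2 <= Y]).
Proof.
move=> cG cH GHY; apply: (@subclosed_compact _ _ [set z : R * R | 0 <= z.1 <= 2 * pi /\ - Y <= z.2 <= Y]).
- by apply: closedI; [exact: closed_in_closed|apply: compact_closed => //; exact: compact_box].
- exact: compact_box.
- by move=> z [].
Qed.

(** Periodicity reduces [weighted_bound] to one compact cell of the channel; [e] measures the defect
    in the equation and [e'] the boundary values. *)
Lemma channel_le (G H : R -> R) w e e' t :
  0 < t -> e < k * v0 * t -> e' <= v0 * t -> continuous G -> continuous H ->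
  (forall x, G (x + 2 * pi) = G x) -> (forall x, H (x + 2 * pi) = H x) ->
  (forall x, - Y <= G x /\ H x <= Y) -> (forall x y, w (x + 2 * pi) y = w x y) ->
  {within closed_in G H, continuous (uc w)} ->
  (forall x y, G x < y < H x -> exists l q, [/\ lap w x y l, k - b ^+ 2 <= q & q * w x y - e <= l]) ->
  (forall x, w x (G x) <= e' /\ w x (H x) <= e') ->
  forall x y, G x <= y <= H x -> w x y <= t.
Proof.
move=> t0 et e't cG cH Gp Hp GHY wp cw wl wb x y xy.
have zY z : closed_in G H z -> - Y <= z.2 <= Y.
  by case: z => p q; rewrite /closed_in /= => /andP[h1 h2]; have [h3 h4] := GHY p; linear.
apply: (@weighted_bound R b k Y v0 (closed_in G H) (closed_in G H `&`
  [set z | 0 <= z.1 <= 2 * pi /\ - Y <= z.2 <= Y]) w e e' t (st_v0 _ _ _ _ _ _ _ _ st)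
  (st_cos _ _ _ _ _ _ _ _ st) (st_k _ _ _ _ _ _ _ _ st) t0 et e't _ _ _ _ _ _ (x, y)) => //.
- exact: channel_cell.
- by apply: continuous_subspaceW cw => z [].
- by move=> z /zY; rewrite ler_norml.
- move=> [p q] pq; have [n nI] := window_shift 0 p.
  have E : (G (p + 2 * pi * n%:~R) = G p) * (H (p + 2 * pi * n%:~R) = H p).
    by rewrite (per_int G Gp) (per_int H Hp).
  exists (p + 2 * pi * n%:~R, q); last first.
    by split => //; rewrite /uc /= (per_int (w^~ q)).
  split; first by rewrite /closed_in /= !E.
  by split => /=; [linear|exact: zY pq].
- move=> [p q]; rewrite /closed_in /= => /andP[pq1 pq2]; have [wG wH] := wb p; rewrite /uc /=.
  have [->|nG] := eqVneq q (G p); first by left.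
  have [->|nH] := eqVneq q (H p); first by left.
  right; have ins : G p < q < H p by rewrite !lt_neqAle eq_sym nG nH pq1 pq2.
  split; last exact: wl.
  have : nbhs (p, q) (inside_set G H) by apply: open_nbhs_nbhs; split; [exact: inside_open|].
  by apply: filterS => z /andP[h1 h2]; apply/andP; split; exact: ltW.
Qed.

Lemma within_lin c (A : set (R * R)) u w : {within A, continuous (uc u)} ->
  {within A, continuous (uc w)} -> {within A, continuous (uc (fun x y => u x y + c * w x y))}.
Proof.
move=> /subspace_continuousP cu /subspace_continuousP cw; apply/subspace_continuousP => z Az.
by apply: cvgD; [exact: cu|apply: cvgMr; exact: cw].
Qed.

Lemma within_scale c (A : set (R * R)) w : {within A, continuous (uc w)} ->
  {within A, continuous (uc (fun x y => c * w x y))}.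
Proof.
by move=> /subspace_continuousP cw; apply/subspace_continuousP => z Az; apply: cvgMr; exact: cw.
Qed.

Lemma within_cont2 (A : set (R * R)) w : (forall x y, A (x, y) -> cont2 w x y) ->
  {within A, continuous (uc w)}.
Proof.
move=> cw; apply/subspace_continuousP => -[x y] Az.
exact: cvg_within_filter (cw x y Az).
Qed.

Lemma channel_abs (G H : R -> R) w e e' t :
  0 < t -> e < k * v0 * t -> e' <= v0 * t -> continuous G -> continuous H ->
  (forall x, G (x + 2 * pi) = G x) -> (forall x, H (x + 2 * pi) = H x) ->
  (forall x, - Y <= G x /\ H x <= Y) -> (forall x y, w (x + 2 * pi) y = w x y) ->
  {within closed_in G H, continuous (uc w)} ->
  (forall x y, G x < y < H x -> exists l q, [/\ lap w x y l, k - b ^+ 2 <= q & `|l - q * w x y| <= e]) ->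
  (forall x, `|w x (G x)| <= e' /\ `|w x (H x)| <= e') ->
  forall x y, G x <= y <= H x -> `|w x y| <= t.
Proof.
move=> t0 et e't cG cH Gp Hp GHY wp cw wl wb x y xy.
rewrite ler_norml; apply/andP; split; last first.
  apply: (channel_le G H w e e' t) => //.
    by move=> p q /wl[l [s [h1 h2 h3]]]; exists l, s; split => //; move: h3; rewrite ler_norml; linear.
  by move=> p; have [h1 h2] := wb p; split; exact: le_trans (ler_norm _) _.
suff : -1 * w x y <= t by linear.
apply: (channel_le G H (fun x y => -1 * w x y) e e' t) => //.
- by move=> p q; rewrite wp.
- exact: within_scale.
- move=> p q /wl[l [s [h1 h2 h3]]]; exists (-1 * l), s; split => //; first exact: lap_scale.
  by move: h3; rewrite ler_norml; linear.
- by move=> p; have [] := wb p; rewrite !ler_norml; linear.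
Qed.

(** It turns the difference of two solutions into a solution of a linear equation with a coefficient
    known only pointwise, which is all that the comparison lemmas ask for. *)
Lemma mean_slope s t : exists q, [/\ k - b ^+ 2 <= q, `|q| <= Kf & f s - f t = q * (s - t)].
Proof.
have [c _ E] := @mvt _ f f1 t s (fun r _ => st_der _ _ _ _ _ _ _ _ st r).
by exists (f1 c); split => //; [exact: (st_ge _ _ _ _ _ _ _ _ st)|exact: (st_le _ _ _ _ _ _ _ _ st)].
Qed.

Lemma lsol_lap (F : R -> R) cG cH (G H : R -> R) u x y : continuous G -> continuous H ->
  lsol F cG cH G H u -> G x < y < H x -> lap u x y (F (u x y)).
Proof.
move=> kG kH [_ _ [D1 [D2 [C2 E]]] _ _] xy; rewrite -E //.
exact: (C2in_lap _ u D1 D2 x y (inside_open _ _ kG kH) C2 xy).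
Qed.

Lemma lsol_unique cG cH (G H : R -> R) u u' : continuous G -> continuous H ->
  (forall x, G (x + 2 * pi) = G x) -> (forall x, H (x + 2 * pi) = H x) ->
  (forall x, - Y <= G x /\ H x <= Y) -> (forall x, G x <= H x) ->
  lsol f cG cH G H u -> lsol f cG cH G H u' ->
  forall x y, G x <= y <= H x -> u x y = u' x y.
Proof.
move=> kG kH Gp Hp GHY GH su su' x y xy; have [up cu _ uH uG] := su; have [u'p cu' _ u'H u'G] := su'.
apply/eqP; rewrite -subr_eq0 -normr_le0; apply/ler_addgt0Pl => t t0; rewrite addr0.
have -> : u x y - u' x y = u x y + -1 * u' x y by ring.
have kv : 0 < k * v0 by rewrite mulr_gt0 ?(st_k _ _ _ _ _ _ _ _ st) ?(st_v0 _ _ _ _ _ _ _ _ st).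
apply: (channel_abs G H (fun x y => u x y + -1 * u' x y) 0 0 t) => //.
- exact: mulr_gt0.
- by rewrite mulr_ge0 ?ltW ?(st_v0 _ _ _ _ _ _ _ _ st).
- by move=> p q; rewrite up u'p.
- exact: within_lin.
- move=> p q pq; have [r [r1 _ E]] := mean_slope (u p q) (u' p q).
  exists (f (u p q) + -1 * f (u' p q)), r; split => //.
    by apply: lap_lin; [exact: lsol_lap kG kH su pq|exact: lsol_lap kG kH su' pq].
  rewrite (_ : _ - _ = f (u p q) - f (u' p q) - r * (u p q - u' p q)); last by ring.
  by rewrite E subrr normr0.
- by move=> p; rewrite uG uH u'G u'H; split; rewrite mulN1r subrr normr0.
Qed.

Lemma lsol_eq (F1 F2 : R -> R) cG cH (G H : R -> R) u :
  (forall x y, G x < y < H x -> F1 (u x y) = F2 (u x y)) ->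
  lsol F1 cG cH G H u -> lsol F2 cG cH G H u.
Proof.
move=> E [up cu [D1 [D2 [C2 eqn]]] uH uG]; split => //.
by exists D1, D2; split => // x y ins; rewrite eqn // E.
Qed.

(** Continuity at the walls follows from the linear bounds [C * (H x - y)] and [C * (y - G x)] that
    the barriers provide. *)
Lemma channel_lsol (G H : R -> R) cG cH Y1 La : Y1 < Y -> 0 <= La ->
  (forall x, - Y1 <= G x /\ H x <= Y1) ->
  (forall x, 1 <= H x - G x <= 4) ->
  (forall s t, `|G s - G t| <= La * `|s - t| /\ `|H s - H t| <= La * `|s - t|) ->
  (forall x h, 0 <= h -> `|G (x + h) + G (x - h) - 2 * G x| <= h ^+ 2 / 16 /\
    `|H (x + h) + H (x - h) - 2 * H x| <= h ^+ 2 / 16) ->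
  (forall x, G (x + 2 * pi) = G x /\ H (x + 2 * pi) = H x) ->
  exists u, lsol f cG cH G H u.
Proof.
move=> YY La0 GHY GH1 GHL GHd GHp.
have [u [D1 [D2 [C [up ub ui]]]]] := channel_solution f f1 b k Kf Lf Y v0 G H cG cH Y1 La st YY La0 GHY GH1 GHL GHd GHp.
have GH x : G x < H x by have := GH1 x; linear.
have bdry x : u x (H x) = cH /\ u x (G x) = cG.
  have [] := ub x (H x); first by rewrite lexx andbT ltW.
  have [_ +] := ub x (G x) (ltac:(by rewrite lexx ltW)).
  by rewrite !subrr !mulr0 !normr_le0 !subr_eq0 => /eqP -> /eqP ->.
have kGH : continuous G /\ continuous H.
  have lip (g : R -> R) : (forall s t, `|g s - g t| <= La * `|s - t|) -> continuous g.
    move=> gL x; apply/cvgrPdist_lt => e e0; have L1 : 0 < La + 1 by linear.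
    apply/near_dist; exists (e / (La + 1)); first exact: divr_gt0.
    move=> t; rewrite ltr_pdivlMr // => td; have := gL x t; rewrite (distrC x).
    by have : 0 <= `|t - x| by []; linear.
  by split; apply: lip => s t; have [] := GHL s t.
have [kG kH] := kGH.
exists u; split => //; last first.
- by move=> x; have [] := bdry x.
- by move=> x; have [] := bdry x.
- by exists D1, D2; split => x y /ui[].
apply/subspace_continuousP => -[x y] xyc.
have key c (e : R -> R -> R) : u x y = c -> e x y = 0 -> cont2 e x y ->
    (forall s t, closed_in G H (s, t) -> `|u s t - c| <= C * e s t) ->
    uc u @ within (closed_in G H) (nbhs (x, y)) --> uc u (x, y).
  move=> uxy exy /cont2P ce H1; rewrite {2}/uc /= uxy; apply/cvgrPdist_lt => r r0.
  have C1 : 0 < `|C| + 1 by rewrite ltr_wpDl.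
  have [|d d0 dP] := ce (r / (`|C| + 1)); first exact: divr_gt0.
  apply/nbhs2P; exists d => // s t sx ty cl; rewrite distrC.
  apply: (le_lt_trans (H1 s t cl)); have := dP s t sx ty; rewrite exy subr0 ltr_pdivlMr // => h.
  apply: le_lt_trans h; rewrite mulrC; apply: le_trans (ler_norm _) _.
  by rewrite normrM ler_wpM2l // lerDl.
have [ins|nins] := boolP (G x < y < H x).
  by have [c _ _ _] := ui x y ins; exact: cvg_within_filter c.
have edge (h : R -> R) : continuous h -> cont2 (fun s t => h s + -1 * t) x y.
  by move=> ch; apply: cont2_lin; [exact: (cont2_fst y (ch x))|exact: (cont2_snd x (@cvg_id _ _))].
have [yH|yH] := eqVneq y (H x).
  apply: (key cH (fun s t => H s + -1 * t)).
  - by rewrite yH; have [] := bdry x.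
  - by rewrite yH mulN1r subrr.
  - exact: edge.
  - by move=> s t /ub[h _]; rewrite mulN1r.
have yG : y = G x.
  move: nins xyc; rewrite negb_and -!leNgt /closed_in /= => /orP[h|h] /andP[h1 h2].
    by apply/le_anti; rewrite h h1.
  by move: yH; rewrite (@le_anti _ _ y (H x)) ?eqxx // h2 h.
apply: (key cG (fun s t => -1 * (G s + -1 * t))).
- by rewrite yG; have [] := bdry x.
- by rewrite yG !mulN1r subrr oppr0.
- by apply: cont2_scale; exact: edge.
- by move=> s t /ub[_ h]; rewrite !mulN1r opprB.
Qed.

End Comparison.

(** * Truncation and the first eigenvalue *)

Section Truncation.
Context {R : realType}.
Implicit Types (a b c d e h l m p q r s t x y C M N K : R).

Lemma antiderivative_right (g : R -> R) a : continuous g ->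
  exists A : R -> R, forall x, a < x -> is_derive x (1 : R) A (g x).
Proof.
move=> cg; exists (fun y => (\int[lebesgue_measure]_(t in [set` `[a, y]]) g t)%R) => x ax.
have [|dA A'] := @continuous_FTC1_closed R g a x (x + 1) (ltr_pwDr ltr01 (lexx x)) _ ax (cg x).
  by apply: continuous_compact_integrable; [exact: segment_compact|exact: continuous_subspaceT].
by apply: (DeriveDef dA); rewrite -derive1E A'.
Qed.

(** Two one-sided antiderivatives, the second obtained from the reflected function, are joined at 0,
    where both are differentiable with the same derivative. *)
Lemma antiderivative (g : R -> R) : continuous g ->
  exists A : R -> R, forall x, is_derive x (1 : R) A (g x).
Proof.
move=> cg; have [A AP] := antiderivative_right g (-1) cg.
have cg' : continuous (fun t => g (0 + (-1) * t)).
  move=> t; apply: (@continuous_comp _ _ _ (fun t => 0 + (-1) * t) g); last exact: cg.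
  by apply: cvgD; [exact: cvg_cst|apply: cvgMr].
have [B BP] := antiderivative_right _ (-1) cg'.
pose L x := 0 + (-1) * B (0 + (-1) * x).
have LP x : x < 1 -> is_derive x (1 : R) L (g x).
  move=> x1; have := BP (0 + (-1) * x) (ltac:(linear)).
  rewrite (_ : 0 + (-1) * (0 + (-1) * x) = x); last by ring.
  move=> /(is_derive_affine 0 (-1)) /(is_derive_lin (-1) (is_derive_cst 0 x 1)).
  by rewrite add0r mulrA mulrNN mulr1 mul1r.
exists (fun x => if 0 <= x then A x - A 0 else L x - L 0) => x.
have shift (f : R -> R) c a' : is_derive x (1 : R) f a' -> is_derive x (1 : R) (fun t => f t - c) a'.
  by move=> fa; have := is_derive_lin (-1) fa (is_derive_cst c x 1); rewrite mulr0 addr0;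
     apply: is_derive_near; near=> t; rewrite mulN1r.
case: (ltgtP x 0) => x0.
- apply: (is_derive_near _ (shift L (L 0) _ (LP x _))); last linear.
  by near=> t; rewrite leNgt ifF //; apply/negbF; near: t; exact: lt_nbhsl.
- apply: (is_derive_near _ (shift A (A 0) _ (AP x _))); last linear.
  by near=> t; rewrite ifT //; apply: ltW; near: t; exact: lt_nbhsr.
- rewrite {}x0 in shift *; apply/is_deriveP => e e0.
  have /is_deriveP/(_ e e0)[d d0 dP] := AP 0 (ltac:(linear)).
  have /is_deriveP/(_ e e0)[d' d'0 d'P] := LP 0 (ltac:(linear)).
  exists (Num.min d d'); first by rewrite lt_min d0.
  move=> h; rewrite lt_min lexx subrr subr0 => /andP[h1 h2].
  by case: ifP => _; [have := dP h h1|have := d'P h h2]; rewrite add0r.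
Unshelve. all: by end_near. Qed.

Lemma eq_of_derive0 (f : R -> R) a c : a <= c ->
  (forall t, a <= t <= c -> is_derive t (1 : R) f 0) -> f c = f a.
Proof.
move=> ac H; have [t|t _ E] := @mvt _ f (fun=> 0) a c.
  by rewrite min_l // max_r //; apply: H.
by apply/eqP; rewrite -subr_eq0 E mul0r.
Qed.

Definition clamp M t := Num.max (- M) (Num.min t M).

Lemma clamp_id M t : - M <= t <= M -> clamp M t = t.
Proof. by rewrite /clamp => /andP[h1 h2]; rewrite min_l // max_r. Qed.

Lemma clamp_itv M t : 0 <= M -> - M <= clamp M t <= M.
Proof.
by move=> M0; rewrite /clamp le_max lexx /= ge_max ge_min lexx orbT andbT; linear.
Qed.

Lemma clamp_lip M s t : `|clamp M s - clamp M t| <= `|s - t|.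
Proof.
have maxl a c : `|Num.max (- M) a - Num.max (- M) c| <= `|a - c|.
  case: (leP (- M) a) => ?; case: (leP (- M) c) => ?; case: (ger0P (a - c)) => ?; rewrite ?ler_norml; linear.
apply: le_trans (maxl _ _) _.
case: (leP s M) => ?; case: (leP t M) => ?; case: (ger0P (s - t)) => ?; rewrite ?ler_norml; linear.
Qed.

Lemma clamp_cont M : continuous (clamp M).
Proof.
move=> x; apply/cvgrPdist_lt => e e0; apply/near_dist; exists e => // t td.
by apply: le_lt_trans (clamp_lip _ _ _) _; rewrite distrC.
Qed.

Lemma continuous_bounded_itv (g : R -> R) a c : a <= c -> continuous g ->
  exists2 C : R, 0 <= C & forall t, a <= t <= c -> `|g t| <= C.
Proof.
move=> ac cg; have [p _ pM] := @EVT_max _ g a c ac (continuous_subspaceT cg).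
have [q _ qm] := @EVT_min _ g a c ac (continuous_subspaceT cg).
exists (`|g p| + `|g q|) => [|t tI]; first by rewrite addr_ge0.
have tI' : t \in `[a, c] by rewrite in_itv.
have := pM t tI'; have := qm t tI'; have := ler_norm (g p); have := ler_norm (- g q).
have : 0 <= `|g p| by []; have : 0 <= `|g q| by [].
rewrite normrN ler_norml; linear.
Qed.

(** [F'] is frozen outside [[- M, M]] and integrated again. By compactness its minimum there keeps a
    gap to [- (pi / 2) ^+ 2]. With [- mu] a nonpositive lower bound, [b ^+ 2] is the midpoint of
    [mu] and [(pi / 2) ^+ 2] and [k] is half their distance, so that [k - b ^+ 2 = - mu]. *)
Lemma truncation (F F1 F2 : R -> R) M lam : 0 < M -> lam <= (pi / 2) ^+ 2 ->
  (forall t, is_derive t (1 : R) F (F1 t)) -> (forall t, is_derive t (1 : R) F1 (F2 t)) ->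
  continuous F2 -> (forall t, - lam < F1 t) ->
  exists f f1 b k Kf Lf Y v0, [/\ stable f f1 b k Kf Lf Y v0, 1 < Y &
    forall t, - M <= t <= M -> f t = F t].
Proof.
move=> M0 lampi dF dF1 cF2 Fl.
have MM : - M <= M by linear.
have cF1 : continuous F1 by move=> t; exact: is_derive_cont (dF1 t).
have [C C0 CP] := continuous_bounded_itv F1 _ _ MM cF1.
have [C2 C20 C2P] := continuous_bounded_itv F2 _ _ MM cF2.
have [p pI pm] := @EVT_min _ F1 (- M) M MM (continuous_subspaceT cF1).
pose f1 t := F1 (clamp M t).
have cf1 : continuous f1.
  by move=> t; apply: (@continuous_comp _ _ _ (clamp M) F1); [exact: clamp_cont|exact: cF1].
have [A AP] := antiderivative f1 cf1.
pose P2 : R := (pi / 2) ^+ 2; pose mu := Num.max (- F1 p) 0.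
have pi0 : 0 < pi / 2 :> R by rewrite divr_gt0 ?pi_gt0.
have P20 : 0 < P2 by rewrite exprn_gt0.
have mu0 : 0 <= mu by rewrite le_max lexx orbT.
have mup : - F1 p <= mu by rewrite le_max lexx.
have muP : mu < P2 by rewrite gt_max P20 andbT; have := Fl p; rewrite /P2; linear.
pose b := Num.sqrt ((mu + P2) / 2).
have b2 : b ^+ 2 = (mu + P2) / 2 by rewrite sqr_sqrtr // divr_ge0 //; linear.
have b0 : 0 < b by rewrite sqrtr_gt0; linear.
have bpi : b < pi / 2.
  by rewrite -(@ltr_pXn2r _ 2) ?nnegrE ?(ltW b0) ?(ltW pi0) // b2 -/P2; linear.
have q1 : 1 < (pi / 2) / b by rewrite ltr_pdivlMr // mul1r.
(* [cos (b * y)] is positive for [|y| < q], and [q > 1]. The choice of [Y] halfway between 1 and [q]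
   leaves room for the walls to move. *)
pose q := (pi / 2) / b; pose Y := (1 + q) / 2.
have bq : b * q = pi / 2 by rewrite /q mulrC divfK // gt_eqF.
have bY : 0 < b * Y < pi / 2.
  have : b * 1 < b * q by rewrite ltr_pM2l.
  by rewrite /Y (_ : b * ((1 + q) / 2) = (b + b * q) / 2); [rewrite bq; linear|rewrite mulrA mulrDr mulr1].
pose k := (P2 - mu) / 2.
exists (fun t => F 0 + - A 0 + A t), f1, b, k, (C + k), C2, Y, (cos (b * Y)).
have clampI t := clamp_itv M t (ltW M0).
split; last first.
- move=> t tI; pose D s := A s - F s.
  have dD s : - M <= s <= M -> is_derive s (1 : R) D 0.
    move=> sI; have := is_derive_lin (-1) (AP s) (dF s).
    rewrite /f1 (clamp_id _ _ sI) mulN1r subrr.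
    by apply: is_derive_near; near=> s'; rewrite mulN1r.
  suff : D t = D 0 by rewrite /D; linear.
  have [t0|/ltW t0] := leP 0 t; first by apply: eq_of_derive0 => // s sI; apply: dD; linear.
  by apply/esym/eq_of_derive0 => // s sI; apply: dD; linear.
- by rewrite /Y; move: q1; rewrite -/q; linear.
split.
- move=> t; have := is_derive_lin 1 (is_derive_cst (F 0 + - A 0) t 1) (AP t).
  by rewrite mul1r add0r; apply: is_derive_near; near=> s; rewrite mul1r.
- move=> t; have := pm (clamp M t); rewrite in_itv /= clampI => /(_ isT).
  by rewrite b2 /k /f1; linear.
- move=> t; have := CP _ (clampI t); rewrite /f1 /k; linear.
- move=> s t; apply: (@le_trans _ _ (C2 * `|clamp M s - clamp M t|)); last first.
    by rewrite ler_wpM2l // clamp_lip.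
  apply: (@lip_of_derive _ F1 F2 (clamp M t) (clamp M s) C2 (fun r _ => dF1 r)) => r rI.
  apply: C2P; move: rI; have := clampI s; have := clampI t.
  by case: (leP (clamp M t) (clamp M s)) => _; linear.
- exact: b0.
- by rewrite /k; linear.
- by rewrite lerDr.
- by rewrite b2 /k; linear.
- by apply: cos_gt0_pihalf; linear.
- move=> y yY; have -> : cos (b * y) = cos (b * `|y|).
    by case: (ger0P y) => _ //; rewrite mulrN cosN.
  have : b * `|y| <= b * Y by rewrite ler_pM2l.
  have : 0 <= b * `|y| by rewrite mulr_ge0 // ltW.
  rewrite le_eqVlt => h1; rewrite le_eqVlt => /orP[/eqP -> //|h2].
  have pp : pi / 2 <= pi :> R by have := pi_gt0 R; linear.
  by rewrite ltW // ltr_cos // in_itv /=; move: h1; rewrite -le_eqVlt; linear.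
Unshelve. all: by end_near. Qed.

End Truncation.

(** * An explicit eigenvalue of the flat channel *)

Section Eigenvalue.
Context {R : realType}.
Implicit Types (x y : R).

(** The eigenfunction is [cos (pi / 2 * y)]; this bounds the first eigenvalue from above. *)
Lemma strip_eigenvalue : @dirichlet_eigenvalue R (cst (-1)) (cst 1) ((pi / 2) ^+ 2).
Proof.
pose c : R := pi / 2; pose u (x y : R) := cos (c * y).
have up x y : u (x + 2 * pi) y = u x y by [].
have cE (y : R) : c * y = 0 + c * y by rewrite add0r.
have du y : is_derive y (1 : R) (fun y => cos (c * y)) (c * - sin (c * y)).
  have := is_derive_cos (0 + c * y) => /(is_derive_affine 0 c); rewrite -cE.
  by apply: is_derive_near; near=> t; rewrite add0r.
have dsin y : is_derive y (1 : R) (fun y => c * - sin (c * y)) (- c ^+ 2 * cos (c * y)).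
  have := is_derive_sin (0 + c * y) => /(is_derive_affine 0 c).
  move=> /(is_derive_lin (- c) (is_derive_cst 0 y 1)).
  rewrite (_ : 0 + - c * (c * cos (0 + c * y)) = - c ^+ 2 * cos (c * y)); last by rewrite !add0r mulNr mulrA -expr2 -mulNr.
  by apply: is_derive_near; near=> t; rewrite !add0r mulNr mulrN.
have cs (f f' : R -> R) x y : (forall t, is_derive t (1 : R) f (f' t)) -> cont2 (fun _ t => f t) x y.
  by move=> df; apply: cont2_snd; exact: is_derive_cont (df y).
have cc (a x y : R) : cont2 (fun _ _ => a) x y by exact: cvg_cst.
have z0 (x : R) : is_derive x (1 : R) (fun=> 0 : R) 0 by exact: is_derive_cst.
exists (descend u); split.
  apply: lift_solution; [by move=> ?; exact: cvg_cst|by move=> ?; exact: cvg_cst|].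
  split => //.
  - by apply: continuous_subspaceT => -[x y]; exact: cs du.
  - exists (fun e _ y => if e then 0 else c * - sin (c * y)),
      (fun e e' _ y => if e || e' then 0 else - c ^+ 2 * cos (c * y)); split; last first.
      by move=> x y _; rewrite /= add0r.
    move=> x y _; split; first exact: cs du.
      by case; split; rewrite /dir_der //=; [exact: is_derive_cst|exact: cs dsin].
    case; case; split; rewrite /dir_der /= //; try exact: is_derive_cst.
    apply: cont2_scale; exact: cs du.
  - by move=> x; rewrite /u /lift1 /= mulr1 cos_pihalf.
  - by move=> x; rewrite /u /lift1 /= mulrN1 cosN cos_pihalf.
exists (to_torus 0, 0); first by rewrite /channel /=; linear.
by rewrite descendE // /u mulr0 cos0 oner_eq0.
Unshelve. all: by end_near. Qed.

End Eigenvalue.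

(** * The unperturbed flow *)

Section FlatState.
Context {R : realType} {f f1 : R -> R} {b k Kf Lf Y v0 : R}.
Hypotheses (st : stable f f1 b k Kf Lf Y v0) (Y_gt1 : 1 < Y).
Ltac linear ::= try clear Y_gt1; linear_core.
Implicit Types (u w : R -> R -> R) (x y t e l q c : R).

Lemma near_between (a c y : R) : a < y < c -> \forall t \near y, a < t < c.
Proof.
move=> yI; apply/near_dist; exists (Num.min (y - a) (c - y)); first by rewrite lt_min; linear.
by move=> t; rewrite lt_min !ltr_norml; linear.
Qed.

Lemma st_kv_gt0 : 0 < k * v0.
Proof. by rewrite mulr_gt0 ?(st_k _ _ _ _ _ _ _ _ st) ?(st_v0 _ _ _ _ _ _ _ _ st). Qed.

Lemma channel_zero (G H : R -> R) w : continuous G -> continuous H ->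
  (forall x, G (x + 2 * pi) = G x) -> (forall x, H (x + 2 * pi) = H x) ->
  (forall x, - Y <= G x /\ H x <= Y) -> (forall x y, w (x + 2 * pi) y = w x y) ->
  {within closed_in G H, continuous (uc w)} ->
  (forall x y, G x < y < H x -> exists2 q, k - b ^+ 2 <= q & lap w x y (q * w x y)) ->
  (forall x, w x (G x) = 0 /\ w x (H x) = 0) ->
  forall x y, G x <= y <= H x -> w x y = 0.
Proof.
move=> kG kH Gp Hp GHY wp cw wl wb x y xy.
apply/eqP; rewrite -normr_le0; apply/ler_addgt0Pl => t t0; rewrite addr0.
apply: (channel_abs st G H w 0 0 t) => //.
- by rewrite mulr_gt0 // st_kv_gt0.
- by rewrite mulr_ge0 ?ltW ?(st_v0 _ _ _ _ _ _ _ _ st).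
- by move=> p q /wl[s h1 h2]; exists (s * w p q), s; split => //; rewrite subrr normr0.
- by move=> p; have [-> ->] := wb p; rewrite normr0.
Qed.

Lemma within_shift c w : {within closed_in (fun=> -1) (fun=> 1), continuous (uc w)} ->
  {within closed_in (fun=> -1) (fun=> 1), continuous (uc (fun x y => w (c + 1 * x) y))}.
Proof.
move=> /subspace_continuousP cw; apply/subspace_continuousP => -[x y] xyc V nV.
have /nbhs2P[d d0 dP] := cw (c + 1 * x, y) xyc V nV.
apply/nbhs2P; exists d => // s t sx ty stc; apply: (dP (c + 1 * s) t) => //.
by rewrite (_ : _ - _ = s - x) //; ring.
Qed.

(** A translate of [u] in [x] solves the same problem, and the difference solves a linear equation
    with zero boundary values. *)
Lemma flat_invariant (cG cH : R) u : lsol f cG cH (fun=> -1) (fun=> 1) u ->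
  forall x y, -1 <= y <= 1 -> u x y = u 0 y.
Proof.
move=> su x y yI; have [up cu _ uH uG] := su.
have c1 (a : R) : continuous (fun _ : R => a) by move=> z; exact: cvg_cst.
suff : u (x + 1 * 0) y + -1 * u 0 y = 0.
  by rewrite mulr0 addr0 mulN1r => /eqP; rewrite subr_eq0 => /eqP.
apply: (channel_zero (fun=> -1) (fun=> 1) (fun s y => u (x + 1 * s) y + -1 * u s y)) => //.
- by move=> s; move: Y_gt1; linear.
- move=> s t; rewrite up -[in RHS](up (x + 1 * s)); congr (u _ _ + _); ring.
- by apply: within_lin => //; exact: within_shift.
- move=> s t tI; have [q [q1 _ E]] := mean_slope st (u (x + 1 * s) t) (u s t).
  exists q => //; rewrite (_ : q * _ = f (u (x + 1 * s) t) + -1 * f (u s t)).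
    apply: lap_lin; last exact: lsol_lap su tI.
    apply: lap_affine; first by rewrite expr1n.
    exact: (lsol_lap _ _ _ _ _ _ (x + 1 * s) t _ _ su tI).
  by rewrite !mulN1r E; ring.
- by move=> s; rewrite !uG !uH; split; ring.
Qed.

(** [P] is obtained on the whole line by integrating [f (u 0 (clamp 1 y))] twice, with the data of
    [u] at [y = 0]. Freezing the right-hand side beyond the walls extends the profile with a
    continuous second derivative to where a perturbed channel sticks out of the flat one. *)
Lemma flat_profile (cG cH : R) u : lsol f cG cH (fun=> -1) (fun=> 1) u ->
  exists P P1, [/\ forall y, is_derive y (1 : R) P (P1 y),
    forall y, is_derive y (1 : R) P1 (f (P (clamp 1 y))) &
    forall x y, -1 <= y <= 1 -> u x y = P y].
Proof.
move=> su; have inv := flat_invariant cG cH u su; have [up cu [D1 [D2 [C2 eqn]]] uH uG] := su.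
pose p y := u 0 y; pose q y := f (p (clamp 1 y)).
have ins x y : -1 < y < 1 -> inside_set (fun=> -1) (fun=> 1) (x, y) by [].
have near_in y : -1 < y < 1 -> \forall t \near y, -1 < t < 1 by exact: near_between.
have Dx0 x y : -1 < y < 1 -> D1 true x y = 0.
  move=> yI; have [_ /(_ true)[d _] _] := C2 x y (ins x y yI).
  apply: (is_derive_uniq d); apply: (is_derive_near _ (is_derive_cst (u x y) x 1)).
  by near=> t; rewrite /= !inv //; move: yI; linear.
have Dxx0 y : -1 < y < 1 -> D2 true true 0 y = 0.
  move=> yI; have [_ _ /(_ true true)[d _]] := C2 0 y (ins 0 y yI).
  apply: (is_derive_uniq d); apply: (is_derive_near _ (is_derive_cst 0 (0 : R) 1)).
  by near=> t; rewrite Dx0.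
have dp y : -1 < y < 1 -> is_derive y (1 : R) p (D1 false 0 y).
  by move=> yI; have [_ /(_ false)[d _] _] := C2 0 y (ins 0 y yI).
have dp1 y : -1 < y < 1 -> is_derive y (1 : R) (D1 false 0) (f (p y)).
  move=> yI; have [_ _ /(_ false false)[d _]] := C2 0 y (ins 0 y yI).
  by have := eqn 0 y (ins 0 y yI); rewrite Dxx0 // add0r => <-.
have cp y e : -1 <= y <= 1 -> 0 < e ->
    exists2 d : R, 0 < d & forall t, -1 <= t <= 1 -> `|t - y| < d -> `|p t - p y| < e.
  move=> yI e0; have /subspace_continuousP/(_ (0, y) yI)/cvgrPdist_lt/(_ e e0)/nbhs2P[d d0 dP] := cu.
  exists d => // t tI td; rewrite distrC; apply: (dP 0 t) => //.
  by rewrite subrr normr0.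
have cI t := clamp_itv 1 t ler01.
have cq : continuous q.
  move=> y; apply: (@continuous_comp _ _ _ (fun y => p (clamp 1 y)) f); last first.
    exact: is_derive_cont (st_der _ _ _ _ _ _ _ _ st _).
  apply/cvgrPdist_lt => e e0; have [d d0 dP] := cp (clamp 1 y) e (cI y) e0.
  apply/near_dist; exists d => // t td; rewrite distrC; apply: dP => //.
  exact: le_lt_trans (clamp_lip _ _ _) td.
have [Q QP] := antiderivative q cq.
pose P1 y := Q y + (D1 false 0 0 - Q 0).
have dP1 y : is_derive y (1 : R) P1 (q y).
  have := is_derive_lin 1 (QP y) (is_derive_cst (D1 false 0 0 - Q 0) y 1); rewrite mulr0 addr0.
  by apply: is_derive_near; near=> t; rewrite mul1r.
have [A AP] : exists A : R -> R, forall x, is_derive x (1 : R) A (P1 x).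
  by apply: antiderivative => y; exact: is_derive_cont (dP1 y).
pose P y := A y + (p 0 - A 0).
have dP y : is_derive y (1 : R) P (P1 y).
  have := is_derive_lin 1 (AP y) (is_derive_cst (p 0 - A 0) y 1); rewrite mulr0 addr0.
  by apply: is_derive_near; near=> t; rewrite mul1r.
have same (g h g' : R -> R) : (forall t, is_derive t (1 : R) g (g' t)) ->
    (forall t, -1 < t < 1 -> is_derive t (1 : R) h (g' t)) -> g 0 = h 0 ->
    forall y, -1 < y < 1 -> g y = h y.
  move=> dg dh gh0 y yI; pose D s := g s + -1 * h s.
  have dD (s : R) : -1 < s < 1 -> is_derive s (1 : R) D 0.
    by move=> sI; have := is_derive_lin (-1) (dg s) (dh s sI); rewrite mulN1r subrr.
  suff : D y = D 0 by rewrite /D; linear.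
  have [y0|/ltW y0] := leP 0 y; first by apply: eq_of_derive0 => // s sI; apply: dD; linear.
  by apply/esym/eq_of_derive0 => // s sI; apply: dD; linear.
have P1E y : -1 < y < 1 -> P1 y = D1 false 0 y.
  apply: (same _ _ q) => //; last by rewrite /P1; linear.
  by move=> t tI; rewrite /q clamp_id ?(ltac:(linear) : -1 <= t <= 1) //; exact: dp1.
have PE y : -1 < y < 1 -> P y = p y.
  apply: (same _ _ P1) => //; last by rewrite /P; linear.
  by move=> t tI; rewrite P1E //; exact: dp.
(* Equality extends to the end points by continuity of [u] within the closed channel; [t] is [y]
   pulled slightly towards 0. *)
have PE' y : -1 <= y <= 1 -> P y = p y.
  move=> yI; apply/eqP; rewrite -subr_eq0 -normr_le0; apply/ler_addgt0Pl => e e0; rewrite addr0.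
  have e2 : 0 < e / 2 by rewrite divr_gt0.
  have [d d0 d1P] := cp y (e / 2) yI e2.
  have /cvgrPdist_lt/(_ (e / 2) e2)/near_dist[d' d'0 d2P] := is_derive_cont (dP y).
  pose r := Num.min (Num.min d d' / 2) 1.
  have m0 : 0 < Num.min d d' by rewrite lt_min d0.
  have m1 : Num.min d d' <= d by rewrite ge_min lexx.
  have m2 : Num.min d d' <= d' by rewrite ge_min lexx orbT.
  have r0 : 0 < r by rewrite lt_min ltr01 divr_gt0.
  have r1 : r <= Num.min d d' / 2 by rewrite ge_min lexx.
  have r2 : r <= 1 by rewrite ge_min lexx orbT.
  pose t := (1 - r) * y + 0.
  have ty : `|t - y| = r * `|y|.
    by rewrite (_ : t - y = - (r * y)) ?normrN ?normrM ?(gtr0_norm r0) // /t; ring.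
  have y1 : `|y| <= 1 by rewrite ler_norml; linear.
  have ryr : r * `|y| <= r by rewrite ler_piMr // ltW.
  have tI : -1 < t < 1.
    rewrite -ltr_norml /t addr0 normrM ger0_norm; last linear.
    apply: (@le_lt_trans _ _ ((1 - r) * 1)); last by linear.
    by rewrite ler_wpM2l //; linear.
  have h1 : `|t - y| < d by rewrite ty; linear.
  have h2 : `|t - y| < d' by rewrite ty; linear.
  have h3 := d1P t (ltac:(linear)) h1; have h4 := d2P t h2.
  have := ler_normD (P y - P t) (P t - p y); rewrite subrKA (PE t tI).
  by rewrite (PE t tI) in h4; linear.
exists P, P1; split => //; last by move=> x y yI; rewrite inv // PE'.
by move=> y; have := dP1 y; rewrite /q -PE'.
Unshelve. all: by end_near. Qed.

(** [E t * exp (- c * t)] is nonnegative, starts at 0 and does not increase. *)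
Lemma gronwall_zero (E E1 : R -> R) c a d : a <= d -> (forall t, 0 <= E t) -> E a = 0 ->
  (forall t, a <= t <= d -> is_derive t (1 : R) E (E1 t)) ->
  (forall t, a <= t <= d -> E1 t <= c * E t) -> E d = 0.
Proof.
move=> ad E0 Ea dE E1c; pose F t := E t * expR (0 + (- c) * t).
have dF t : a <= t <= d -> is_derive t (1 : R) F
    (E t *: ((- c) * expR (0 + (- c) * t)) + expR (0 + (- c) * t) *: E1 t).
  move=> tI; have /(is_derive_affine 0 (- c)) := is_derive_expR (0 + (- c) * t).
  by move=> h; exact: (is_deriveM (dE t tI) h).
have [t|t] := @mvt _ F (fun t => E t *: ((- c) * expR (0 + (- c) * t)) + expR (0 + (- c) * t) *: E1 t) a d.
  by rewrite min_l // max_r //; exact: dF.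
rewrite min_l // max_r // => tI FE.
have FE' : F d - F a <= 0.
  rewrite FE mulr_le0_ge0 ?subr_ge0 // /GRing.scale /=.
  rewrite (_ : _ + _ = (E1 t - c * E t) * expR (0 + (- c) * t)); last by ring.
  by rewrite mulr_le0_ge0 ?expR_ge0 // subr_le0 E1c.
have ed := expR_gt0 (0 + (- c) * d).
move: FE'; rewrite /F Ea mul0r subr0 pmulr_lle0 // => Ed.
by apply/le_anti; rewrite Ed E0.
Qed.

Variables P P1 : R -> R.
Hypotheses (dP : forall y, is_derive y (1 : R) P (P1 y))
  (dP1 : forall y, is_derive y (1 : R) P1 (f (P (clamp 1 y)))).

(** Uniqueness for [P'' = f (P)] with the initial data of a constant solution, by Gronwall's
    inequality for the squared distance in the phase plane. The contrapositive yields
    [f (P y0) != 0] at the height of the stagnation point. *)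
Lemma flat_stationary y0 : -1 < y0 < 1 -> P1 y0 = 0 -> f (P y0) = 0 ->
  forall y, -1 <= y <= 1 -> P y = P y0.
Proof.
move=> y0I P10 f0; pose E y := (P y - P y0) ^+ 2 + P1 y ^+ 2.
pose E1 y := 2 * P1 y * ((P y - P y0) + f (P (clamp 1 y))).
have E_ge0 t : 0 <= E t by rewrite addr_ge0 ?sqr_ge0.
have E_0 : E y0 = 0 by rewrite /E P10 subrr expr0n addr0.
have sq (g g' : R -> R) t : is_derive t (1 : R) g (g' t) ->
    is_derive t (1 : R) (fun t => g t ^+ 2) (2 * g t * g' t).
  move=> dg; have := is_deriveM dg dg; rewrite /GRing.scale /= -mulr2n => h.
  by rewrite (_ : 2 * _ * _ = (g t * g' t) *+ 2) // -mulrA mulr_natl.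
have dE t : is_derive t (1 : R) E (E1 t).
  have d1 : is_derive t (1 : R) (fun t => P t - P y0) (P1 t).
    have := is_derive_lin (-1) (dP t) (is_derive_cst (P y0) t 1); rewrite mulr0 addr0.
    by apply: is_derive_near; near=> s; rewrite mulN1r.
  have := is_derive_lin 1 (sq (fun t => P t - P y0) P1 t d1) (sq P1 (fun t => f (P (clamp 1 t))) t (dP1 t)).
  rewrite (_ : _ + 1 * _ = E1 t); last by rewrite /E1; ring.
  by apply: is_derive_near; near=> s; rewrite mul1r.
have Kf0 : 0 <= Kf := le_trans (normr_ge0 _) (st_le _ _ _ _ _ _ _ _ st 0).
have bound t : -1 <= t <= 1 -> `|E1 t| <= (1 + Kf) * E t.
  move=> tI; have [q [_ q1 qE]] := mean_slope st (P t) (P y0).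
  rewrite f0 subr0 in qE; rewrite /E1 clamp_id // qE /E.
  rewrite (_ : 2 * _ * _ = (1 + q) * (2 * P1 t * (P t - P y0))); last by ring.
  rewrite normrM; apply: ler_pM => //.
    by apply: le_trans (ler_normD _ _) _; rewrite normr1 lerD2l.
  have := sqr_ge0 (P1 t - (P t - P y0)); have := sqr_ge0 (P1 t + (P t - P y0)).
  rewrite ler_norml; nra.
move=> y yI; suff Ey : E y = 0.
  apply/eqP; rewrite -subr_eq0 -sqrf_eq0; apply/eqP.
  have h1 := sqr_ge0 (P y - P y0); have h2 := sqr_ge0 (P1 y).
  by move: Ey; rewrite /E; linear.
have [le|/ltW le] := leP y0 y.
  apply: (gronwall_zero E E1 (1 + Kf) y0 y) => // t tI.
  by have := bound t; rewrite ler_norml; linear.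
rewrite -[y]opprK -[- - y]mulN1r -[_ * _]add0r.
apply: (gronwall_zero (fun t => E (0 + -1 * t)) (fun t => -1 * E1 (0 + -1 * t)) (1 + Kf) (- y0) (- y)).
- by rewrite lerN2.
- by move=> t; exact: E_ge0.
- by rewrite add0r mulN1r opprK.
- by move=> t _; apply: is_derive_affine.
- by move=> t tI; have := bound (0 + -1 * t); rewrite ler_norml; linear.
Unshelve. all: by end_near. Qed.

(** [P1] solves the equation linearised at [P], so it vanishes if it does so at both walls. A
    non-constant flow thus has nonzero slope at one wall at least, and moving that wall produces a
    response. *)
Lemma flat_slopes : P1 1 = 0 -> P1 (-1) = 0 -> forall y, -1 <= y <= 1 -> P y = P 0.
Proof.
move=> h1 h2; have c1 (a : R) : continuous (fun _ : R => a) by move=> z; exact: cvg_cst.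
have P10 y : -1 <= y <= 1 -> P1 y = 0.
  move=> yI; apply: (channel_zero (fun=> -1) (fun=> 1) (fun _ y => P1 y) _ _ _ _ _ _ _ _ _ 0 y) => //.
  - by move=> s; move: Y_gt1; linear.
  - by apply: within_cont2 => s t _; apply: cont2_snd; exact: is_derive_cont (dP1 t).
  move=> s t tI; exists (f1 (P t)); first exact: (st_ge _ _ _ _ _ _ _ _ st).
  apply: lap_snd; apply: (is_d2_glob dP1).
  have := is_derive1_comp (st_der _ _ _ _ _ _ _ _ st (P t)) (dP t).
  apply: is_derive_near; apply: filterS (near_between (-1) 1 t tI) => r rI.
  by rewrite clamp_id //; linear.
move=> y yI; have dP0 t : -1 <= t <= 1 -> is_derive t (1 : R) P 0.
  by move=> tI; have := dP t; rewrite P10.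
have [y0|/ltW y0] := leP 0 y; first by apply: eq_of_derive0 => // s sI; apply: dP0; linear.
by apply/esym/eq_of_derive0 => // s sI; apply: dP0; linear.
Qed.

End FlatState.

(** * Expansion in the size of the perturbation *)

Section Expansion.
Context {R : realType} {f f1 : R -> R} {b k Kf Lf Y v0 : R}.
Hypotheses (st : stable f f1 b k Kf Lf Y v0) (Y_gt1 : 1 < Y).
Ltac linear ::= try clear Y_gt1; linear_core.
Implicit Types (u w : R -> R -> R) (x y t e l q c s : R) (h : R -> R) (hh : bool -> R -> R).
Variables P P1 : R -> R.
Hypotheses (dP : forall y, is_derive y (1 : R) P (P1 y))
  (dP1 : forall y, is_derive y (1 : R) P1 (f (P (clamp 1 y)))).

Lemma is_derive_scale (g : R -> R) a t c : is_derive t (1 : R) g a ->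
  is_derive t (1 : R) (fun s => c * g s) (c * a).
Proof.
move=> dg; have := is_derive_lin c (is_derive_cst 0 t 1) dg; rewrite add0r.
by apply: is_derive_near; near=> s; rewrite add0r.
Unshelve. all: by end_near. Qed.

Definition side (i : bool) : R := if i then 1 else -1.

Lemma sideK i : side i * side i = 1.
Proof. by case: i; rewrite /side ?mulrNN mulr1. Qed.

Definition datum La h := exists h1 h2, [/\ forall x, h (x + 2 * pi) = h x,
  forall x, is_derive x (1 : R) h (h1 x), forall x, is_derive x (1 : R) h1 (h2 x) &
  forall x, [/\ `|h x| <= La, `|h1 x| <= La & `|h2 x| <= La]].

Definition edge e hh i x := side i + e * hh i x.

(** The perturbed problem for the truncated nonlinearity, with the boundary constants written as
    values of the profile. *)
Definition psol e hh u := lsol f (P (-1)) (P 1) (edge e hh false) (edge e hh true) u.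

Lemma edge_derive e hh i h1 x : is_derive x (1 : R) (hh i) (h1 x) ->
  is_derive x (1 : R) (edge e hh i) (e * h1 x).
Proof. by move=> d; rewrite -[e * h1 x]add0r; apply: is_derive_lin; exact: is_derive_cst. Qed.

Lemma edge_cont e hh i La : datum La (hh i) -> continuous (edge e hh i).
Proof. by move=> [h1 [h2 [_ d1 _ _]]] x; exact: is_derive_cont (edge_derive e hh i h1 x (d1 x)). Qed.

Lemma edge_per e hh i La : datum La (hh i) -> forall x, edge e hh i (x + 2 * pi) = edge e hh i x.
Proof. by move=> [h1 [h2 [hp _ _ _]]] x; rewrite /edge hp. Qed.

Lemma edge_bound e hh i La x : 0 <= e -> datum La (hh i) -> `|edge e hh i x - side i| <= e * La.
Proof.
move=> e0 [h1 [h2 [_ _ _ /(_ x)[hb _ _]]]]; rewrite /edge addrC addKr normrM ger0_norm //.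
exact: ler_wpM2l.
Qed.

(** [1 / 16] is the curvature of the walls that the boundary barrier tolerates, and [(Y - 1) / 2]
    keeps the channel inside [|y| <= Y]. *)
Lemma psol_exists La e hh : 0 < e -> e * La <= 1 / 16 -> e * La <= (Y - 1) / 2 ->
  (forall i, datum La (hh i)) -> exists u, psol e hh u.
Proof.
move=> e0 eL eY hd; have La0 : 0 <= La.
  by have [h1 [h2 [_ _ _ /(_ 0)[+ _ _]]]] := hd true; exact: le_trans.
have eb i x : - (e * La) <= edge e hh i x - side i <= e * La.
  by rewrite -ler_norml; apply: edge_bound; [exact: ltW|].
have bt x := eb true x; have bf x := eb false x; rewrite /side in bt bf.
apply: (channel_lsol st _ _ _ _ ((1 + Y) / 2) (e * La)).
- by move: Y_gt1; linear.
- by rewrite mulr_ge0 // ltW.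
- by move=> x; have := bt x; have := bf x; move: Y_gt1; linear.
- by move=> x; have := bt x; have := bf x; linear.
- have main i s t : `|edge e hh i s - edge e hh i t| <= e * La * `|s - t|.
    have [h1 [h2 [_ d1 _ hb]]] := hd i.
    apply: (@lip_of_derive _ (edge e hh i) (fun x => e * h1 x)) => r _; first exact: edge_derive.
    by rewrite normrM ger0_norm ?(ltW e0) // ler_wpM2l ?(ltW e0) //; have [] := hb r.
  by move=> s t.
- have main i x s : 0 <= s ->
      `|edge e hh i (x + s) + edge e hh i (x - s) - 2 * edge e hh i x| <= s ^+ 2 / 16.
    move=> s0; have [h1 [h2 [_ d1 d2 hb]]] := hd i.
    have s2 : e * La * s ^+ 2 <= s ^+ 2 / 16.
      by have := ler_wpM2r (sqr_ge0 s) eL; linear.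
    have up : hh i (x + s) + hh i (x - s) - 2 * hh i x <= La * s ^+ 2.
      apply: (@second_diff_le _ (hh i) h1 h2) => // t _.
      by have [_ _] := hb t; rewrite ler_norml => /andP[].
    have dn : -1 * hh i (x + s) + -1 * hh i (x - s) - 2 * (-1 * hh i x) <= La * s ^+ 2.
      apply: (@second_diff_le _ (fun t => -1 * hh i t) (fun t => -1 * h1 t) (fun t => -1 * h2 t)) => //.
      by move=> t _; have [_ _] := hb t; rewrite ler_norml; linear.
    rewrite /edge (_ : _ - _ = e * (hh i (x + s) + hh i (x - s) - 2 * hh i x)); last by ring.
    rewrite normrM ger0_norm ?(ltW e0) //; apply: le_trans s2; rewrite -mulrA ler_wpM2l ?(ltW e0) //.
    by rewrite ler_norml; linear.
  by move=> x s s0; split; exact: main.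
- by move=> x; rewrite !(edge_per _ _ _ La).
Qed.

Lemma profile_bounds : exists2 C, 0 < C & [/\ forall y, -2 <= y <= 2 -> `|P1 y| <= C,
  forall y y', -2 <= y <= 2 -> -2 <= y' <= 2 -> `|P y - P y'| <= C * `|y - y'| &
  forall y y', -2 <= y <= 2 -> -2 <= y' <= 2 -> `|P y - P y' - P1 y' * (y - y')| <= C * (y - y') ^+ 2].
Proof.
have c1 : continuous P1 by move=> y; exact: is_derive_cont (dP1 y).
have c2 : continuous (fun y => f (P (clamp 1 y))).
  move=> y; apply: (@continuous_comp _ _ _ (clamp 1) (fun y => f (P y))); first exact: clamp_cont.
  apply: (@continuous_comp _ _ _ P f); first exact: is_derive_cont (dP _).
  exact: is_derive_cont (st_der _ _ _ _ _ _ _ _ st _).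
have [|C1 C10 C1P] := continuous_bounded_itv P1 (-2) 2 _ c1; first by lra.
have [|C2 C20 C2P] := continuous_bounded_itv _ (-2) 2 _ c2; first by lra.
have btw y y' t : -2 <= y <= 2 -> -2 <= y' <= 2 -> Num.min y y' <= t <= Num.max y y' -> -2 <= t <= 2.
  by case: (leP y y') => _; linear.
exists (C1 + C2 + 1); first linear.
split.
- by move=> y /C1P; linear.
- move=> y y' yI y'I; apply: (@lip_of_derive _ P P1 y' y (C1 + C2 + 1) (fun t _ => dP t)) => t tI.
  by have := C1P t (btw _ _ _ y'I yI tI); linear.
move=> y y' yI y'I; have [t tI E] := @mvt _ P P1 y' y (fun t _ => dP t).
have lip := @lip_of_derive _ P1 (fun y => f (P (clamp 1 y))) y' t C2 (fun t _ => dP1 t).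
rewrite E -mulrBl normrM -[(y - y') ^+ 2]real_normK ?num_real // expr2 mulrA ler_wpM2r //.
have tI2 := btw _ _ _ y'I yI tI.
apply: le_trans (lip _) _.
  by move=> r rI; apply: C2P; exact: btw rI.
apply: (@le_trans _ _ (C2 * `|y - y'|)); last by rewrite ler_wpM2r //; linear.
rewrite ler_wpM2l //; move: tI; case: (leP y' y) => _ tI; rewrite !ler_norml;
  case: (ger0P (y - y')) => ?; linear.
Qed.

(** In the perturbed channel [P] solves the equation up to [f (P y) - f (P (clamp 1 y))], which is
    of order [e], and it misses the boundary values by the same order. *)
Lemma psol_close La hh : (forall i, datum La (hh i)) -> exists2 C, 0 < C &
  forall e u, 0 < e -> e * La <= 1 / 16 -> e * La <= (Y - 1) / 2 -> psol e hh u ->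
  forall x y, edge e hh false x <= y <= edge e hh true x -> `|u x y - P y| <= C * e.
Proof.
move=> hd; have La0 : 0 <= La.
  by have [h1 [h2 [_ _ _ /(_ 0)[+ _ _]]]] := hd true; exact: le_trans.
have [Cp Cp0 [_ PL _]] := profile_bounds.
have kp := st_k _ _ _ _ _ _ _ _ st; have vp := st_v0 _ _ _ _ _ _ _ _ st.
have Kf0 : 0 <= Kf := le_trans (normr_ge0 _) (st_le _ _ _ _ _ _ _ _ st 0).
have CL : 0 <= Cp * La by rewrite mulr_ge0 // ltW.
have KCL : 0 <= Kf * (Cp * La) by rewrite mulr_ge0.
pose C := ((Kf * (Cp * La) + 1) / k + Cp * La) / v0.
have C0 : 0 < C by rewrite divr_gt0 // ltr_pwDl // divr_gt0 //; linear.
have CvE : v0 * C = (Kf * (Cp * La) + 1) / k + Cp * La by rewrite /C mulrC divfK // gt_eqF.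
have CkE : k * v0 * C = Kf * (Cp * La) + 1 + k * (Cp * La).
  by rewrite -mulrA CvE mulrDr mulrC divfK // gt_eqF.
exists C => // e u e0 eL eY su x y xy; have eb i s := edge_bound e hh i La s (ltW e0) (hd i).
have ebt s := eb true s; have ebf s := eb false s; rewrite /side in ebt ebf.
have kG := edge_cont e hh false La (hd false); have kH := edge_cont e hh true La (hd true).
have [up cu _ uH uG] := su.
have -> : u x y - P y = u x y + -1 * P y by ring.
apply: (channel_abs st (edge e hh false) (edge e hh true) (fun x y => u x y + -1 * P y)
  (Kf * (Cp * La) * e) (Cp * La * e)) xy => //.
- exact: mulr_gt0.
- rewrite (mulrA (k * v0)) CkE !mulrDl mul1r -addrA ltrDl ltr_pwDl // mulr_ge0 ?(ltW e0) //.
  by rewrite mulr_ge0 // ltW.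
- rewrite (mulrA v0) CvE ler_wpM2r ?(ltW e0) // lerDr divr_ge0 ?(ltW kp) //; linear.
- exact: edge_per (hd false).
- exact: edge_per (hd true).
- by move=> s; have := ebt s; have := ebf s; rewrite !ler_norml; move: Y_gt1; linear.
- by move=> s t; rewrite up.
- by apply: within_lin => //; apply: within_cont2 => s t _; apply: cont2_snd; exact: is_derive_cont (dP t).
- move=> s t tI; have [q [q1 _ E1]] := mean_slope st (u s t) (P t).
  have [q' [_ q2 E2]] := mean_slope st (P t) (P (clamp 1 t)).
  exists (f (u s t) + -1 * f (P (clamp 1 t))), q; split => //.
    apply: lap_lin; first exact: lsol_lap su tI.
    exact: (lap_snd s (is_d2_glob dP (dP1 t))).
  have -> : f (u s t) + -1 * f (P (clamp 1 t)) - q * (u s t + -1 * P t) = q' * (P t - P (clamp 1 t)).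
    by rewrite -E2 mulN1r mulN1r -E1; ring.
  have tb := ebt s; have tb' := ebf s; rewrite !ler_norml in tb tb'.
  have cI := clamp_itv 1 t ler01.
  have ct : `|t - clamp 1 t| <= e * La.
    have [t1|t1] := leP t 1; last first.
      by rewrite /clamp min_r ?(ltW t1) // max_r; [rewrite ger0_norm; linear|linear].
    have [t2|t2] := leP (-1) t; first by rewrite clamp_id ?subrr ?normr0 ?mulr_ge0 ?(ltW e0) //; linear.
    by rewrite /clamp min_l // max_l ?(ltW t2) // ler0_norm; linear.
  rewrite normrM -[Kf * _ * e]mulrA; apply: ler_pM => //.
  have := PL t (clamp 1 t) (ltac:(linear)) (ltac:(linear)) => h; apply: (le_trans h).
  by rewrite -mulrA (mulrC La) ler_wpM2l ?(ltW Cp0).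
- move=> s; rewrite uG uH !mulN1r.
  have h1 := eb true s; have h2 := eb false s; rewrite /side in h1 h2.
  have PP a c : `|c - a| <= e * La -> -1 <= a <= 1 -> `|P a - P c| <= Cp * La * e.
    move=> ca aI; have := PL a c (ltac:(linear)) (ltac:(move: ca; rewrite ler_norml; linear)) => h.
    by apply: (le_trans h); rewrite -mulrA (mulrC La) ler_wpM2l ?(ltW Cp0) // distrC.
  by split; apply: PP => //; linear.
Qed.

End Expansion.

(** * First-order behaviour of the solution at the walls *)

Section BoundaryLayer.
Context {R : realType} {f f1 : R -> R} {b k Kf Lf Y v0 : R}.
Hypotheses (st : stable f f1 b k Kf Lf Y v0) (Y_gt1 : 1 < Y).
Ltac linear ::= try clear Y_gt1; linear_core.
Implicit Types (u w : R -> R -> R) (x y t e l q c s : R) (h : R -> R) (hh : bool -> R -> R).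
Variables P P1 : R -> R.
Hypotheses (dP : forall y, is_derive y (1 : R) P (P1 y))
  (dP1 : forall y, is_derive y (1 : R) P1 (f (P (clamp 1 y)))).
Local Notation sg := (@side R).
Local Notation psol := (@psol R f P).

Lemma clamp1_dist t d : 0 <= d -> -1 - d <= t <= 1 + d -> `|t - clamp 1 t| <= d.
Proof.
move=> d0 td; have [t1|t1] := leP t 1; last first.
  by rewrite /clamp min_r ?(ltW t1) // max_r; [rewrite ger0_norm; linear|linear].
have [t2|t2] := leP (-1) t; first by rewrite clamp_id ?subrr ?normr0 //; linear.
by rewrite /clamp min_l // max_l ?(ltW t2) // ler0_norm; linear.
Qed.

(* Near the wall [y = sg i] the first-order term of [u - P] is [- e P1 (sg i) hh i];
   the barrier is a parabola in the distance [s] to the outermost position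
   of that wall. *)
Lemma psol_edge La hh : (forall i, datum La (hh i)) -> exists2 C, 0 < C &
  forall e u, 0 < e -> e * La <= 1 / 16 -> e * La <= (Y - 1) / 2 -> psol e hh u ->
  forall i x y, edge e hh false x <= y <= edge e hh true x ->
    `|u x y - P y + e * P1 (sg i) * hh i x| <= C * e * (e + (1 + e * La - sg i * y)).
Proof.
move=> hd; have La0 : 0 <= La.
  by have [h1 [h2 [_ _ _ /(_ 0)[+ _ _]]]] := hd true; exact: le_trans.
have [Cp Cp0 [P1b PL PT]] := profile_bounds st P P1 dP dP1.
have [C C0 CP] := psol_close st Y_gt1 P P1 dP dP1 La hh hd.
have Kf0 : 0 <= Kf := le_trans (normr_ge0 _) (st_le _ _ _ _ _ _ _ _ st 0).
have kp := st_k _ _ _ _ _ _ _ _ st; have vp := st_v0 _ _ _ _ _ _ _ _ st.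
have CL : 0 <= Cp * La by rewrite mulr_ge0 // ltW.
have CL2 : 0 <= Cp * La ^+ 2 by rewrite mulr_ge0 ?sqr_ge0 // ltW.
have KC : 0 <= Kf * C by rewrite mulr_ge0 // ltW.
have KCL : 0 <= Kf * (Cp * La) by rewrite mulr_ge0.
pose B := Kf * C + Kf * (Cp * La) + Cp * La + C.
have B0 : 0 < B by rewrite /B; linear.
exists (Cp * La ^+ 2 + 10 * B); first linear.
move=> e u e0 eL eY su i x y xy.
have eLa0 : 0 <= e * La by rewrite mulr_ge0 // ltW.
have CPe := CP e u e0 eL eY su.
have kG := edge_cont e hh false La (hd false); have kH := edge_cont e hh true La (hd true).
have [up cu _ uH uG] := su.
have eb j s : `|edge e hh j s - sg j| <= e * La := edge_bound e hh j La s (ltW e0) (hd j).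
have ebt s := eb true s; have ebf s := eb false s; rewrite /side in ebt ebf.
have strip s t : edge e hh false s <= t <= edge e hh true s -> -1 - e * La <= t <= 1 + e * La.
  by have := ebt s; have := ebf s; rewrite !ler_norml; linear.
have sb s t : edge e hh false s <= t <= edge e hh true s -> 0 <= 1 + e * La - sg i * t <= 3.
  by move=> /strip; rewrite /side; case: (i); linear.
have Pedge j s : -2 <= (sg j : R) <= 2 /\ -2 <= edge e hh j s <= 2.
  by have := eb j s; rewrite ler_norml /side; case: (j) => ?; split; linear.
have [h1 [h2 [hp dh dh1 hb]]] := hd i.
have P1i : `|P1 (sg i)| <= Cp by apply: P1b; rewrite /side; case: (i); linear.
pose q0 := e * P1 (sg i).
have q0b : `|q0| <= Cp * e by rewrite /q0 normrM (gtr0_norm e0) mulrC ler_wpM2r // ltW.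
have uedge j s : u s (edge e hh j s) = P (sg j) by rewrite /side; case: (j).
have order s : edge e hh false s <= edge e hh true s.
  by have := ebt s; have := ebf s; rewrite !ler_norml; linear.
have Zi s : `|u s (edge e hh i s) - P (edge e hh i s) + q0 * hh i s| <= Cp * La ^+ 2 * e ^+ 2.
  have [p1 p2] := Pedge i s; have := PT (edge e hh i s) (sg i) p2 p1.
  rewrite uedge -normrN.
  have -> : - (P (edge e hh i s) - P (sg i) - P1 (sg i) * (edge e hh i s - sg i)) =
      P (sg i) - P (edge e hh i s) + q0 * hh i s by rewrite /q0 /edge; ring.
  move=> h; apply: (le_trans h); rewrite /edge addrC addKr exprMn mulrCA -mulrA (mulrC (La ^+ 2)) mulrCA.
  apply: ler_wpM2l; first exact: ltW.
  apply: ler_wpM2l; rewrite ?sqr_ge0 // -[hh i s ^+ 2]real_normK ?num_real //.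
  by rewrite ler_pXn2r ?nnegrE //; have [] := hb s.
have Zall s t : edge e hh false s <= t <= edge e hh true s ->
    `|u s t - P t + q0 * hh i s| <= (C + Cp * La) * e.
  move=> tI; apply: le_trans (ler_normD _ _) _; rewrite mulrDl; apply: lerD; first exact: CPe.
  by rewrite normrM mulrAC; apply: ler_pM => //; have [] := hb s.
pose c0 := 1 + e * La; pose c1 := - sg i.
have c1E : c1 ^+ 2 = 1 by rewrite /c1 sqrrN expr2 sideK.
pose bar t := (c0 + c1 * t) ^+ 2 + -10 * (c0 + c1 * t).
have dbar t : is_d2 bar t 2.
  have := is_d2_lin (-10) (is_d2_affine c0 c1 (is_d2_sqr (c0 + c1 * t)))
     (is_d2_affine c0 c1 (is_d2_id (c0 + c1 * t))).
  by rewrite c1E !mulr0 addr0 mul1r.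
have cbar : continuous bar.
  move=> t; rewrite /bar; have ca : {for t, continuous (fun t => c0 + c1 * t)}.
    by apply: cvgD; [exact: cvg_cst|apply: cvgMr].
  by apply: cvgD; [rewrite /continuous_at expr2; apply: cvgM|apply: cvgMr].
suff main tau : `|tau| = 1 -> tau * (u x y - P y + q0 * hh i x) <=
    Cp * La ^+ 2 * e ^+ 2 + B * e * (10 * (c0 + c1 * y) - (c0 + c1 * y) ^+ 2).
  have := main 1 (normr1 _); have := main (-1) (normrN1 _); rewrite mul1r mulN1r.
  rewrite /c0 /c1 mulNr; have /andP[s0 s3] := sb x y xy; set s := 1 + e * La - sg i * y in s0 s3 *.
  have s2 : 0 <= B * e * s ^+ 2 by rewrite !mulr_ge0 ?sqr_ge0 // ltW.
  have s4 : 0 <= Cp * La ^+ 2 * e * s by rewrite !mulr_ge0 // ltW.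
  have s5 : 0 <= 10 * B * e ^+ 2 by rewrite mulr_ge0 ?sqr_ge0 //; linear.
  by rewrite -/q0 ler_norml; move: (q0 * _) => q1; clearbody s; linear.
move=> tau1.
(* [bar] has second derivative 2, so [B * e * bar] dominates source terms of order [e]. The added
   constant makes up for the Taylor error [Cp * La ^+ 2 * e ^+ 2] on the wall itself. *)
pose W s t := tau * (u s t + -1 * P t + q0 * hh i s) + (B * e) * (bar t + - (Cp * La ^+ 2 * e ^+ 2 / (B * e))).
have Be : 0 < B * e by exact: mulr_gt0.
have WE s t : W s t = tau * (u s t - P t + q0 * hh i s) -
    (Cp * La ^+ 2 * e ^+ 2 + B * e * (10 * (c0 + c1 * t) - (c0 + c1 * t) ^+ 2)).
  by rewrite /W (mulrDr (B * e)) mulrN (mulrC (B * e) (_ / _)) divfK ?gt_eqF // /bar; ring.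
suff : W x y <= 0 by rewrite WE; linear.
apply/ler_addgt0Pl => t t0; rewrite addr0.
have tauM z c : `|z| <= c -> tau * z <= c.
  by move=> zc; apply: le_trans (ler_norm _) _; rewrite normrM tau1 mul1r.
apply: (channel_le st (edge e hh false) (edge e hh true) W 0 0 t) xy => //.
- by rewrite !mulr_gt0.
- by rewrite mulr_ge0 // ltW.
- exact: edge_per (hd false).
- exact: edge_per (hd true).
- by move=> s; have := ebt s; have := ebf s; rewrite !ler_norml; move: Y_gt1; linear.
- by move=> s r; rewrite /W up hp.
- apply: within_lin.
    apply: within_scale; apply: within_lin.
      by apply: within_lin => //; apply: within_cont2 => s r _; apply: cont2_snd; exact: is_derive_cont (dP r).
    by apply: within_cont2 => s r _; apply: cont2_fst; exact: is_derive_cont (dh s).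
  apply: within_cont2 => s r _; apply: (@cont2_snd _ (fun r => bar r + _)).
  by apply: cvgD; [exact: cbar|exact: cvg_cst].
- move=> s r rI; have rI' : edge e hh false s <= r <= edge e hh true s by linear.
  pose l := f (u s r) + -1 * f (P (clamp 1 r)) + q0 * h2 s.
  (* The slope 0 is admissible by [k <= b ^+ 2]; the nonlinear term is part of the source [l]. *)
  exists (tau * l + (B * e) * 2), 0; split.
  + apply: lap_lin; first apply: lap_scale.
      apply: lap_lin; first apply: lap_lin.
      * exact: lsol_lap kG kH su rI.
      * exact: (lap_snd s (is_d2_glob dP (dP1 r))).
      * exact: (lap_fst r (is_d2_glob dh (dh1 s))).
    apply: (lap_snd (f := fun t => bar t + _)).
    have := is_d2_lin 1 (dbar r) (is_d2_cst (- (Cp * La ^+ 2 * e ^+ 2 / (B * e))) r).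
    rewrite mulr0 addr0; apply: is_d2_near; by near=> z; rewrite mul1r.
  + by have := st_kb _ _ _ _ _ _ _ _ st; linear.
  rewrite mul0r subr0; suff lb : `|l| <= (Kf * C + Kf * (Cp * La) + Cp * La) * e.
    have := tauM (- l) _ (ltac:(rewrite normrN; exact: lb)).
    have := mulr_gt0 C0 e0; have : 0 <= (Kf * C + Kf * (Cp * La) + Cp * La) * e.
      by rewrite mulr_ge0 ?(ltW e0) // !addr_ge0.
    by rewrite /B mulrN; linear.
  rewrite /l mulN1r !mulrDl; apply: le_trans (ler_normD _ _) _; apply: lerD.
    have [q [_ q1 E1]] := mean_slope st (u s r) (P r).
    have [q' [_ q2 E2]] := mean_slope st (P r) (P (clamp 1 r)).
    rewrite (_ : _ - _ = q * (u s r - P r) + q' * (P r - P (clamp 1 r))); last first.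
      by rewrite -E1 -E2; ring.
    apply: le_trans (ler_normD _ _) _; rewrite !normrM; apply: lerD.
      by rewrite -mulrA; apply: ler_pM => //; exact: CPe.
    rewrite -[Kf * _ * e]mulrA; apply: ler_pM => //.
    have rs := strip s r rI'; have cI := clamp_itv 1 r ler01.
    have h := PL r (clamp 1 r) (ltac:(linear)) (ltac:(linear)); apply: (le_trans h).
    by rewrite -mulrA (mulrC La) ler_wpM2l ?(ltW Cp0) // clamp1_dist.
  by rewrite normrM mulrAC; apply: ler_pM => //; have [] := hb s.
- have wi s j : W s (edge e hh j s) <= 0.
    rewrite WE subr_le0.
    have tI : edge e hh false s <= edge e hh j s <= edge e hh true s.
      by case: (j); rewrite lexx ?andbT order.
    have := sb s _ tI; rewrite /c0 /c1 mulNr; set z := _ - sg i * _ => z3.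
    (* As [0 <= z <= 3], the parabola is at least [7 * z]. At the opposite wall [z >= 1], so there
       it exceeds the crude bound [(C + Cp * La) * e]. *)
    have z2 : 7 * z <= 10 * z - z ^+ 2.
      have : 0 <= z * (3 - z) by rewrite mulr_ge0; linear.
      by linear.
    have z4 : B * e * (7 * z) <= B * e * (10 * z - z ^+ 2) by rewrite ler_pM2l.
    have [ij|ij] := eqVneq i j.
      have := tauM _ _ (Zi s); rewrite ij.
      have : 0 <= B * e * (7 * z) by rewrite mulr_ge0 ?(ltW Be) //; linear.
      by move: z4; linear.
    have z5 : 1 <= z.
      have := ebt s; have := ebf s; rewrite !ler_norml; move: ij.
      by rewrite /z /side; case: (i); case: (j) => //= _; linear.
    have z6 : B * e * 7 <= B * e * (7 * z) by rewrite ler_pM2l //; linear.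
    have := tauM _ _ (Zall s _ tI).
    have : (C + Cp * La) * e <= B * e * 7.
      have -> : B * e * 7 = B * 7 * e by ring.
      by rewrite ler_wpM2r ?(ltW e0) //; move: B0; rewrite /B; linear.
    have : 0 <= Cp * La ^+ 2 * e ^+ 2 by rewrite mulr_ge0 ?sqr_ge0.
    linear.
  by move=> s; split; exact: wi.
Unshelve. all: by end_near. Qed.

End BoundaryLayer.

(** * Approximate solutions of the linearised problem *)

Section Linearization.
Context {R : realType} {f f1 : R -> R} {b k Kf Lf Y v0 : R}.
Hypotheses (st : stable f f1 b k Kf Lf Y v0) (Y_gt1 : 1 < Y).
Ltac linear ::= try clear Y_gt1; linear_core.
Implicit Types (u w : R -> R -> R) (x y t e l q c s N dl : R) (h : R -> R) (hh : bool -> R -> R).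
Variables P P1 : R -> R.
Hypotheses (dP : forall y, is_derive y (1 : R) P (P1 y))
  (dP1 : forall y, is_derive y (1 : R) P1 (f (P (clamp 1 y)))).
Local Notation sg := (@side R).
Local Notation psol := (@psol R f P).

(* [w] solves, up to errors of order [dl], the equation linearised at [P] with
   the boundary values that the wall perturbation [hh] prescribes. *)
Definition nearlin N dl w hh : Prop := (forall x y, w (x + 2 * pi) y = w x y) /\
  forall x y, `|y| <= 1 - dl -> [/\ cont2 w x y,
    exists2 l, lap w x y l & `|l - f1 (P y) * w x y| <= N * dl &
    forall i, `|w x y + P1 (sg i) * hh i x| <= N * (dl + (1 - sg i * y))].

Lemma side_dist i y dl : 0 <= dl -> `|y| <= 1 - dl -> 0 <= 1 - sg i * y.
Proof. by move=> d0; rewrite ler_norml /side; case: i; linear. Qed.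

Lemma nearlin_lin c N N' dl w w' hh hh' : nearlin N dl w hh -> nearlin N' dl w' hh' ->
  nearlin (N + `|c| * N') dl (fun x y => w x y + c * w' x y) (fun i x => hh i x + c * hh' i x).
Proof.
move=> [wp H] [w'p H']; split; first by move=> x y; rewrite wp w'p.
move=> x y yI; have [c1 [l1 d1 e1] b1] := H x y yI; have [c2 [l2 d2 e2] b2] := H' x y yI.
have split2 (a a' B B' : R) : `|a| <= B -> `|a'| <= B' -> `|a + c * a'| <= B + `|c| * B'.
  by move=> h h'; apply: le_trans (ler_normD _ _) (lerD h _); rewrite normrM ler_wpM2l.
split; first exact: cont2_lin.
  exists (l1 + c * l2); first exact: lap_lin.
  have := split2 _ _ _ _ e1 e2; rewrite mulrDl mulrA => h; apply: le_trans h.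
  by rewrite le_eqVlt; apply/orP; left; apply/eqP; congr `|_|; ring.
move=> i; have := split2 _ _ _ _ (b1 i) (b2 i); rewrite mulrDl mulrA => h; apply: le_trans h.
by rewrite le_eqVlt; apply/orP; left; apply/eqP; congr `|_|; ring.
Qed.

(** Used to bring responses that belong to different [e] onto one common strip before they are
    subtracted. *)
Lemma nearlin_mono N N' dl dl' w hh : 0 <= N -> N <= N' -> 0 <= dl -> dl <= dl' ->
  nearlin N dl w hh -> nearlin N' dl' w hh.
Proof.
move=> N0 NN d0 dd [wp H]; split => // x y yI.
have yI' : `|y| <= 1 - dl by linear.
have [c1 [l1 d1 e1] b1] := H x y yI'.
have Nd : N * dl <= N' * dl' by apply: ler_pM.
split => //; first by exists l1 => //; exact: le_trans e1 Nd.
move=> i; have s0 := side_dist i y dl d0 yI'.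
by apply: le_trans (b1 i) _; apply: ler_pM => //; linear.
Qed.

Lemma nearlin_reflect N dl w hh : nearlin N dl w hh ->
  nearlin N dl (fun x y => w (0 + -1 * x) y) (fun i x => hh i (0 + -1 * x)).
Proof.
move=> [wp H]; split; first by move=> x y; rewrite -[in RHS](subrK (2 * pi) (0 + -1 * x)) wp; congr w; ring.
move=> x y yI; have [c1 [l1 d1 e1] b1] := H (0 + -1 * x) y yI; split => //.
  exact: cont2_affine.
by exists l1 => //; apply: lap_affine => //; rewrite sqrrN expr1n.
Qed.

(** Comparison in the strip [|y| <= 1 - dl]: on its edges [w] is [- P1 * hh] up to [2 * N * dl], and
    inside it the linear equation holds up to [N * dl]. *)
Lemma nearlin_bound : exists2 C, 0 < C & forall N dl w hh eta, 0 < N -> 0 < dl < 1 ->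
  nearlin N dl w hh -> (forall i x, `|hh i x| <= eta) ->
  forall x y, `|y| <= 1 - dl -> `|w x y| <= C * (eta + N * dl).
Proof.
have [Cp Cp0 [P1b _ _]] := profile_bounds st P P1 dP dP1.
have kp := st_k _ _ _ _ _ _ _ _ st; have vp := st_v0 _ _ _ _ _ _ _ _ st.
pose C := (2 / k + (2 + Cp)) / v0.
have C0 : 0 < C by rewrite divr_gt0 // addr_gt0 ?divr_gt0 //; linear.
have CvE : v0 * C = 2 / k + (2 + Cp) by rewrite /C mulrC divfK // gt_eqF.
have CkE : k * v0 * C = 2 + k * (2 + Cp) by rewrite -mulrA CvE mulrDr mulrC divfK // gt_eqF.
exists C => // N dl w hh eta N0 dl01 [wp H] hb x y yI.
have eta0 : 0 <= eta := le_trans (normr_ge0 _) (hb true 0).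
have Nd : 0 < N * dl by rewrite mulr_gt0 //; linear.
have c1 (a : R) : continuous (fun _ : R => a) by move=> z; exact: cvg_cst.
apply: (channel_abs st (fun=> - (1 - dl)) (fun=> 1 - dl) w (N * dl) (Cp * eta + 2 * (N * dl))) => //.
- by rewrite mulr_gt0 //; linear.
- rewrite (mulrA (k * v0)) CkE.
  have : 0 <= k * (2 + Cp) * (eta + N * dl) by rewrite !mulr_ge0 //; linear.
  by linear.
- rewrite (mulrA v0) CvE; have : 0 <= 2 / k * (eta + N * dl) by rewrite mulr_ge0 ?divr_ge0 //; linear.
  have : 0 <= Cp * (N * dl) by rewrite mulr_ge0 // ltW.
  by linear.
- by move=> s; move: Y_gt1; linear.
- apply: within_cont2 => s t; rewrite /closed_in /= => tI.
  by have [] := H s t (ltac:(rewrite ler_norml; linear)).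
- move=> s t tI; have [_ [l h1 h2] _] := H s t (ltac:(rewrite ler_norml; linear)).
  by exists l, (f1 (P t)); split => //; exact: (st_ge _ _ _ _ _ _ _ _ st).
- have edge i s : `|w s (sg i * (1 - dl))| <= Cp * eta + 2 * (N * dl).
    have [_ _ /(_ i)] := H s (sg i * (1 - dl)) (ltac:(rewrite ler_norml /side; case: (i); linear)).
    rewrite mulrA sideK mul1r => h.
    have h2 : `|P1 (sg i) * hh i s| <= Cp * eta.
      rewrite normrM; apply: ler_pM => //; apply: P1b.
      by rewrite /side; case: (i); linear.
    have := ler_normB (w s (sg i * (1 - dl)) + P1 (sg i) * hh i s) (P1 (sg i) * hh i s).
    by rewrite addrK; linear.
  by move=> s; have := edge true s; have := edge false s; rewrite /side mulN1r mul1r.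
- by move: yI; rewrite ler_norml.
Qed.

(** After division by [e] the nonlinear error is [(f1 c - f1 (P y)) * (u - P) / e], with [c] between
    [P y] and [u]. It is of order [e] by the Lipschitz bound on [f1], and the wall estimate is
    [psol_edge]. The strip loses [N * e] at each wall in order to lie in the perturbed channel for
    every [x]. *)
Lemma psol_nearlin La hh : (forall i, datum La (hh i)) -> exists N e1, [/\ 1 <= N, 0 < e1 &
  forall e, 0 < e < e1 -> (exists u, psol e hh u) /\ forall u, psol e hh u ->
    nearlin N (N * e) (fun x y => e^-1 * (u x y + -1 * P y)) hh].
Proof.
move=> hd; have La0 : 0 <= La.
  by have [h1 [h2 [_ _ _ /(_ 0)[+ _ _]]]] := hd true; exact: le_trans.
have [C C0 CP] := psol_close st Y_gt1 P P1 dP dP1 La hh hd.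
have [C2 C20 CP2] := psol_edge st Y_gt1 P P1 dP dP1 La hh hd.
have Lf0 : 0 <= Lf.
  have := st_lip _ _ _ _ _ _ _ _ st 1 0; rewrite subr0 normr1 mulr1.
  exact: le_trans.
pose N := 2 + 2 * La + Lf * C ^+ 2 + C2 * (1 + La).
have LC : 0 <= Lf * C ^+ 2 by rewrite mulr_ge0 ?sqr_ge0.
have C2L : 0 <= C2 * La by rewrite mulr_ge0 // ltW.
have m0 : 0 < Num.min (1 / 16) ((Y - 1) / 2) by rewrite lt_min; move: Y_gt1; linear.
exists N, (Num.min (1 / 16) ((Y - 1) / 2) / (La + 1)); split.
- by rewrite /N; linear.
- by rewrite divr_gt0 //; linear.
move=> e /andP[e0]; rewrite ltr_pdivlMr; last linear.
rewrite lt_min => /andP[eL eY].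
have eL' : e * La <= 1 / 16 by linear.
have eY' : e * La <= (Y - 1) / 2 by linear.
split; first exact: (psol_exists st Y_gt1 P La e hh e0 eL' eY' hd).
move=> u su; have CPe := CP e u e0 eL' eY' su; have CP2e := CP2 e u e0 eL' eY' su.
have kG := edge_cont e hh false La (hd false); have kH := edge_cont e hh true La (hd true).
have [up cu _ _ _] := su; split; first by move=> x y; rewrite up.
have N2 : 2 * La + 2 <= N by rewrite /N; linear.
move=> x y yI; have yb : -1 <= y <= 1.
  have : 0 <= N * e by rewrite mulr_ge0 ?(ltW e0) //; linear.
  by move: yI; rewrite ler_norml; linear.
have eLN : e * La < N * e.
  by rewrite mulrC ltr_pM2r //; linear.
have ins : edge e hh false x < y < edge e hh true x.
  have h1 := edge_bound e hh false La x (ltW e0) (hd false).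
  have h2 := edge_bound e hh true La x (ltW e0) (hd true).
  by move: h1 h2 yI; rewrite !ler_norml /side; linear.
have cl : edge e hh false x <= y <= edge e hh true x by linear.
have ei0 : 0 <= e^-1 by rewrite invr_ge0 ltW.
have e1 : e^-1 * e = 1 by rewrite mulVf // gt_eqF.
split.
- apply/cont2_scale/cont2_lin; first exact: within_at kG kH cu ins.
  by apply: cont2_snd; exact: is_derive_cont (dP y).
- exists (e^-1 * (f (u x y) + -1 * f (P (clamp 1 y)))).
    apply/lap_scale/lap_lin; first exact: lsol_lap kG kH su ins.
    exact: (lap_snd x (is_d2_glob dP (dP1 y))).
  have [c cI E] := @mvt _ f f1 (P y) (u x y) (fun r _ => st_der _ _ _ _ _ _ _ _ st r).
  rewrite clamp_id // (_ : _ - _ = e^-1 * ((f1 c - f1 (P y)) * (u x y - P y))); last first.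
    by rewrite mulrBl -E; ring.
  have cd : `|c - P y| <= `|u x y - P y|.
    by move: cI; case: (leP (P y) (u x y)) => ? ?; rewrite ler_norml;
      case: (ger0P (u x y - P y)) => ?; linear.
  have ub := CPe x y cl.
  have h1 : `|f1 c - f1 (P y)| <= Lf * (C * e).
    apply: le_trans (st_lip _ _ _ _ _ _ _ _ st _ _) _.
    by rewrite ler_wpM2l //; exact: le_trans ub.
  have h2 : `|(f1 c - f1 (P y)) * (u x y - P y)| <= Lf * (C * e) * (C * e).
    by rewrite normrM ler_pM.
  rewrite normrM ger0_norm //; apply: (le_trans (ler_wpM2l ei0 h2)).
  rewrite (_ : e^-1 * (Lf * (C * e) * (C * e)) = Lf * C ^+ 2 * (e^-1 * e) * e); last by ring.
  rewrite e1 mulr1; have : 0 <= (N - Lf * C ^+ 2) * e by rewrite mulr_ge0 ?(ltW e0) // /N; linear.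
  have : 0 <= (N - 1) * N * e by rewrite !mulr_ge0 ?(ltW e0) //; linear.
  by move=> h3 h4; rewrite mulrA; linear.
- move=> i; have := CP2e i x y cl; have s0 : 0 <= 1 - sg i * y.
    by rewrite /side; case: (i); linear.
  move=> h; rewrite (_ : _ + _ = e^-1 * (u x y - P y + e * P1 (sg i) * hh i x)); last first.
    by rewrite [RHS]mulrDr !mulrA e1 mul1r mulN1r.
  rewrite normrM ger0_norm //; apply: (le_trans (ler_wpM2l ei0 h)).
  rewrite (_ : e^-1 * (C2 * e * _) = C2 * (e^-1 * e) * (e + (1 + e * La - sg i * y))); last by ring.
  rewrite e1 mulr1.
  have h1 : C2 * (1 + La) * e <= N * e by rewrite ler_wpM2r ?(ltW e0) // /N; linear.
  have h2 : N * e <= N * (N * e) by rewrite ler_peMl // ?mulr_ge0 ?(ltW e0) //; linear.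
  have h3 : C2 * (1 - sg i * y) <= N * (1 - sg i * y) by rewrite ler_wpM2r // /N; linear.
  by linear.
Qed.

End Linearization.

(** * Oscillation of the linear response *)

Section Response.
Context {R : realType} {f f1 : R -> R} {b k Kf Lf Y v0 : R}.
Hypotheses (st : stable f f1 b k Kf Lf Y v0) (Y_gt1 : 1 < Y).
Ltac linear ::= try clear Y_gt1; linear_core.
Implicit Types (u w : R -> R -> R) (x y t e l q c s N dl : R) (h : R -> R) (hh : bool -> R -> R).
Variables P P1 : R -> R.
Hypotheses (dP : forall y, is_derive y (1 : R) P (P1 y))
  (dP1 : forall y, is_derive y (1 : R) P1 (f (P (clamp 1 y)))).
Local Notation sg := (@side R).
Local Notation psol := (@psol R f P).
Local Notation nearlin := (@nearlin R f1 P P1).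

Lemma is_d2_cont (g : R -> R) t l : is_d2 g t l -> {for t, continuous g}.
Proof. by move=> [g1 [/nbhs_singleton /is_derive_cont]]. Qed.

Lemma is_d2_expn (m : nat) t : is_d2 (fun t => t ^+ m.+2) t ((m.+2%:R * m.+1%:R) * t ^+ m).
Proof.
have d (n : nat) (r : R) : is_derive r (1 : R) (fun t => t ^+ n.+1) (n.+1%:R * r ^+ n).
  by have := @is_deriveX R R id n.+1 r 1 1 (is_derive_id r 1); rewrite exprfctE /= [_ *: _]mulr1.
apply: (is_d2_glob (d m.+1)); rewrite -mulrA; exact: is_derive_scale (d m t).
Qed.

(** Sign and factor are such that the prescribed boundary values [- P1 * hh] become
    [P1 ^+ 2 * sin x], nonnegative over [[0, pi]] at both walls. *)
Definition sine_data (i : bool) x := - P1 (sg i) * sin x.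

Lemma sine_reflect : (fun i x => sine_data i x + 1 * sine_data i (0 + -1 * x)) =
  (fun (i : bool) (x : R) => 0).
Proof.
apply/funext => i; apply/funext => x.
by rewrite /sine_data add0r mulN1r sinN mulrN mul1r subrr.
Qed.

(* Comparison in the half period [0, pi], where the odd symmetry provides the
   boundary values, with the subsolution [S y * sin x]. *)
Lemma sine_response y0 : ~ (P1 1 = 0 /\ P1 (-1) = 0) -> -1 < y0 < 1 ->
  exists kap C, [/\ 0 < kap, 0 < C & forall N dl w, 1 <= N -> 0 < dl < 1 ->
    `|y0| <= 1 - dl -> nearlin N dl w sine_data ->
    kap - C * (N * dl) <= w (pi / 2) y0 - w 0 y0].
Proof.
move=> P1n y0I.
have [C0 C00 C0P] := nearlin_bound st Y_gt1 P P1 dP dP1.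
have kp := st_k _ _ _ _ _ _ _ _ st; have vp := st_v0 _ _ _ _ _ _ _ _ st.
have Kf0 : 0 <= Kf := le_trans (normr_ge0 _) (st_le _ _ _ _ _ _ _ _ st 0).
pose a i := P1 (sg i) ^+ 2.
have a0 i : 0 <= a i by exact: sqr_ge0.
(* The power [m + 2] of [p = (1 + s y) / 2] is so high that [phi'' >= (1 + Kf) * phi]: the 1 offsets
   the second derivative of [sin x], and [Kf] the zero-order term. [phi] is 1 at the wall [s] and 0
   at the other one. *)
pose m := Num.Def.archi_bound (4 * (Kf + 1)).
have mb : 4 * (Kf + 1) < m%:R by apply: archi_boundP; linear.
pose p s y := 1 / 2 + s / 2 * y.
pose phi s y := p s y ^+ m.+2.
pose phi2 s y := (s / 2) ^+ 2 * ((m.+2%:R * m.+1%:R) * p s y ^+ m).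
have dphi s y : is_d2 (phi s) y (phi2 s y) := is_d2_affine (1 / 2) (s / 2) (is_d2_expn m (p s y)).
have p01 i y : -1 <= y <= 1 -> 0 <= p (sg i) y <= 1.
  by rewrite /p /side; case: i; linear.
have phi01 i y : -1 <= y <= 1 -> 0 <= phi (sg i) y <= 1.
  by move=> /(p01 i)/andP[h1 h2]; rewrite exprn_ge0 // exprn_ile1.
have phi2P i y : -1 <= y <= 1 -> (1 + Kf) * phi (sg i) y <= phi2 (sg i) y.
  move=> yI; have /andP[h1 h2] := p01 i y yI.
  have pm : 0 <= p (sg i) y ^+ m by rewrite exprn_ge0.
  have p2 : p (sg i) y ^+ 2 <= 1 by rewrite exprn_ile1.
  have s4 : (sg i / 2) ^+ 2 = 1 / 4 by rewrite /side; case: (i); field.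
  have mm : 4 * (1 + Kf) <= m.+2%:R * m.+1%:R :> R.
    have m0 : 0 <= m%:R :> R by [].
    have : m%:R * 1 <= m.+2%:R * m.+1%:R :> R by apply: ler_pM; rewrite // ?ler1n // ler_nat -addn2 leq_addr.
    by linear.
  have e1 : phi (sg i) y = p (sg i) y ^+ m * p (sg i) y ^+ 2 by rewrite /phi -exprD addn2.
  have h3 : p (sg i) y ^+ m * p (sg i) y ^+ 2 <= p (sg i) y ^+ m by rewrite ler_piMr.
  have h4 := ler_wpM2r pm mm.
  have h5 : (1 + Kf) * (p (sg i) y ^+ m * p (sg i) y ^+ 2) <= (1 + Kf) * p (sg i) y ^+ m.
    by rewrite ler_wpM2l //; linear.
  by rewrite e1 /phi2 s4; linear.
(* On the edges of the strip [S y * sin x] stays below the boundary values up to [A * dl]; the value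
   of [S] at [y0] is the constant [kap]. *)
pose S y := a true * phi (sg true) y + a false * phi (sg false) y.
pose S2 y := a true * phi2 (sg true) y + a false * phi2 (sg false) y.
have dS y : is_d2 S y (S2 y).
  have := is_d2_lin (a false) (is_d2_lin (a true) (is_d2_cst 0 y) (dphi (sg true) y)) (dphi (sg false) y).
  by rewrite add0r; apply: is_d2_near; near=> t; rewrite add0r.
have S0 y : -1 <= y <= 1 -> 0 <= S y.
  by move=> yI; rewrite addr_ge0 // mulr_ge0 //; [have := phi01 true y yI|have := phi01 false y yI]; linear.
have S2P y : -1 <= y <= 1 -> (1 + Kf) * S y <= S2 y.
  move=> yI; have h1 := ler_wpM2l (a0 true) (phi2P true y yI).
  by have h2 := ler_wpM2l (a0 false) (phi2P false y yI); rewrite /S /S2; linear.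
pose A := a true + a false.
have A0 : 0 <= A by rewrite addr_ge0.
have S_edge i dl : 0 < dl < 1 -> S (sg i * (1 - dl)) <= a i + A * dl.
  move=> d01; have yI : -1 <= sg i * (1 - dl) <= 1 by rewrite /side; case: (i); linear.
  have far : phi (- sg i) (sg i * (1 - dl)) <= dl.
    have pE : p (- sg i) (sg i * (1 - dl)) = dl / 2.
      by rewrite /p (_ : _ * (sg i * _) = - (sg i * sg i) / 2 * (1 - dl)); [rewrite sideK; field|field].
    rewrite /phi pE exprS; apply: (@le_trans _ _ (dl / 2 * 1)); last by linear.
    by rewrite ler_wpM2l ?exprn_ile1 //; linear.
  have near : phi (sg i) (sg i * (1 - dl)) <= 1 by have := phi01 i _ yI; linear.
  rewrite /S /A; move: near far (a0 true) (a0 false); rewrite /side; case: (i) => /= near far a1 a2.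
    have := ler_wpM2l a1 near; have := ler_wpM2l a2 far; have := mulr_ge0 a1 (ltac:(linear) : 0 <= dl).
    by linear.
  rewrite opprK in far.
  have := ler_wpM2l a2 near; have := ler_wpM2l a1 far; have := mulr_ge0 a2 (ltac:(linear) : 0 <= dl).
  by linear.
have Sy0 : 0 < S y0.
  have pos i : 0 < phi (sg i) y0 by rewrite exprn_gt0 // /p /side; case: (i); linear.
  have ge i : 0 <= a i * phi (sg i) y0 := mulr_ge0 (a0 i) (ltW (pos i)).
  have [h|h] := eqVneq (P1 1) 0; last first.
    have a1 : 0 < a true by rewrite /a /side exprn_even_gt0.
    exact: ltr_pwDl (mulr_gt0 a1 (pos true)) (ge false).
  have a1 : 0 < a false.
    by rewrite /a /side exprn_even_gt0 //=; apply/eqP => h'; apply: P1n.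
  exact: ltr_wpDl (ge true) (mulr_gt0 a1 (pos false)).
pose C1 := ((A + 2 + 2 * C0) + 2 / k) / v0.
have C10 : 0 < C1 by rewrite divr_gt0 // addr_gt0 ?divr_gt0 //; linear.
have CvE : v0 * C1 = (A + 2 + 2 * C0) + 2 / k by rewrite /C1 mulrC divfK // gt_eqF.
have CkE : k * v0 * C1 = k * (A + 2 + 2 * C0) + 2.
  by rewrite -mulrA CvE mulrDr; congr (_ + _); rewrite mulrC divfK // gt_eqF.
exists (S y0), (C1 + 2 * C0); split => //; first linear.
move=> N dl w N1 dl01 y0d wn; have [wp H] := wn.
have Nd : 0 < N * dl by rewrite mulr_gt0 //; linear.
have dlN : dl <= N * dl by rewrite ler_peMl //; linear.
have N0 : 0 <= N by linear.
(* An approximate solution is odd up to the error, because its sum with its reflection is an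
   approximate solution with zero data. This supplies the bounds on [x = 0] and, by periodicity, on
   [x = pi]. *)
have odd_w x y : `|y| <= 1 - dl -> `|w x y + w (- x) y| <= C0 * (2 * (N * dl)).
  move=> yI; have := nearlin_lin _ _ 1 N N dl _ _ _ _ wn (nearlin_reflect P P1 N dl w sine_data wn).
  rewrite sine_reflect normr1 mul1r => wn2.
  have := C0P (N + N) dl _ _ 0 (ltac:(linear)) dl01 wn2 (ltac:(by move=> *; rewrite normr0)) x y yI.
  by rewrite mul1r add0r mulN1r (_ : 0 + (N + N) * dl = 2 * (N * dl)) //; ring.
have w0 y : `|y| <= 1 - dl -> `|w 0 y| <= C0 * (N * dl).
  by move=> /(odd_w 0); rewrite oppr0 !ler_norml; linear.
have wpi y : `|y| <= 1 - dl -> `|w pi y| <= C0 * (N * dl).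
  by move=> /(odd_w pi); rewrite -(wp (- pi)) (_ : - pi + 2 * pi = pi) ?ler_norml; [linear|ring].
pose z x y := (0 + S y * sin x) + -1 * w x y.
suff zle x y : 0 <= x <= pi -> `|y| <= 1 - dl -> z x y <= C1 * (N * dl).
  have := zle (pi / 2) y0 (ltac:(have := pi_gt0 R; linear)) y0d.
  by rewrite /z sin_pihalf; have := w0 y0 y0d; rewrite ler_norml; linear.
move=> xI yI.
pose K := [set z : R * R | 0 <= z.1 <= pi /\ - (1 - dl) <= z.2 <= 1 - dl].
have inK s r : K (s, r) -> `|r| <= 1 - dl by move=> [_]; rewrite ler_norml.
have zc s r : K (s, r) -> cont2 z s r.
  move=> Kpq; have [cw _ _] := H s r (inK s r Kpq).
  apply: cont2_lin cw; apply: cvgD; first exact: cvg_cst.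
  apply: cvgM; first exact: (cont2_snd s (is_d2_cont S r (S2 r) (dS r))).
  exact: (cont2_fst r (is_derive_cont (is_derive_sin s))).
apply: (@weighted_bound R b k Y v0 K K z (N * dl) ((A + 2 + 2 * C0) * (N * dl)) (C1 * (N * dl)) vp
  (st_cos _ _ _ _ _ _ _ _ st) kp _ _ _ _ _ _ _ _ _ (x, y)) => //.
- exact: mulr_gt0.
- rewrite (mulrA (k * v0)) CkE; have : 0 <= k * (A + 2 + 2 * C0) * (N * dl) by rewrite !mulr_ge0 //; linear.
  by linear.
- rewrite (mulrA v0) CvE; have : 0 <= 2 / k * (N * dl) by rewrite mulr_ge0 ?divr_ge0 //; linear.
  by linear.
- exact: compact_box.
- by apply: within_cont2.
- by move=> [p' q] /inK /= h; move: Y_gt1; linear.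
- by move=> z' Kz'; exists z'.
- move=> [p' q] Kpq; have qI := inK p' q Kpq; have [/= /andP[p1 p2] /andP[q1 q2]] := Kpq.
  have s0 : 0 <= sin p' <= 1 by rewrite sin_ge0_pi ?sin_le1 // p1.
  have C0N : 0 <= C0 * (N * dl) by rewrite mulr_ge0 // ltW.
  have AN : 0 <= A * (N * dl) by rewrite mulr_ge0 // ltW.
  have AdN : A * dl <= A * (N * dl) by rewrite ler_wpM2l.
  have edge i : q = sg i * (1 - dl) -> z p' q <= (A + 2 + 2 * C0) * (N * dl).
    move=> qE; have [_ _ /(_ i)] := H p' q qI.
    rewrite qE mulrA sideK mul1r ler_norml /sine_data /z => /andP[h1 _].
    have := S_edge i dl dl01; have := S0 q (ltac:(move: qI; rewrite ler_norml; linear)).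
    rewrite -qE in h1 *; rewrite add0r => S0q Sle.
    have h2 : S q * sin p' <= (a i + A * dl) * sin p' by rewrite ler_wpM2r //; linear.
    have h3 : A * dl * sin p' <= A * dl * 1 by rewrite ler_wpM2l ?mulr_ge0 //; linear.
    have h4 : P1 (sg i) * (- P1 (sg i) * sin p') = - (a i * sin p') by rewrite /a; ring.
    by rewrite h4 in h1; linear.
  have [pE|p0] := eqVneq p' 0.
    left; rewrite /uc /= /z pE sin0 mulr0; have := w0 q qI; rewrite ler_norml; linear.
  have [pE|ppi] := eqVneq p' pi.
    left; rewrite /uc /= /z pE sinpi mulr0; have := wpi q qI; rewrite ler_norml; linear.
  have [qE|q3] := eqVneq q (1 - dl).
    by left; apply: (edge true); rewrite /side mul1r.
  have [qE|q4] := eqVneq q (- (1 - dl)).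
    by left; apply: (edge false); rewrite /side mulN1r.
  have p1' : 0 < p' by rewrite lt_neqAle eq_sym p0.
  have p2' : p' < pi by rewrite lt_neqAle ppi.
  have q1' : - (1 - dl) < q by rewrite lt_neqAle eq_sym q4.
  have q2' : q < 1 - dl by rewrite lt_neqAle q3.
  right; split.
    apply/nbhs2P; exists (Num.min (Num.min p' (pi - p')) (Num.min (q + (1 - dl)) (1 - dl - q))).
      by rewrite !lt_min; linear.
    move=> s t; rewrite !lt_min => /andP[/andP[s1 s2] _] /andP[_ /andP[t1 t2]].
    by move: s1 s2 t1 t2; rewrite !ltr_norml /K /=; split; linear.
  have [_ [l lw le] _] := H p' q qI.
  exists ((- (S q * sin p') + S2 q * sin p') + -1 * l), (f1 (P q)); split.
  + apply: lap_lin lw; exists (- (S q * sin p')), (S2 q * sin p'); split => //.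
      have := is_d2_lin (S q) (is_d2_cst 0 p') (is_d2_glob (@is_derive_sin R) (is_derive_cos p')).
      by rewrite add0r mulrN.
    have := is_d2_lin (sin p') (is_d2_cst 0 q) (dS q).
    rewrite add0r [sin p' * _]mulrC; apply: is_d2_near.
    by near=> t; rewrite [in RHS]mulrC.
  + exact: (st_ge _ _ _ _ _ _ _ _ st).
  move: le; rewrite /uc /= /z add0r ler_norml => /andP[_ le].
  have qb : -1 <= q <= 1 by linear.
  have h1 : f1 (P q) * (S q * sin p') <= Kf * (S q * sin p').
    rewrite ler_wpM2r ?mulr_ge0 ?S0 //; first linear.
    by apply: le_trans (ler_norm _) (st_le _ _ _ _ _ _ _ _ st _).
  have h2 : (1 + Kf) * S q * sin p' <= S2 q * sin p' by rewrite ler_wpM2r ?S2P //; linear.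
  move: le h1 h2; move: (S q) (S2 q) (sin p') (f1 (P q)) (w p' q) => s1 s2 s3 s4 s5 le h1 h2.
  by linear.
- by split => //; move: yI; rewrite ler_norml.
Unshelve. all: by end_near. Qed.

End Response.

(** * Stability and genericity of the oscillation *)

Section Wobble.
Context {R : realType} {f f1 : R -> R} {b k Kf Lf Y v0 : R}.
Hypotheses (st : stable f f1 b k Kf Lf Y v0) (Y_gt1 : 1 < Y).
Implicit Types (u w : R -> R -> R) (x y t e l q c s N dl d r : R) (h : R -> R) (hh : bool -> R -> R).
Variables P P1 : R -> R.
Hypotheses (dP : forall y, is_derive y (1 : R) P (P1 y))
  (dP1 : forall y, is_derive y (1 : R) P1 (f (P (clamp 1 y)))).
Local Notation sg := (@side R).
Local Notation psol := (@psol R f P).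
Local Notation nearlin := (@nearlin R f1 P P1).
Variable y0 : R.
Hypothesis y0_in : -1 < y0 < 1.
Ltac linear ::= try clear Y_gt1; try clear y0_in; linear_core.

(** The condition is imposed on the nonlinear solutions at all small [e], with points that may
    depend on [e]; no limiting response is needed to state it. *)
Definition wobble hh := exists d e1, [/\ 0 < d, 0 < e1 & forall e u, 0 < e < e1 -> psol e hh u ->
  exists x x', u x y0 + e * d <= u x' y0].

Lemma small_step (c d : R) : 0 <= c -> 0 < d -> exists2 e : R, 0 < e & c * e < d.
Proof.
move=> c0 d0; exists (d / (c + 1)); first by rewrite divr_gt0 //; linear.
by rewrite mulrA ltr_pdivrMr; [rewrite mulrC ltr_pM2l //; linear|linear].
Qed.

Lemma quotient_le e d u x x' : 0 < e -> (u x y0 + e * d <= u x' y0) =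
  (d <= e^-1 * (u x' y0 + -1 * P y0) - e^-1 * (u x y0 + -1 * P y0)).
Proof.
move=> e0; rewrite -mulrBr (_ : _ - _ = u x' y0 - u x y0); last by ring.
by rewrite [_^-1 * _]mulrC ler_pdivlMr // lerBrDl mulrC.
Qed.

(** For small [e] the responses [(u - P) / e] to the two data differ by at most [d / 4], half of it
    due to [r] and half to the error, so an oscillation by [d] leaves one by [d / 2]. *)
Lemma wobble_open La hh : (forall i, datum La (hh i)) -> wobble hh ->
  exists2 r, 0 < r & forall La' hh', (forall i, datum La' (hh' i)) ->
    (forall i x, `|hh i x - hh' i x| <= r) -> wobble hh'.
Proof.
move=> hd [d [e1 [d0 e10 W]]].
have [C C0 CP] := nearlin_bound st Y_gt1 P P1 dP dP1.
exists (d / (8 * C)); first by rewrite divr_gt0 ?mulr_gt0.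
move=> La' hh' hd' close.
have [N1 [e2 [N10 e20 S1]]] := psol_nearlin st Y_gt1 P P1 dP dP1 La hh hd.
have [N2 [e3 [N20 e30 S2]]] := psol_nearlin st Y_gt1 P P1 dP dP1 La' hh' hd'.
pose M := N1 + N2; have M0 : 0 < M by rewrite /M; linear.
have y01 : `|y0| < 1 by rewrite ltr_norml y0_in.
have [e4 e40 h4] := small_step M ((1 - `|y0|)) (ltW M0) (ltac:(linear)).
have CM : 0 <= C * (2 * M * M) by rewrite !mulr_ge0 // ltW.
have [e5 e50 h5] := small_step (C * (2 * M * M)) (d / 8) CM (ltac:(linear)).
pose e6 := Num.min (Num.min (Num.min e1 e2) e3) (Num.min e4 e5).
have e60 : 0 < e6 by rewrite !lt_min e10 e20 e30 e40.
exists (d / 2), e6; split => //; first linear.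
move=> e u' /andP[e0]; rewrite !lt_min => /andP[/andP[/andP[l1 l2] l3] /andP[l4 l5]] su'.
have [[u su] nl] := S1 e (ltac:(by rewrite e0)).
have [_ nl'] := S2 e (ltac:(by rewrite e0)).
have Me : M * e < 1 - `|y0| by apply: lt_trans h4; rewrite ltr_pM2l.
have Me0 : 0 < M * e by rewrite mulr_gt0.
have Ce : C * (2 * M * M) * e <= d / 8.
  by apply/ltW/(le_lt_trans _ h5); rewrite ler_wpM2l // ltW.
have mono N w g : 1 <= N -> N <= M -> nearlin N (N * e) w g -> nearlin M (M * e) w g.
  move=> n1 nM; apply: nearlin_mono; [linear|exact: nM|by rewrite mulr_ge0 ?(ltW e0) //; linear|].
  by rewrite ler_wpM2r // ltW.
have D := nearlin_lin _ _ (-1) _ _ _ _ _ _ _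
  (mono N1 _ _ N10 (ltac:(rewrite /M; linear)) (nl u su)) (mono N2 _ _ N20 (ltac:(rewrite /M; linear)) (nl' u' su')).
rewrite normrN1 mul1r in D.
have db : forall i x, `|hh i x + -1 * hh' i x| <= d / (8 * C) by move=> i x; rewrite mulN1r.
have MM : 0 < M + M by exact: addr_gt0.
have d01 : 0 < M * e < 1 by have : 0 <= `|y0| by []; linear.
have bd x : `|e^-1 * (u x y0 + -1 * P y0) - e^-1 * (u' x y0 + -1 * P y0)| <= d / 4.
  have yI : `|y0| <= 1 - M * e by linear.
  have := CP (M + M) (M * e) _ _ _ MM d01 D db x y0 yI.
  rewrite (mulN1r (e^-1 * _)) (mulrDr C) => h; apply: (le_trans h).
  rewrite (_ : C * (d / (8 * C)) = d / 8); last by field; rewrite gt_eqF.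
  have -> : C * ((M + M) * (M * e)) = C * (2 * M * M) * e by ring.
  by linear.
have [x [x' xx]] := W e u (ltac:(by rewrite e0)) su; exists x, x'.
move: xx; rewrite !quotient_le //; have := bd x; have := bd x'; rewrite !ler_norml.
linear.
Qed.

(** The response to the sum is close to the response to [hh], which is nearly flat if [hh] does not
    wobble, plus [t] times the response to the sine datum, which oscillates by at least
    [kap / 2]. *)
Lemma wobble_dense La L2 L3 hh t : ~ (P1 1 = 0 /\ P1 (-1) = 0) -> t != 0 ->
  (forall i, datum La (hh i)) -> (forall i, datum L2 (sine_data P1 i)) ->
  (forall i, datum L3 (fun x => hh i x + t * sine_data P1 i x)) ->
  ~ wobble hh -> wobble (fun i x => hh i x + t * sine_data P1 i x).
Proof.
move=> P1n t0 hd sd hsd nW.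
have [C C0 CP] := nearlin_bound st Y_gt1 P P1 dP dP1.
have [kap [C' [kap0 C'0 RP]]] := sine_response st Y_gt1 P P1 dP dP1 y0 P1n y0_in.
have [N1 [e1 [N10 e10 S1]]] := psol_nearlin st Y_gt1 P P1 dP dP1 _ _ hd.
have [N2 [e2 [N20 e20 S2]]] := psol_nearlin st Y_gt1 P P1 dP dP1 _ _ sd.
have [N3 [e3 [N30 e30 S3]]] := psol_nearlin st Y_gt1 P P1 dP dP1 _ (fun i x => hh i x + t * sine_data P1 i x) hsd.
pose M := N1 + N2 + N3; have M0 : 0 < M by rewrite /M; linear.
have M1 : 1 <= M by rewrite /M; linear.
have y01 : `|y0| < 1 by rewrite ltr_norml y0_in.
have tk : 0 < `|t| * kap by rewrite mulr_gt0 // normr_gt0.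
have [e4 e40 h4] := small_step M ((1 - `|y0|)) (ltW M0) (ltac:(linear)).
have Ct : 0 <= C * ((2 + `|t|) * M) * M.
  by rewrite !mulr_ge0 ?(ltW C0) ?(ltW M0) //; have : 0 <= `|t| by []; linear.
have [e5 e50 h5] := small_step _ (`|t| * kap / 16) Ct (ltac:(linear)).
have C'M : 0 <= C' * M * M by rewrite !mulr_ge0 ?(ltW C'0) ?(ltW M0).
have [e7 e70 h7] := small_step _ (kap / 2) C'M (ltac:(linear)).
pose e6 := Num.min (Num.min (Num.min e1 e2) e3) (Num.min (Num.min e4 e5) e7).
have e60 : 0 < e6 by rewrite !lt_min e10 e20 e30 e40 e50.
have [l1 l2 l3] : [/\ e6 <= e1, e6 <= e2 & e6 <= e3] by rewrite !ge_min !lexx !orbT.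
have [l4 l5 l7] : [/\ e6 <= e4, e6 <= e5 & e6 <= e7] by rewrite !ge_min !lexx !orbT.
pose dl := M * e6.
have dl0 : 0 < dl by rewrite mulr_gt0.
have dly : dl < 1 - `|y0| by apply: le_lt_trans h4; rewrite ler_pM2l.
have yI : `|y0| <= 1 - dl by clearbody dl; linear.
have dl01 : 0 < dl < 1 by have : 0 <= `|y0| by []; clearbody dl; linear.
have small5 : C * ((2 + `|t|) * M * dl) <= `|t| * kap / 16.
  rewrite (_ : C * _ = C * ((2 + `|t|) * M) * M * e6); last by rewrite /dl; ring.
  by apply/ltW/(le_lt_trans _ h5); rewrite ler_wpM2l.
have small7 : C' * (M * dl) <= kap / 2.
  rewrite (_ : C' * _ = C' * M * M * e6); last by rewrite /dl; ring.
  by apply/ltW/(le_lt_trans _ h7); rewrite ler_wpM2l.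
have mono N e w g : 1 <= N -> N <= M -> 0 < e < e6 -> nearlin N (N * e) w g -> nearlin M dl w g.
  move=> n1 nM /andP[e0 e6l]; apply: nearlin_mono; [linear|exact: nM|by rewrite mulr_ge0 ?(ltW e0) //; linear|].
  by apply: ler_pM => //; [linear|exact: ltW|exact: ltW].
(* The negation of [wobble] yields flatness at one [ea] only. It serves for every [e < e6], since
   the responses at [ea] and at [e] solve the same linear problem up to errors governed by [dl]. *)
have [ea [u1 [eaI su1 flat]]] : exists ea u1, [/\ 0 < ea < e6, psol ea hh u1 &
    forall x x', e6 = e6 -> ea^-1 * (u1 x' y0 + -1 * P y0) - ea^-1 * (u1 x y0 + -1 * P y0) < `|t| * kap / 8].
  apply: contrapT => nex; apply: nW; exists (`|t| * kap / 8), e6; split => //; first linear.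
  move=> e u eI su; apply: contrapT => nxx; apply: nex; exists e, u; split => // x x' _.
  rewrite ltNge; apply/negP => h; apply: nxx; exists x, x'.
  by rewrite quotient_le //; have /andP[] := eI.
have nl1 := mono N1 ea _ _ N10 (ltac:(rewrite /M; linear)) eaI ((S1 ea (ltac:(linear))).2 u1 su1).
exists (`|t| * kap / 4), e6; split => //; first linear.
move=> e u3 eI su3; have e0 : 0 < e by linear.
have nl3 := mono N3 e _ _ N30 (ltac:(rewrite /M; linear)) eI ((S3 e (ltac:(linear))).2 u3 su3).
have [[u2 su2] S2'] := S2 e (ltac:(linear)).
have nl2 := mono N2 e _ _ N20 (ltac:(rewrite /M; linear)) eI (S2' u2 su2).
have resp := RP M dl _ M1 dl01 yI nl2.
have D := nearlin_lin _ _ (- t) _ _ _ _ _ _ _ (nearlin_lin _ _ (-1) _ _ _ _ _ _ _ nl3 nl1) nl2.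
have D0 : forall i x, `|(hh i x + t * sine_data P1 i x + -1 * hh i x) + - t * sine_data P1 i x| <= 0.
  by move=> i x; rewrite (_ : _ + _ = 0) ?normr0 //; ring.
have MM : M + `|-1| * M + `|- t| * M = (2 + `|t|) * M by rewrite normrN1 normrN; ring.
rewrite MM in D.
have M30 : 0 < (2 + `|t|) * M by rewrite mulr_gt0 //; have : 0 <= `|t| by []; linear.
pose w1 x := ea^-1 * (u1 x y0 + -1 * P y0); pose w2 x := e^-1 * (u2 x y0 + -1 * P y0).
pose w3 x := e^-1 * (u3 x y0 + -1 * P y0).
have bd x : `|w3 x + -1 * w1 x + - t * w2 x| <= `|t| * kap / 16.
  have := CP _ _ _ _ 0 M30 dl01 D D0 x y0 yI; rewrite add0r => h.
  exact: le_trans h small5.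
have fl x x' : w1 x' - w1 x < `|t| * kap / 8 := flat x x' erefl.
have resp' : kap / 2 <= w2 (pi / 2) - w2 0 by rewrite /w2; linear.
have wP x x' : (u3 x y0 + e * (`|t| * kap / 4) <= u3 x' y0) = (`|t| * kap / 4 <= w3 x' - w3 x).
  exact: quotient_le.
clear - wP fl resp' bd t0 kap0.
have := bd 0; have := bd (pi / 2); rewrite !ler_norml => b1 b2.
have := fl 0 (pi / 2); have := fl (pi / 2) 0 => f2 f3.
move: wP b1 b2 f2 f3 resp'; move: (w2 (pi / 2)) (w2 0) => a a' wP b1 b2 f2 f3 resp'.
case: (ltrgt0P t) t0 => // ht _ in b1 b2 f2 f3 wP *.
  exists 0, (pi / 2); rewrite wP.
  have : t * (kap / 2) <= t * (a - a') by rewrite ler_pM2l.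
  by linear.
exists (pi / 2), 0; rewrite wP.
have : (- t) * (kap / 2) <= (- t) * (a - a') by rewrite ler_pM2l // oppr_gt0.
by linear.
Qed.

End Wobble.

(** * Interior derivative estimates and the island of the perturbed flow *)

Section Interior.
Context {R : realType} {f f1 : R -> R} {b k Kf Lf Y v0 : R}.
Hypotheses (st : stable f f1 b k Kf Lf Y v0) (Y_gt1 : 1 < Y).
Implicit Types (u w : R -> R -> R) (x y t e l q c s N dl d r : R) (h : R -> R) (hh : bool -> R -> R).
Variables P P1 : R -> R.
Hypotheses (dP : forall y, is_derive y (1 : R) P (P1 y))
  (dP1 : forall y, is_derive y (1 : R) P1 (f (P (clamp 1 y)))).
Local Notation psol := (@psol R f P).
Variable y0 : R.
Hypothesis y0_in : -1 < y0 < 1.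
Ltac linear ::= try clear Y_gt1; try clear y0_in; linear_core.

Lemma derive_le_lip (g : R -> R) x a C : is_derive x (1 : R) g a ->
  (forall s, 0 < s -> `|g (x + s) - g x| <= C * s) -> `|a| <= C.
Proof.
move=> /is_deriveP dg lip; apply/ler_addgt0Pl => e e0; have [d d0 dgP] := dg e e0.
have s0 : 0 < d / 2 by rewrite divr_gt0.
have := dgP (d / 2); rewrite !(gtr0_norm s0) => /(_ (ltac:(linear))) h1; have h2 := lip _ s0.
have h3 : `|a * (d / 2)| <= (e + C) * (d / 2).
  have := ler_normB (g (x + d / 2) - g x) (g (x + d / 2) - g x - a * (d / 2)).
  by rewrite opprB addrCA subrr addr0; linear.
by move: h3; rewrite normrM (gtr0_norm s0) ler_pM2r.
Qed.

(** [grad_bound] is applied to [u - P] in both directions and to difference quotients of [u] in [x];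
    the second derivative in [y] then follows from the equation. The strip shrinks by [rho] at each
    of the two levels, starting from [3 * rho]. *)
Lemma psol_interior La hh rho : (forall i, datum La (hh i)) -> 0 < rho -> `|y0| + 3 * rho < 1 ->
  exists C e1, [/\ 0 < C, 0 < e1 & forall e u, 0 < e < e1 -> psol e hh u ->
    exists D1 D2, forall x y, `|y - y0| <= rho -> [/\ edge e hh false x < y < edge e hh true x,
      `|u x y - P y| <= C * e,
      forall i, dir_der i u x y (D1 i x y) /\ cont2 (D1 i) x y,
      is_derive y (1 : R) (D1 false x) (D2 x y) &
      [/\ `|D1 true x y| <= C * e, `|D1 false x y - P1 y| <= C * e & `|D2 x y - f (P y)| <= C * e]]].
Proof.
move=> hd rho0 y0rho; have La0 : 0 <= La.
  by have [h1 [h2 [_ _ _ /(_ 0)[+ _ _]]]] := hd true; exact: le_trans.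
have [C1 C10 CP] := psol_close st Y_gt1 P P1 dP dP1 La hh hd.
have Kf0 : 0 <= Kf := le_trans (normr_ge0 _) (st_le _ _ _ _ _ _ _ _ st 0).
pose N1 := Kf * C1 + 1.
pose C2 := 2 * C1 / rho + N1 * rho / 2.
have N10 : 0 < N1 by rewrite ltr_wpDl // mulr_ge0 // ltW.
have C20 : 0 < C2 by rewrite addr_gt0 ?divr_gt0 ?mulr_gt0.
pose N2 := Kf * C2 + 1.
pose C3 := 2 * C2 / rho + N2 * rho / 2.
have N20 : 0 < N2 by rewrite ltr_wpDl // mulr_ge0 // ltW.
have C30 : 0 < C3 by rewrite addr_gt0 ?divr_gt0 ?mulr_gt0.
pose C := C1 + C2 + C3 + N1.
have m0 : 0 < Num.min (Num.min (1 / 16) ((Y - 1) / 2)) (1 - (`|y0| + 3 * rho)).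
  by rewrite !lt_min; move: Y_gt1; linear.
exists C, (Num.min (Num.min (1 / 16) ((Y - 1) / 2)) (1 - (`|y0| + 3 * rho)) / (La + 1)); split.
- by rewrite /C; linear.
- by rewrite divr_gt0 //; linear.
move=> e u /andP[e0]; rewrite ltr_pdivlMr; last linear.
rewrite !lt_min => /andP[/andP[eL eY] er] su.
have eL' : e * La <= 1 / 16 by linear.
have eY' : e * La <= (Y - 1) / 2 by linear.
have CPe := CP e u e0 eL' eY' su.
have kG := edge_cont e hh false La (hd false); have kH := edge_cont e hh true La (hd true).
have [up cu [D1 [D2 [C2u eqn]]] uH uG] := su.
have insb x y : `|y - y0| <= 3 * rho -> edge e hh false x < y < edge e hh true x /\ -1 <= y <= 1.
  move=> yI; have h1 := edge_bound e hh false La x (ltW e0) (hd false).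
  have h2 := edge_bound e hh true La x (ltW e0) (hd true).
  have h3 : `|y| <= `|y0| + 3 * rho by have := ler_normD (y - y0) y0; rewrite subrK; linear.
  have h4 : 0 <= e * La by rewrite mulr_ge0 // ltW.
  by move: h1 h2 h3; rewrite !ler_norml /side => h1 h2 h3; split; linear.
have close x y : `|y - y0| <= 3 * rho -> `|u x y - P y| <= C1 * e.
  by move=> /(insb x)[h _]; apply: CPe; linear.
have C2P x y : `|y - y0| <= 3 * rho -> [/\ cont2 u x y,
    forall i, dir_der i u x y (D1 i x y) /\ cont2 (D1 i) x y &
    forall i j, dir_der j (D1 i) x y (D2 j i x y) /\ cont2 (D2 j i) x y].
  by move=> /(insb x)[h _]; exact: C2u.
pose w x y := u x y + -1 * P y.
have wP x y : `|y - y0| <= 3 * rho -> [/\ `|w x y| <= C1 * e, cont2 w x y &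
    exists2 l, lap w x y l & `|l| < N1 * e].
  move=> yI; have [ins yb] := insb x y yI; have [cu' _ _] := C2P x y yI; split.
  - by rewrite /w mulN1r; exact: close.
  - by apply: cont2_lin => //; apply: cont2_snd; exact: is_derive_cont (dP y).
  - exists (f (u x y) + -1 * f (P (clamp 1 y))).
      apply: lap_lin; first exact: lsol_lap kG kH su ins.
      exact: (lap_snd x (is_d2_glob dP (dP1 y))).
    have [q [_ q1 E]] := mean_slope st (u x y) (P y).
    rewrite clamp_id // mulN1r E normrM /N1 mulrDl mul1r.
    apply: (@le_lt_trans _ _ (Kf * C1 * e)); last by rewrite ltrDl.
    by rewrite -mulrA ler_pM //; exact: close.
have ball x x' y y' (r r' : R) : `|y - y0| <= r -> `|y' - y| <= r' -> `|y' - y0| <= r + r'.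
  by move=> h1 h2; have := ler_normD (y' - y) (y - y0); rewrite subrKA; linear.
have d1x x y : `|y - y0| <= 2 * rho -> `|D1 true x y| <= C2 * e.
  move=> yI; have yI3 : `|y - y0| <= 3 * rho by linear.
  have [_ /(_ true)[d _] _] := C2P x y yI3.
  have := @grad_bound R w x y rho (C1 * e) (N1 * e) (D1 true x y) rho0.
  rewrite (_ : C2 * e = 2 * (C1 * e) / rho + N1 * e * rho / 2); last first.
    by rewrite /C2; field; rewrite gt_eqF.
  apply; first by rewrite mulr_ge0 // ltW.
  - exact: mulr_gt0.
  - by move=> x' y' _ y'I; apply: wP; have := ball x x' y y' _ _ yI y'I; linear.
  - have := is_derive_lin (-1) d (is_derive_cst (P y) x 1).
    by rewrite mulr0 addr0.
have d1y x y : `|y - y0| <= 2 * rho -> `|D1 false x y - P1 y| <= C2 * e.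
  move=> yI; have yI3 : `|y - y0| <= 3 * rho by linear.
  have [_ /(_ false)[d _] _] := C2P x y yI3.
  have := @grad_bound R (fun s t => w t s) y x rho (C1 * e) (N1 * e) (D1 false x y - P1 y) rho0.
  rewrite (_ : C2 * e = 2 * (C1 * e) / rho + N1 * e * rho / 2); last first.
    by rewrite /C2; field; rewrite gt_eqF.
  apply; first by rewrite mulr_ge0 // ltW.
  - exact: mulr_gt0.
  - move=> y' x' y'I _; have [|h1 h2 [l h3 h4]] := wP x' y'.
      by have := ball x x' y y' _ _ yI y'I; linear.
    by split => //; [exact: cont2_swap|exists l => //; exact: lap_swap].
  - by have := is_derive_lin (-1) d (dP y); rewrite mulN1r.
have d2x x y : `|y - y0| <= rho -> `|D2 true true x y| <= C3 * e.
  move=> yI; have yI3 : `|y - y0| <= 3 * rho by linear.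
  have [_ _ /(_ true true)[d _]] := C2P x y yI3.
  apply: (derive_le_lip (fun t => D1 true t y) x) d _ => s s0.
  (* The quotient stands in for [D1 true], whose Laplacian would involve third derivatives. Its
     bounds are uniform in [s], so [D1 true] is Lipschitz in [x]. *)
  pose g x y := s^-1 * (u (s + 1 * x) y + -1 * u x y).
  have si : 0 < s^-1 by rewrite invr_gt0.
  have ulip x' y' : `|y' - y0| <= 2 * rho -> `|u (s + 1 * x') y' - u x' y'| <= C2 * e * s.
    move=> y'I; have := @lip_of_derive R (u^~ y') (D1 true ^~ y') x' (s + 1 * x') (C2 * e).
    rewrite (_ : s + 1 * x' - x' = s) ?(gtr0_norm s0); last by ring.
    apply; last by move=> t _; apply: d1x.
    by move=> t _; have [|_ /(_ true)[]] := C2P t y'; first linear.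
  have gb := @grad_bound R g x y rho (C2 * e) (N2 * e) (s^-1 * (D1 true (s + 1 * x) y - D1 true x y)) rho0.
  suff : `|s^-1 * (D1 true (s + 1 * x) y - D1 true x y)| <= C3 * e.
    by rewrite normrM (gtr0_norm si) mulrC ler_pdivrMr // mul1r (addrC s x).
  move: gb; rewrite (_ : 2 * (C2 * e) / rho + N2 * e * rho / 2 = C3 * e); last first.
    by rewrite /C3; field; rewrite gt_eqF.
  apply; first by rewrite mulr_ge0 // ltW.
  - exact: mulr_gt0.
  - move=> x' y' _ y'I; have y'I2 : `|y' - y0| <= 2 * rho by have := ball x x' y y' _ _ yI y'I; linear.
    have y'I3 : `|y' - y0| <= 3 * rho by linear.
    have [ins1 _] := insb (s + 1 * x') y' y'I3; have [ins2 _] := insb x' y' y'I3.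
    have [c1 _ _] := C2P (s + 1 * x') y' y'I3; have [c2 _ _] := C2P x' y' y'I3.
    split.
    + rewrite /g mulN1r normrM (gtr0_norm si) mulrC ler_pdivrMr //; exact: ulip.
    + by apply: cont2_scale; apply: cont2_lin => //; exact: cont2_affine.
    exists (s^-1 * (f (u (s + 1 * x') y') + -1 * f (u x' y'))).
      apply/lap_scale/lap_lin; last exact: lsol_lap kG kH su ins2.
      by apply: lap_affine; [rewrite expr1n|exact: lsol_lap kG kH su ins1].
    have [q [_ q1 E]] := mean_slope st (u (s + 1 * x') y') (u x' y').
    rewrite mulN1r E normrM (gtr0_norm si) mulrC ltr_pdivrMr //.
    apply: (@le_lt_trans _ _ (Kf * (C2 * e * s))); first by rewrite normrM ler_pM // ulip.
    rewrite /N2 (_ : Kf * _ = Kf * C2 * e * s); last by ring.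
    by rewrite ltr_pM2r // ltr_pM2r // ltrDl.
  - have [|_ /(_ true)[dx1 _] _] := C2P (s + 1 * x) y; first linear.
    have [_ /(_ true)[dx2 _] _] := C2P x y yI3.
    have := is_derive_lin (-1) (is_derive_affine s 1 dx1) dx2.
    by rewrite mul1r mulN1r; exact: is_derive_scale.
exists D1, (D2 false false) => x y yI.
have yI3 : `|y - y0| <= 3 * rho by linear.
have yI2 : `|y - y0| <= 2 * rho by linear.
have [ins yb] := insb x y yI3; have [cu' h1 h2] := C2P x y yI3.
have le1 : C1 * e <= C * e by rewrite ler_wpM2r ?(ltW e0) // /C; linear.
have le2 : C2 * e <= C * e by rewrite ler_wpM2r ?(ltW e0) // /C; linear.
split => //; first by apply: le_trans (close x y yI3) le1.
  by have [] := h2 false false.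
split; first by apply: le_trans (d1x x y yI2) le2.
  by apply: le_trans (d1y x y yI2) le2.
have -> : D2 false false x y - f (P y) = (f (u x y) - f (P y)) - D2 true true x y.
  by rewrite -(eqn x y ins); ring.
apply: le_trans (ler_normB _ _) _.
have [q [_ q1 ->]] := mean_slope st (u x y) (P y).
have h3 : `|q * (u x y - P y)| <= Kf * (C1 * e) by rewrite normrM ler_pM // close.
have := d2x x y yI; have : (C3 + N1) * e <= C * e by rewrite ler_wpM2r ?(ltW e0) // /C; linear.
by rewrite /N1; linear.
Qed.

Lemma psol_island La hh : (forall i, datum La (hh i)) -> P1 y0 = 0 -> f (P y0) != 0 ->
  wobble (f := f) P y0 hh -> exists c e1, [/\ 0 < c, 0 < e1 &
    forall e u (G H : torus R -> R) psi, 0 < e < e1 -> psol e hh u ->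
      lift1 G = edge e hh false -> lift1 H = edge e hh true ->
      (forall x y, psi (to_torus x, y) = u x y) ->
      exists2 U, island G H psi U & c * Num.sqrt e <= height U].
Proof.
move=> hd P10 fP0 [d [e1 [d0 e10 W]]].
have [sig [sig1 sig2 sigA]] : exists sig : R, [/\ sig = 1 \/ sig = -1, sig * sig = 1 & 0 < sig * f (P y0)].
  move: fP0; rewrite neq_lt => /orP[h|h]; [exists (-1)|exists 1]; rewrite ?mulrNN mulr1 ?mulN1r ?mul1r ?oppr_gt0;
    by split; [|by []..|]; [by [right|left]|].
pose A := sig * f (P y0).
have A0 : 0 < A by [].
have Kf0 : 0 <= Kf := le_trans (normr_ge0 _) (st_le _ _ _ _ _ _ _ _ st 0).
have [Cp Cp0 [_ PL _]] := profile_bounds st P P1 dP dP1.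
have KC : 0 <= Kf * Cp by rewrite mulr_ge0 // ltW.
have y01 : `|y0| < 1 by rewrite ltr_norml y0_in.
have [rho1 rho10 hrho1] := small_step (Kf * Cp) (A / 4) KC (ltac:(linear)).
(* For [|y - y0| <= rho] the value [sig * f (P y)] is within [A / 4] of [A]. Together with
   [C * e <= A / 4] this gives the bounds [A / 2] and [2 * A] for the second derivative. *)
pose rho := Num.min rho1 ((1 - `|y0|) / 4).
have rho0 : 0 < rho by rewrite lt_min rho10; linear.
have rho_le : rho <= rho1 by rewrite ge_min lexx.
have rho_y : rho <= (1 - `|y0|) / 4 by rewrite ge_min lexx orbT.
have y0rho : `|y0| + 3 * rho < 1 by clearbody rho; linear.
have yb y : `|y - y0| <= rho -> -1 <= y <= 1.
  by move=> yI; rewrite -ler_norml; have := ler_normD (y - y0) y0; rewrite subrK; clearbody rho; linear.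
have fb y : `|y - y0| <= rho -> `|sig * f (P y) - A| <= A / 4.
  move=> yI; rewrite /A -mulrBr normrM.
  have -> : `|sig| = 1 by case: sig1 => ->; rewrite ?normrN1 ?normr1.
  have [q [_ q1 ->]] := mean_slope st (P y) (P y0); rewrite mul1r normrM.
  have h1 := PL y y0 (ltac:(have := yb y yI; linear)) (ltac:(have := y0_in; linear)).
  apply: (@le_trans _ _ (Kf * (Cp * rho))).
    apply: ler_pM => //; apply: le_trans h1 _; rewrite ler_wpM2l //; exact: ltW.
  apply/ltW/(le_lt_trans _ hrho1); rewrite mulrA ler_wpM2l //.
have [C [e2 [C0 e20 I]]] := psol_interior La hh rho hd rho0 y0rho.
have [e3 e30 h3] := small_step C (A / 4) (ltW C0) (ltac:(linear)).
have A8 : 0 < A / 8 * rho ^+ 2 by rewrite mulr_gt0 ?exprn_gt0 //; linear.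
(* For [e < e4] the rise [A / 4 * rho ^+ 2] of [sig * P] from [y0] to the edge of the strip beats
   twice the error [C * e]. *)
have [e4 e40 h4] := small_step C (A / 8 * rho ^+ 2) (ltW C0) A8.
have C2 : 0 <= C ^+ 2 by exact: sqr_ge0.
have Ad : 0 < A / 2 * d by rewrite mulr_gt0 //; linear.
have [e5 e50 h5] := small_step (C ^+ 2) (A / 2 * d) C2 Ad.
exists (Num.sqrt (d / 2 / (2 * A))), (Num.min (Num.min e1 e2) (Num.min e3 (Num.min e4 e5))).
split; first by rewrite sqrtr_gt0 !divr_gt0 // mulr_gt0.
  by rewrite !lt_min e10 e20 e30 e40.
move=> e u G H psi /andP[e0]; rewrite !lt_min => /andP[/andP[l1 l2] /and3P[l3 l4 l5]] su GE HE psiE.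
have [D1 [D2 IP]] := I e u (ltac:(by rewrite e0)) su.
have Ce3 : C * e <= A / 4 by apply/ltW/(le_lt_trans _ h3); rewrite ler_wpM2l ?ltW.
have Ce4 : C * e < A / 8 * rho ^+ 2 by apply/(le_lt_trans _ h4); rewrite ler_wpM2l ?ltW.
have Ce5 : C ^+ 2 * e <= A / 2 * d by apply/ltW/(le_lt_trans _ h5); rewrite ler_wpM2l // ltW.
have sigN z : `|sig * z| = `|z| by case: sig1 => ->; rewrite ?mul1r // mulN1r normrN.
have sigM z : sig * (sig * z) = z by rewrite mulrA sig2 mul1r.
pose v x y := sig * u x y.
have y0I : `|y0 - y0| <= rho by rewrite subrr normr0 ltW.
have vyy x y : `|y - y0| <= rho -> A / 2 <= sig * D2 x y <= 2 * A.
  move=> yI; have [_ _ _ _ [_ _ h]] := IP x y yI; have := fb y yI.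
  rewrite -sigN mulrBr in h; move: h; rewrite !ler_norml; clearbody A; linear.
have vy x y : `|y - y0| <= rho -> [/\ is_derive y (1 : R) (v x) (sig * D1 false x y),
    is_derive y (1 : R) (fun t => sig * D1 false x t) (sig * D2 x y) & A / 2 <= sig * D2 x y <= 2 * A].
  move=> yI; have [_ _ /(_ false)[h1 _] h2 _] := IP x y yI.
  by split; [exact: is_derive_scale|exact: is_derive_scale|exact: vyy].
have itv t : y0 - rho <= t <= y0 + rho -> `|t - y0| <= rho by rewrite ler_norml; linear.
have [x1 [x2 osc]] : exists x1 x2, v x1 y0 + e * d <= v x2 y0.
  have [x [x' xx]] := W e u (ltac:(by rewrite e0)) su.
  case: sig1 => sE; [exists x, x'|exists x', x]; rewrite /v sE ?mul1r ?mulN1r //; linear.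
have A20 : 0 < A / 2 by clearbody A; linear.
have AA : A / 2 <= 2 * A by clearbody A; linear.
have Ce0 : 0 <= C * e by rewrite mulr_ge0 // ltW.
have ed0 : 0 < e * d / 2 by rewrite divr_gt0 // mulr_gt0.
have sig_n0 : sig != 0 by apply: contraTneq sigA => ->; rewrite mul0r ltxx.
have [up _ _ _ _] := su.
have v_per x y : v (x + 2 * pi) y = v x y by rewrite /v up.
have strip x y : `|y - y0| <= rho ->
    channel G H (Defs.cover (x, y)) /\ psi (Defs.cover (x, y)) = sig * v x y.
  move=> yI; have [ins _ _ _ _] := IP x y yI; split; last by rewrite psiE /v sigM.
  rewrite /channel /= -[G _]/(lift1 G x) -[H _]/(lift1 H x) GE HE; linear.
have vx x y : `|y - y0| <= rho -> [/\ is_derive x (1 : R) (v^~ y) (sig * D1 true x y),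
    `|sig * D1 true x y| <= C * e & cont2 (fun x y => sig * D1 true x y) x y].
  move=> yI; have [_ _ /(_ true)[h1 h2] _ [h _ _]] := IP x y yI.
  by split; [exact: is_derive_scale|rewrite sigN|exact: cont2_scale].
have vP x y : `|y - y0| <= rho -> `|v x y - sig * P y| <= C * e.
  by move=> yI; have [_ h _ _ _] := IP x y yI; rewrite /v -mulrBr sigN.
have Pgap q : q = y0 - rho \/ q = y0 + rho -> A / 4 * rho ^+ 2 <= sig * P q - sig * P y0.
  move=> qE; have q2 : (q - y0) ^+ 2 = rho ^+ 2 by case: qE => ->; ring.
  have b1 : y0 - rho <= y0 <= y0 + rho by clearbody rho; linear.
  have b2 : y0 - rho <= q <= y0 + rho by clearbody rho; case: qE => ->; linear.
  have dg t : y0 - rho <= t <= y0 + rho -> is_derive t (1 : R) (fun t => sig * P t) (sig * P1 t) /\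
      is_derive t (1 : R) (fun t => sig * P1 t) (sig * f (P (clamp 1 t))).
    by move=> _; split; apply: is_derive_scale.
  have gb t : y0 - rho <= t <= y0 + rho -> A / 2 <= sig * f (P (clamp 1 t)) <= 2 * A.
    move=> /itv tI; rewrite clamp_id ?yb //; have := fb t tI; rewrite ler_norml; clearbody A; linear.
  have := taylor_bounds _ _ _ _ _ _ _ _ _ AA dg gb b1 b2.
  rewrite P10 mulr0 mul0r subr0 q2 => /andP[h _]; apply: le_trans h.
  by rewrite le_eqVlt; apply/orP; left; apply/eqP; clearbody A; field.
have edge x x' : v x' y0 < v x (y0 - rho) /\ v x' y0 < v x (y0 + rho).
  have h0 := vP x' y0 y0I.
  have gap q : q = y0 - rho \/ q = y0 + rho -> v x' y0 < v x q.
    move=> qE; have qI : `|q - y0| <= rho by apply: itv; clearbody rho; case: qE => ->; linear.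
    have := vP x q qI; have := Pgap q qE; move: h0; rewrite !ler_norml; clearbody A v rho; linear.
  by split; apply: gap; [left|right].
(* Over the high point the minimum in [y] may undercut the value at [y0]. The slope there is at most
   [C * e], so by completing the square the loss is at most [(C * e) ^+ 2 / A <= e * d / 2], and
   half of the oscillation survives. *)
have below y : `|y - y0| <= rho -> v x1 y0 + e * d / 2 <= v x2 y.
  move=> yI; have b1 : y0 - rho <= y0 <= y0 + rho by clearbody rho; linear.
  have b2 : y0 - rho <= y <= y0 + rho by move: yI; rewrite ler_norml; clearbody rho; linear.
  have dg t : y0 - rho <= t <= y0 + rho -> is_derive t (1 : R) (v x2) (sig * D1 false x2 t) /\
      is_derive t (1 : R) (fun t => sig * D1 false x2 t) (sig * D2 x2 t).
    by move=> /itv tI; have [] := vy x2 t tI.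
  have := taylor_bounds _ _ _ _ _ _ _ _ _ AA dg (fun t tI => vyy x2 t (itv t tI)) b1 b2.
  have [_ _ _ _ [_ + _]] := IP x2 y0 y0I; rewrite P10 subr0 -sigN.
  move: (sig * D1 false x2 y0) (y - y0) => p s ps /andP[lo _].
  have h1 : - (C * e * `|s|) <= p * s.
    have : `|p * s| <= C * e * `|s| by rewrite normrM ler_wpM2r.
    by rewrite ler_norml => /andP[].
  have h2 : 0 <= (A / 2 * `|s| - C * e) ^+ 2 by exact: sqr_ge0.
  have g3 : s ^+ 2 = `|s| ^+ 2 by rewrite real_normK // num_real.
  have g4 : C ^+ 2 * e * e <= A / 2 * d * e by rewrite ler_pM2r.
  have g5 : 0 <= A * (A / 4 * `|s| ^+ 2 - C * e * `|s| + e * d / 2).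
    rewrite (_ : A * _ = (A / 2 * `|s| - C * e) ^+ 2 + (A / 2 * d * e - C ^+ 2 * e * e)).
      by rewrite addr_ge0 // subr_ge0.
    by clearbody A; field.
  have g6 : 0 <= A / 4 * `|s| ^+ 2 - C * e * `|s| + e * d / 2 by rewrite pmulr_rge0 in g5.
  by move: lo; rewrite g3; clearbody A v; linear.
have [U isl hU] := valley_island G H psi sig v _ _ _ y0 rho _ _ _ x1 x2 _ sig_n0 rho0 A20 AA Ce0 ed0
  v_per strip vx vy edge below.
exists U => //; apply: le_trans hU.
have dA : 0 < d / 2 / (2 * A) by rewrite !divr_gt0 // mulr_gt0.
rewrite -(sqrtrM _ (ltW dA)).
rewrite le_eqVlt; apply/orP; left; apply/eqP; congr Num.sqrt.
by field; rewrite gt_eqF.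
Qed.

End Interior.

(** * The wall data *)

Section Regularity.
Context {R : realType}.
Implicit Types (a c x y t La : R) (h : torus R -> R).
Local Notation T := (torus R).

Lemma derive1_fun (g g1 : R -> R) : (forall x, is_derive x (1 : R) g (g1 x)) -> derive1 g = g1.
Proof. by move=> dg; apply/funext => x; rewrite derive1E; have [_] := dg x. Qed.

Lemma continuously_differentiable2 (g : R -> R) : continuously_differentiable 2 g ->
  [/\ forall x, is_derive x (1 : R) g (derive1n 1 g x),
      forall x, is_derive x (1 : R) (derive1n 1 g) (derive1n 2 g x) & continuous (derive1n 2 g)].
Proof.
move=> [dg cg]; split; [move=> x|move=> x|exact: cg].
  have d := derivableP (dg 0%N isT x); rewrite -derive1E in d; exact: d.
have d := derivableP (dg 1%N isT x); rewrite -derive1E in d; exact: d.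
Qed.

Lemma C2alpha_intro a h (g g1 g2 : R -> R) C : lift1 h = g ->
  (forall x, is_derive x (1 : R) g (g1 x)) -> (forall x, is_derive x (1 : R) g1 (g2 x)) ->
  continuous g2 -> (forall x y, `|g2 x - g2 y| <= C * `|x - y| `^ a) -> C2alpha a h.
Proof.
move=> hg d1 d2 c2 hol; have E1 := derive1_fun g g1 d1; have E2 := derive1_fun g1 g2 d2.
have D0 : derive1n 0 g = g by [].
have D1 : derive1n 1 g = g1 by [].
have D2 : derive1n 2 g = g2 by rewrite /= E1.
split; last by exists C => x y; rewrite hg D2.
split; last by rewrite hg D2.
move=> [|[|//]] _ x; rewrite hg ?D0 ?D1; first by have [] := d1 x.
by have [] := d2 x.
Qed.

Lemma lift1_per h x : lift1 h (x + 2 * pi) = lift1 h x.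
Proof. by rewrite /lift1 /= to_torus_per. Qed.

Lemma derive_per (g g1 : R -> R) : (forall x, g (x + 2 * pi) = g x) ->
  (forall x, is_derive x (1 : R) g (g1 x)) -> forall x, g1 (x + 2 * pi) = g1 x.
Proof.
move=> gp dg x; have d := is_derive_affine (2 * pi) 1 (dg (2 * pi + 1 * x)).
have E : is_derive x (1 : R) g (1 * g1 (2 * pi + 1 * x)).
  by apply: is_derive_near d; near=> t; rewrite mul1r addrC gp.
by have := is_derive_uniq E (dg x); rewrite !mul1r addrC.
Unshelve. all: by end_near. Qed.

Lemma periodic_bounded (g : R -> R) : continuous g -> (forall x, g (x + 2 * pi) = g x) ->
  exists2 C : R, 0 <= C & forall x, `|g x| <= C.
Proof.
move=> cg gp; have pi2 : 0 <= 2 * pi :> R by rewrite mulr_ge0 // pi_ge0.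
have [C C0 CP] := continuous_bounded_itv g 0 (2 * pi) pi2 cg.
exists C => // x; have [n nI] := window_shift 0 x; rewrite -(per_int g gp n).
by apply: CP; linear.
Qed.

Lemma datum_mono La La' (g : R -> R) : La <= La' -> datum La g -> datum La' g.
Proof.
move=> LL [g1 [g2 [gp d1 d2 b]]]; exists g1, g2; split => // x.
by have [b1 b2 b3] := b x; split; apply: le_trans LL.
Qed.

Lemma C2alpha_datum a h : C2alpha a h -> exists2 La, 0 <= La & datum La (lift1 h).
Proof.
move=> [/continuously_differentiable2[d1 d2 c2] _].
have hp := lift1_per h; have hp1 := derive_per _ _ hp d1; have hp2 := derive_per _ _ hp1 d2.
have [C0 C00 b0] := periodic_bounded _ (fun x => is_derive_cont (d1 x)) hp.
have [C1 C10 b1] := periodic_bounded _ (fun x => is_derive_cont (d2 x)) hp1.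
have [C2 C20 b2] := periodic_bounded _ c2 hp2.
exists (C0 + C1 + C2); first by rewrite !addr_ge0.
exists (derive1n 1 (lift1 h)), (derive1n 2 (lift1 h)); split => // x.
by split; [have := b0 x|have := b1 x|have := b2 x]; linear.
Qed.

(** If [S] has no supremum, [sup S] is 0 by convention. *)
Lemma sup_ge0 (S : set R) : (forall x, S x -> 0 <= x) -> 0 <= sup S.
Proof.
move=> S0; have [hs|/sup_out -> //] := pselect (has_sup S).
have [[x Sx] ub] := hs; exact: le_trans (S0 x Sx) (ub_le_sup ub Sx).
Qed.

Lemma sup_norm_ge0 (g : R -> R) : 0 <= sup_norm g.
Proof. by apply: sup_ge0 => _ [x _ <-]. Qed.

Lemma holder_ge0 a (g : R -> R) : 0 <= holder_seminorm a g.
Proof. by apply: sup_ge0 => _ [x [y [_ ->]]]; rewrite divr_ge0 ?powR_ge0. Qed.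

(** The bound [C] guards against the default value of [sup] on an unbounded set and does not enter
    the estimate. *)
Lemma le_C2alpha_norm a h C : (forall x, `|lift1 h x| <= C) ->
  forall x, `|lift1 h x| <= C2alpha_norm a h.
Proof.
move=> hC x; have : `|lift1 h x| <= sup_norm (lift1 h).
  by apply: ub_le_sup; [exists C => _ [t _ <-]|exists x].
move=> le; apply: (le_trans le); rewrite /C2alpha_norm big_ord_recl /= -addrA lerDl.
rewrite addr_ge0 ?holder_ge0 // sumr_ge0 // => i _; exact: sup_norm_ge0.
Qed.

Lemma sin_lip x y : `|sin x - sin y| <= `|x - y|.
Proof.
rewrite -[leRHS]mul1r; apply: (@lip_of_derive _ sin cos y x 1 (fun t _ => is_derive_sin t)) => t _.
by rewrite ler_norml cos_geN1 cos_le1.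
Qed.

(** Up to distance 1 the Lipschitz bound is the stronger one, and beyond it the difference of two
    sines is at most 2. *)
Lemma sin_holder a x y : 0 < a < 1 -> `|sin x - sin y| <= 2 * `|x - y| `^ a.
Proof.
move=> aI; have [xy|xy] := eqVneq x y.
  by rewrite xy !subrr normr0 mulr_ge0 ?powR_ge0.
have d0 : 0 < `|x - y| by rewrite normr_gt0 subr_eq0.
have p0 : 0 <= `|x - y| `^ a by exact: powR_ge0.
have [d1|d1] := leP `|x - y| 1.
  have : `|x - y| `^ 1 <= `|x - y| `^ a by apply: ger_powR; [rewrite d0|linear].
  by rewrite powRr1 //; have := sin_lip x y; linear.
have : `|x - y| `^ 0 <= `|x - y| `^ a by apply: ler_powR; linear.
rewrite powRr0 => h; apply: le_trans (ler_normB _ _) _.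
have := sin_le1 x; have := sin_geN1 x; have := sin_le1 y; have := sin_geN1 y.
have n (z : R) : -1 <= sin z -> sin z <= 1 -> `|sin z| <= 1 by rewrite ler_norml => -> ->.
by move=> s1 s2 s3 s4; have := n x s3 s4; have := n y s1 s2; linear.
Qed.

Lemma scaled_sin_derive c : [/\ forall x, is_derive x (1 : R) (fun x => c * sin x) (c * cos x),
  forall x, is_derive x (1 : R) (fun x => c * cos x) (c * - sin x) &
  continuous (fun x => c * - sin x)].
Proof.
split => x; [exact: is_derive_scale (is_derive_sin x)|exact: is_derive_scale (is_derive_cos x)|].
by apply: cvgMr; apply: cvgN; exact: is_derive_cont (is_derive_sin x).
Qed.

(** The 5 collects three sup norms of at most [|c|] and a Hoelder seminorm of at most [2 * |c|]. *)
Lemma sin_C2alpha_norm a c h : 0 < a < 1 -> lift1 h = (fun x => c * sin x) ->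
  C2alpha_norm a h <= 5 * `|c|.
Proof.
move=> aI hE; have [d1 d2 _] := scaled_sin_derive c.
have E1 := derive1_fun _ _ d1; have E2 := derive1_fun _ _ d2.
have sb (z : R) : `|sin z| <= 1 by rewrite ler_norml sin_geN1 sin_le1.
have cb (z : R) : `|cos z| <= 1 by rewrite ler_norml cos_geN1 cos_le1.
have supb (g : R -> R) : (forall x, `|g x| <= 1) -> sup_norm (fun x => c * g x) <= `|c|.
  move=> gb; apply: ge_sup; first by exists `|c * g 0|, 0.
  by move=> _ [x _ <-]; rewrite normrM ler_piMr.
rewrite /C2alpha_norm hE !big_ord_recl big_ord0 addr0 /= E1 E2.
have h1 := supb sin sb; have h2 := supb cos cb.
have h3 := supb (fun x => - sin x) (fun x => ltac:(rewrite normrN; exact: sb x)).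
suff : holder_seminorm a (fun x => c * - sin x) <= 2 * `|c| by linear.
apply: ge_sup; first by exists (`|c * - sin 1 - c * - sin 0| / `|1 - 0| `^ a), 1, 0; rewrite oner_neq0.
move=> _ [x [y [xy ->]]]; rewrite ler_pdivrMr ?powR_gt0 ?normr_gt0 ?subr_eq0 //.
rewrite (_ : c * - sin x - c * - sin y = - c * (sin x - sin y)); last by ring.
rewrite normrM normrN (mulrC 2) -mulrA; apply: ler_wpM2l => //.
exact: (sin_holder a x y aI).
Qed.

Definition torus_sin : T -> R := fun p => sin (repr p).

Lemma torus_sinE x : torus_sin (to_torus x) = sin x.
Proof.
apply: (torus_fun sin) => [t|]; last exact: reprK.
by have := sinD2pi t; rewrite mulr2n mulrDl mul1r.
Qed.

Lemma datum_sin c : datum `|c| (fun x => c * sin x).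
Proof.
have [d1 d2 _] := scaled_sin_derive c.
exists (fun x => c * cos x), (fun x => c * - sin x); split => // x.
  by rewrite -!torus_sinE to_torus_per.
by rewrite !normrM normrN; split; rewrite ler_piMr // ler_norml
  ?sin_geN1 ?sin_le1 ?cos_geN1 ?cos_le1.
Qed.

Lemma C2alpha_add_sin a c h : 0 < a < 1 -> C2alpha a h ->
  C2alpha a (fun p => h p + c * torus_sin p).
Proof.
move=> aI [/continuously_differentiable2[d1 d2 c2] [C hol]].
have [s1 s2 s3] := scaled_sin_derive c.
apply: (C2alpha_intro _ _ (fun x => lift1 h x + 1 * (c * sin x))
  (fun x => derive1n 1 (lift1 h) x + 1 * (c * cos x))
  (fun x => derive1n 2 (lift1 h) x + 1 * (c * - sin x)) (C + 2 * `|c|)).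
- by apply/funext => x; rewrite /lift1 /= torus_sinE mul1r.
- by move=> x; apply: cvgD; [exact: c2|apply: cvgMr; exact: s3].
have split_sin p q t u : p + 1 * (c * - t) - (q + 1 * (c * - u)) = p - q + - c * (t - u) by ring.
move=> x y; rewrite split_sin.
apply: le_trans (ler_normD _ _) _; rewrite mulrDl; apply: lerD; first exact: hol.
rewrite normrM normrN (mulrC 2) -mulrA; apply: ler_wpM2l => //.
exact: (sin_holder a x y aI).
Qed.

End Regularity.

(** * Pairs of walls *)

Section Walls.
Context {R : realType}.
Implicit Types (x y : R).
Local Notation T := (torus R).

Definition walls (p : (T -> R) * (T -> R)) (i : bool) : R -> R :=
  if i then lift1 p.2 else lift1 p.1.

Lemma walls_datum a (p : (T -> R) * (T -> R)) : C2alpha a p.1 -> C2alpha a p.2 ->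
  exists La, forall i, datum La (walls p i).
Proof.
move=> /C2alpha_datum[L1 L10 d1] /C2alpha_datum[L2 L20 d2].
by exists (L1 + L2); case; [apply: datum_mono d2|apply: datum_mono d1]; linear.
Qed.

(** It carries the stability of [wobble], which is measured in the sup norm, over to the topology of
    the data. *)
Lemma walls_dist a (p q : (T -> R) * (T -> R)) :
  C2alpha a p.1 -> C2alpha a p.2 -> C2alpha a q.1 -> C2alpha a q.2 ->
  forall i x, `|walls p i x - walls q i x| <= C2alpha_dist a p q.
Proof.
move=> p1 p2 q1 q2; have [L1 d1] := walls_datum a p p1 p2; have [L2 d2] := walls_datum a q q1 q2.
have bd i x : `|walls p i x - walls q i x| <= L1 + L2.
  have [h1 [h2 [_ _ _ /(_ x)[b1 _ _]]]] := d1 i; have [h3 [h4 [_ _ _ /(_ x)[b2 _ _]]]] := d2 i.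
  by apply: le_trans (ler_normB _ _) _; exact: lerD.
have n0 (h : T -> R) : 0 <= C2alpha_norm a h.
  by rewrite addr_ge0 ?holder_ge0 // sumr_ge0 // => j _; exact: sup_norm_ge0.
have n1 x := le_C2alpha_norm a (p.1 \- q.1) (L1 + L2) (bd false) x.
have n2 x := le_C2alpha_norm a (p.2 \- q.2) (L1 + L2) (bd true) x.
move=> [] x; first exact: (ler_wpDl (n0 (p.1 \- q.1)) (n2 x)).
exact: (ler_wpDr (n0 (p.2 \- q.2)) (n1 x)).
Qed.

(** The zero function is treated as [0 * sin x]. *)
Lemma dist_refl a (p : (T -> R) * (T -> R)) : 0 < a < 1 -> C2alpha_dist a p p <= 0.
Proof.
move=> aI; have z (h : T -> R) : C2alpha_norm a (h \- h) <= 0.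
  have := sin_C2alpha_norm a 0 (h \- h) aI; rewrite normr0 mulr0; apply.
  by apply/funext => x; rewrite mul0r /lift1 /= subrr.
by rewrite /C2alpha_dist -[leRHS]addr0 lerD.
Qed.

Lemma lsol_bounded (F : R -> R) cG cH u : lsol F cG cH (fun=> -1) (fun=> 1) u ->
  exists2 M : R, 0 <= M & forall x y, -1 <= y <= 1 -> `|u x y| <= M.
Proof.
move=> [up cu _ _ _]; have c1 (a : R) : continuous (fun _ : R => a) by move=> z; exact: cvg_cst.
have cK : compact (closed_in (fun=> -1) (fun=> 1) `&` [set z : R * R | 0 <= z.1 <= 2 * pi /\ -1 <= z.2 <= 1]).
  by apply: (@channel_cell R 1).
have [||p _ pM] := @compact_EVT_max _ _ (fun z => `|uc u z|) _ _ cK.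
- exists (0, 0); split; rewrite /closed_in /=; first linear.
  by have := pi_ge0 R; split; linear.
- have /(continuous_subspaceW (@subIsetl _ _ _))/subspace_continuousP cu' := cu.
  by apply/subspace_continuousP => z Kz; apply: cvg_norm; exact: cu'.
exists `|uc u p| => // x y yI; have [n nI] := window_shift 0 x.
have := pM (x + 2 * pi * n%:~R, y); rewrite /uc /= (per_int (u^~ y)) // inE; apply.
by split => //; split => //=; linear.
Qed.

End Walls.

(** * From the hypotheses to the truncated problem and back *)

Section Assembly.
Context {R : realType}.
Implicit Types (x y t e : R) (u : R -> R -> R).
Local Notation T := (torus R).
Local Notation strip := (channel (cst (-1)) (cst 1) : set (T * R)).

Lemma flat_setup (F : R -> R) (cG cH lam : R) (psi0 : T * R -> R) :
  continuously_differentiable 4 F -> first_dirichlet_eigenvalue (cst (-1)) (cst 1) lam ->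
  (forall s, - lam < derive1 F s) -> is_solution F cG cH (cst (-1)) (cst 1) psi0 ->
  nonconstant_on strip psi0 -> (exists z : R * R, -1 < z.2 < 1 /\ stagnation_point psi0 z) ->
  exists f f1 b k Kf Lf Y v0 P P1 y0 M,
    [/\ stable f f1 b k Kf Lf Y v0, 1 < Y, forall y, is_derive y (1 : R) P (P1 y) &
        forall y, is_derive y (1 : R) P1 (f (P (clamp 1 y)))] /\
    [/\ P (-1) = cG, P 1 = cH, forall x y, -1 <= y <= 1 -> psi0 (to_torus x, y) = P y,
        forall t, - M <= t <= M -> f t = F t & forall y, -1 <= y <= 1 -> `|P y| <= M - 2] /\
    [/\ -1 < y0 < 1, P1 y0 = 0, f (P y0) != 0 & ~ (P1 1 = 0 /\ P1 (-1) = 0)].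
Proof.
move=> [dF cF] [_ lmin] Fl sol [p [q [pS qS pq]]] [[x0 y0] [/= y0I [_ dy0]]].
have c1 (a : R) : continuous (fun _ : R => a) by move=> z; exact: cvg_cst.
have su := solution_lift F cG cH (cst (-1)) (cst 1) psi0 (c1 _) (c1 _) sol.
have [M0 M00 M0P] := lsol_bounded F cG cH _ su.
have dF0 t : is_derive t (1 : R) F (derive1n 1 F t).
  by have d := derivableP (dF 0%N isT t); rewrite -derive1E in d; exact: d.
have dF1 t : is_derive t (1 : R) (derive1n 1 F) (derive1n 2 F t).
  by have d := derivableP (dF 1%N isT t); rewrite -derive1E in d; exact: d.
have cF2 : continuous (derive1n 2 F).
  by move=> t; have d := derivableP (dF 2%N isT t); exact: is_derive_cont d.
(* The margin 2 beyond the bound [M0] of [psi0] keeps every function within distance 1 of [psi0] in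
   the range where [f = F]. *)
have [|f [f1 [b [k [Kf [Lf [Y [v0 [st Y1 fF]]]]]]]]] :=
  truncation F (derive1n 1 F) (derive1n 2 F) (M0 + 2) lam _ (lmin _ strip_eigenvalue) dF0 dF1 cF2 Fl.
  by linear.
have su' : lsol f cG cH (fun=> -1) (fun=> 1) (fun x y => psi0 (to_torus x, y)).
  apply: (lsol_eq F) su => x y yI; rewrite fF //.
  have yI' : -1 <= y <= 1 by move: yI; rewrite /lift1 /=; linear.
  by have := M0P x y yI'; rewrite ler_norml; linear.
have [P [P1 [dP dP1 uP]]] := flat_profile st Y1 cG cH _ su'.
have [_ _ _ uH uG] := su'.
exists f, f1, b, k, Kf, Lf, Y, v0, P, P1, y0, (M0 + 2); split; first by split.
split.
  split => //.
  - by rewrite -(uP 0) ?uG //; linear.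
  - by rewrite -(uP 0) ?uH //; linear.
  - by move=> y yI; rewrite -(uP 0) // addrK; exact: M0P.
have const (P0 : R) : ~ (forall y, -1 <= y <= 1 -> P y = P0).
  move=> cP; apply: pq; have val r : strip r -> psi0 r = P0.
    case: r => r y yI; have [x <-] := to_torus_surj r.
    by rewrite uP ?cP.
  by rewrite !val.
have P10 : P1 y0 = 0.
  have d : is_derive y0 (1 : R) (fun y => psi0 (to_torus x0, y)) (P1 y0).
    apply: is_derive_near (dP y0); apply: filterS (near_between (-1) 1 y0 y0I) => y yI.
    by rewrite uP //; linear.
  have uE : lift2 psi0 = uc (fun x y => psi0 (to_torus x, y)) by apply/funext => -[].
  have [_ <-] := d; rewrite -dy0 uE.
  by have [_ ->] := partial_y (fun x y => psi0 (to_torus x, y)) x0 y0.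
split => //.
  apply/eqP => f0; apply: (const (P y0)); exact: (flat_stationary st P P1 dP dP1 y0 y0I P10 f0).
by move=> [h1 h2]; apply: (const (P 0)); exact: (flat_slopes st Y1 P P1 dP dP1 h1 h2).
Qed.

(** A solution within distance 1 of [psi0] has values in [[- M, M]] and hence solves the truncated
    problem. The unconditional uniqueness of the latter becomes uniqueness near [psi0]. *)
Lemma psol_perturbed (F f f1 : R -> R) (b k Kf Lf Y v0 : R) (P P1 : R -> R) (M La : R)
    (psi0 : T * R -> R) (g h : T -> R) :
  stable f f1 b k Kf Lf Y v0 -> 1 < Y -> (forall y, is_derive y (1 : R) P (P1 y)) ->
  (forall y, is_derive y (1 : R) P1 (f (P (clamp 1 y)))) ->
  (forall x y, -1 <= y <= 1 -> psi0 (to_torus x, y) = P y) ->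
  (forall t, - M <= t <= M -> f t = F t) -> (forall y, -1 <= y <= 1 -> `|P y| <= M - 2) ->
  (forall i, datum La (walls (g, h) i)) ->
  exists2 e1, 0 < e1 & forall e u, 0 < e < e1 -> psol (f := f) P e (walls (g, h)) u ->
    (forall x : T, perturbed_graph (-1) e g x < perturbed_graph 1 e h x) /\
    is_perturbed_solution F (P (-1)) (P 1) psi0 1 (perturbed_graph (-1) e g)
      (perturbed_graph 1 e h) (descend u).
Proof.
move=> st Y1 dP dP1 psiP fF PM hd.
have La0 : 0 <= La.
  by have [h1 [h2 [_ _ _ /(_ 0)[+ _ _]]]] := hd true; exact: le_trans.
have [C C0 CP] := psol_close st Y1 P P1 dP dP1 La _ hd.
have [Cp Cp0 [_ PL _]] := profile_bounds st P P1 dP dP1.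
have CL : 0 <= Cp * La by rewrite mulr_ge0 // ltW.
have [e1 e10 s1] := small_step La (1 / 16) La0 (ltac:(linear)).
have [e2 e20 s2] := small_step La ((Y - 1) / 2) La0 (ltac:(linear)).
have [e3 e30 s3] := small_step (C + Cp * La) 1 (ltac:(linear)) ltr01.
exists (Num.min (Num.min e1 e2) e3); first by rewrite !lt_min e10 e20.
move=> e u /andP[e0]; rewrite !lt_min => /andP[/andP[l1 l2] l3] su.
pose G := perturbed_graph (-1) e g; pose H := perturbed_graph 1 e h.
have eL1 : e * La <= 1 / 16.
  by rewrite mulrC; apply/ltW/(le_lt_trans _ s1); rewrite ler_wpM2l // ltW.
have eL2 : e * La <= (Y - 1) / 2.
  by rewrite mulrC; apply/ltW/(le_lt_trans _ s2); rewrite ler_wpM2l // ltW.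
have eC : (C + Cp * La) * e < 1.
  by apply: (le_lt_trans _ s3); rewrite ler_wpM2l ?(ltW l3) //; linear.
have CPe := CP e u e0 eL1 eL2 su.
have kG := edge_cont e _ false La (hd false); have kH := edge_cont e _ true La (hd true).
have GE : lift1 G = edge e (walls (g, h)) false by [].
have HE : lift1 H = edge e (walls (g, h)) true by [].
have eb i x : - (e * La) <= e * walls (g, h) i x <= e * La.
  by have := edge_bound e _ i La x (ltW e0) (hd i); rewrite /edge addrC addKr ler_norml.
have Gx x : G (to_torus x) = -1 + e * walls (g, h) false x by [].
have Hx x : H (to_torus x) = 1 + e * walls (g, h) true x by [].
have GHx x : G (to_torus x) + 1 <= H (to_torus x).
  by rewrite Gx Hx; have := eb true x; have := eb false x; linear.
have GH p : G p < H p by have [x <-] := to_torus_surj p; have := GHx x; linear.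
have [up _ _ _ _] := su.
have Pnear x y y' : -1 <= y <= 1 -> `|y' - y| <= e * La -> edge e (walls (g, h)) false x <= y' <= edge e (walls (g, h)) true x ->
    `|u x y' - P y| < 1.
  move=> yI yy y'I; have h1 := CPe x y' y'I.
  have h2 := PL y' y (ltac:(move: yy; rewrite ler_norml; linear)) (ltac:(linear)).
  have h3 : Cp * `|y' - y| <= Cp * (e * La) by rewrite ler_wpM2l // ltW.
  by have := ler_normD (u x y' - P y') (P y' - P y); rewrite subrKA; linear.
have ub x y : edge e (walls (g, h)) false x <= y <= edge e (walls (g, h)) true x -> - M <= u x y <= M.
  move=> yI; have yI2 : -1 - e * La <= y <= 1 + e * La.
    by move: yI; rewrite -GE -HE /lift1 /= Gx Hx; have := eb true x; have := eb false x; linear.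
  have cI := clamp_itv 1 y ler01.
  have h1 := Pnear x (clamp 1 y) y cI (clamp1_dist y (e * La) (ltac:(rewrite mulr_ge0 // ltW)) yI2) yI.
  by have := PM _ cI; move: h1; rewrite ltr_norml ler_norml; linear.
have suF : lsol F (P (-1)) (P 1) (lift1 G) (lift1 H) u.
  apply: (lsol_eq f) su => x y yI; rewrite fF //; apply: ub; linear.
split => //; split.
- exact: lift_solution kG kH suF.
- move=> [p y] yI; have [x xE] := to_torus_surj p; have {}yI : -1 <= y <= 1 by [].
  rewrite -xE psiP // /straighten /=.
  have bt := eb true x; have bf := eb false x.
  rewrite descendE //; move: bt bf; rewrite -/G -/H Gx Hx.
  have yE := GHx x; rewrite Gx Hx in yE.
  move: yE; have := Pnear x y; rewrite -GE -HE /lift1 /= Gx Hx.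
  move: (e * walls (g, h) true x) (e * walls (g, h) false x) => B A PN AB bt bf.
  have a0 : 0 <= (1 - y) / 2 by linear.
  have b0 : 0 <= (1 + y) / 2 by linear.
  have m1 : (1 - y) / 2 * A <= (1 - y) / 2 * (e * La) by rewrite ler_wpM2l //; linear.
  have m2 : (1 - y) / 2 * - (e * La) <= (1 - y) / 2 * A by rewrite ler_wpM2l //; linear.
  have m3 : (1 + y) / 2 * B <= (1 + y) / 2 * (e * La) by rewrite ler_wpM2l //; linear.
  have m4 : (1 + y) / 2 * - (e * La) <= (1 + y) / 2 * B by rewrite ler_wpM2l //; linear.
  have m5 : 0 <= (1 - y) / 2 * (1 + B - (-1 + A)) by rewrite mulr_ge0 //; linear.
  have m6 : 0 <= (1 + y) / 2 * (1 + B - (-1 + A)) by rewrite mulr_ge0 //; linear.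
  apply: PN => //; first by rewrite ler_norml; linear.
  by linear.
- move=> psi' sol' near'.
  have su2 := solution_lift F _ _ _ _ psi' kG kH sol'.
  have ub2 x y : lift1 G x <= y <= lift1 H x -> - M <= psi' (to_torus x, y) <= M.
    move=> yI; have GH1 := GHx x; rewrite /lift1 /= in yI.
    have d0 : 0 < H (to_torus x) - G (to_torus x) by linear.
    (* The height in the flat channel that [straighten] maps to [y]. *)
    pose s := (2 * y - G (to_torus x) - H (to_torus x)) / (H (to_torus x) - G (to_torus x)).
    have sI : -1 <= s <= 1.
      by rewrite /s ler_pdivlMr // ler_pdivrMr //; linear.
    have := near' (to_torus x, s) sI; rewrite psiP // /straighten /=.
    have sE : (1 - s) / 2 * G (to_torus x) + (1 + s) / 2 * H (to_torus x) = y.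
      by rewrite /s; move: d0; move: (G _) (H _) => A B d0; field; rewrite gt_eqF.
    rewrite -/G -/H sE.
    by have := PM s sI; rewrite ltr_norml ler_norml; clearbody s; linear.
  have su3 : lsol f (P (-1)) (P 1) (lift1 G) (lift1 H) (fun x y => psi' (to_torus x, y)).
    by apply: (lsol_eq F) su2 => x y yI; rewrite fF //; apply: ub2; linear.
  move=> [p y]; rewrite inE => yI; have [x xE] := to_torus_surj p.
  rewrite -xE in yI *; rewrite descendE //.
  apply/esym/(lsol_unique st _ _ (lift1 G) (lift1 H) u _ kG kH _ _ _ _ su su3) => //.
  + exact: edge_per (hd false).
  + exact: edge_per (hd true).
  + by move=> t; rewrite /lift1 /= Gx Hx; have := eb true t; have := eb false t; linear.
  + by move=> t; have := GHx t; rewrite /lift1 /=; linear.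
Qed.

End Assembly.

Theorem theorem1p2 (R : realType) (alpha cG cH lambda1 : R) (F : R -> R)
    (psi0 : torus R * R -> R)
    (alpha_bounds : 0 < alpha < 1)
    (F_C4 : continuously_differentiable 4 F)
    (lambda1_first : first_dirichlet_eigenvalue (cst (-1)) (cst 1) lambda1)
    (F_stable : forall s, - lambda1 < derive1 F s)
    (psi0_sol : is_solution F cG cH (cst (-1)) (cst 1) psi0)
    (psi0_nonconstant : nonconstant_on (channel (cst (-1)) (cst 1)) psi0)
    (psi0_stagnation : exists z : R * R, -1 < z.2 < 1 /\ stagnation_point psi0 z) :
  exists B0 : set ((torus R -> R) * (torus R -> R)),
    [/\ B0 `<=` admissible_perturbations alpha,
        relatively_open alpha (admissible_perturbations alpha) B0,
        relatively_dense alpha (admissible_perturbations alpha) B0 &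
        forall g h : torus R -> R, B0 (g, h) ->
          exists eps_star c delta : R,
            [/\ 0 < eps_star, 0 < c, 0 < delta &
                forall eps : R, 0 < eps < eps_star ->
                  let G := perturbed_graph (-1) eps g in
                  let H := perturbed_graph 1 eps h in
                  (forall x, G x < H x) /\
                  exists psi : torus R * R -> R,
                    is_perturbed_solution F cG cH psi0 delta G H psi /\
                    exists2 U, island G H psi U &
                      c * Num.sqrt eps <= height U]].
Proof.
have [f [f1 [b [k [Kf [Lf [Y [v0 [P [P1 [y0 [M [[st Y1 dP dP1] [[PG PH psiP fF PM] [y0I P10 fP0 P1n]]]]]]]]]]]]]]] :=
  flat_setup F cG cH lambda1 psi0 F_C4 lambda1_first F_stable psi0_sol psi0_nonconstant psi0_stagnation.
pose W p := wobble (f := f) P y0 (walls p).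
exists [set p | admissible_perturbations alpha p /\ W p]; split.
- by move=> p [].
- move=> p [[p1 p2 _] Wp]; have [La d] := walls_datum alpha p p1 p2.
  have [r r0 H] := wobble_open st Y1 P P1 dP dP1 y0 y0I La (walls p) d Wp.
  exists r => // q qadm pq; split => //; have [q1 q2 _] := qadm.
  have [La' d'] := walls_datum alpha q q1 q2; apply: (H La' (walls q) d') => i x.
  exact: le_trans (walls_dist alpha p q p1 p2 q1 q2 i x) (ltW pq).
- move=> p padm r r0; have [p1 p2 [xs xsn]] := padm.
  (* A datum that wobbles approximates itself; otherwise a small multiple of the sine datum is
     added. *)
  have [Wp|nWp] := pselect (W p).
    by exists p => //; apply: le_lt_trans r0; exact: dist_refl.
  have [La d] := walls_datum alpha p p1 p2.
  pose c i := - P1 (side i).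
  pose Cs := `|c true| + `|c false|.
  have Cs0 : 0 <= Cs by rewrite addr_ge0.
  pose v := derive1 (lift1 p.2) xs + derive1 (lift1 p.1) xs.
  have v0' : 0 < `|v| by rewrite normr_gt0.
  (* [t1] keeps the sum of the derivatives nonzero at [xs], so that the new datum stays admissible,
     and [t2] keeps it within distance [r]. *)
  have [t1 t10 h1] := small_step Cs `|v| Cs0 v0'.
  have [t2 t20 h2] := small_step (5 * Cs) r (mulr_ge0 (ler0n _ _) Cs0) r0.
  pose t := Num.min t1 t2.
  have t0 : 0 < t by rewrite lt_min t10.
  have ht1 : Cs * t < `|v| by apply: le_lt_trans h1; rewrite ler_wpM2l // ge_min lexx.
  have ht2 : 5 * Cs * t < r.
    by apply: le_lt_trans h2; rewrite ler_wpM2l ?mulr_ge0 // ge_min lexx orbT.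
  pose q : (torus R -> R) * (torus R -> R) :=
    (fun z => p.1 z + t * c false * torus_sin z, fun z => p.2 z + t * c true * torus_sin z).
  have qE i : walls q i = fun x => walls p i x + t * sine_data P1 i x.
    by apply/funext => x; case: i; rewrite /q /walls /lift1 /= torus_sinE /sine_data /c mulrA.
  have q1 : C2alpha alpha q.1 by exact: C2alpha_add_sin.
  have q2 : C2alpha alpha q.2 by exact: C2alpha_add_sin.
  have dq i : derive1 (walls q i) xs = derive1 (walls p i) xs + t * c i * cos xs.
    have dp : is_derive xs (1 : R) (walls p i) (derive1 (walls p i) xs).
      by case: i; [have [/continuously_differentiable2[h _ _] _] := p2|
        have [/continuously_differentiable2[h _ _] _] := p1]; exact: h.
    have [ds _ _] := scaled_sin_derive (t * c i).
    have := is_derive_lin 1 dp (ds xs); rewrite mul1r => dd.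
    rewrite derive1E; suff [_ ->] : is_derive xs (1 : R) (walls q i)
      (derive1 (walls p i) xs + t * c i * cos xs) by [].
    by apply: is_derive_near dd; near=> x; rewrite qE /sine_data mul1r mulrA.
  exists q; first split.
  + split => //; exists xs.
    rewrite -[lift1 q.2]/(walls q true) -[lift1 q.1]/(walls q false) !dq.
    rewrite (_ : _ + _ = v + t * (c true + c false) * cos xs); last first.
      by rewrite /v /walls; ring.
    apply/eqP => E; have E' : v = - (t * (c true + c false) * cos xs) by linear.
    have : `|v| <= Cs * t.
      rewrite E' normrN !normrM (gtr0_norm t0) [Cs * t]mulrC -mulrA ler_wpM2l ?(ltW t0) //.
      apply: le_trans (ler_normD _ _); rewrite ler_piMr // ler_norml.
      by rewrite cos_geN1 cos_le1.
    by rewrite leNgt ht1.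
  + rewrite /W; have -> : walls q = fun i x => walls p i x + t * sine_data P1 i x.
      by apply/funext => i; exact: qE.
    have [La' d'] := walls_datum alpha q q1 q2.
    apply: (wobble_dense st Y1 P P1 dP dP1 y0 y0I La Cs La' (walls p) t P1n _ d _ _ nWp).
    * by rewrite gt_eqF.
    * move=> i; apply: (datum_mono `|c i|); last exact: datum_sin.
      by rewrite /Cs; case: i; rewrite ?lerDl ?lerDr.
    * by move=> i; rewrite -qE.
  + apply: le_lt_trans ht2; rewrite /C2alpha_dist /Cs.
    have nb i (a a' : torus R -> R) : a' = (fun z => a z + t * c i * torus_sin z) ->
        C2alpha_norm alpha (a \- a') <= 5 * `|t * c i|.
      move=> ->; rewrite -normrN; apply: sin_C2alpha_norm => //.
      by apply/funext => x; rewrite /lift1 /= torus_sinE; ring.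
    have n1 := nb false p.1 q.1 erefl; have n2 := nb true p.2 q.2 erefl.
    rewrite normrM (gtr0_norm t0) in n1; rewrite normrM (gtr0_norm t0) in n2.
    apply: le_trans (lerD n1 n2) _; rewrite le_eqVlt; apply/orP; left; apply/eqP.
    by move: `|c true| `|c false| => a a'; ring.
move=> g h [[g1 h1 _] Wgh]; have [La d] := walls_datum alpha (g, h) g1 h1.
have [c [e1 [c0 e10 I]]] := psol_island st Y1 P P1 dP dP1 y0 y0I La (walls (g, h)) d P10 fP0 Wgh.
have [e2 e20 S] := psol_perturbed F f f1 b k Kf Lf Y v0 P P1 M La psi0 g h st Y1 dP dP1 psiP fF PM d.
have [N [e3 [_ e30 E]]] := psol_nearlin st Y1 P P1 dP dP1 La (walls (g, h)) d.
(* The neighbourhood [delta = 1] fits into the margin of the truncation. *)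
exists (Num.min (Num.min e1 e2) e3), c, 1; split => //.
  by rewrite !lt_min e10 e20.
move=> e /andP[e0]; rewrite !lt_min => /andP[/andP[l1 l2] l3] G H.
have [[u su] _] := E e (ltac:(by rewrite e0)).
have [GH sol] := S e u (ltac:(by rewrite e0)) su.
split => //; exists (descend u); split; first by rewrite -PG -PH.
have [up _ _ _ _] := su.
apply: (I e u G H (descend u) _ su) => //; first by rewrite e0.
by move=> x y; exact: descendE.
Unshelve. all: by end_near. Qed.
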